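(* Let $\gamma>0$ and $z_\star\in\mathbb{R}$ be fixed. For $\alpha>0$, let $\mu_\alpha$ be the (unique) invariant probability measure on $S^1\times\mathbb{R}$ of the system $$\dot\theta=1-z\sin^2(\theta),\qquad \dot z=-\gamma(z-z_\star)+\alpha\,\xi,$$ with $\xi$ white noise, and set $$\lambda_\alpha=-1+\frac12\int z\sin(2\theta)\,\mu_\alpha(d\theta,dz).$$ Then $$\lim_{\alpha\to\infty}\alpha^{-1/2}\lambda_\alpha=\frac{\Gamma(3/4)}{2\gamma^{1/4}\pi^{1/2}},\qquad \lim_{\alpha\to0}\lambda_\alpha=\begin{cases}\sqrt{z_\star-1}-1 & \text{if } z_\star>1,\\ -1 & \text{otherwise.}\end{cases}$$
   Context: White noise $\xi$ means $dW/dt$ for a standard one-dimensional Brownian motion $W$; $S^1=\mathbb{R}/2\pi\mathbb{Z}$. In the first limit $\Gamma(3/4)$ denotes the value of Euler's Gamma function. *)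

(* Defs.v *)
From HB Require Import structures.
From mathcomp Require Import all_boot all_order all_algebra.
From mathcomp Require Import all_classical all_reals all_analysis.
Set Implicit Arguments.
Unset Strict Implicit.
Unset Printing Implicit Defensive.
Import Order.TTheory GRing.Theory Num.Theory.
Import numFieldNormedType.Exports.
Local Open Scope classical_set_scope.
Local Open Scope ring_scope.
Local Open Scope quotient_scope.

Section circle.
Variable R : realType.

Definition circle_rel (x y : R) : bool := (x - y) / (2 * pi) \is a Num.int.

Lemma circle_rel_refl : reflexive circle_rel.
Proof. by move=> x; rewrite /circle_rel subrr mul0r rpred0. Qed.

Lemma circle_rel_sym : symmetric circle_rel.
Proof. by move=> x y; rewrite /circle_rel -opprB mulNr rpredN. Qed.

Lemma circle_rel_trans : transitive circle_rel.
Proof.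
move=> y x z xy yz; rewrite /circle_rel.
by rewrite -(subrKA y) mulrDl rpredD.
Qed.

Canonical circle_equiv :=
  EquivRel circle_rel circle_rel_refl circle_rel_sym circle_rel_trans.

Definition circle := {eq_quot circle_equiv}.

HB.instance Definition _ := Topological.copy circle (quotient_topology circle).
HB.instance Definition _ := Quotient.on circle.
HB.instance Definition _ := isPointed.Build circle (\pi_circle 0).

(* The Borel sigma-algebra of the quotient topology. *)
HB.instance Definition _ :=
  @isMeasurable.Build (sigma_display (@open circle)) circle <<s @open circle >>
    (@sigma_algebra0 _ setT _) (@sigma_algebraC _ _)
    (@sigma_algebra_bigcup _ setT _).

End circle.

Definition Gamma (R : realType) (x : R) : R :=
  \int[lebesgue_measure]_(t in `]0, +oo[) (t `^ (x - 1) * expR (- t)).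

Section sde.
Variables (R : realType) (d : measure_display) (T : measurableType d).
Variable P : probability T R.

(* Only the times t >= 0 are constrained.  The second parameter of
   [normal_prob] is the standard deviation. *)
Record brownian_motion (W : R -> {RV P >-> R}) : Prop := {
  brownian0 : {ae P, forall w, W 0 w = 0} ;
  brownian_continuous :
    {ae P, forall w, {within `[0, +oo[, continuous (fun t : R => W t w)}} ;
  brownian_normal : forall s t : R, 0 <= s -> s < t ->
    forall A : set R, measurable A ->
      P [set w | A (W t w - W s w)] = normal_prob 0 (Num.sqrt (t - s)) A ;
  brownian_independent : forall (n : nat) (t : nat -> R), 0 <= t 0%N ->
    {homo t : i j / (i <= j)%N >-> i <= j} ->
    forall A : nat -> set R, (forall i, measurable (A i)) ->
      P [set w | forall i, (i < n)%N -> A i (W (t i.+1) w - W (t i) w)] =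
      (\prod_(i < n) P [set w | A i (W (t i.+1) w - W (t i) w)%R])%E
}.

Variables (gamma z_star alpha : R) (W : R -> {RV P >-> R}).

(* Solution with deterministic initial condition [x]; [theta] is a continuous
   real-valued lift of the angle.  The noise being additive, the system
   is its integrated form, and no stochastic integral occurs. *)
Definition solution (x : circle R * R) (theta z : R -> {RV P >-> R}) : Prop :=
  {ae P, forall w,
    [/\ {within `[0, +oo[, continuous (fun t : R => theta t w)},
        {within `[0, +oo[, continuous (fun t : R => z t w)},
        \pi_(circle R) (theta 0 w) = x.1,
        forall t : R, 0 <= t -> theta t w = theta 0 w +
          \int[lebesgue_measure]_(s in `[0, t]) (1 - z s w * sin (theta s w) ^+ 2)
      & forall t : R, 0 <= t -> z t w = x.2 +
          \int[lebesgue_measure]_(s in `[0, t]) (- gamma * (z s w - z_star)) +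
          alpha * W t w]}.

(* [mu] is invariant under the transition probabilities
   P_t(x, A) = P(X^x_t \in A), X^x being the solution started at x. *)
Definition invariant_measure (mu : probability (circle R * R)%type R) : Prop :=
  exists theta z : circle R * R -> R -> {RV P >-> R},
    (forall x, solution x (theta x) (z x)) /\
    forall t : R, 0 <= t -> forall A : set (circle R * R), measurable A ->
      (\int[mu]_x P [set w | A (\pi_(circle R) (theta x t w), z x t w)] = mu A)%E.

End sde.

Definition lyapunov (R : realType) (mu : probability (circle R * R)%type R) : R :=
  -1 + 2^-1 * \int[mu]_x (x.2 * sin (2 * repr x.1)).

(* Main.v *)
From HB Require Import structures.
Require Import Defs.
From mathcomp Require Import all_boot all_order all_algebra.
From mathcomp Require Import all_classical all_reals all_analysis.
From mathcomp Require Import measurable_realfun.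
From mathcomp Require Import ring lra.
Set Implicit Arguments.
Unset Strict Implicit.
Unset Printing Implicit Defensive.
Import Order.TTheory GRing.Theory Num.Theory.
Import numFieldNormedType.Exports.
Local Open Scope classical_set_scope.
Local Open Scope ring_scope.
Local Open Scope quotient_scope.

(** If (x, y) = r (cos theta, sin theta) solves the linear system x' = (z - 1) y, y' = x, then
    theta' = 1 - z sin ^ 2 theta and (ln r)' = z sin theta cos theta. The mean of the latter,
    lambda + 1, is thus the growth rate of the solutions of y'' = (z - 1) y, which for a frozen z is
    sqrt (z - 1) if z > 1 and 0 otherwise. Under vanishing noise z stays near z_star. Under strong
    noise z is about alpha x where x is Gaussian of variance 1 / (2 gamma); it varies on times of
    order 1, which is slow compared with the rate sqrt (alpha x), so that lambda is about
    sqrt alpha times the Gaussian mean of the square root of the positive part, and this mean is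
    Gamma (3/4) / (2 gamma ^ (1/4) sqrt pi) by the substitution x = sqrt (t / gamma).

    Two facts on the invariant measure are used: its fourth moment in z, of order alpha ^ 4
    ([invariant_moment4]), and that the generator L of the process has mean zero on test functions
    ([generator_mean]). Both come from expansions over a short time along the paths of the process,
    where the additive noise makes stochastic integrals unnecessary. Test functions of z alone give the
    Gaussian law of z by the Stein equation ([mean_gauss_compact], [mean_sqrt]).

    Since L J has mean zero, lambda + 1 is the mean of z sin theta cos theta + L J for every test
    function J, and pointwise bounds on this sum are bounds on lambda ([lyapunov_ge], [lyapunov_le]).
    The main choice is J = 1/2 ln (U ^ 2 + V ^ 2) with U = cos theta + M sin theta and
    V = cos theta - M sin theta, where M is a smooth function of z close to sqrt (z - 1) where this is
    real: there these linear forms nearly grow and decay at the rates M and - M. The sum is nearly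
    (z - 1 + M ^ 2) / (2 M) * (1 - 2 v), that is M (1 - 2 v), with v = V ^ 2 / (U ^ 2 + V ^ 2)
    ([rate_approx]). The upper bounds on lambda follow from |1 - 2 v| <= 1, and so does the limit for
    z_star <= 1, where a constant M makes the first factor small ([small_noise_subcritical]).

    The lower bounds require that v be small on average, although the frozen system leaves the line
    U = 0, where v = 1, invariant. The noise in M expels the angle from it. To see this, compare J with
    1/2 ln (U ^ 2 + d ^ 2 V ^ 2) for a small d: the two differ by at most ln (1 / d), but the
    latter grows faster, by a multiple of v ([form_gain], [localized_gain]). Taking d of order alpha
    for vanishing noise and alpha ^ (-1/4) for strong noise, one finds that the mean of M v is
    negligible ([small_noise_supercritical], [large_noise_lower]). *)

(** * Calculus and integration *)

Section taylor.
Variable R : realType.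
Implicit Types (f g h : R -> R) (x y a b L : R).

Lemma is_derive_continuous f g : (forall x, is_derive x 1 f (g x)) -> continuous f.
Proof.
move=> fg x; apply: differentiable_continuous.
by apply/derivable1_diffP; case: (fg x).
Qed.

Lemma mean_value f g a b : (forall x, is_derive x 1 f (g x)) ->
  exists2 c, `|c - a| <= `|b - a| & f b - f a = g c * (b - a).
Proof.
move=> fg; have cf (A : set R) : {within A, continuous f}.
  exact/continuous_subspaceT/(is_derive_continuous fg).
have [ab|ba] := leP a b.
  have [c cab ->] := MVT_segment ab (fun x _ => fg x) (cf _).
  exists c => //; move: cab; rewrite in_itv/= => /andP[ac cb].
  by rewrite !ger0_norm ?subr_ge0// lerD2r.
have [c cab E] := MVT_segment (ltW ba) (fun x _ => fg x) (cf _).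
exists c; last by rewrite -opprB E; ring.
move: cab; rewrite in_itv/= => /andP[bc ca].
by rewrite !ler0_norm ?subr_le0 ?(ltW ba)// lerN2 lerD2r.
Qed.

Lemma derive_bounded_lipschitz f g L : (forall x, is_derive x 1 f (g x)) ->
  (forall x, `|g x| <= L) -> forall x y, `|f y - f x| <= L * `|y - x|.
Proof.
move=> fg gL x y; have [c _ ->] := mean_value x y fg.
by rewrite normrM ler_wpM2r.
Qed.

Lemma taylor2 f g L : (forall x, is_derive x 1 f (g x)) ->
  (forall x y, `|g y - g x| <= L * `|y - x|) ->
  forall x y, `|f y - f x - g x * (y - x)| <= L * `|y - x| ^+ 2.
Proof.
move=> fg gL x y; have [c cx ->] := mean_value x y fg.
rewrite -mulrBl normrM expr2 mulrA ler_wpM2r// (le_trans (gL _ _))//.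
have [yx|xy] := eqVneq y x.
  by move: cx; rewrite yx subrr normr0 normr_le0 => /eqP->; rewrite normr0.
rewrite ler_wpM2l//.
have := gL x y; rewrite -ler_pdivrMr ?normr_gt0 ?subr_eq0//; apply: le_trans.
by rewrite divr_ge0.
Qed.

Lemma taylor3 f g h L : (forall x, is_derive x 1 f (g x)) ->
  (forall x, is_derive x 1 g (h x)) ->
  (forall x y, `|h y - h x| <= L * `|y - x|) ->
  forall x y, `|f y - f x - g x * (y - x) - 2^-1 * h x * (y - x) ^+ 2|
              <= L * `|y - x| ^+ 3.
Proof.
move=> fg gh hL x y.
pose r t := f t - f x - g x * (t - x) - 2^-1 * h x * (t - x) ^+ 2.
pose r' t := g t - g x - h x * (t - x).
have rr' (t : R) : is_derive t 1 r (r' t).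
  rewrite /r /r'; apply: is_deriveB => //; last first.
    by apply: is_derive_eq; rewrite /GRing.scale/=; field.
  by apply: is_derive_eq; rewrite /GRing.scale/=; ring.
have [c cx] := mean_value x y rr'.
have -> : r x = 0 by rewrite /r; ring.
rewrite subr0 -/(r y) => ->.
rewrite normrM exprSr mulrA ler_wpM2r//.
apply: (le_trans (taylor2 gh hL _ _)).
have [yx|xy] := eqVneq y x.
  move: cx; rewrite yx subrr normr0 normr_le0 => /eqP->.
  by rewrite normr0 !expr0n !mulr0.
have L0 : 0 <= L.
  have := hL x y; rewrite -ler_pdivrMr ?normr_gt0 ?subr_eq0//; apply: le_trans.
  by rewrite divr_ge0.
by rewrite ler_wpM2l// lerXn2r// nnegrE.
Qed.

End taylor.

Section real_dominated_convergence.
Context d (T : measurableType d) (R : realType) (mu : {measure set T -> \bar R}).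
Variables (f_ : nat -> T -> R) (f g : T -> R).
Hypothesis mf_ : forall n, measurable_fun setT (f_ n).
Hypothesis f_f : forall x, f_ n x @[n --> \oo] --> f x.
Hypothesis ig : mu.-integrable setT (EFin \o g).
Hypothesis f_g : forall n x, `|f_ n x| <= g x.

Lemma Rintegral_dominated_cvg :
  \int[mu]_x f_ n x @[n --> \oo] --> \int[mu]_x f x.
Proof.
have mf_' n : measurable_fun setT (EFin \o f_ n) by exact/measurable_EFinP.
have f_f' x : setT x -> (EFin \o f_ n) x @[n --> \oo] --> (EFin \o f) x.
  by move=> _; apply: cvg_EFin; [exact: nearW|exact: f_f].
have mf := emeasurable_fun_cvg _ _ mf_' f_f'.
have f_g' : {ae mu, forall x n, setT x -> (`|(EFin \o f_ n) x| <= (EFin \o g) x)%E}.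
  by apply: aeW => x n _; rewrite lee_fin; exact: f_g.
have [If _] := dominated_convergence measurableT mf_' mf (aeW _ f_f') ig f_g'.
rewrite -[X in _ --> X -> _](fineK (integrable_fin_num measurableT If)).
by move=> /fine_cvgP[_].
Qed.

End real_dominated_convergence.

Section density.
Context d (T : measurableType d) (R : realType).
Variables (mu nu : {measure set T -> \bar R}) (p : T -> R).
Hypothesis p0 : forall x, 0 <= p x.
Hypothesis mp : measurable_fun setT p.
Hypothesis nuE : forall A, measurable A -> nu A = (\int[mu]_(x in A) (p x)%:E)%E.
Import HBNNSimple.

Let mpE : measurable_fun setT (EFin \o p). Proof. exact/measurable_EFinP. Qed.

Let density_indic A : measurable A ->
  (\int[nu]_x (\1_A x)%:E = \int[mu]_x ((\1_A x)%:E * (p x)%:E))%E.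
Proof.
move=> mA; rewrite integral_indic// setIT nuE// integral_mkcond.
apply: eq_integral => x _; rewrite patchE indicE.
by case: ifPn => xA; rewrite ?mul1e ?mul0e.
Qed.

Let density_nnsfun (f : {nnsfun T >-> R}) :
  (\int[nu]_x (f x)%:E = \int[mu]_x ((f x)%:E * (p x)%:E))%E.
Proof.
under [LHS]eq_integral do rewrite fimfunE -fsumEFin//.
rewrite [LHS]ge0_integral_fsum//; last 2 first.
  - by move=> r; exact/measurable_EFinP/measurableT_comp.
  - by move=> n x _; rewrite EFinM nnfun_muleindic_ge0.
under [RHS]eq_integral.
  move=> x xD; rewrite fimfunE -fsumEFin// ge0_mule_fsuml; last first.
    by move=> r; rewrite EFinM nnfun_muleindic_ge0.
  over.
rewrite [RHS]ge0_integral_fsum//; last 2 first.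
  - move=> r; apply: emeasurable_funM => //.
    by apply/measurable_EFinP; do 2 apply/measurableT_comp => //.
  - move=> n x _; rewrite mule_ge0//; first by rewrite EFinM nnfun_muleindic_ge0.
    by rewrite lee_fin.
apply: eq_fsbigr => r _.
under [LHS]eq_integral do rewrite EFinM.
under [RHS]eq_integral do rewrite EFinM -muleA.
have [r0|r0] := leP 0 r.
  rewrite !ge0_integralZl//.
  - by rewrite density_indic.
  - apply: emeasurable_funM => //; exact/measurable_EFinP.
  - by move=> x _; rewrite mule_ge0// lee_fin.
  - exact/measurable_EFinP.
rewrite preimage_nnfun0//.
by rewrite !integral0_eq// => x _; rewrite indic0/= ?mul0e ?mule0.
Qed.

Lemma ge0_integral_density (f : T -> \bar R) : measurable_fun setT f ->
  (forall x, 0 <= f x)%E -> (\int[nu]_x f x = \int[mu]_x (f x * (p x)%:E))%E.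
Proof.
move=> mf f0.
pose f_ := nnsfun_approx measurableT mf.
transitivity (lim (\int[nu]_x (f_ n x)%:E @[n --> \oo])%E).
  rewrite -monotone_convergence//=.
  - apply: eq_integral => ? /[!inE] xD; apply/esym/cvg_lim => //=.
    exact: cvg_nnsfun_approx.
  - by move=> n; exact/measurable_EFinP/measurable_funTS.
  - by move=> n ? _; rewrite lee_fin.
  - by move=> ? _ ? ? mn; rewrite lee_fin; exact/lefP/nd_nnsfun_approx.
under eq_fun do rewrite density_nnsfun.
rewrite -monotone_convergence//=.
- apply: eq_integral => x _; apply/cvg_lim => //=.
  apply: cvgeZr => //; exact: cvg_nnsfun_approx.
- move=> n; apply: emeasurable_funM => //; exact/measurable_EFinP/measurable_funTS.
- by move=> n ? _; rewrite mule_ge0// lee_fin.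
- move=> x _ m n mn; rewrite lee_wpmul2r ?lee_fin//.
  exact/lefP/nd_nnsfun_approx.
Qed.

End density.

(** * Gaussian integrals *)

Section gaussian_integrals.
Variable R : realType.
Notation mu := (@lebesgue_measure R).
Implicit Types (f F : R -> R).

(** The fundamental theorem of calculus on [-n, n], and dominated convergence. *)
Lemma integral_derivative_eq0 f F : (forall x : R, is_derive x 1 F (f x)) ->
  continuous f -> mu.-integrable setT (EFin \o f) ->
  F n.+1%:R @[n --> \oo] --> 0 -> F (- n.+1%:R) @[n --> \oo] --> 0 ->
  \int[mu]_x f x = 0.
Proof.
move=> Ff cf intf F0 FN0.
have cF := is_derive_continuous Ff.
pose I n := `[- n.+1%:R, n.+1%:R]%classic : set R.
have step n : \int[mu]_x (f \_ (I n)) x = F n.+1%:R - F (- n.+1%:R).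
  rewrite -Rintegral_mkcond /Rintegral (@continuous_FTC2 _ f F)//.
  - by rewrite ltrNl (lt_trans _ (ltr0Sn _ n))// oppr_lt0.
  - exact: continuous_subspaceT.
  - split => [x _||]; [by case: (Ff x)|exact: cvg_at_right_filter (cF _)
      |exact: cvg_at_left_filter (cF _)].
  - by move=> x _; rewrite derive1E; case: (Ff x).
have mf : measurable_fun setT f by exact: continuous_measurable_fun.
have lim1 : \int[mu]_x (f \_ (I n)) x @[n --> \oo] --> \int[mu]_x f x.
  apply: (@Rintegral_dominated_cvg _ _ _ mu _ _ (fun x => `|f x|)).
  - move=> n; apply/(measurable_restrictT _ _).1; first exact: measurable_itv.
    exact: measurable_funTS.
  - move=> x; apply: cvg_near_cst; near=> n; rewrite patchE ifT// inE /I /= in_itv/=.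
    rewrite -ler_norml; near: n.
    exists (Num.truncn `|x|) => // n /= xn.
    by rewrite (le_trans (ltW (truncnS_gt _)))// ler_nat.
  - exact: integrable_norm intf.
  - by move=> n x; rewrite patchE; case: ifP => // _; rewrite normr0.
have lim2 : \int[mu]_x (f \_ (I n)) x @[n --> \oo] --> 0.
  rewrite (_ : (fun n => _) = (fun n => F n.+1%:R - F (- n.+1%:R))); last exact/funext.
  suff : F n.+1%:R - F (- n.+1%:R) @[n --> \oo] --> 0 - 0 by rewrite subr0.
  exact: cvgB.
exact: cvg_unique lim1 lim2.
Unshelve. all: by end_near. Qed.


Variable v : R.
Hypothesis v0 : 0 < v.

Definition gauss (x : R) : R := expR (- x ^+ 2 / (2 * v)).

Lemma gauss_ge0 x : 0 <= gauss x. Proof. exact: expR_ge0. Qed.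

Lemma is_derive_gauss (x : R) : is_derive x 1 gauss (- x / v * gauss x).
Proof.
rewrite /gauss; apply: is_derive_eq.
rewrite /GRing.scale/=; field; exact: lt0r_neq0.
Qed.

Lemma continuous_gauss : continuous gauss.
Proof. exact: is_derive_continuous is_derive_gauss. Qed.

Lemma normal_pdf_gauss (x : R) :
  normal_pdf 0 (Num.sqrt v) x = (Num.sqrt (2 * v * pi))^-1 * gauss x.
Proof.
rewrite normal_pdfE; last by rewrite gt_eqF// sqrtr_gt0.
rewrite /normal_peak /normal_fun /gauss sqr_sqrtr ?ltW// subr0.
by rewrite -mulr_natl mulrA -(mulr_natl v).
Qed.

Lemma integrable_gauss : mu.-integrable setT (EFin \o gauss).
Proof.
have := integrable_normal_pdf 0 (Num.sqrt v).
rewrite (_ : (fun x => _) = (fun x => (Num.sqrt (2 * v * pi))^-1%:E * (EFin \o gauss) x)%E); last first.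
  by apply/funext => x; rewrite normal_pdf_gauss EFinM.
move=> /(integrableZl measurableT (Num.sqrt (2 * v * pi))).
apply: eq_integrable => // x _ /=; rewrite -!EFinM mulrA divff ?mul1r//.
by rewrite gt_eqF// sqrtr_gt0 !mulr_gt0// pi_gt0.
Qed.

Lemma Rintegral_gauss : \int[mu]_x gauss x = Num.sqrt (2 * v * pi).
Proof.
have := integral_normal_pdf 0 (Num.sqrt v).
under eq_integral do rewrite normal_pdf_gauss EFinM.
rewrite integralZl//; last exact: integrable_gauss.
move=> /(congr1 fine); rewrite fineM//=; last first.
  by apply: integrable_fin_num => //; exact: integrable_gauss.
move/(congr1 (fun t => Num.sqrt (2 * v * pi) * t)).
rewrite mulr1 mulrA divff ?mul1r//.
by rewrite gt_eqF// sqrtr_gt0 !mulr_gt0// pi_gt0.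
Qed.

End gaussian_integrals.

Section gaussian_moments.
Variables (R : realType) (v : R).
Hypothesis v0 : 0 < v.
Notation mu := (@lebesgue_measure R).

(** Half of the exponent pays for the power: u ^ 2 / 2 <= exp u at u = x ^ 2 / (4 v). *)
Lemma pow4_gauss_le (x : R) : x ^+ 4 * gauss v x <= 32 * v ^+ 2 * gauss (2 * v) x.
Proof.
set u := x ^+ 2 / (4 * v).
have u0 : 0 <= u by rewrite divr_ge0 ?sqr_ge0// mulr_ge0// ltW.
have E1 : gauss v x = expR (- u) * expR (- u).
  rewrite -expRD /gauss /u; congr expR; field; exact: lt0r_neq0.
have E2 : gauss (2 * v) x = expR (- u).
  rewrite /gauss /u; congr expR; field; exact: lt0r_neq0.
have -> : x ^+ 4 = 16 * v ^+ 2 * u ^+ 2 by rewrite /u; field; exact: lt0r_neq0.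
have := expR_ge1Dxn 1 u0; rewrite -[expR u]invrK -expRN.
rewrite E1 E2; have := expR_gt0 (- u); set e := expR _ => e0.
rewrite -(ler_pM2l e0) divff ?gt_eqF// => H.
have {}H : e * u ^+ 2 <= 2.
  move: H; rewrite (_ : 2`! = 2)%N//; nra.
have -> : 16 * v ^+ 2 * u ^+ 2 * (e * e) = (16 * v ^+ 2 * e) * (e * u ^+ 2) by ring.
have -> : 32 * v ^+ 2 * e = (16 * v ^+ 2 * e) * 2 by ring.
by rewrite ler_wpM2l// !mulr_ge0 ?sqr_ge0// ltW.
Qed.

Lemma integrable_moment_gauss k : (k <= 4)%N ->
  mu.-integrable setT (fun x : R => (x ^+ k * gauss v x)%:E).
Proof.
move=> k4.
have v20 : 0 < 2 * v by rewrite mulr_gt0.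
have int1 := integrable_gauss v0.
have int2 := integrableZl measurableT (32 * v ^+ 2) (integrable_gauss v20).
apply: le_integrable (integrableD measurableT int1 int2) => //.
  apply/measurable_EFinP; apply: continuous_measurable_fun => x.
  by apply: cvgM; [exact: exprn_continuous|exact: continuous_gauss].
move=> x _.
change (`|x ^+ k * gauss v x|%:E <= `|gauss v x + 32 * v ^+ 2 * gauss (2 * v) x|%:E)%E.
rewrite lee_fin.
rewrite [leRHS]ger0_norm; last first.
  by apply: addr_ge0; rewrite ?gauss_ge0// mulr_ge0 ?gauss_ge0// mulr_ge0 ?sqr_ge0.
rewrite normrM (ger0_norm (gauss_ge0 _ _)) normrX.
apply: le_trans (_ : (1 + x ^+ 4) * gauss v x <= _); last first.
  by rewrite mulrDl mul1r lerD2l pow4_gauss_le.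
rewrite ler_wpM2r ?(gauss_ge0 _ _)//.
rewrite -(normr_idP (_ : 0 <= x ^+ 4)) ?exprn_even_ge0// normrX.
have [x1|x1] := leP `|x| 1.
  by rewrite (le_trans (exprn_ile1 _ _ _))// lerDl exprn_ge0.
by rewrite (le_trans (ler_weXn2l (ltW x1) k4))// lerDr.
Qed.

Lemma gauss_moment_cvg0 (s : nat -> R) k : (k <= 3)%N ->
  (forall n, `|s n| = n.+1%:R) -> s n ^+ k * gauss v (s n) @[n --> \oo] --> 0.
Proof.
move=> k3 sn; apply/norm_cvg0P.
apply: (@squeeze_cvgr _ _ _ _ (fun=> 0) (fun n => 32 * v ^+ 2 * n.+1%:R^-1)).
- apply: nearW => n; rewrite normr_ge0/= normrM (ger0_norm (gauss_ge0 _ _)).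
  rewrite ler_pdivlMr// mulrAC normrX sn -exprSr.
  have n1 : 1 <= n.+1%:R :> R by rewrite ler1n.
  apply: le_trans (_ : `|s n| ^+ 4 * gauss v (s n) <= _).
    by rewrite sn ler_wpM2r ?(gauss_ge0 _ _)// ler_weXn2l.
  rewrite -normrX (ger0_norm (_ : 0 <= s n ^+ 4)) ?exprn_even_ge0//.
  apply: (le_trans (pow4_gauss_le _)).
  have C0 : 0 <= 32 * v ^+ 2 by rewrite mulr_ge0 ?sqr_ge0.
  rewrite ler_piMr// /gauss -expR0 ler_expR mulNr oppr_le0.
  by rewrite divr_ge0 ?sqr_ge0// mulr_ge0// mulr_ge0// ltW.
- exact: cvg_cst.
- rewrite -[X in _ --> X](mulr0 (32 * v ^+ 2)); apply: cvgMr.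
  exact: cvg_harmonic.
Qed.

(** Integration of the derivative of x ^ (k + 1) exp (- x ^ 2 / (2 v)). *)
Lemma gauss_moment_rec k : (k <= 2)%N ->
  \int[mu]_x (x ^+ k.+2 * gauss v x) = v * k.+1%:R * \int[mu]_x (x ^+ k * gauss v x).
Proof.
move=> k2.
pose f x := k.+1%:R * (x ^+ k * gauss v x) - v^-1 * (x ^+ k.+2 * gauss v x).
have i1 := integrable_moment_gauss (leq_trans k2 (isT : (2 <= 4)%N)).
have i2 := integrable_moment_gauss (k2 : (k.+2 <= 4)%N).
have f0 : \int[mu]_x f x = 0.
  apply: (@integral_derivative_eq0 _ f (fun x => x ^+ k.+1 * gauss v x)).
  - move=> x; have := is_derive_gauss v0 x => ?.
    have Dk : is_derive x 1 (fun y : R => y ^+ k.+1) (k.+1%:R * x ^+ k).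
      apply: DeriveDef; first exact: exprn_derivable.
      by rewrite exp_derive /GRing.scale/=; ring.
    apply: is_derive_eq; rewrite /GRing.scale/= /f 3!exprS.
    by field; exact: lt0r_neq0.
  - move=> x; have cg := @continuous_gauss _ _ v0 x.
    apply: cvgB; apply: cvgMr; apply: cvgM => //; exact: exprn_continuous.
  - have := integrableB measurableT (integrableZl measurableT k.+1%:R i1)
      (integrableZl measurableT v^-1 i2).
    by apply: eq_integrable => // x _; rewrite /f EFinB !EFinM.
  - by apply: gauss_moment_cvg0 => // n; rewrite ger0_norm.
  - by apply: gauss_moment_cvg0 => // n; rewrite normrN ger0_norm.
move: f0; rewrite /f RintegralB//; first last.
- by have := integrableZl measurableT v^-1 i2; apply: eq_integrable => // x _; rewrite EFinM.
- by have := integrableZl measurableT k.+1%:R i1; apply: eq_integrable => // x _; rewrite EFinM.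
rewrite !RintegralZl// => /eqP; rewrite subr_eq0 => /eqP H.
by rewrite -mulrA H mulrA divff ?mul1r// gt_eqF.
Qed.

Lemma gauss_moment1 : \int[mu]_x (x ^+ 1 * gauss v x) = 0.
Proof.
have i1 := integrable_moment_gauss (isT : (1 <= 4)%N).
have : \int[mu]_x (- v^-1 * (x ^+ 1 * gauss v x)) = 0.
  apply: (@integral_derivative_eq0 _ _ (gauss v)).
  - move=> x; rewrite (_ : - v^-1 * _ = - x / v * gauss v x); last by ring.
    exact: is_derive_gauss.
  - move=> x; have cg := @continuous_gauss _ _ v0 x.
    apply: cvgMr; apply: cvgM => //; exact: exprn_continuous.
  - by have := integrableZl measurableT (- v^-1) i1; apply: eq_integrable => // x _; rewrite EFinM.
  - have := @gauss_moment_cvg0 (fun n => n.+1%:R) 0 isT.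
    under eq_fun do rewrite expr0 mul1r; apply => n; by rewrite ger0_norm.
  - have := @gauss_moment_cvg0 (fun n => - n.+1%:R) 0 isT.
    under eq_fun do rewrite expr0 mul1r; apply => n; by rewrite normrN ger0_norm.
rewrite RintegralZl// => /eqP; rewrite mulf_eq0 oppr_eq0 invr_eq0 gt_eqF//=.
by move/eqP.
Qed.

End gaussian_moments.


Lemma le_sqrtr (R : rcfType) (x y : R) : y ^+ 2 <= x -> y <= Num.sqrt x.
Proof.
move=> yx; have [y0|y0] := leP y 0; first exact: le_trans y0 (sqrtr_ge0 _).
by rewrite -[leLHS](ger0_norm (ltW y0)) -sqrtr_sqr ler_wsqrtr.
Qed.

Lemma sqrtr_le (R : rcfType) (x y : R) : 0 <= y -> x <= y ^+ 2 -> Num.sqrt x <= y.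
Proof. by move=> y0 xy; rewrite -[leRHS](ger0_norm y0) -sqrtr_sqr ler_wsqrtr. Qed.

(** Under x = kappa * sqrt t the integrand sqrt x exp (- x ^ 2 / (2 v)) becomes that of
    Gamma (3 / 4). The map is not differentiable at 0, so that the substitution is made on the
    half-lines from [a_ n] = 1 / (n + 1) and the limit is taken by monotone convergence. *)
Section sqrt_moment.
Variables (R : realType) (v : R).
Hypothesis v0 : 0 < v.
Notation mu := (@lebesgue_measure R).
Let kappa : R := Num.sqrt (2 * v).
Let a_ n : R := n.+1%:R^-1.
Let G (x : R) : R := Num.sqrt x * gauss v x.
Let H (t : R) : R := t `^ (3 / 4 - 1) * expR (- t).

Let kappa0 : 0 < kappa. Proof. by rewrite sqrtr_gt0 mulr_gt0. Qed.
Let a0 n : 0 < a_ n. Proof. by rewrite invr_gt0. Qed.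

Let F (t : R) : R := kappa * Num.sqrt t.
Let F' (t : R) : R := kappa * (2 * Num.sqrt t)^-1.

Let FF' (t : R) : 0 < t -> is_derive t 1 F (F' t).
Proof. by move=> t0; have := is_derive1_sqrt t0 => ?; apply: is_derive_eq. Qed.

Let derF (t : R) : 0 < t -> derive1 F t = F' t.
Proof. by move=> t0; rewrite derive1E; have [_] := FF' t0. Qed.

Let cF' (t : R) : 0 < t -> {for t, continuous F'}.
Proof.
move=> t0; apply: cvgMr; apply: cvgV; first by rewrite mulf_neq0// gt_eqF// sqrtr_gt0.
by apply: cvgMr; exact: sqrt_continuous.
Qed.

Let GF (t : R) : 0 < t -> G (F t) * F' t = Num.sqrt kappa * kappa / 2 * H t.
Proof.
move=> t0; have st0 : 0 < Num.sqrt t by rewrite sqrtr_gt0.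
rewrite /G /F /F' /H /gauss.
have -> : - (kappa * Num.sqrt t) ^+ 2 / (2 * v) = - t.
  rewrite exprMn !sqr_sqrtr ?ltW// ?mulr_gt0//; field; exact: lt0r_neq0.
have -> : t `^ (3 / 4 - 1) = Num.sqrt (Num.sqrt t) / Num.sqrt t.
  rewrite -!powR12_sqrt ?sqrtr_ge0 ?powR_ge0 ?(ltW t0)//.
  rewrite -powRrM -powRN -powRD; last by rewrite (gt_eqF t0) implybT.
  by congr powR; field.
rewrite sqrtrM ?ltW//; field; exact: lt0r_neq0.
Qed.

Let cF (t : R) : 0 < t -> {for t, continuous F}.
Proof. by move=> t0; apply: cvgMr; exact: sqrt_continuous. Qed.

Let cdF (t : R) : 0 < t -> {for t, continuous (derive1 F)}.
Proof.
move=> t0; rewrite /prop_for /continuous_at derF//.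
apply: cvg_trans (cF' t0); apply: near_eq_cvg; near=> x; rewrite derF//.
near: x; exact: lt_nbhsr.
Unshelve. all: by end_near. Qed.

Let cG : continuous G.
Proof.
by move=> x; apply: cvgM; [exact: sqrt_continuous|exact: continuous_gauss].
Qed.

Let mG : measurable_fun setT G.
Proof.
exact: continuous_measurable_fun cG.
Qed.

Let mH : measurable_fun setT H.
Proof.
apply: measurable_funM; first exact: measurable_powR.
by apply: measurableT_comp => //; exact: measurable_funN.
Qed.

Let subst n : (\int[mu]_(x in `[F (a_ n), +oo[) (G x)%:E =
  (Num.sqrt kappa * kappa / 2)%:E * \int[mu]_(t in `[a_ n, +oo[) (H t)%:E)%E.
Proof.
have an0 := a0 n.
have lea t : t \in `[a_ n, +oo[ -> 0 < t.
  by rewrite in_itv/= andbT; exact: lt_le_trans.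
rewrite (@increasing_ge0_integration_by_substitutiony _ F G (a_ n)).
- rewrite -ge0_integralZl//=.
  + apply: eq_integral => t; rewrite inE => /lea t0.
    by rewrite -EFinM -GF// -derF.
  + by apply/measurable_EFinP; exact: measurable_funTS.
  + by move=> t _; rewrite lee_fin mulr_ge0 ?powR_ge0 ?expR_ge0.
  + by rewrite lee_fin !mulr_ge0 ?sqrtr_ge0.
- move=> s t /lea s0 /lea t0 st; rewrite /F ltr_pM2l// ltr_sqrt//.
- move=> t; rewrite in_itv/= andbT => t1; have t0 := lt_trans an0 t1.
  exact: cdF.
- by apply: cvgP; apply: cvg_at_right_filter; exact: cdF.
- apply/cvg_ex; exists 0; apply: (@cvg_trans _ (F' x @[x --> +oo])).
    apply: near_eq_cvg; near=> x.
    have x0 : 0 < x by near: x; exact: nbhs_pinfty_gt.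
    by rewrite derF.
  suff : F' x @[x --> +oo] --> kappa * 0 by rewrite mulr0.
  apply: cvgMr.
  apply/gtr0_cvgV0; first by near=> x; rewrite mulr_gt0// sqrtr_gt0; near: x; exact: nbhs_pinfty_gt.
  apply/cvgryPge => A; near=> x.
  have : A <= Num.sqrt x.
    by apply: le_sqrtr; near: x; exact: (nbhs_pinfty_ge (num_real _)).
  have := sqrtr_ge0 x; lra.
- split; last exact: cvg_at_right_filter (cF an0).
  by move=> t; rewrite in_itv/= andbT => t1; have [] := FF' (lt_trans an0 t1).
- apply/cvgryPge => A; near=> x.
  rewrite /F -ler_pdivrMl//; set B := kappa^-1 * A.
  by apply: le_sqrtr; near: x; exact: (nbhs_pinfty_ge (num_real _)).
- apply: continuous_subspaceT => x; exact: cG.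
- by move=> t _; rewrite mulr_ge0 ?sqrtr_ge0 ?gauss_ge0.
Unshelve. all: by end_near. Qed.

Lemma Rintegral_sqrt_gauss : mu.-integrable setT (EFin \o G) /\
  \int[mu]_x (Num.sqrt x * gauss v x) =
   Num.sqrt kappa / (2 * Num.sqrt pi) * Gamma (3 / 4) * \int[mu]_x gauss v x.
Proof.
have H0 t : 0 <= H t by rewrite mulr_ge0 ?powR_ge0 ?expR_ge0.
have G0 x : 0 <= G x by rewrite mulr_ge0 ?sqrtr_ge0 ?gauss_ge0.
have C0 : 0 <= Num.sqrt kappa * kappa / 2 by rewrite !mulr_ge0 ?sqrtr_ge0.
have an_lt (x : R) : 0 < x -> exists n, a_ n <= x.
  by move=> x0; have [n /ltW nx] := ltr_add_invr x0; exists n; move: nx; rewrite add0r.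
have FI : (\int[mu]_(x in `]0%R, +oo[) (G x)%:E =
   (Num.sqrt kappa * kappa / 2)%:E * \int[mu]_(t in `]0%R, +oo[) (H t)%:E)%E.
  have U1 : `]0, +oo[%classic = \bigcup_n `[F (a_ n), +oo[%classic :> set R.
    apply/seteqP; split => x /=.
      rewrite in_itv/= andbT => x0.
      have [|n nx] := an_lt ((x / kappa) ^+ 2); first by rewrite exprn_gt0// divr_gt0.
      exists n => //=; rewrite in_itv/= andbT /F mulrC -ler_pdivlMr//.
      by apply: sqrtr_le => //; rewrite divr_ge0 ?ltW.
    by move=> [n _] /=; rewrite !in_itv/= !andbT; apply: lt_le_trans; rewrite mulr_gt0// sqrtr_gt0.
  have U2 : `]0, +oo[%classic = \bigcup_n `[a_ n, +oo[%classic :> set R.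
    apply/seteqP; split => x /=.
      rewrite in_itv/= andbT => /an_lt[n nx].
      by exists n => //=; rewrite in_itv/= andbT.
    by move=> [n _] /=; rewrite !in_itv/= !andbT; apply: lt_le_trans.
  have an_mono m n : (m <= n)%N -> a_ n <= a_ m by move=> mn; rewrite lef_pV2 ?posrE// ler_nat.
  have L2 : (\int[mu]_(x in `[a_ i, +oo[) (H x)%:E)%E @[i --> \oo] --> (\int[mu]_(x in `]0%R, +oo[) (H x)%:E)%E.
    rewrite U2; apply: ge0_nondecreasing_set_cvg_integral => //.
    - move=> m n mn; apply/subsetPset => x /=; rewrite !in_itv/= !andbT; apply: le_trans; exact: an_mono.
    - by move=> i; apply/measurable_EFinP; exact: measurable_funTS.
    - by move=> i x _; rewrite lee_fin.
  have L1 : (\int[mu]_(x in `[F (a_ i), +oo[) (G x)%:E)%E @[i --> \oo] --> (\int[mu]_(x in `]0%R, +oo[) (G x)%:E)%E.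
    rewrite U1; apply: ge0_nondecreasing_set_cvg_integral => //.
    - move=> m n mn; apply/subsetPset => x /=; rewrite !in_itv/= !andbT; apply: le_trans.
      by rewrite ler_pM2l// ler_sqrt ?an_mono ?ltW.
    - by move=> i; apply/measurable_EFinP; exact: measurable_funTS.
    - by move=> i x _; rewrite lee_fin.
  rewrite (_ : (fun i => _) = (fun i => (Num.sqrt kappa * kappa / 2)%:E * \int[mu]_(t in `[a_ i, +oo[) (H t)%:E))%E in L1; last first.
    by apply/funext => i; exact: subst.
  exact: cvg_unique L1 (cvgeZl _ L2).
have intG : mu.-integrable setT (EFin \o G).
  have i0 := integrable_gauss v0.
  have i2 := integrable_moment_gauss v0 (isT : (2 <= 4)%N).
  apply: le_integrable (integrableD measurableT i0 i2) => //.
    exact/measurable_EFinP.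
  move=> x _; change (`|G x|%:E <= `|gauss v x + x ^+ 2 * gauss v x|%:E)%E.
  have g0 := gauss_ge0 v x.
  rewrite lee_fin !ger0_norm//; last by rewrite addr_ge0// mulr_ge0// sqr_ge0.
  rewrite /G -{2}[gauss v x]mul1r -mulrDl ler_wpM2r//.
  have [x0|x0] := leP x 0; first by rewrite ler0_sqrtr// addr_ge0 ?sqr_ge0.
  rewrite -{2}(sqr_sqrtr (ltW x0)) -subr_ge0; set s : R := Num.sqrt x.
  have -> : 1 + (s ^+ 2) ^+ 2 - s = (s ^+ 2 - 2^-1) ^+ 2 + (s - 2^-1) ^+ 2 + 2^-1 by field.
  by rewrite !addr_ge0 ?sqr_ge0.
have GT : (\int[mu]_x (G x)%:E = \int[mu]_(x in `]0%R, +oo[) (G x)%:E)%E.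
  rewrite [RHS]integral_mkcond; apply: eq_integral => x _; rewrite patchE.
  case: ifPn => //; rewrite notin_setE/= in_itv/= andbT => /negP; rewrite -leNgt => x0.
  by rewrite /G ler0_sqrtr// mul0r.
have IH : (\int[mu]_(t in `]0%R, +oo[) (H t)%:E = (Gamma (3 / 4) : R)%:E)%E.
  rewrite /Gamma /Rintegral fineK//.
  have := integrable_fin_num measurableT intG; rewrite GT FI.
  have : 0 < Num.sqrt kappa * kappa / 2.
    by apply: divr_gt0 => //; apply: mulr_gt0 => //; rewrite sqrtr_gt0.
  have : (0 <= \int[mu]_(t in `]0%R, +oo[) (H t)%:E)%E.
    by apply: integral_ge0 => x _; rewrite lee_fin.
  case: (\int[mu]_(t in `]0%R, +oo[) (H t)%:E)%E => //= _ c0.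
  by rewrite gt0_muley.
split=> //; rewrite {1}/Rintegral GT FI IH /= Rintegral_gauss//.
have sp0 : 0 < Num.sqrt pi :> R by rewrite sqrtr_gt0 pi_gt0.
rewrite sqrtrM ?mulr_ge0 ?ltW// -/kappa; field.
by rewrite !gt_eqF.
Qed.

End sqrt_moment.

(** * Moments and paths of Brownian motion *)

(** The real line carries its Borel sets under two displays, one of which is that of the Lebesgue
    measure; this passes from one to the other. *)
Lemma measurable_fun_Borel d (T : measurableType d) (R : realType) (f : T -> R) :
  measurable_fun setT f -> measurable_fun setT (f : T -> measurableTypeR R).
Proof.
move=> mf mT B mB.
have H : measurable (setT `&` f @^-1` B) by apply: mf.
exact: H.
Qed.

Lemma measure_ae_eq d (T : measurableType d) (R : realType)
  (P : {measure set T -> \bar R}) (A B : set T) : measurable A -> measurable B ->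
  {ae P, forall w, A w <-> B w} -> P A = P B.
Proof.
move=> mA mB AB.
have PE C : measurable C -> P C = (\int[P]_w (\1_C w)%:E)%E.
  by move=> mC; rewrite integral_indic// setIT.
rewrite !PE//; apply: ge0_ae_eq_integral => //.
- exact/measurable_EFinP/measurable_indic.
- exact/measurable_EFinP/measurable_indic.
apply: filterS AB => w [AB BA] _; rewrite !indicE.
suff -> : (w \in A) = (w \in B) by [].
by apply/idP/idP; rewrite !inE.
Qed.

Section brownian_moments.
Context (R : realType) d (T : measurableType d) (P : probability T R).
Variable W : R -> {RV P >-> R}.
Hypothesis BW : brownian_motion W.
Notation mu := (@lebesgue_measure R).

Lemma brownian_distribution (t : R) : 0 < t -> forall A, measurable A ->
  distribution P (W t) A = normal_prob 0 (Num.sqrt t) A.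
Proof.
move=> t0 A mA; have := brownian_normal BW (lexx 0) t0 mA; rewrite subr0 => <-.
apply: (@measure_ae_eq _ _ _ P (W t @^-1` A) [set w | A (W t w - W 0 w)]).
- exact: measurable_funPTI.
- rewrite -[X in measurable X]setTI.
  have mD : measurable_fun setT (fun w => W t w - W 0 w) by exact: measurable_funB.
  exact: mD.
- by apply: filterS (brownian0 BW) => w /= ->; rewrite subr0.
Qed.

Lemma ge0_integral_brownian (t : R) (f : R -> R) : 0 < t -> measurable_fun setT f ->
  (forall x, 0 <= f x) -> mu.-integrable setT (fun x => (f x * gauss t x)%:E) ->
  (\int[P]_w (f (W t w))%:E =
   ((Num.sqrt (2 * t * pi))^-1 * \int[mu]_x (f x * gauss t x))%:E)%E.
Proof.
move=> t0 mf f0 fi.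
have mfE : measurable_fun setT (EFin \o f) by exact/measurable_EFinP.
have f0E x : (0 <= (EFin \o f) x)%E by rewrite lee_fin.
have mX : measurable_fun setT (W t : T -> measurableTypeR R) by exact: measurable_fun_Borel.
pose X : {mfun T >-> measurableTypeR R} := HB.pack (W t : T -> measurableTypeR R)
  (isMeasurableFun.Build _ _ _ _ _ mX).
rewrite -[LHS](ge0_integral_distribution X mfE f0E).
have nuE A : measurable A -> distribution P X A = (\int[mu]_(x in A) (normal_pdf 0 (Num.sqrt t) x)%:E)%E.
  move=> mA; exact: brownian_distribution.
have pdf0 (x : R) : 0 <= normal_pdf 0 (Num.sqrt t) x by exact: normal_pdf_ge0.
have mpdf := measurable_normal_pdf 0 (Num.sqrt t).
have mfE' : measurable_fun [set: measurableTypeR R] (EFin \o f) by exact: mfE.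
have mpdf' : measurable_fun [set: measurableTypeR R] (normal_pdf 0 (Num.sqrt t)) by exact: mpdf.
rewrite (ge0_integral_density (T := measurableTypeR R) pdf0 mpdf' nuE mfE' f0E).
under eq_integral do rewrite normal_pdf_gauss// -EFinM mulrCA EFinM.
rewrite integralZl//= EFinM; congr (_ * _)%E.
by rewrite /Rintegral fineK//; exact: integrable_fin_num.
Qed.

Lemma brownian_moment2 (t : R) : 0 < t -> (\int[P]_w ((W t w) ^+ 2)%:E = t%:E)%E.
Proof.
move=> t0.
rewrite (@ge0_integral_brownian t (fun x => x ^+ 2))//.
- rewrite (gauss_moment_rec t0 (isT : (0 <= 2)%N)).
  under eq_Rintegral do rewrite expr0 mul1r.
  rewrite Rintegral_gauss// mulr1 mulrCA mulVf ?mulr1//.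
  by rewrite gt_eqF// sqrtr_gt0 !mulr_gt0// pi_gt0.
- by move=> x; exact: sqr_ge0.
- exact: (integrable_moment_gauss t0 (isT : (2 <= 4)%N)).
Qed.

Lemma brownian_moment4 (t : R) : 0 < t ->
  (\int[P]_w ((W t w) ^+ 4)%:E = (3 * t ^+ 2)%:E)%E.
Proof.
move=> t0.
rewrite (@ge0_integral_brownian t (fun x => x ^+ 4))//.
- rewrite (gauss_moment_rec t0 (isT : (2 <= 2)%N)) (gauss_moment_rec t0 (isT : (0 <= 2)%N)).
  under eq_Rintegral do rewrite expr0 mul1r.
  rewrite Rintegral_gauss//; congr EFin; field.
  by rewrite gt_eqF// sqrtr_gt0 !mulr_gt0// pi_gt0.
- by move=> x; rewrite exprn_even_ge0.
- exact: (integrable_moment_gauss t0 (isT : (4 <= 4)%N)).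
Qed.

Lemma integrable_brownian2 (t : R) : 0 < t -> P.-integrable setT (fun w => ((W t w) ^+ 2)%:E).
Proof.
move=> t0; apply/integrableP; split; first exact/measurable_EFinP/measurable_funX.
rewrite (eq_integral (fun w => ((W t w) ^+ 2)%:E)).
  by rewrite brownian_moment2// ltry.
by move=> w _; rewrite gee0_abs// lee_fin sqr_ge0.
Qed.

Lemma integrable_brownian (t : R) : 0 < t -> P.-integrable setT (fun w => (W t w)%:E).
Proof.
move=> t0.
have i1 : P.-integrable setT (fun=> 1%:E) by exact: finite_measure_integrable_cst.
apply: le_integrable (integrableD measurableT i1 (integrable_brownian2 t0)) => //.
  exact/measurable_EFinP.
move=> w _; change (`|W t w|%:E <= `|1 + W t w ^+ 2|%:E)%E.
rewrite lee_fin [leRHS]ger0_norm ?addr_ge0 ?sqr_ge0// -[W t w ^+ 2]real_normK ?num_real//.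
have := sqr_ge0 (`|W t w| - 2^-1); lra.
Qed.

(** The density formula is for nonnegative integrands: it is applied to 1 + x + x ^ 2, whose mean
    1 + E W + t is 1 + t. *)
Lemma brownian_mean (t : R) : 0 < t -> \int[P]_w W t w = 0.
Proof.
move=> t0.
have i1 : P.-integrable setT (fun=> 1%:E) by exact: finite_measure_integrable_cst.
have iW := integrable_brownian t0; have iW2 := integrable_brownian2 t0.
have : \int[P]_w (1 + W t w + W t w ^+ 2) = 1 + t.
  have p0 (x : R) : 0 <= 1 + x + x ^+ 2 by have := sqr_ge0 (x + 2^-1); lra.
  have g0 := integrable_gauss t0.
  have g1 := integrable_moment_gauss t0 (isT : (1 <= 4)%N).
  have g2 := integrable_moment_gauss t0 (isT : (2 <= 4)%N).
  have g01 := integrableD measurableT g0 g1.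
  rewrite /Rintegral (@ge0_integral_brownian t (fun x => 1 + x + x ^+ 2))//=; first last.
  - apply: eq_integrable (integrableD measurableT g01 g2) => // x _.
    by rewrite /= -!EFinD expr1 !mulrDl mul1r.
  - by apply: measurable_funD; [exact: measurable_funD|exact: exprn_measurable].
  have -> : \int[mu]_x ((1 + x + x ^+ 2) * gauss t x) =
     \int[mu]_x gauss t x + \int[mu]_x (x ^+ 1 * gauss t x) + \int[mu]_x (x ^+ 2 * gauss t x).
    rewrite -RintegralD// -RintegralD//.
    by apply: eq_Rintegral => x _; rewrite expr1 !mulrDl mul1r.
  rewrite (gauss_moment1 t0) (gauss_moment_rec t0 (isT : (0 <= 2)%N)).
  under [in X in t * _ * X]eq_Rintegral do rewrite expr0 mul1r.
  rewrite Rintegral_gauss//; field.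
  by rewrite gt_eqF// sqrtr_gt0 !mulr_gt0// pi_gt0.
have i12 : P.-integrable setT (EFin \o (fun w => 1 + W t w)).
  by apply: eq_integrable (integrableD measurableT i1 iW).
rewrite (RintegralD measurableT i12 iW2) (RintegralD measurableT i1 iW).
have PT : fine (P setT) = 1 by rewrite probability_setT.
rewrite Rintegral_cst// mul1r PT {2}/Rintegral brownian_moment2//=.
lra.
Qed.

End brownian_moments.

(** Paths are extended evenly in time, in order to be continuous on the whole line. *)
Lemma continuous_even_extension (R : realType) (g : R -> R) :
  {within `[0, +oo[, continuous g} -> continuous (fun t : R => g `|t|).
Proof.
move=> /subspace_continuousP cg x; have x0 : `[0, +oo[%classic `|x|.
  by rewrite /= in_itv/= andbT.
apply: cvg_comp (cg _ x0) => U HU.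
have HN : \forall t \near x, `[0, +oo[%classic `|t| -> U `|t|.
  exact: (@norm_continuous R R^o x _ HU).
by apply: filterS HN => t; apply; rewrite /= in_itv/= andbT.
Qed.

(** W t is measurable for each time t, but nothing is assumed on W as a function of (t, w). Rounding
    the time down to the grid of step 1 / (n + 1) gives a jointly measurable function; the lower
    limit agrees with W ^ 4 on continuous paths, Fatou bounds its means, and Tonelli exchanges the
    integrals in time and in w. *)
Section joint_measurability.
Context (R : realType) d (T : measurableType d) (P : probability T R).
Variable W : R -> {RV P >-> R}.
Hypothesis BW : brownian_motion W.
Notation mu := (@lebesgue_measure R).

Let grid n (s : R) : R := (Num.truncn (s * n.+1%:R))%:R / n.+1%:R.

Let grid_ge0 n s : 0 <= grid n s. Proof. by rewrite divr_ge0. Qed.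

Let grid_le n s : 0 <= s -> grid n s <= s.
Proof. by move=> s0; rewrite ler_pdivrMr// truncn_le mulr_ge0. Qed.

Let grid_cvg (s : R) : 0 <= s -> grid n s @[n --> \oo] --> s.
Proof.
move=> s0; apply: (@squeeze_cvgr _ _ _ _ (fun n => s - n.+1%:R^-1) (fun=> s)).
- apply: nearW => n; rewrite grid_le// andbT lerBlDr.
  by rewrite /grid -[X in _ + X]mul1r -mulrDl ler_pdivlMr// ltW// natr1 truncnS_gt.
- suff : s - n.+1%:R^-1 @[n --> \oo] --> s - 0 by rewrite subr0.
  by apply: cvgB; [exact: cvg_cst|exact: cvg_harmonic].
- exact: cvg_cst.
Qed.

Let cell n k : set R := [set s | Num.truncn (s * n.+1%:R) = k].

Let measurable_lt n (k : R) : measurable [set s : R | s * n.+1%:R < k].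
Proof.
rewrite (_ : [set s | _] = `]-oo, (k / n.+1%:R)[%classic)//.
by apply/seteqP; split => s /=; rewrite in_itv/= ltr_pdivlMr.
Qed.

Let measurable_cell n k : measurable (cell n k).
Proof.
rewrite (_ : cell n k = [set s | s * n.+1%:R < k.+1%:R] `\`
   (if k is k'.+1 then [set s | s * n.+1%:R < k'.+1%:R] else set0)).
  by apply: measurableD; [exact: measurable_lt|case: k].
apply/seteqP; split => s; rewrite /cell/= -!truncn_le_nat.
  by move=> <-; split => //; case E: (Num.truncn _) => [|k'] //=; rewrite -truncn_le_nat E ltnn.
case: k => [|k] [h1 h2].
  by apply/eqP; rewrite -leqn0.
by apply/eqP; rewrite eqn_leq h1 ltnNge; apply/negP => h; apply: h2; rewrite /= -truncn_le_nat.
Qed.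

Let step n (x : measurableTypeR R * T) : \bar R := ((W (grid n x.1) x.2) ^+ 4)%:E.

Let measurable_step n : measurable_fun setT (step n).
Proof.
have -> : [set: measurableTypeR R * T] = \bigcup_k (cell n k `*` [set: T]).
  by apply/seteqP; split => // -[s w] _; exists (Num.truncn (s * n.+1%:R)).
apply/measurable_fun_bigcup => [k|k].
  by apply: measurableX => //; exact: measurable_cell.
apply: (@eq_measurable_fun _ _ _ _ _ (fun x => ((W (k%:R / n.+1%:R) x.2) ^+ 4)%:E)).
  by move=> -[s w]; rewrite inE /step /grid => -[/= -> _].
apply: measurable_funTS; apply/measurable_EFinP; apply: measurable_funX.
exact: measurableT_comp.
Qed.

Let jointW (x : measurableTypeR R * T) : \bar R := limn_einf (step ^~ x).

Let measurable_jointW : measurable_fun setT jointW.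
Proof.
rewrite (_ : jointW = (fun x => - limn_esup ((fun n x => - step n x) ^~ x))%E).
  apply: measurableT_comp => //; apply: measurable_fun_limn_esup => // n.
  exact: measurableT_comp.
apply/funext => x; rewrite /jointW /limn_einf; congr (- _)%E.
Qed.

Let step_ge0 n x : (0 <= step n x)%E.
Proof. by rewrite lee_fin exprn_even_ge0. Qed.

Let jointW_ge0 x : (0 <= jointW x)%E.
Proof.
rewrite /jointW limn_einf_lim; apply: lime_ge; first exact: is_cvg_einfs.
by apply: nearW => n; apply: le_ereal_inf_tmp => _ [m _ <-].
Qed.

Let jointWE w s : {within `[0, +oo[, continuous (fun t : R => W t w)} -> 0 <= s ->
  jointW (s, w) = ((W s w) ^+ 4)%:E.
Proof.
move=> cW s0; apply/(cvg_limn_einf_sup _).1.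
apply: cvg_EFin; first exact: nearW.
suff : W (grid n s) w @[n --> \oo] --> W s w.
  by move=> H; exact: (cvg_comp _ (fun x : R => x ^+ 4) H (@exprn_continuous R 4 _)).
have := continuous_even_extension cW => /(_ s) /(cvg_comp _ _ (grid_cvg s0)).
rewrite (ger0_norm s0); apply: cvg_trans; apply: near_eq_cvg.
by apply: nearW => n /=; rewrite ger0_norm.
Qed.

Let integral_jointW (s t : R) : 0 <= s -> s <= t -> 0 < t ->
  (\int[P]_w jointW (s, w) <= (3 * t ^+ 2)%:E)%E.
Proof.
move=> s0 st t0.
have mstep n : measurable_fun setT (fun w => step n (s, w)).
  rewrite /step /=.
  by apply/measurable_EFinP; exact: measurable_funX.
apply: (le_trans (fatou P measurableT mstep _)); first by move=> n x _; exact: step_ge0.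
rewrite limn_einf_lim; apply: lime_le; first exact: is_cvg_einfs.
apply: nearW => n; apply: ereal_inf_le; exists (\int[P]_w step n (s, w))%E.
  by exists n => //=.
rewrite /step /=.
have [g0|g0] := eqVneq (grid n s) 0.
  rewrite g0 (ae_eq_integral (cst 0%E))//.
  - by rewrite integral_cst// mul0e lee_fin mulr_ge0// sqr_ge0.
  - by apply/measurable_EFinP; apply: measurable_funX.
  - by apply: filterS (brownian0 BW) => w W0 _; rewrite W0 expr0n.
have gp : 0 < grid n s by rewrite lt_neqAle eq_sym g0 grid_ge0.
rewrite brownian_moment4// lee_fin ler_wpM2l// lerXn2r ?nnegrE ?(ltW gp) ?(ltW t0)//.
exact: le_trans (grid_le _ s0) st.
Qed.

Lemma brownian_path_moment4 (t : R) : 0 < t -> exists B : T -> \bar R,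
  [/\ measurable_fun setT B, forall w, (0 <= B w)%E,
      (\int[P]_w B w <= (3 * t ^+ 3)%:E)%E &
      forall w, {within `[0, +oo[, continuous (fun t : R => W t w)} ->
        (\int[mu]_(s in `[0%R, t]) ((W s w) ^+ 4)%:E = B w)%E].
Proof.
move=> t0.
pose I : set (measurableTypeR R) := `[0, t]%classic.
have mI : measurable I by exact: measurable_itv.
pose f (x : measurableTypeR R * T) := ((\1_I x.1)%:E * jointW x)%E.
have mf : measurable_fun setT f.
  apply: emeasurable_funM => //; apply/measurable_EFinP.
  by apply: measurableT_comp => //; exact: measurable_indic.
have f0 x : (0 <= f x)%E by rewrite mule_ge0// lee_fin.
have fI (g : R -> \bar R) : (\int[mu]_s ((\1_I s)%:E * g s) = \int[mu]_(s in I) g s)%E.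
  rewrite [RHS]integral_mkcond; apply: eq_integral => s _; rewrite patchE indicE.
  by case: ifP => _; rewrite ?mul1e ?mul0e.
exists (fun w => \int[mu]_s f (s, w))%E; split.
- exact: measurable_fun_fubini_tonelli_G.
- by move=> w; exact: integral_ge0.
- rewrite -(@fubini_tonelli _ _ _ _ _ mu P)//.
  apply: (@le_trans _ _ (\int[mu]_s ((\1_I s)%:E * (3 * t ^+ 2)%:E))%E).
    apply: ge0_le_integral => //.
    + by move=> s _; exact: integral_ge0.
    + exact: (@measurable_fun_fubini_tonelli_F _ _ _ _ _ P).
    + by apply/measurable_EFinP; apply: measurable_funM.
    move=> s _; rewrite /f /= indicE; case: (boolP (s \in I)) => [|_].
      rewrite inE /I/= in_itv/= => /andP[s0 st].
      under eq_integral do rewrite mul1e.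
      by rewrite mul1e integral_jointW.
    by under eq_integral do rewrite mul0e; rewrite integral0 mul0e.
  rewrite fI integral_cst//= lebesgue_measure_itv/= lte_fin t0 -EFinB -EFinM lee_fin subr0.
  by rewrite -mulrA -exprSr.
- move=> w cW; rewrite fI; apply: eq_integral => s; rewrite inE /I/= in_itv/= => /andP[s0 _].
  by rewrite jointWE.
Qed.

End joint_measurability.

(** * One small time step along a path *)

Section continuity.
Variable R : realType.
Implicit Types g h : R -> R.

Lemma continuous_const (c : R) : continuous (fun _ : R => c).
Proof. by move=> ?; exact: cvg_cst. Qed.

Lemma continuous_add g h : continuous g -> continuous h -> continuous (fun u : R => g u + h u).
Proof. by move=> cg ch x; apply: cvgD; [exact: cg|exact: ch]. Qed.

Lemma continuous_mul g h : continuous g -> continuous h -> continuous (fun u : R => g u * h u).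
Proof. by move=> cg ch x; apply: cvgM; [exact: cg|exact: ch]. Qed.

Lemma continuous_opp g : continuous g -> continuous (fun u : R => - g u).
Proof. by move=> cg x; apply: cvgN; exact: cg. Qed.

Lemma continuous_abs g : continuous g -> continuous (fun u : R => `|g u|).
Proof. by move=> cg x; apply: cvg_norm; exact: cg. Qed.

Lemma continuous_power n g : continuous g -> continuous (fun u : R => g u ^+ n).
Proof.
by move=> cg x; exact: (cvg_comp _ (fun u : R => u ^+ n) (cg x) (@exprn_continuous R n _)).
Qed.

Lemma continuous_sine g : continuous g -> continuous (fun u : R => sin (g u)).
Proof. by move=> cg x; exact: (cvg_comp g sin (cg x) (@continuous_sin R (g x))). Qed.

End continuity.
Arguments continuous_const {R} c.
Arguments continuous_add {R g h} _ _.
Arguments continuous_mul {R g h} _ _.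
Arguments continuous_opp {R g} _.
Arguments continuous_abs {R g} _.
Arguments continuous_power {R} n {g} _.
Arguments continuous_sine {R g} _.

Section path_integrals.
Variable R : realType.
Notation mu := (@lebesgue_measure R).
Implicit Types (g h : R -> R) (t c : R).

Lemma continuous_integrable_itv g (a b : R) : continuous g ->
  mu.-integrable `[a, b] (EFin \o g).
Proof.
move=> cg; apply: continuous_compact_integrable; first exact: segment_compact.
exact: continuous_subspaceT.
Qed.

Lemma le_Rintegral_itv g h t : continuous g -> continuous h ->
  (forall s, 0 <= s <= t -> g s <= h s) ->
  \int[mu]_(s in `[0, t]) g s <= \int[mu]_(s in `[0, t]) h s.
Proof.
by move=> cg ch gh; apply: le_Rintegral => //; exact: continuous_integrable_itv.
Qed.

Lemma Rintegral_itv_cst c t : 0 <= t -> \int[mu]_(s in `[0, t]) c = c * t.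
Proof.
move=> t0; rewrite Rintegral_cst//= lebesgue_measure_itv/= lte_fin.
move: t0; rewrite le_eqVlt => /orP[/eqP<-|t0]; first by rewrite ltxx mulr0.
by rewrite t0/= subr0.
Qed.

Lemma norm_Rintegral_itv_le g h t : continuous g -> continuous h ->
  (forall s, 0 <= s <= t -> `|g s| <= h s) ->
  `|\int[mu]_(s in `[0, t]) g s| <= \int[mu]_(s in `[0, t]) h s.
Proof.
move=> cg ch gh; apply: le_trans (le_Rintegral_itv (fun s => cvg_norm (cg s)) ch gh).
by apply: le_normr_Rintegral => //; exact: continuous_integrable_itv.
Qed.

Lemma RintegralD_itv g h t : continuous g -> continuous h ->
  \int[mu]_(s in `[0, t]) (g s + h s) =
  \int[mu]_(s in `[0, t]) g s + \int[mu]_(s in `[0, t]) h s.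
Proof. by move=> cg ch; rewrite RintegralD//; exact: continuous_integrable_itv. Qed.

Lemma RintegralZ_itv c g t : continuous g ->
  \int[mu]_(s in `[0, t]) (c * g s) = c * \int[mu]_(s in `[0, t]) g s.
Proof. by move=> cg; rewrite RintegralZl//; exact: continuous_integrable_itv. Qed.

Lemma Rintegral_itv_mono g s t : continuous g -> (forall u, 0 <= g u) ->
  0 <= s -> s <= t ->
  \int[mu]_(u in `[0, s]) g u <= \int[mu]_(u in `[0, t]) g u.
Proof.
move=> cg g0 s0 st; rewrite -subr_ge0 Rintegral_itvB.
- by apply: Rintegral_ge0 => u _.
- exact: continuous_integrable_itv.
- by rewrite bnd_simp.
- by rewrite bnd_simp.
Qed.

Lemma Rintegral_itv_ge0 g t : (forall u, 0 <= g u) ->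
  0 <= \int[mu]_(u in `[0, t]) g u.
Proof. by move=> g0; apply: Rintegral_ge0 => u _. Qed.

(** Integration of the tangent inequality u ^ 4 >= m ^ 4 + 4 m ^ 3 (u - m) at the mean m. *)
Lemma Rintegral_pow4_le g t : 0 < t -> continuous g -> (forall u, 0 <= g u) ->
  (\int[mu]_(s in `[0, t]) g s) ^+ 4 <= t ^+ 3 * \int[mu]_(s in `[0, t]) (g s) ^+ 4.
Proof.
move=> t0 cg g0; set I := \int[mu]_(s in `[0, t]) g s.
pose m := I / t.
have I0 : 0 <= I by exact: Rintegral_itv_ge0.
have m0 : 0 <= m by rewrite divr_ge0// ltW.
have c4 : continuous (fun s => g s ^+ 4).
  by move=> x; exact: (cvg_comp _ (fun u : R => u ^+ 4) (cg x) (@exprn_continuous R 4 _)).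
have cl : continuous (fun s => 4 * m ^+ 3 * g s) by move=> x; apply: cvgMr; exact: cg.
have ct : continuous (fun s => - 3 * m ^+ 4 + 4 * m ^+ 3 * g s).
  by move=> x; apply: cvgD; [exact: continuous_const|exact: cl].
have : \int[mu]_(s in `[0, t]) (- 3 * m ^+ 4 + 4 * m ^+ 3 * g s) <=
    \int[mu]_(s in `[0, t]) (g s) ^+ 4.
  apply: le_Rintegral_itv => // s _; rewrite -subr_ge0.
  have -> : g s ^+ 4 - (- 3 * m ^+ 4 + 4 * m ^+ 3 * g s) =
     (g s - m) ^+ 2 * ((g s + m) ^+ 2 + 2 * m ^+ 2) by ring.
  by rewrite mulr_ge0 ?sqr_ge0// addr_ge0 ?sqr_ge0// mulr_ge0// sqr_ge0.
rewrite (RintegralD_itv t (continuous_const (- 3 * m ^+ 4)) cl) (RintegralZ_itv _ _ cg).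
rewrite Rintegral_itv_cst ?(ltW t0)// -/I => H.
have -> : I ^+ 4 = t ^+ 3 * (- 3 * m ^+ 4 * t + 4 * m ^+ 3 * I).
  by rewrite /m; field; rewrite gt_eqF.
by rewrite ler_wpM2l ?exprn_ge0 ?(ltW t0).
Qed.

End path_integrals.

Section test_functions.
Variable R : realType.

(** The derivatives are carried as explicit functions: j1 in theta, j2 and j22 the first and second
    in z. They make the action of the generator a formula. *)
Record jet := Jet { j0 : R -> R -> R; j1 : R -> R -> R; j2 : R -> R -> R; j22 : R -> R -> R }.

Definition generator (gamma zs alpha : R) (F : jet) (th z : R) : R :=
  j1 F th z * (1 - z * sin th ^+ 2) - gamma * (z - zs) * j2 F th z +
  alpha ^+ 2 / 2 * j22 F th z.

Definition jet_remainder (F : jet) (th z th' z' : R) : R :=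
  j0 F th' z' - j0 F th z - j1 F th z * (th' - th) - j2 F th z * (z' - z)
  - 2^-1 * j22 F th z * (z' - z) ^+ 2.

End test_functions.

Section pathwise.
Variables (R : realType) (gamma zs alpha z0 t : R) (Th Z b : R -> R).
Notation mu := (@lebesgue_measure R).
Hypotheses (gamma0 : 0 < gamma) (alpha0 : 0 < alpha) (t0 : 0 < t).
Hypotheses (cTh : continuous Th) (cZ : continuous Z) (cb : continuous b).
Hypothesis gammat : gamma * t <= 2^-1.
Hypothesis ThE : forall s : R, 0 <= s -> Th s = Th 0 +
  \int[mu]_(u in `[0, s]) (1 - Z u * sin (Th u) ^+ 2).
Hypothesis ZE : forall s : R, 0 <= s -> Z s = z0 +
  \int[mu]_(u in `[0, s]) (- gamma * (Z u - zs)) + alpha * b s.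

Let y := z0 - zs.
Let J := \int[mu]_(u in `[0, t]) `|Z u - z0|.
Let Ib := \int[mu]_(u in `[0, t]) `|b u|.

Let cZ0 : continuous (fun u => Z u - z0). Proof. by apply: continuous_add => //; exact: continuous_const. Qed.
Let J0 : 0 <= J. Proof. exact: Rintegral_itv_ge0. Qed.
Let Ib0 : 0 <= Ib. Proof. exact: Rintegral_itv_ge0. Qed.

Lemma path_z_increment (s : R) : 0 <= s -> Z s - z0 = - gamma * y * s + alpha * b s -
  gamma * \int[mu]_(u in `[0, s]) (Z u - z0).
Proof.
move=> s0; rewrite {1}ZE//.
have -> : \int[mu]_(u in `[0, s]) (- gamma * (Z u - zs)) =
   \int[mu]_(u in `[0, s]) (- gamma * y + - gamma * (Z u - z0)).
  by apply: eq_Rintegral => u _; rewrite /y; ring.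
rewrite (RintegralD_itv s (continuous_const (- gamma * y)) (continuous_mul (continuous_const (- gamma)) cZ0)).
rewrite Rintegral_itv_cst// RintegralZ_itv//; ring.
Qed.

Let int_Zz0 (s : R) : 0 <= s -> s <= t -> `|\int[mu]_(u in `[0, s]) (Z u - z0)| <= J.
Proof.
move=> s0 st; apply: le_trans (_ : \int[mu]_(u in `[0, s]) `|Z u - z0| <= _).
  by apply: norm_Rintegral_itv_le => //; exact: continuous_abs.
by apply: Rintegral_itv_mono => //; exact: continuous_abs.
Qed.

Lemma path_z_bound (s : R) : 0 <= s -> s <= t ->
  `|Z s - z0| <= gamma * t * `|y| + gamma * J + alpha * `|b s|.
Proof.
move=> s0 st; rewrite path_z_increment//.
apply: (le_trans (ler_normB _ _)); rewrite normrM (gtr0_norm gamma0).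
apply: (le_trans (lerD (ler_normD _ _) (lexx _))).
rewrite !normrM normrN (gtr0_norm gamma0) (gtr0_norm alpha0) (ger0_norm s0).
rewrite addrAC lerD2r lerD//; last by rewrite ler_wpM2l ?(ltW gamma0)// int_Zz0.
by rewrite mulrAC ler_wpM2r// ler_wpM2l// ltW.
Qed.

(** The drift of z contributes gamma * t * J to J itself, which gamma * t <= 1 / 2 absorbs. *)
Lemma path_J_bound : J <= 2 * (gamma * t ^+ 2 * `|y| + alpha * Ib).
Proof.
have H : J <= (gamma * t * `|y| + gamma * J) * t + alpha * Ib.
  have E : \int[mu]_(u in `[0, t]) (gamma * t * `|y| + gamma * J + alpha * `|b u|) =
      (gamma * t * `|y| + gamma * J) * t + alpha * Ib.
    rewrite (RintegralD_itv t (continuous_const _) (continuous_mul (continuous_const alpha) (continuous_abs cb))).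
    by rewrite (RintegralZ_itv _ _ (continuous_abs cb)) Rintegral_itv_cst// ltW.
  rewrite -E.
  apply: le_Rintegral_itv.
  - exact: continuous_abs.
  - by apply: continuous_add; [exact: continuous_const|apply: continuous_mul; [exact: continuous_const|exact: continuous_abs]].
  - by move=> s /andP[s0 st]; exact: path_z_bound.
have : gamma * J * t <= 2^-1 * J by rewrite mulrAC ler_wpM2r.
by move: H; rewrite mulrDl; lra.
Qed.

Lemma path_theta_bound (s : R) : 0 <= s -> s <= t ->
  `|Th s - Th 0| <= t * (1 + `|z0|) + J.
Proof.
move=> s0 st; rewrite ThE// addrC addKr.
apply: le_trans (_ : \int[mu]_(u in `[0, s]) (1 + `|z0| + `|Z u - z0|) <= _).
  apply: norm_Rintegral_itv_le.
  - by apply: continuous_add; [exact: continuous_const|]; apply: continuous_opp; apply: continuous_mul => //; apply: continuous_power; exact: continuous_sine.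
  - by apply: continuous_add; [exact: continuous_const|exact: continuous_abs].
  - move=> u _; apply: (le_trans (ler_normB _ _)); rewrite normr1 -addrA lerD2l.
    rewrite normrM; have s1 : `|sin (Th u) ^+ 2| <= 1.
      by rewrite normrX exprn_ile1// ler_norml sin_geN1 sin_le1.
    apply: (le_trans (ler_wpM2l (normr_ge0 _) s1)); rewrite mulr1.
    by rewrite (le_trans _ (ler_normD _ _))// addrC subrK.
rewrite RintegralD_itv; [|exact: continuous_const|exact: continuous_abs].
rewrite Rintegral_itv_cst// lerD//; first by rewrite mulrC ler_wpM2r// addr_ge0.
by apply: Rintegral_itv_mono => //; exact: continuous_abs.
Qed.

Lemma path_theta_increment :
  `|Th t - Th 0 - t * (1 - z0 * sin (Th 0) ^+ 2)| <=
  J + 2 * `|z0| * t * (t * (1 + `|z0|) + J).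
Proof.
set A := t * (1 + `|z0|) + J.
have A0 : 0 <= A by rewrite addr_ge0// mulr_ge0 ?(ltW t0)// addr_ge0.
rewrite (ThE (ltW t0)) [Th 0 + _]addrC addrK mulrC.
have cf : continuous (fun u => 1 - Z u * sin (Th u) ^+ 2).
  by apply: continuous_add; [exact: continuous_const|]; apply: continuous_opp; apply: continuous_mul => //; apply: continuous_power; exact: continuous_sine.
rewrite -(Rintegral_itv_cst _ (ltW t0)).
rewrite -RintegralB//; first last.
- exact: (continuous_integrable_itv _ _ (continuous_const _)).
- exact: continuous_integrable_itv.
apply: le_trans (_ : \int[mu]_(u in `[0, t]) (`|Z u - z0| + 2 * `|z0| * A) <= _).
  apply: norm_Rintegral_itv_le.
  - by apply: continuous_add => //; apply: continuous_opp; exact: continuous_const.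
  - by apply: continuous_add; [exact: continuous_abs|exact: continuous_const].
  move=> u /andP[u0 ut].
  have -> : 1 - Z u * sin (Th u) ^+ 2 - (1 - z0 * sin (Th 0) ^+ 2) =
    - ((Z u - z0) * sin (Th u) ^+ 2) - z0 * (sin (Th u) ^+ 2 - sin (Th 0) ^+ 2) by ring.
  apply: (le_trans (ler_normB _ _)).
  rewrite normrN (normrM (Z u - z0)) (normrM z0); apply: lerD.
    have s1 : `|sin (Th u) ^+ 2| <= 1.
      by rewrite normrX exprn_ile1// ler_norml sin_geN1 sin_le1.
    by apply: (le_trans (ler_wpM2l (normr_ge0 _) s1)); rewrite mulr1.
  have -> : 2 * `|z0| * A = `|z0| * (2 * A) by ring.
  rewrite ler_wpM2l//.
  rewrite subr_sqr normrM mulrC ler_pM//.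
    apply: (le_trans (ler_normD _ _)); rewrite -[2]/(1 + 1).
    by rewrite lerD// ler_norml sin_geN1 sin_le1.
  apply: le_trans (path_theta_bound u0 ut).
  rewrite -[leRHS]mul1r; apply: (@derive_bounded_lipschitz R sin cos).
    by move=> x; rewrite ler_norml cos_geN1 cos_le1.
rewrite RintegralD_itv; [|exact: continuous_abs|exact: continuous_const].
by rewrite Rintegral_itv_cst ?(ltW t0)// lerD2l mulrAC.
Qed.

Lemma path_z_contraction : `|Z t - zs| <=
  (1 - gamma * t + 2 * (gamma * t) ^+ 2) * `|y| + alpha * (`|b t| + 2 * gamma * Ib).
Proof.
have -> : Z t - zs = (1 - gamma * t) * y + (alpha * b t -
   gamma * \int[mu]_(u in `[0, t]) (Z u - z0)).
  by have := path_z_increment (ltW t0); rewrite /y => H; lra.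
have gt1 : 0 <= 1 - gamma * t by move: gammat; lra.
apply: (le_trans (ler_normD _ _)); rewrite normrM (ger0_norm gt1).
apply: (le_trans (lerD (lexx _) (ler_normB _ _))).
rewrite !normrM (gtr0_norm gamma0) (gtr0_norm alpha0).
have H1 : gamma * `|\int[mu]_(u in `[0, t]) (Z u - z0)| <=
  gamma * (2 * (gamma * t ^+ 2 * `|y| + alpha * Ib)).
  by rewrite ler_wpM2l ?(ltW gamma0)// (le_trans (int_Zz0 (ltW t0) (lexx _)) path_J_bound).
apply: (le_trans (lerD (lexx _) (lerD (lexx _) H1))).
by rewrite le_eqVlt; apply/orP; left; apply/eqP; ring.
Qed.


Section taylor_expansion.
Variables (F : jet R) (C K r : R).
Hypotheses (t1 : t <= 1) (r0 : 0 < r) (rt : r ^+ 2 = t) (K1 : 1 <= K).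
Hypotheses (bK : `|b t| <= r * K) (IbK : Ib <= r ^+ 3 * K).
Hypotheses (F1 : `|j1 F (Th 0) z0| <= C) (F2 : `|j2 F (Th 0) z0| <= C)
  (F22 : `|j22 F (Th 0) z0| <= C).
Hypothesis FE : `|jet_remainder F (Th 0) z0 (Th t) (Z t)| <=
  C * ((`|Th t - Th 0| + `|Z t - z0| ^+ 2) * (`|Th t - Th 0| + `|Z t - z0|)).

Let c1 := 1 + gamma + alpha + `|zs|.
Let V := 1 + `|y| + K.

Let r1 : r <= 1.
Proof.
have : r ^+ 2 <= 1 ^+ 2 by rewrite rt expr1n.
by rewrite ler_sqr ?nnegrE ?ler01 // ltW.
Qed.

Let c11 : 1 <= c1. Proof. by rewrite /c1 -!addrA lerDl !addr_ge0// ltW. Qed.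
Let V1 : 1 <= V. Proof. by rewrite /V -addrA lerDl addr_ge0// (le_trans ler01). Qed.
Let mono (k : R) (a a' m m' n n' : nat) : 0 <= k -> (a <= a')%N -> (m' <= m)%N ->
  (n <= n')%N -> k * (c1 ^+ a * (r ^+ m * V ^+ n)) <= k * (c1 ^+ a' * (r ^+ m' * V ^+ n')).
Proof.
have V0 : 0 <= V by rewrite (le_trans ler01).
have c0 : 0 <= c1 by rewrite (le_trans ler01).
have r00 : 0 <= r by exact: ltW.
move=> k0 aa mm nn; rewrite ler_wpM2l//; apply: ler_pM.
- by rewrite exprn_ge0.
- by rewrite mulr_ge0 ?exprn_ge0.
- by rewrite ler_weXn2l.
- apply: ler_pM; rewrite ?exprn_ge0//; first by apply: ler_wiXn2l.
  by rewrite ler_weXn2l.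
Qed.

Let gc : gamma <= c1. Proof. by rewrite /c1; have := normr_ge0 zs; move: alpha0; lra. Qed.
Let ac : alpha <= c1. Proof. by rewrite /c1; have := normr_ge0 zs; move: gamma0; lra. Qed.
Let yV : `|y| <= V. Proof. by rewrite /V; move: K1; lra. Qed.
Let KV : K <= V. Proof. by rewrite /V; have := normr_ge0 y; lra. Qed.
Let z0V : 1 + `|z0| <= 2 * c1 * V.
Proof.
have zE : z0 = y + zs by rewrite /y; ring.
have : `|z0| <= `|y| + `|zs| by rewrite {1}zE ler_normD.
have := normr_ge0 y; have := normr_ge0 zs.
rewrite /c1 /V; move: gamma0 alpha0 K1; nra.
Qed.

Let JV : J <= 2 * c1 * r ^+ 3 * V.
Proof.
apply: (le_trans path_J_bound).
have -> : 2 * c1 * r ^+ 3 * V = 2 * (r ^+ 3 * (c1 * V)) by ring.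
rewrite ler_wpM2l//.
apply: (@le_trans _ _ (r ^+ 3 * (gamma * `|y| + alpha * K))).
  rewrite mulrDr; apply: lerD; last by rewrite mulrCA ler_wpM2l// ltW.
  rewrite -rt mulrAC [leRHS]mulrC ler_wpM2l//; first by rewrite mulr_ge0// ltW.
  by rewrite -exprM; apply: ler_wiXn2l => //; exact: ltW.
rewrite ler_wpM2l ?exprn_ge0 ?(ltW r0)//.
rewrite /c1 /V; have := normr_ge0 y; have := normr_ge0 zs; move: gamma0 alpha0 K1; nra.
Qed.

Let dThV : `|Th t - Th 0| <= 4 * c1 * r ^+ 2 * V.
Proof.
apply: (le_trans (path_theta_bound (ltW t0) (lexx _))).
have H : J <= 2 * c1 * r ^+ 2 * V.
  apply: (le_trans JV); rewrite ler_wpM2r ?(le_trans ler01)// ler_wpM2l//.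
    by rewrite mulr_ge0// (le_trans ler01).
  by apply: ler_wiXn2l => //; exact: ltW.
rewrite -rt; have : r ^+ 2 * (1 + `|z0|) <= r ^+ 2 * (2 * c1 * V).
  by rewrite ler_wpM2l// sqr_ge0.
lra.
Qed.

Let dzbV : `|Z t - z0 - alpha * b t| <= 3 * c1 ^+ 2 * r ^+ 2 * V.
Proof.
have -> : Z t - z0 - alpha * b t =
    - gamma * y * t - gamma * \int[mu]_(u in `[0, t]) (Z u - z0).
  by rewrite (path_z_increment (ltW t0)); ring.
apply: (le_trans (ler_normB _ _)); rewrite !normrM normrN (gtr0_norm gamma0) (gtr0_norm t0).
have H : gamma * `|\int[mu]_(u in `[0, t]) (Z u - z0)| <= c1 * (2 * c1 * r ^+ 3 * V).
  apply: ler_pM => //; first exact: ltW.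
  exact: le_trans (int_Zz0 (ltW t0) (lexx _)) JV.
have H1 : gamma * `|y| * t <= c1 * V * r ^+ 2.
  rewrite rt ler_wpM2r ?(ltW t0)//; apply: ler_pM => //; exact: ltW.
have H2 : c1 * V * r ^+ 2 <= c1 ^+ 2 * V * r ^+ 2.
  have := @mono 1 1 2 2 2 1 1 ler01 isT isT isT; lra.
have H3 : c1 * (2 * c1 * r ^+ 3 * V) <= 2 * c1 ^+ 2 * r ^+ 2 * V.
  have := @mono 2 2 2 3 2 1 1 (ler0n _ _) isT isT isT; lra.
lra.
Qed.

Let abV : `|alpha * b t| <= c1 * r * V.
Proof.
rewrite normrM (gtr0_norm alpha0) -mulrA; apply: ler_pM => //; first exact: ltW.
by apply: (le_trans bK); rewrite ler_wpM2l// ltW.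
Qed.

Let dzV : `|Z t - z0| <= 4 * c1 ^+ 2 * r * V.
Proof.
have -> : Z t - z0 = (Z t - z0 - alpha * b t) + alpha * b t by ring.
apply: (le_trans (ler_normD _ _)); apply: (le_trans (lerD dzbV abV)).
have H1 := @mono 1 1 2 1 1 1 1 ler01 isT isT isT.
have H2 := @mono 3 2 2 2 1 1 1 (ler0n _ _) isT isT isT.
lra.
Qed.

(** The noise is additive, so that Ito's formula for a short time t = r ^ 2 is a Taylor expansion
    along each path, without stochastic integral. The noise has size r, the drift moves the point by
    O(r ^ 2), and the remainder is O(r ^ 3), cubic in V = 1 + |z0 - zs| + K where K measures the
    noise on the scale r. *)
Lemma path_taylor :
  `|j0 F (Th t) (Z t) - j0 F (Th 0) z0 - t * generator gamma zs alpha F (Th 0) z0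
    - j2 F (Th 0) z0 * (alpha * b t)
    - 2^-1 * j22 F (Th 0) z0 * (alpha ^+ 2 * (b t ^+ 2 - t))| <=
  200 * c1 ^+ 6 * C * (r ^+ 3 * V ^+ 3).
Proof.
set th := Th 0; set dth := Th t - th; set dz := Z t - z0; set ab := alpha * b t.
have C0 : 0 <= C by exact: le_trans F1.
pose e1 := dth - t * (1 - z0 * sin th ^+ 2).
pose e2 := \int[mu]_(u in `[0, t]) (Z u - z0).
have dzE : dz = - gamma * y * t + ab - gamma * e2 by exact: path_z_increment (ltW t0).
have -> : j0 F (Th t) (Z t) - j0 F th z0 - t * generator gamma zs alpha F th z0
    - j2 F th z0 * ab - 2^-1 * j22 F th z0 * (alpha ^+ 2 * (b t ^+ 2 - t)) =
  jet_remainder F th z0 (Th t) (Z t) + j1 F th z0 * e1 + j2 F th z0 * (- (gamma * e2))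
  + j22 F th z0 * (2^-1 * ((dz - ab) * (dz + ab))).
  rewrite /jet_remainder -/dth -/dz /generator -/y /e1.
  have -> : j2 F th z0 * dz = j2 F th z0 * (- gamma * y * t + ab - gamma * e2) by rewrite dzE.
  by rewrite /ab; field.
have V0 : 0 <= V by rewrite (le_trans ler01).
have c0 : 0 <= c1 by rewrite (le_trans ler01).
have r00 : 0 <= r by exact: ltW.
set S := c1 ^+ 6 * (r ^+ 3 * V ^+ 3).
have T1 : `|jet_remainder F th z0 (Th t) (Z t)| <= C * (160 * S).
  apply: (le_trans FE); rewrite ler_wpM2l//.
  have A1 : `|dth| + `|dz| ^+ 2 <= 20 * (c1 ^+ 4 * (r ^+ 2 * V ^+ 2)).
    have h1 : 4 * c1 * r ^+ 2 * V <= 4 * (c1 ^+ 4 * (r ^+ 2 * V ^+ 2)).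
      have := @mono 4 1 4 2 2 1 2 (ler0n _ _) isT isT isT; lra.
    have h2 : `|dz| ^+ 2 <= 16 * (c1 ^+ 4 * (r ^+ 2 * V ^+ 2)).
      have -> : 16 * (c1 ^+ 4 * (r ^+ 2 * V ^+ 2)) = (4 * c1 ^+ 2 * r * V) ^+ 2 by ring.
      by rewrite lerXn2r// nnegrE !mulr_ge0// exprn_ge0.
    by have := le_trans dThV h1; move: h2; rewrite -/dth -/th; lra.
  have A2 : `|dth| + `|dz| <= 8 * (c1 ^+ 2 * (r * V)).
    have h1 : 4 * c1 * r ^+ 2 * V <= 4 * (c1 ^+ 2 * (r * V)).
      have := @mono 4 1 2 2 1 1 1 (ler0n _ _) isT isT isT; lra.
    have h2 : `|dz| <= 4 * (c1 ^+ 2 * (r * V)).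
      by rewrite (le_trans dzV)// !mulrA.
    by have := le_trans dThV h1; move: h2; rewrite -/dth -/th; lra.
  have -> : 160 * S = (20 * (c1 ^+ 4 * (r ^+ 2 * V ^+ 2))) * (8 * (c1 ^+ 2 * (r * V))).
    by rewrite /S; ring.
  by apply: ler_pM => //; rewrite addr_ge0.
have T2 : `|j1 F th z0 * e1| <= C * (18 * S).
  rewrite normrM; apply: ler_pM => //; apply: (le_trans path_theta_increment).
  have dB : t * (1 + `|z0|) + J <= 4 * c1 * r ^+ 2 * V.
    have H : J <= 2 * c1 * r ^+ 2 * V.
      apply: (le_trans JV); have := @mono 2 1 1 3 2 1 1 (ler0n _ _) isT isT isT; lra.
    have : t * (1 + `|z0|) <= t * (2 * c1 * V) by rewrite ler_wpM2l// ltW.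
    by rewrite -rt; lra.
  have h1 : 2 * `|z0| * t * (t * (1 + `|z0|) + J) <= (2 * (2 * c1 * V)) * r ^+ 2 * (4 * c1 * r ^+ 2 * V).
    apply: ler_pM => //.
    - by rewrite !mulr_ge0// ltW.
    - by rewrite addr_ge0// mulr_ge0 ?(ltW t0)// addr_ge0.
    - rewrite rt ler_wpM2r ?(ltW t0)// ler_wpM2l//; apply: le_trans z0V; lra.
  have h2 := @mono 2 1 6 3 3 1 3 (ler0n _ _) isT isT isT.
  have h3 := @mono 16 2 6 4 3 2 3 (ler0n _ _) isT isT isT.
  have E1 : 2 * (c1 ^+ 1 * (r ^+ 3 * V ^+ 1)) = 2 * c1 * r ^+ 3 * V by ring.
  have E2 : 16 * (c1 ^+ 2 * (r ^+ 4 * V ^+ 2)) = (2 * (2 * c1 * V)) * r ^+ 2 * (4 * c1 * r ^+ 2 * V) by ring.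
  rewrite -/S E1 in h2; rewrite -/S E2 in h3; have := JV; lra.
have T3 : `|j2 F th z0 * (- (gamma * e2))| <= C * (2 * S).
  rewrite normrM; apply: ler_pM => //; rewrite normrN normrM (gtr0_norm gamma0).
  apply: (@le_trans _ _ (c1 * (2 * c1 * r ^+ 3 * V))).
    apply: ler_pM => //; first exact: ltW.
    exact: le_trans (int_Zz0 (ltW t0) (lexx _)) JV.
  have := @mono 2 2 6 3 3 1 3 (ler0n _ _) isT isT isT; rewrite -/S; apply: le_trans.
  by rewrite le_eqVlt; apply/orP; left; apply/eqP; ring.
have T4 : `|j22 F th z0 * (2^-1 * ((dz - ab) * (dz + ab)))| <= C * (8 * S).
  rewrite normrM; apply: ler_pM => //; rewrite !normrM (ger0_norm (_ : 0 <= 2^-1 :> R))//.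
  have h1 : `|dz + ab| <= 5 * c1 ^+ 2 * r * V.
    apply: (le_trans (ler_normD _ _)); apply: (le_trans (lerD dzV abV)).
    have : c1 * r * V <= c1 ^+ 2 * r * V.
      have := @mono 1 1 2 1 1 1 1 ler01 isT isT isT; lra.
    lra.
  apply: (@le_trans _ _ (2^-1 * ((3 * c1 ^+ 2 * r ^+ 2 * V) * (5 * c1 ^+ 2 * r * V)))).
    by rewrite ler_wpM2l//; apply: ler_pM.
  have h2 := @mono (15 / 2) 4 6 3 3 2 3 (_ : 0 <= 15 / 2) isT isT isT.
  have -> : 2^-1 * ((3 * c1 ^+ 2 * r ^+ 2 * V) * (5 * c1 ^+ 2 * r * V)) =
     15 / 2 * (c1 ^+ 4 * (r ^+ 3 * V ^+ 2)) by field.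
  apply: (le_trans (h2 _)); first by rewrite divr_ge0.
  by rewrite -/S ler_wpM2r ?mulr_ge0 ?exprn_ge0//; lra.
have S0 : 0 <= S by rewrite !mulr_ge0 ?exprn_ge0.
apply: (le_trans (ler_normD _ _)); apply: (le_trans (lerD (ler_normD _ _) (lexx _))).
apply: (le_trans (lerD (lerD (ler_normD _ _) (lexx _)) (lexx _))).
apply: (le_trans (lerD (lerD (lerD T1 T2) T3) T4)).
have -> : 200 * c1 ^+ 6 * C * (r ^+ 3 * V ^+ 3) = C * (200 * S) by rewrite /S; ring.
by rewrite -!mulrDr ler_wpM2l//; lra.
Qed.

End taylor_expansion.

End pathwise.

(** * Functions on the phase space *)

Section circle_functions.
Variable R : realType.

Lemma circle_repr_period (x y : R) : \pi_(circle R) x = \pi_(circle R) y ->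
  cos x = cos y /\ sin x = sin y.
Proof.
move/eqmodP => /= ; rewrite /circle_rel => /intrP[k] /eqP.
rewrite eq_sym -(inj_eq (mulIf (_ : 2 * pi != 0 :> R))); last first.
  by rewrite mulf_neq0// gt_eqF// pi_gt0.
rewrite divfK; last by rewrite mulf_neq0// gt_eqF// pi_gt0.
move=> /eqP /esym/eqP; rewrite subr_eq => /eqP ->.
have p2 : 2 * pi = pi *+ 2 :> R by rewrite mulr_natl.
rewrite p2; case: k => n.
  have -> : (Posz n)%:~R * (pi *+ 2) + y = y + (pi *+ 2) *+ n :> R.
    by rewrite addrC -pmulrn mulr_natl.
  by rewrite (periodicn (@cosD2pi R)) (periodicn (@sinD2pi R)).
have -> : y = (Negz n)%:~R * (pi *+ 2) + y + (pi *+ 2) *+ n.+1 :> R.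
  by rewrite NegzE mulrNz -pmulrn mulNr mulr_natl addrAC addNr add0r.
rewrite (periodicn (@cosD2pi R)) (periodicn (@sinD2pi R)).
by rewrite NegzE mulrNz -pmulrn mulNr mulr_natl addrAC addNr add0r.
Qed.

Let measurable_continuous_circle (g : R -> R) : continuous g ->
  (forall x y : R, \pi_(circle R) x = \pi_(circle R) y -> g x = g y) ->
  measurable_fun setT (fun c : circle R => g (repr c)).
Proof.
move=> cg gE.
have cgr : continuous (g \o repr : circle R -> R).
  apply: (@repr_comp_continuous _ (circle R)) => // x y /eqP xy; apply/eqP; exact: gE.
apply: (measurability _ (RGenOInfty.measurableE R)) => _ [_ [a ->] <-].
rewrite setTI; apply: sub_sigma_algebra.
by move/continuousP: cgr => /(_ `]a, +oo[%classic); apply; exact: interval_open.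
Qed.

Lemma measurable_circle_cos : measurable_fun setT (fun c : circle R => cos (repr c) : R).
Proof.
apply: measurable_continuous_circle; first exact: continuous_cos.
by move=> x y /circle_repr_period[].
Qed.

Lemma measurable_circle_sin : measurable_fun setT (fun c : circle R => sin (repr c) : R).
Proof.
apply: measurable_continuous_circle; first exact: continuous_sin.
by move=> x y /circle_repr_period[].
Qed.

Lemma measurable_circle_pi : measurable_fun setT (\pi_(circle R) : R -> circle R).
Proof.
apply: (@measurability _ _ R (circle R) setT _ (@open (circle R))) => // _ [U oU <-].
rewrite setTI; apply: open_measurable.
have /continuousP := @pi_continuous R (circle R); exact.
Qed.

(** Such a function does not depend on the representative of the angle, and is measurable on the
    phase space since cos and sin are continuous on the circle. *)
Definition cyl (f : R -> R -> R) := exists2 F : R * R * R -> R,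
  measurable_fun setT F & forall th z, f th z = F (cos th, sin th, z).

Definition on_circle (f : R -> R -> R) (x : circle R * R) : R := f (repr x.1) x.2.

Lemma measurable_cyl f : cyl f -> measurable_fun setT (on_circle f).
Proof.
move=> [F mF fF]; rewrite (_ : on_circle f = F \o
    (fun x : circle R * R => (cos (repr x.1), sin (repr x.1), x.2))); last first.
  by apply/funext => x; rewrite /on_circle fF.
apply: measurableT_comp => //; apply: measurable_fun_pair => //.
apply: measurable_fun_pair.
  exact: (measurableT_comp measurable_circle_cos (@measurable_fst _ _ _ _)).
exact: (measurableT_comp measurable_circle_sin (@measurable_fst _ _ _ _)).
Qed.

Lemma cyl_pi f th z : cyl f -> on_circle f (\pi_(circle R) th, z) = f th z.
Proof.
move=> [F _ fF]; rewrite /on_circle/= !fF.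
by have [-> ->] := @circle_repr_period (repr (\pi_(circle R) th)) th (reprK _).
Qed.

Lemma cyl_cos : cyl (fun th _ => cos th).
Proof. by exists (fun x => x.1.1) => //; apply: measurableT_comp. Qed.

Lemma cyl_sin : cyl (fun th _ => sin th).
Proof. by exists (fun x => x.1.2) => //; apply: measurableT_comp. Qed.

Lemma cyl_z : cyl (fun _ z => z).
Proof. by exists snd => //; exact: measurable_snd. Qed.

Lemma cyl_comp (psi : R -> R) f : measurable_fun setT psi -> cyl f ->
  cyl (fun th z => psi (f th z)).
Proof.
move=> mpsi [F mF fF]; exists (psi \o F); first exact: measurableT_comp.
by move=> th z; rewrite fF.
Qed.

Lemma cyl_cst (c : R) : cyl (fun _ _ => c).
Proof. by exists (fun=> c). Qed.

Lemma cylD f g : cyl f -> cyl g -> cyl (fun th z => f th z + g th z).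
Proof.
move=> [F mF fF] [G mG gG]; exists (fun x => F x + G x); first exact: measurable_funD.
by move=> th z; rewrite fF gG.
Qed.

Lemma cylM f g : cyl f -> cyl g -> cyl (fun th z => f th z * g th z).
Proof.
move=> [F mF fF] [G mG gG]; exists (fun x => F x * G x); first exact: measurable_funM.
by move=> th z; rewrite fF gG.
Qed.

Lemma cylN f : cyl f -> cyl (fun th z => - f th z).
Proof. exact: (@cyl_comp -%R). Qed.

Lemma cylB f g : cyl f -> cyl g -> cyl (fun th z => f th z - g th z).
Proof. by move=> cf cg; apply: cylD => //; exact: cylN. Qed.

Lemma cylX n f : cyl f -> cyl (fun th z => f th z ^+ n).
Proof. exact: (@cyl_comp (fun x => x ^+ n)). Qed.

End circle_functions.

(** * Invariance when measurability in the initial point is unknown *)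

Section lower_integral.
Context d (X : measurableType d) (R : realType).
Variable mu : {finite_measure set X -> \bar R}.
Import HBNNSimple.

(** The integral of a nonnegative function is the supremum over simple functions below it, whether or
    not it is measurable; the supremum of a maximizing sequence attains it. *)
Lemma lower_integral_attained (u : X -> \bar R) : (forall x, 0 <= u x)%E ->
  (\int[mu]_x u x)%E \is a fin_num ->
  exists h : X -> \bar R, [/\ measurable_fun setT h, forall x, (0 <= h x)%E,
    forall x, (h x <= u x)%E & (\int[mu]_x h x = \int[mu]_x u x)%E].
Proof.
move=> u0; rewrite (ge0_integralTE _ u0).
set S := (X in ereal_sup X) => Sfin.
have : forall n : nat, exists g : {nnsfun X >-> R}, (forall x, (g x)%:E <= u x)%E /\
    (ereal_sup S - (n.+1%:R^-1)%:E < sintegral mu g)%E.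
  move=> n; have n0 : 0 < n.+1%:R^-1 :> R by [].
  by have [_ [g gu <-] lt] := ub_ereal_sup_adherent n0 Sfin; exists g.
move=> /choice[g gP].
pose h x := esups (fun n => (g n x)%:E) 0.
have mh : measurable_fun setT h.
  by apply: measurable_fun_esups => n; exact/measurable_EFinP.
have gh n x : ((g n x)%:E <= h x)%E by apply: ereal_sup_ubound; exists n.
have h0 x : (0 <= h x)%E by apply: le_trans (gh 0%N x); rewrite lee_fin.
have hu x : (h x <= u x)%E by apply: ge_ereal_sup => _ [n _ <-]; exact: (gP n).1.
exists h; split => //.
apply/eqP; rewrite eq_le; apply/andP; split.
  rewrite (ge0_integralTE _ h0); apply: le_ereal_sup => _ [f fh <-].
  by exists f => // x; exact: le_trans (fh x) (hu x).
apply/lee_addgt0Pr => e e0.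
have [n ne] : exists n, n.+1%:R^-1 < e.
  by have [n] := ltr_add_invr e0; rewrite add0r => ?; exists n.
have := (gP n).2; rewrite lteBlDr// => /ltW /le_trans; apply.
apply: leeD; last by rewrite lee_fin ltW.
rewrite -integralT_nnsfun; apply: ge0_le_integral => //.
- by move=> x _; rewrite lee_fin.
- exact/measurable_EFinP.
Qed.

Variable nu : X -> {measure set X -> \bar R}.
Hypothesis inv : forall A, measurable A -> (\int[mu]_x nu x A = mu A)%E.

(** The laws nu x are known for each x, but not to be measurable in x, so that invariance is an
    identity between lower integrals, which are only superadditive. This suffices for an upper bound:
    for a simple function below psi each term of the sum is replaced by a measurable minorant with the
    same integral, and the sum of the minorants stays below K. *)
Lemma invariant_integral_le (psi : X -> R) (K : X -> \bar R) :
  measurable_fun setT psi -> (forall x, 0 <= psi x) ->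
  measurable_fun setT K -> (forall x, \int[nu x]_y (psi y)%:E <= K x)%E ->
  (\int[mu]_x (psi x)%:E <= \int[mu]_x K x)%E.
Proof.
move=> mpsi psi0 mK nuK.
have psi0E x : (0 <= (psi x)%:E)%E by rewrite lee_fin.
have K0 x : (0 <= K x)%E by apply: le_trans (nuK x); exact: integral_ge0.
rewrite (ge0_integralTE _ psi0E); apply: ge_ereal_sup => _ [f fpsi <-].
have /choice[h hP] : forall r : R, exists h : X -> \bar R,
    [/\ measurable_fun setT h, forall x, (0 <= h x)%E,
    forall x, (h x <= nu x (f @^-1` [set r]))%E & (\int[mu]_x h x = mu (f @^-1` [set r]))%E].
  move=> r; have mr : measurable (f @^-1` [set r]) by exact: measurable_funPTI.
  have [//||h [mh h0 hu hE]] := @lower_integral_attained (fun x => nu x (f @^-1` [set r])).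
    by rewrite inv//; exact: fin_num_measure.
  by exists h; split => //; rewrite hE inv.
rewrite -integralT_nnsfun.
under eq_integral do rewrite fimfunE -fsumEFin//.
have rh0 r x : (0 <= r%:E * (\1_(f @^-1` [set r]) x)%:E)%E.
  by rewrite -EFinM; exact: nnfun_muleindic_ge0.
rewrite ge0_integral_fsum//; last 2 first.
  - by move=> r; exact/measurable_EFinP/measurableT_comp.
  - by move=> r x _; rewrite EFinM.
apply: (@le_trans _ _ (\sum_(r \in range f) (r%:E * \int[mu]_x h r x)%E)%E).
  apply: lee_fsum => // r [x _ fx].
  have [_ _ _ ->] := hP r; under eq_integral do rewrite EFinM.
  have r0 : 0 <= r by rewrite -fx.
  rewrite ge0_integralZl//=.
  - by rewrite integral_indic// ?setIT.
  - by apply/measurable_EFinP; exact: measurable_indic.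
have hm r : measurable_fun setT (h r) by have [] := hP r.
have h0 r x : (0 <= h r x)%E by have [] := hP r.
have -> : (\sum_(r \in range f) (r%:E * \int[mu]_x h r x) =
    \int[mu]_x \sum_(r \in range f) (`|r|%:E * h r x))%E.
  rewrite ge0_integral_fsum//.
  - apply: eq_fsbigr => r; rewrite inE => -[x _ fx].
    have r0 : 0 <= r by rewrite -fx.
    by rewrite ge0_integralZl// ger0_norm.
  - by move=> r; exact: measurable_funeM.
  - by move=> r x _; rewrite mule_ge0// lee_fin.
apply: ge0_le_integral => //.
- by move=> x _; apply: fsume_ge0 => r _; rewrite mule_ge0// lee_fin.
- by apply: emeasurable_fsum => // r; exact: measurable_funeM.
move=> x _; apply: le_trans (nuK x).
apply: (@le_trans _ _ (\int[nu x]_y (f y)%:E)%E).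
  under eq_integral do rewrite fimfunE -fsumEFin//.
  rewrite ge0_integral_fsum//; last 2 first.
    - by move=> r; exact/measurable_EFinP/measurableT_comp.
    - by move=> r y _; rewrite EFinM.
  apply: lee_fsum => // r [y _ fy]; have r0 : 0 <= r by rewrite -fy.
  rewrite ger0_norm//; under eq_integral do rewrite EFinM.
  have mr : measurable (f @^-1` [set r]) by exact: measurable_funPTI.
  rewrite ge0_integralZl//=.
  - by rewrite integral_indic// ?setIT lee_wpmul2l ?lee_fin//; have [_ _ ->] := hP r.
  - by apply/measurable_EFinP; exact: measurable_indic.
apply: ge0_le_integral => //.
- by move=> y _; rewrite lee_fin.
- exact/measurable_EFinP.
- exact/measurable_EFinP.
Qed.

End lower_integral.

Lemma ae_le_Rintegral d (T : measurableType d) (R : realType)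
  (P : {measure set T -> \bar R}) (f g : T -> R) :
  P.-integrable setT (EFin \o f) -> P.-integrable setT (EFin \o g) ->
  {ae P, forall w, f w <= g w} -> \int[P]_w f w <= \int[P]_w g w.
Proof.
move=> If Ig fg; rewrite -subr_ge0 -RintegralB//.
have Igf : P.-integrable setT (EFin \o (fun w => g w - f w)).
  by apply: eq_integrable (integrableB measurableT Ig If).
rewrite /Rintegral (ae_eq_integral (fun w => `|g w - f w|%:E))//.
- by apply: fine_ge0; apply: integral_ge0 => w _; rewrite lee_fin.
- exact: measurable_int Igf.
- exact: measurable_int (integrable_norm Igf).
- by apply: filterS fg => w fgw _; rewrite ger0_norm// subr_ge0.
Qed.

Section brownian_bound.
Context (R : realType) d (T : measurableType d) (P : probability T R).
Variable W : R -> {RV P >-> R}.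
Hypothesis BW : brownian_motion W.
Notation mu := (@lebesgue_measure R).

Lemma integrable_brownian4 (t : R) : 0 < t -> P.-integrable setT (fun w => ((W t w) ^+ 4)%:E).
Proof.
move=> t0; apply/integrableP; split; first exact/measurable_EFinP/measurable_funX.
rewrite (eq_integral (fun w => ((W t w) ^+ 4)%:E)).
  by rewrite brownian_moment4// ltry.
by move=> w _; rewrite gee0_abs// lee_fin exprn_even_ge0.
Qed.

Lemma brownian_path_bound (t : R) : 0 < t -> exists B : T -> R,
  [/\ P.-integrable setT (EFin \o B), \int[P]_w B w <= 3 * t ^+ 3 &
      {ae P, forall w, forall b : R -> R, continuous b ->
        (forall s, 0 <= s -> b s = W s w) ->
        (\int[mu]_(s in `[0, t]) `|b s|) ^+ 4 <= t ^+ 3 * B w}].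
Proof.
move=> t0; have [B [mB B0 BE BW4]] := brownian_path_moment4 BW t0.
have iB : P.-integrable setT B.
  apply/integrableP; split => //; rewrite (eq_integral B).
    by apply: le_lt_trans BE _; rewrite ltry.
  by move=> w _; rewrite gee0_abs.
have finB : {ae P, forall w, B w \is a fin_num}.
  by apply: filterS (integrable_ae measurableT iB) => w; apply.
have aeB : ae_eq P setT (EFin \o (fine \o B)) B.
  by apply: filterS finB => w Bw _ /=; rewrite fineK.
have mfB : measurable_fun setT (EFin \o (fine \o B)).
  by apply/measurable_EFinP; apply: measurableT_comp.
have E : (\int[P]_w (EFin \o (fine \o B)) w = \int[P]_w B w)%E by exact: ae_eq_integral.
exists (fine \o B); split.
- apply/integrableP; split => //.
  rewrite (eq_integral (EFin \o (fine \o B))).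
    by rewrite E; apply: le_lt_trans BE _; rewrite ltry.
  by move=> w _; rewrite gee0_abs// lee_fin fine_ge0.
- rewrite /Rintegral E -lee_fin fineK//; exact: integrable_fin_num.
- apply: filterS finB => w Bw b cb bW.
  apply: (le_trans (Rintegral_pow4_le t0 (continuous_abs cb) _)) => //.
  rewrite ler_wpM2l ?exprn_ge0 ?(ltW t0)//.
  have cW : {within `[0, +oo[, continuous (fun t => W t w)}.
    apply/subspace_continuousP => x; rewrite /= in_itv/= andbT => x0.
    change (W y w @[y --> within `[0, +oo[%classic (nbhs x)] --> W x w).
    rewrite -bW//; apply: (@cvg_trans _ (b y @[y --> within `[0, +oo[%classic (nbhs x)])); last first.
      by apply: cvg_trans (cb x); apply: cvg_app; exact: cvg_within.
    apply: near_eq_cvg; near=> y; apply: bW.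
    have : `[0, +oo[%classic y by near: y; exact: withinT.
    by rewrite /= in_itv/= andbT.
  rewrite /Rintegral /comp -(BW4 w cW) le_eqVlt; apply/orP; left; apply/eqP; congr fine.
  apply: eq_integral => s; rewrite inE/= in_itv/= => /andP[s0 _].
  by rewrite bW// -normrX ger0_norm// exprn_even_ge0.
Unshelve. all: by end_near. Qed.

End brownian_bound.

Section solution_laws.
Context (R : realType) d (T : measurableType d) (P : probability T R).
Variable W : R -> {RV P >-> R}.
Hypothesis BW : brownian_motion W.
Variables (gamma zs alpha : R).
Hypotheses (gamma0 : 0 < gamma) (alpha0 : 0 < alpha).
Notation leb := (@lebesgue_measure R).
Notation X := (circle R * R)%type.

Lemma solution_path (x : X) (theta z : R -> {RV P >-> R}) :
  solution gamma zs alpha W x theta z ->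
  {ae P, forall w, exists Th Z b : R -> R,
    [/\ continuous Th, continuous Z & continuous b] /\
    [/\ forall s, 0 <= s -> Th s = theta s w, forall s, 0 <= s -> Z s = z s w &
        forall s, 0 <= s -> b s = W s w] /\
    [/\ \pi_(circle R) (Th 0) = x.1,
        forall s : R, 0 <= s -> Th s = Th 0 +
          \int[leb]_(u in `[0, s]) (1 - Z u * sin (Th u) ^+ 2) &
        forall s : R, 0 <= s -> Z s = x.2 +
          \int[leb]_(u in `[0, s]) (- gamma * (Z u - zs)) + alpha * b s]}.
Proof.
move=> sol; apply: filterS2 sol (brownian_continuous BW) => w [cth cz th0 thE zE] cW.
exists (fun s => theta `|s| w), (fun s => z `|s| w), (fun s => W `|s| w); split.
  split; [exact: (@continuous_even_extension R (fun s => theta s w)) |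
    exact: (@continuous_even_extension R (fun s => z s w)) |
    exact: (@continuous_even_extension R (fun s => W s w))].
split; first by split => s s0; rewrite ger0_norm.
split.
- by rewrite normr0.
- move=> s s0; rewrite normr0 (ger0_norm s0) thE//; congr (_ + _).
  apply: eq_Rintegral => u; rewrite inE/= in_itv/= => /andP[u0 _].
  by rewrite ger0_norm.
- move=> s s0; rewrite (ger0_norm s0) zE//; congr (_ + _ + _).
  apply: eq_Rintegral => u; rewrite inE/= in_itv/= => /andP[u0 _].
  by rewrite ger0_norm.
Qed.

Variable mu : probability X R.
Hypothesis inv : invariant_measure gamma zs alpha W mu.

Lemma invariant_le (psi : R -> R -> R) (t : R) (K : X -> R) : 0 <= t ->
  cyl psi -> (forall th z, 0 <= psi th z) ->
  measurable_fun setT K ->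
  (forall x (theta z : R -> {RV P >-> R}), solution gamma zs alpha W x theta z ->
    (\int[P]_w (psi (theta t w) (z t w))%:E <= (K x)%:E)%E) ->
  (\int[mu]_x (on_circle psi x)%:E <= \int[mu]_x (K x)%:E)%E.
Proof.
move=> t0 cpsi psi0 mK PK; have [theta [z [sol invA]]] := inv.
have mg x : measurable_fun setT (fun w => (\pi_(circle R) (theta x t w), z x t w)).
  by apply: measurable_fun_pair => //; apply: (measurableT_comp (@measurable_circle_pi R)).
pose g x : {mfun T >-> X} := HB.pack (fun w => (\pi_(circle R) (theta x t w), z x t w))
  (isMeasurableFun.Build _ _ _ _ _ (mg x)).
have mpsi := measurable_cyl cpsi.
apply: (@invariant_integral_le _ X R mu (fun x => distribution P (g x))) => //.
- by move=> A mA; exact: invA.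
- by move=> x; exact: psi0.
- exact/measurable_EFinP.
- move=> x; rewrite ge0_integral_distribution//.
  + by apply: le_trans (PK x (theta x) (z x) (sol x)); under eq_integral do rewrite /= cyl_pi//.
  + exact/measurable_EFinP.
  + by move=> y; rewrite lee_fin; exact: psi0.
Qed.

End solution_laws.

Lemma integrable_dominated d (X : measurableType d) (R : realType)
  (mu : {measure set X -> \bar R}) (f g : X -> R) : measurable_fun setT f ->
  (forall x, `|f x| <= g x) -> mu.-integrable setT (EFin \o g) ->
  mu.-integrable setT (EFin \o f).
Proof.
move=> mf fg; apply: le_integrable => //; first exact/measurable_EFinP.
by move=> x _; rewrite /= lee_fin; apply: le_trans (fg x) (ler_norm _).
Qed.

Lemma integrable_bounded d (X : measurableType d) (R : realType)
  (mu : {finite_measure set X -> \bar R}) (f : X -> R) (C : R) : measurable_fun setT f ->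
  (forall x, `|f x| <= C) -> mu.-integrable setT (EFin \o f).
Proof.
move=> mf fC; apply: (@integrable_dominated _ _ _ _ _ (cst C)) => //.
exact: finite_measure_integrable_cst.
Qed.

Lemma integrableRZ d (X : measurableType d) (R : realType)
  (mu : {measure set X -> \bar R}) (c : R) (f : X -> R) :
  mu.-integrable setT (EFin \o f) -> mu.-integrable setT (EFin \o (fun x => c * f x)).
Proof. by move=> i; apply: eq_integrable (integrableZl measurableT c i). Qed.

Lemma integrableRD d (X : measurableType d) (R : realType)
  (mu : {measure set X -> \bar R}) (f g : X -> R) :
  mu.-integrable setT (EFin \o f) -> mu.-integrable setT (EFin \o g) ->
  mu.-integrable setT (EFin \o (fun x => f x + g x)).
Proof. by move=> i j; apply: eq_integrable (integrableD measurableT i j). Qed.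

(** * Moments of the invariant measure *)

Section regular_functions.
Variable R : realType.

(** Bounded and Lipschitz, uniformly in the angle, for z in I. *)
Definition bl (I : set R) (f : R -> R -> R) := exists2 C : R, 0 <= C &
  (forall th z, I z -> `|f th z| <= C) /\
  (forall th th' z z', I z -> I z' -> `|f th' z' - f th z| <= C * (`|th' - th| + `|z' - z|)).

(** The test functions. The derivatives hold everywhere while the bounds are required on I: functions
    of z such as z itself enter on compact intervals, before they are cut off. *)
Record smooth (I : set R) (F : jet R) : Prop := Smooth {
  cyl_j0 : cyl (j0 F) ; cyl_j1 : cyl (j1 F) ; cyl_j2 : cyl (j2 F) ; cyl_j22 : cyl (j22 F) ;
  derive_j1 : forall th z : R, is_derive th 1 (fun th => j0 F th z) (j1 F th z) ;
  derive_j2 : forall th z : R, is_derive z 1 (j0 F th) (j2 F th z) ;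
  derive_j22 : forall th z : R, is_derive z 1 (j2 F th) (j22 F th z) ;
  bl_j0 : bl I (j0 F) ; bl_j1 : bl I (j1 F) ; bl_j2 : bl I (j2 F) ; bl_j22 : bl I (j22 F) }.

Lemma smooth_jet_remainder F : smooth setT F -> exists2 C : R, 0 <= C &
  [/\ forall th z, `|j0 F th z| <= C, forall th z, `|j1 F th z| <= C,
      forall th z, `|j2 F th z| <= C, forall th z, `|j22 F th z| <= C &
      forall th z th' z', `|jet_remainder F th z th' z'| <=
        C * ((`|th' - th| + `|z' - z| ^+ 2) * (`|th' - th| + `|z' - z|))].
Proof.
move=> sF; have [C0 C00 [b0 _]] := bl_j0 sF; have [C1 C10 [b1 l1]] := bl_j1 sF.
have [C2 C20 [b2 _]] := bl_j2 sF; have [C3 C30 [b3 l3]] := bl_j22 sF.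
exists (C0 + C1 + C2 + C3); first by rewrite !addr_ge0.
split=> [th z|th z|th z|th z|th z th' z'].
- by have := b0 th z Logic.I; move: C10 C20 C30; lra.
- by have := b1 th z Logic.I; move: C00 C20 C30; lra.
- by have := b2 th z Logic.I; move: C00 C10 C30; lra.
- by have := b3 th z Logic.I; move: C00 C10 C20; lra.
set a := `|th' - th|; set b := `|z' - z|.
have T1 : `|j0 F th' z' - j0 F th z' - j1 F th z' * (th' - th)| <= C1 * a ^+ 2.
  apply: (taylor2 (fun u => derive_j1 sF u z')) => x y.
  by have := l1 x y z' z' Logic.I Logic.I; rewrite subrr normr0 addr0.
have T2 : `|(j1 F th z' - j1 F th z) * (th' - th)| <= C1 * b * a.
  rewrite normrM ler_wpM2r//.
  by have := l1 th th z z' Logic.I Logic.I; rewrite subrr normr0 add0r.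
have T3 : `|j0 F th z' - j0 F th z - j2 F th z * (z' - z) - 2^-1 * j22 F th z * (z' - z) ^+ 2|
    <= C3 * b ^+ 3.
  apply: (taylor3 (fun u => derive_j2 sF th u) (fun u => derive_j22 sF th u)) => x y.
  by have := l3 th th x y Logic.I Logic.I; rewrite subrr normr0 add0r.
rewrite /jet_remainder.
have -> : j0 F th' z' - j0 F th z - j1 F th z * (th' - th) - j2 F th z * (z' - z) -
    2^-1 * j22 F th z * (z' - z) ^+ 2 =
  (j0 F th' z' - j0 F th z' - j1 F th z' * (th' - th)) +
  (j1 F th z' - j1 F th z) * (th' - th) +
  (j0 F th z' - j0 F th z - j2 F th z * (z' - z) - 2^-1 * j22 F th z * (z' - z) ^+ 2) by ring.
apply: (le_trans (ler_normD _ _)); apply: (le_trans (lerD (ler_normD _ _) (lexx _))).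
apply: (le_trans (lerD (lerD T1 T2) T3)).
have a0 : 0 <= a by exact: normr_ge0.
have b0' : 0 <= b by exact: normr_ge0.
have -> : (a + b ^+ 2) * (a + b) = a ^+ 2 + b * a + a * b ^+ 2 + b ^+ 3 by ring.
have h1 : 0 <= C1 * (a * b ^+ 2 + b ^+ 3) by rewrite !(mulr_ge0,addr_ge0,exprn_ge0).
have h2 : 0 <= C3 * (a ^+ 2 + b * a + a * b ^+ 2) by rewrite !(mulr_ge0,addr_ge0,exprn_ge0).
have h3 : 0 <= (C0 + C2) * (a ^+ 2 + b * a + a * b ^+ 2 + b ^+ 3).
  by rewrite !(mulr_ge0,addr_ge0,exprn_ge0).
by move: h1 h2 h3; rewrite !(mulrDl,mulrDr) -!mulrA; lra.
Qed.

End regular_functions.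

Lemma convex_pow4 (R : realType) (a n : R) :
  (7 / 8 * a + n) ^+ 4 <= 7 / 8 * a ^+ 4 + 512 * n ^+ 4.
Proof.
pose u := 7 / 8 * a + n.
have T (x : R) : u ^+ 4 + 4 * u ^+ 3 * (x - u) <= x ^+ 4.
  rewrite -subr_ge0.
  have -> : x ^+ 4 - (u ^+ 4 + 4 * u ^+ 3 * (x - u)) = (x - u) ^+ 2 * ((x + u) ^+ 2 + 2 * u ^+ 2) by ring.
  by rewrite mulr_ge0 ?sqr_ge0// addr_ge0 ?sqr_ge0// mulr_ge0 ?sqr_ge0.
have := T a; have := T (8 * n); rewrite -/u.
have -> : (8 * n) ^+ 4 = 4096 * n ^+ 4 by ring.
have : 4 * u ^+ 3 * (8 * n - u) = - 7 * (4 * u ^+ 3 * (a - u)) by rewrite /u; field.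
lra.
Qed.

Lemma pow4_sum2 (R : realType) (a b : R) : (a + b) ^+ 4 <= 8 * (a ^+ 4 + b ^+ 4).
Proof.
rewrite -subr_ge0.
have -> : 8 * (a ^+ 4 + b ^+ 4) - (a + b) ^+ 4 =
  (a - b) ^+ 2 * (7 * a ^+ 2 + 10 * (a * b) + 7 * b ^+ 2) by ring.
rewrite mulr_ge0 ?sqr_ge0//.
have := sqr_ge0 (a + b); have := sqr_ge0 a; have := sqr_ge0 b; rewrite sqrrD; lra.
Qed.

Section invariance.
Context (R : realType) d (T : measurableType d) (P : probability T R).
Variable W : R -> {RV P >-> R}.
Hypothesis BW : brownian_motion W.
Variables (gamma zs alpha : R).
Hypotheses (gamma0 : 0 < gamma) (alpha0 : 0 < alpha).
Notation leb := (@lebesgue_measure R).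
Notation X := (circle R * R)%type.
Variable mu : probability X R.
Hypothesis inv : invariant_measure gamma zs alpha W mu.

Record solution_curve (x : X) (w : T) (Th Z b : R -> R) : Prop := {
  curve_theta_cont : continuous Th ;
  curve_z_cont : continuous Z ;
  curve_noise_cont : continuous b ;
  curve_noise : forall s, 0 <= s -> b s = W s w ;
  curve_init : \pi_(circle R) (Th 0) = x.1 ;
  curve_theta : forall s : R, 0 <= s -> Th s = Th 0 +
          \int[leb]_(u in `[0, s]) (1 - Z u * sin (Th u) ^+ 2) ;
  curve_z : forall s : R, 0 <= s -> Z s = x.2 +
          \int[leb]_(u in `[0, s]) (- gamma * (Z u - zs)) + alpha * b s }.

(** The bounds needed later hold along almost every path, uniformly over the solutions; G collects
    them. *)
Lemma invariant_Rle (psi : R -> R -> R) (t C : R) (K : X -> R) : 0 <= t ->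
  cyl psi -> (forall th z, 0 <= psi th z <= C) ->
  mu.-integrable setT (EFin \o K) ->
  (forall x, exists G : T -> R, [/\ P.-integrable setT (EFin \o G), \int[P]_w G w <= K x &
     {ae P, forall w, forall Th Z b, solution_curve x w Th Z b -> psi (Th t) (Z t) <= G w}]) ->
  \int[mu]_x on_circle psi x <= \int[mu]_x K x.
Proof.
move=> t0 cpsi psiC iK PK.
have mpsi := measurable_cyl cpsi.
have ipsi : mu.-integrable setT (EFin \o on_circle psi).
  apply: (@integrable_bounded _ _ _ _ _ C) => // x.
  by have /andP[p0 pC] := psiC (repr x.1) x.2; rewrite ger0_norm.
rewrite /Rintegral fine_le//; [exact: integrable_fin_num|exact: integrable_fin_num|].
apply: (@invariant_le _ _ _ _ _ _ _ _ _ inv psi t K t0 cpsi) => //.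
- by move=> th z; have /andP[] := psiC th z.
- by apply/measurable_EFinP; exact: measurable_int iK.
move=> x theta z sol; have [G [iG GK Gae]] := PK x.
pose p w := psi (theta t w) (z t w).
have ip : P.-integrable setT (EFin \o p).
  apply: (@integrable_bounded _ _ _ _ _ C) => [|w]; last first.
    by have /andP[p0 pC] := psiC (theta t w) (z t w); rewrite ger0_norm.
  rewrite (_ : p = on_circle psi \o (fun w => (\pi_(circle R) (theta t w), z t w))); last first.
    by apply/funext => w; rewrite /= cyl_pi.
  apply: measurableT_comp => //; apply: measurable_fun_pair => //.
  exact: (measurableT_comp (@measurable_circle_pi R)).
rewrite -(fineK (integrable_fin_num measurableT ip)) lee_fin; apply: le_trans GK.
apply: ae_le_Rintegral => //.
apply: filterS2 Gae (solution_path BW sol) => w Gw [Th [Z [b [[cT cZ cb] [[ET EZ Eb] [i0 iT iZ]]]]]].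
rewrite /p -ET// -EZ//; exact: (Gw Th Z b).
Qed.

Let Y (x : X) : R := x.2 - zs.
Let mY : measurable_fun setT (fun x : X => Y x).
Proof. by apply: measurable_funB => //; exact: measurable_snd. Qed.

(** No moment of the invariant measure is known to be finite. The truncations min (lam * y ^ 4) 1 are
    bounded: one time step contracts y, hence replaces lam by 7 / 8 * lam at the cost lam * C1, and
    the iterated costs form a geometric series. *)
Let g (lam : R) : R := \int[mu]_x Num.min (lam * (Y x) ^+ 4) 1.
Let C1 : R := 816 * alpha ^+ 4 / gamma ^+ 2.

Let C10 : 0 <= C1.
Proof.
apply: divr_ge0; last by rewrite exprn_ge0// ltW.
by apply: mulr_ge0; [exact: ler0n|rewrite exprn_ge0// ltW].
Qed.

Let int_min lam : 0 <= lam -> mu.-integrable setT (fun x => (Num.min (lam * (Y x) ^+ 4) 1)%:E).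
Proof.
move=> lam0; apply: (@integrable_bounded _ _ _ _ (fun x => Num.min (lam * (Y x) ^+ 4) 1) 1).
  by apply: measurable_minr => //; apply: measurable_funM => //; apply: measurable_funX.
move=> x; rewrite ger0_norm; first by rewrite ge_min lexx orbT.
by rewrite le_min ler01 mulr_ge0// exprn_even_ge0.
Qed.

Let g_step lam : 0 <= lam -> g lam <= g (7 / 8 * lam) + lam * C1.
Proof.
move=> lam0.
have l78 : 0 <= 7 / 8 * lam by rewrite mulr_ge0.
have iK : mu.-integrable setT (EFin \o (fun x => Num.min (7 / 8 * lam * (Y x) ^+ 4) 1 + lam * C1)).
  apply: (integrableD _ (int_min l78) (_ : mu.-integrable setT (EFin \o cst (lam * C1)))) => //.
  exact: finite_measure_integrable_cst.
have -> : g (7 / 8 * lam) + lam * C1 =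
    \int[mu]_x (Num.min (7 / 8 * lam * (Y x) ^+ 4) 1 + lam * C1).
  rewrite RintegralD//; [|exact: int_min|exact: finite_measure_integrable_cst].
  rewrite Rintegral_cst//=.
  have -> : fine (mu setT) = 1 by rewrite probability_setT.
  by rewrite mulr1.
(* With gamma t = 1/4 the contraction factor 1 - gamma t + 2 (gamma t) ^ 2 is 7/8. *)
pose t : R := (4 * gamma)^-1.
have t0 : 0 < t by rewrite invr_gt0 mulr_gt0.
have gt : gamma * t = 4^-1 by rewrite /t; field; rewrite gt_eqF.
have [B [iB BE BP]] := brownian_path_bound BW t0.
apply: (@invariant_Rle (fun th z => Num.min (lam * (z - zs) ^+ 4) 1) t 1 _ (ltW t0)) => //.
- apply: (@cyl_comp _ (fun z => Num.min (lam * (z - zs) ^+ 4) 1)); last exact: cyl_z.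
  apply: measurable_minr => //; apply: measurable_funM => //; apply: measurable_funX.
  exact: measurable_funB.
- move=> th z; rewrite ge_min lexx orbT andbT.
  by rewrite le_min ler01 mulr_ge0// exprn_even_ge0.
move=> x; have B4 := integrable_brownian4 BW t0.
(* 4096 = 512 * 8, from the two convexity inequalities below. *)
have [q q0 qE] : exists2 q : R, 0 <= q & q = 4096 by eexists; [|exact: erefl]; exact: ler0n.
pose c := lam * (q * alpha ^+ 4).
exists (fun w => Num.min (7 / 8 * lam * (Y x) ^+ 4) 1 + (c * (W t w) ^+ 4 +
   (c * (16 * gamma ^+ 4 * t ^+ 3)) * B w)).
have i1 : P.-integrable setT (EFin \o (fun w => c * (W t w) ^+ 4)).
  exact: integrableRZ.
have i2 : P.-integrable setT (EFin \o (fun w => (c * (16 * gamma ^+ 4 * t ^+ 3)) * B w)).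
  exact: integrableRZ.
have i12 : P.-integrable setT (EFin \o (fun w => c * (W t w) ^+ 4 + (c * (16 * gamma ^+ 4 * t ^+ 3)) * B w)).
  exact: integrableRD i1 i2.
have i0 : P.-integrable setT (EFin \o cst (Num.min (7 / 8 * lam * (Y x) ^+ 4) 1)).
  exact: finite_measure_integrable_cst.
have c0 : 0 <= c.
  by rewrite /c !mulr_ge0// ?exprn_ge0// ltW.
split.
- exact: integrableRD i0 i12.
- rewrite RintegralD// RintegralD// Rintegral_cst//= RintegralZl// RintegralZl//.
  have -> : fine (P setT) = 1 by rewrite probability_setT.
  rewrite mulr1 lerD2l {1}/Rintegral brownian_moment4//=.
  apply: (@le_trans _ _ (c * (3 * t ^+ 2) + c * (16 * gamma ^+ 4 * t ^+ 3) * (3 * t ^+ 3))).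
    rewrite lerD2l ler_wpM2l// mulr_ge0// !mulr_ge0// ?exprn_ge0// ltW//.
  rewrite le_eqVlt; apply/orP; left; apply/eqP.
  by rewrite /c /C1 /t qE; field; rewrite gt_eqF.
- apply: filterS BP => w Bw Th Z b sc.
  have gt2 : gamma * t <= 2^-1 by rewrite gt; lra.
  have := path_z_contraction gamma0 alpha0 t0 (curve_z_cont sc) (curve_noise_cont sc) gt2 (curve_z sc).
  rewrite gt (curve_noise sc (ltW t0)).
  have -> : 1 - 4^-1 + 2 * 4^-1 ^+ 2 = 7 / 8 :> R by field.
  have := Bw b (curve_noise_cont sc) (curve_noise sc).
  set Ib := \int[_]_(_ in _) _ => IbB H.
  have Ib0 : 0 <= Ib by exact: Rintegral_itv_ge0.
  have [h|h] := leP 1 (7 / 8 * lam * (Y x) ^+ 4).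
    apply: (@le_trans _ _ 1); first by rewrite ge_min lexx orbT.
    have B0 : 0 <= B w.
      by rewrite -(pmulr_rge0 _ (exprn_gt0 3 t0)); apply: le_trans IbB; exact: exprn_ge0.
    rewrite lerDl; apply: addr_ge0; first by rewrite mulr_ge0// exprn_even_ge0.
    have g40 : 0 <= gamma ^+ 4 * t ^+ 3 by apply: mulr_ge0; rewrite exprn_ge0// ltW.
    by apply: mulr_ge0 => //; apply: mulr_ge0 => //; rewrite -mulrA mulr_ge0.
  rewrite ge_min; apply/orP; left.
  have Hn : `|Z t - zs| ^+ 4 <= (7 / 8 * `|x.2 - zs| + alpha * (`|W t w| + 2 * gamma * Ib)) ^+ 4.
    apply: lerXn2r => //; rewrite nnegrE//.
    by apply: le_trans H.
  have H4 := le_trans Hn (convex_pow4 _ _).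
  have e4 (u : R) : `|u| ^+ 4 = u ^+ 4 by rewrite -normrX ger0_norm// exprn_even_ge0.
  rewrite !e4 exprMn in H4.
  have H5 : (`|W t w| + 2 * gamma * Ib) ^+ 4 <= 8 * (W t w ^+ 4 + 16 * gamma ^+ 4 * (t ^+ 3 * B w)).
    apply: (le_trans (pow4_sum2 _ _)); rewrite e4 ler_wpM2l// lerD2l.
    have -> : (2 * gamma * Ib) ^+ 4 = 16 * gamma ^+ 4 * Ib ^+ 4 by ring.
    by rewrite ler_wpM2l// mulr_ge0// exprn_ge0// ltW.
  have H6 : alpha ^+ 4 * (`|W t w| + 2 * gamma * Ib) ^+ 4 <=
      alpha ^+ 4 * (8 * (W t w ^+ 4 + 16 * gamma ^+ 4 * (t ^+ 3 * B w))).
    by rewrite ler_wpM2l// exprn_ge0// ltW.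
  have := ler_wpM2l lam0 (le_trans H4 (lerD (lexx _) (ler_wpM2l (ler0n _ 512) H6))).
  move=> H7; apply: (le_trans H7); rewrite le_eqVlt; apply/orP; left; apply/eqP.
  by rewrite /c /Y qE; ring.
Qed.


Let g_iter lam k : 0 <= lam -> g lam <= g ((7 / 8) ^+ k * lam) + 8 * (lam * C1).
Proof.
move=> lam0; have lc : 0 <= lam * C1 by exact: mulr_ge0.
suff : g lam <= g ((7 / 8) ^+ k * lam) + 8 * (1 - (7 / 8) ^+ k) * (lam * C1).
  move/le_trans; apply; rewrite lerD2l ler_wpM2r//.
  have : 0 <= (7 / 8 : R) ^+ k by rewrite exprn_ge0.
  lra.
elim: k => [|k IH]; first by rewrite expr0 mul1r subrr mulr0 mul0r addr0.
apply: (le_trans IH); have l0 : 0 <= (7 / 8) ^+ k * lam by rewrite mulr_ge0// exprn_ge0.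
have := g_step l0; rewrite mulrA -exprS.
have -> : 8 * (1 - (7 / 8) ^+ k.+1) * (lam * C1) =
  8 * (1 - (7 / 8) ^+ k) * (lam * C1) + (7 / 8) ^+ k * lam * C1 by rewrite exprS; field.
by rewrite addrA; lra.
Qed.

Let g_le lam : 0 <= lam -> g lam <= 8 * (lam * C1).
Proof.
move=> lam0.
have cv : g ((7 / 8) ^+ k * lam) @[k --> \oo] --> (0 : R).
  rewrite (_ : 0 = \int[mu]_x (0 : R)); last by rewrite Rintegral_cst// mul0r.
  apply: (@Rintegral_dominated_cvg _ _ _ mu _ _ (cst 1)) => //.
  - move=> n; apply/measurable_EFinP; apply: measurable_int (int_min _).
    by rewrite mulr_ge0// exprn_ge0.
  - move=> x; apply: (@squeeze_cvgr _ _ _ _ (cst 0) (fun n => (7 / 8) ^+ n * (lam * Y x ^+ 4))).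
    + apply: nearW => n; rewrite /= le_min ler01 andbT ge_min -mulrA lexx andbT.
      by rewrite mulr_ge0// ?exprn_ge0// mulr_ge0// exprn_even_ge0.
    + exact: cvg_cst.
    + suff : (7 / 8) ^+ n * (lam * Y x ^+ 4) @[n --> \oo] --> 0 * (lam * Y x ^+ 4) by rewrite mul0r.
      apply: cvgMl; apply: cvg_expr; rewrite ger0_norm; lra.
  - exact: finite_measure_integrable_cst.
  - move=> n x; rewrite ger0_norm ?ge_min ?lexx ?orbT//.
    rewrite le_min ler01 andbT; apply: mulr_ge0; last by rewrite exprn_even_ge0.
    by rewrite mulr_ge0// exprn_ge0.
have cv2 : g ((7 / 8) ^+ k * lam) + 8 * (lam * C1) @[k --> \oo] --> 8 * (lam * C1).
  suff : g ((7 / 8) ^+ k * lam) + 8 * (lam * C1) @[k --> \oo] --> 0 + 8 * (lam * C1) by rewrite add0r.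
  by apply: cvgD => //; exact: cvg_cst.
rewrite -(cvg_lim _ cv2)//; apply: limr_ge; first by apply/cvg_ex; eexists; exact: cv2.
by apply: nearW => k; exact: g_iter.
Qed.

(** Division of the bound for the truncations by lam, and lam -> 0. *)
Lemma invariant_moment4 : mu.-integrable setT (fun x => ((x.2 - zs) ^+ 4)%:E) /\
  \int[mu]_x ((x.2 - zs) ^+ 4) <= 6528 * alpha ^+ 4 / gamma ^+ 2.
Proof.
have mY4 : measurable_fun setT (fun x => ((Y x) ^+ 4)%:E).
  by apply/measurable_EFinP; apply: measurable_funX.
have Y40 x : 0 <= (Y x) ^+ 4 by rewrite exprn_even_ge0.
have bound : (\int[mu]_x ((Y x) ^+ 4)%:E <= (8 * C1)%:E)%E.
  pose f (n : nat) x := (n.+1%:R * Num.min (n.+1%:R^-1 * (Y x) ^+ 4) 1)%:E : \bar R.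
  have fE n x : f n x = (Num.min ((Y x) ^+ 4) n.+1%:R)%:E.
    by rewrite /f minr_pMr// mulr1 mulrA mulfV// mul1r.
  have cvf x : f n x @[n --> \oo] --> ((Y x) ^+ 4)%:E.
    apply: cvg_near_cst; near=> n; rewrite fE min_l//.
    have : (Num.truncn ((Y x) ^+ 4) <= n)%N by near: n; exact: nbhs_infty_ge.
    move=> h; apply: (le_trans (ltW (truncnS_gt _))); by rewrite ler_nat ltnS.
  have mf n : measurable_fun setT (f n).
    apply/measurable_EFinP; apply: measurable_funM => //; apply: measurable_minr => //.
    by apply: measurable_funM => //; apply: measurable_funX.
  have f0 n x : setT x -> (0 <= f n x)%E by rewrite fE lee_fin le_min Y40 ler0n.
  have nd x : setT x -> {homo f^~ x : n m / (n <= m)%N >-> (n <= m)%E}.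
    move=> _ n m nm; rewrite !fE lee_fin le_min ge_min lexx/= ge_min.
    by rewrite ler_nat ltnS nm orbT.
  have := cvg_monotone_convergence measurableT mf f0 nd (mu := mu).
  have -> : (\int[mu]_x (limn (f^~ x)) = \int[mu]_x ((Y x) ^+ 4)%:E)%E.
    by apply: eq_integral => x _; apply: cvg_lim.
  move=> cv; rewrite -(cvg_lim _ cv)//; apply: lime_le; first by apply/cvg_ex; eexists; exact: cv.
  apply: nearW => n.
  have n0 : 0 <= n.+1%:R^-1 :> R by [].
  have -> : (\int[mu]_x f n x = (n.+1%:R * g n.+1%:R^-1)%:E)%E.
    rewrite /g -RintegralZl//; last exact: int_min.
    rewrite /Rintegral fineK//; apply: integrable_fin_num => //.
    exact: integrableRZ (int_min n0).
  rewrite lee_fin; apply: (le_trans (ler_wpM2l (ler0n _ _) (g_le n0))).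
  by rewrite mulrCA (mulrA n.+1%:R) mulfV// mul1r.
have i4 : mu.-integrable setT (fun x => ((x.2 - zs) ^+ 4)%:E).
  apply/integrableP; split => //.
  rewrite (eq_integral (fun x => ((Y x) ^+ 4)%:E)); last by move=> x _; rewrite gee0_abs// lee_fin; exact: Y40.
  by apply: le_lt_trans bound _; rewrite ltry.
split=> //; rewrite -lee_fin /Rintegral fineK; last exact: integrable_fin_num.
by apply: le_trans bound _; rewrite lee_fin /C1 mulrA mulrA -natrM.
Unshelve. all: by end_near. Qed.

End invariance.

(** * The generator has mean zero *)

Lemma pow4_sum4 (R : realType) (a b c e : R) :
  (a + b + c + e) ^+ 4 <= 64 * (a ^+ 4 + b ^+ 4 + c ^+ 4 + e ^+ 4).
Proof.
have := pow4_sum2 (a + b) (c + e); have := pow4_sum2 a b; have := pow4_sum2 c e.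
rewrite addrA; lra.
Qed.

Section stationarity.
Context (R : realType) d (T : measurableType d) (P : probability T R).
Variable W : R -> {RV P >-> R}.
Hypothesis BW : brownian_motion W.
Variables (gamma zs alpha : R).
Hypotheses (gamma0 : 0 < gamma) (alpha0 : 0 < alpha).
Notation X := (circle R * R)%type.
Variable mu : probability X R.
Hypothesis inv : invariant_measure gamma zs alpha W mu.

Let Y (x : X) : R := 1 + `|x.2 - zs|.
Let Y1 x : 1 <= Y x. Proof. by rewrite /Y lerDl. Qed.
Let mY : measurable_fun setT Y.
Proof.
apply: measurable_funD => //; apply: measurableT_comp => //.
by apply: measurable_funB => //; exact: measurable_snd.
Qed.

Lemma integrable_Y4 : mu.-integrable setT (EFin \o (fun x => Y x ^+ 4)).
Proof.
have [i4 _] := invariant_moment4 BW gamma0 alpha0 inv.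
apply: (@integrable_dominated _ _ _ _ _ (fun x : X => 8 + 8 * (x.2 - zs) ^+ 4)).
- exact: measurable_funX.
- move=> x; rewrite ger0_norm ?exprn_ge0 ?(le_trans ler01)//.
  have := pow4_sum2 1 `|x.2 - zs|; rewrite -/(Y x) expr1n mulrDr mulr1.
  by rewrite -normrX ger0_norm// exprn_even_ge0.
- apply: (@integrableRD _ _ _ _ (fun=> 8) (fun x : X => 8 * (x.2 - zs) ^+ 4)); last exact: integrableRZ.
  exact: finite_measure_integrable_cst.
Qed.

(** The growth for which the fourth moment ensures integrability. *)
Definition moderate (f : R -> R -> R) := cyl f /\
  exists C, forall th z, `|f th z| <= C * (1 + `|z - zs|) ^+ 4.

Lemma integrable_moderate f : moderate f -> mu.-integrable setT (EFin \o on_circle f).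
Proof.
move=> [cf [C fC]]; apply: (@integrable_dominated _ _ _ _ _ (fun x => C * Y x ^+ 4)).
- exact: measurable_cyl.
- by move=> x; exact: fC.
- exact/integrableRZ/integrable_Y4.
Qed.

Lemma cyl_generator J I : smooth I J -> cyl (generator gamma zs alpha J).
Proof.
move=> sJ; apply: cylD; first apply: cylB.
- apply: cylM; first exact: cyl_j1 sJ.
  apply: cylB; first exact: cyl_cst.
  by apply: cylM; [exact: cyl_z|apply: cylX; exact: cyl_sin].
- apply: cylM; last exact: cyl_j2 sJ.
  by apply: cylM; [exact: cyl_cst|apply: cylB; [exact: cyl_z|exact: cyl_cst]].
- by apply: cylM; [exact: cyl_cst|exact: cyl_j22 sJ].
Qed.

Lemma generator_bound J : smooth setT J -> exists C, forall th z,
  `|generator gamma zs alpha J th z| <= C * (1 + `|z - zs|).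
Proof.
move=> sJ; have [C C0 [_ b1 b2 b3 _]] := smooth_jet_remainder sJ.
exists (C * (2 + `|zs|) + gamma * C + alpha ^+ 2 / 2 * C) => th z.
have a2 : 0 <= alpha ^+ 2 / 2 by rewrite divr_ge0// exprn_ge0// ltW.
have y0 : 0 <= `|z - zs| by [].
have T1 : `|j1 J th z * (1 - z * sin th ^+ 2)| <= C * ((2 + `|zs|) * (1 + `|z - zs|)).
  rewrite normrM ler_pM//; apply: (le_trans (ler_normB _ _)); rewrite normr1 normrM.
  have s1 : `|sin th ^+ 2| <= 1.
    by rewrite normrX exprn_ile1// ler_norml sin_geN1 sin_le1.
  have := ler_wpM2l (normr_ge0 z) s1; rewrite mulr1.
  have : `|z| <= `|z - zs| + `|zs| by rewrite -{1}(subrK zs z) ler_normD.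
  have : 0 <= `|zs| * `|z - zs| by rewrite mulr_ge0.
  by rewrite mulrDr mulr1 mulrDl; move: y0; lra.
have T2 : `|gamma * (z - zs) * j2 J th z| <= gamma * C * (1 + `|z - zs|).
  rewrite !normrM (gtr0_norm gamma0) mulrAC -!mulrA ler_wpM2l ?(ltW gamma0)//.
  by rewrite ler_pM// lerDr.
have T3 : `|alpha ^+ 2 / 2 * j22 J th z| <= alpha ^+ 2 / 2 * C * (1 + `|z - zs|).
  rewrite normrM (ger0_norm a2) -mulrA ler_wpM2l//.
  by apply: (le_trans (b3 th z)); rewrite ler_peMr// lerDl.
apply: (le_trans (ler_normD _ _)); apply: (le_trans (lerD (ler_normB _ _) (lexx _))).
apply: (le_trans (lerD (lerD T1 T2) T3)).
by rewrite le_eqVlt; apply/orP; left; apply/eqP; ring.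
Qed.

Lemma moderate_generator J : smooth setT J -> moderate (generator gamma zs alpha J).
Proof.
move=> sJ; split; first exact: cyl_generator sJ.
have [C CP] := generator_bound sJ; exists `|C| => th z.
apply: (le_trans (CP th z)); apply: (le_trans (ler_wpM2r _ (ler_norm C))).
  by rewrite addr_ge0.
by rewrite ler_wpM2l// -{1}(expr1 (1 + _)) ler_weXn2l// lerDl.
Qed.

(** Over the time r ^ 2 the mean of J is unchanged while its pathwise expansion has mean
    r ^ 2 * L J + O(r ^ 3), the first and second order noise terms being centered. *)
Lemma generator_mean_lower J : smooth setT J -> exists D : R, forall r : R,
  0 < r -> r <= 1 -> gamma * r ^+ 2 <= 2^-1 ->
  - (D * r) <= \int[mu]_x on_circle (generator gamma zs alpha J) x.
Proof.
move=> sJ; have [C C0 [b0 b1 b2 b3 rem]] := smooth_jet_remainder sJ.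
pose c1 := 1 + gamma + alpha + `|zs|.
have [D0 D00 D0E] : exists2 D, 0 <= D & D = 200 * c1 ^+ 6 * C.
  eexists; [|exact: erefl].
  have c10 : 0 <= c1 by rewrite /c1 !addr_ge0// ltW.
  apply: mulr_ge0 => //; apply: mulr_ge0; [exact: ler0n|exact: exprn_ge0].
pose L := generator gamma zs alpha J.
have iL : mu.-integrable setT (EFin \o on_circle L) by exact/integrable_moderate/moderate_generator.
have ij0 : mu.-integrable setT (EFin \o on_circle (j0 J)).
  apply: (@integrable_bounded _ _ _ _ _ C); first exact: (measurable_cyl (cyl_j0 sJ)).
  by move=> x; exact: b0.
pose e := \int[mu]_x (Y x ^+ 4).
exists (D0 * (64 * (e + 7))) => r r0 r1 gr.
pose t := r ^+ 2; have t0 : 0 < t by exact: exprn_gt0.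
have t1 : t <= 1 by rewrite /t exprn_ile1// ltW.
(* The constant makes the test function nonnegative. *)
pose psi th z := j0 J th z + C.
pose K x := (on_circle (j0 J) x + C) + (t * on_circle L x + D0 * (r ^+ 3 * 64) * (Y x ^+ 4 + 7)).
have icst c : mu.-integrable setT (EFin \o (fun _ : X => c)).
  exact: finite_measure_integrable_cst.
have iY7 : mu.-integrable setT (EFin \o (fun x => Y x ^+ 4 + 7)).
  exact: (integrableRD integrable_Y4 (icst 7)).
have iA : mu.-integrable setT (EFin \o (fun x => on_circle (j0 J) x + C)) by exact: integrableRD ij0 (icst C).
have iB : mu.-integrable setT (EFin \o (fun x => t * on_circle L x + D0 * (r ^+ 3 * 64) * (Y x ^+ 4 + 7))).
  by apply: integrableRD; exact: integrableRZ.
have iK : mu.-integrable setT (EFin \o K) by exact: integrableRD iA iB.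
have key : \int[mu]_x on_circle psi x <= \int[mu]_x K x.
  apply: (@invariant_Rle _ _ _ P W BW gamma zs alpha mu inv psi t (2 * C)) => //; first exact: ltW.
  - by apply: cylD; [exact: cyl_j0 sJ|exact: cyl_cst].
  - by move=> th z; rewrite /psi; have := b0 th z; rewrite ler_norml => /andP[]; lra.
  move=> x; have [B [iBr BE BP]] := brownian_path_bound BW t0.
  have iW := integrable_brownian BW t0.
  have iW2 := integrable_brownian2 BW t0.
  have iW4 := integrable_brownian4 BW t0.
  have ic c : P.-integrable setT (EFin \o (fun _ : T => c)).
    exact: finite_measure_integrable_cst.
  pose a2 := on_circle (j2 J) x * alpha; pose a22 := 2^-1 * on_circle (j22 J) x * alpha ^+ 2.
  pose D3 := D0 * (r ^+ 3 * 64).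
  have D30 : 0 <= D3 by rewrite /D3 !mulr_ge0// ?exprn_ge0// ltW.
  pose c0 := on_circle (j0 J) x + C + t * on_circle L x.
  pose G1 w := a2 * W t w. pose G2 w := a22 * (W t w ^+ 2 + - t).
  pose G3 w := D3 * (Y x ^+ 4 + 1 + (t ^- 2 * W t w ^+ 4 + t ^- 3 * B w)).
  have i1 : P.-integrable setT (EFin \o G1) by exact: integrableRZ.
  have i2 : P.-integrable setT (EFin \o G2).
    by apply: integrableRZ; exact: (integrableRD iW2 (ic (- t))).
  have i34 : P.-integrable setT (EFin \o (fun w => t ^- 2 * W t w ^+ 4 + t ^- 3 * B w)).
    by apply: integrableRD; exact: integrableRZ.
  have i33 := integrableRD (ic (Y x ^+ 4 + 1)) i34.
  have i3 : P.-integrable setT (EFin \o G3) by exact: integrableRZ.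
  have i23 := integrableRD i2 i3.
  have i123 := integrableRD i1 i23.
  have P1 : fine (P setT) = 1 by rewrite probability_setT.
  have E1 : \int[P]_w G1 w = 0.
    by rewrite /G1 RintegralZl// brownian_mean// mulr0.
  have E2 : \int[P]_w G2 w = 0.
    rewrite /G2 RintegralZl//; last exact: (integrableRD iW2 (ic (- t))).
    rewrite (RintegralD measurableT iW2 (ic _)) Rintegral_cst// P1.
    by rewrite {1}/Rintegral brownian_moment2//= mulr1 subrr mulr0.
  have E3 : \int[P]_w G3 w <= D3 * (Y x ^+ 4 + 7).
    rewrite /G3 RintegralZl// ler_wpM2l//.
    rewrite (RintegralD measurableT (ic _) i34) Rintegral_cst// P1 mulr1.
    rewrite RintegralD//; [|exact: integrableRZ|exact: integrableRZ].
    rewrite RintegralZl// RintegralZl// {1}/Rintegral brownian_moment4//=.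
    have -> : t ^- 2 * (3 * t ^+ 2) = 3 by rewrite mulrC -mulrA mulfV ?mulr1// expf_neq0// gt_eqF.
    have t3B : t ^- 3 * \int[P]_w B w <= 3.
      apply: (@le_trans _ _ (t ^- 3 * (3 * t ^+ 3))).
        by rewrite ler_wpM2l// invr_ge0 exprn_ge0// ltW.
      by rewrite mulrC -mulrA mulfV ?mulr1// expf_neq0// gt_eqF.
    by move: t3B; lra.
  exists (fun w => c0 + (G1 w + (G2 w + G3 w))); split.
  - exact: (integrableRD (ic c0) i123).
  - rewrite (RintegralD measurableT (ic c0) i123) (RintegralD measurableT i1 i23).
    rewrite (RintegralD measurableT i2 i3) Rintegral_cst// P1 mulr1 E1 E2 !add0r /K /c0.
    by rewrite -!addrA !lerD2l.
  apply: filterS BP => w Bw Th Z b sc.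
  have x1 : x = (\pi_(circle R) (Th 0), x.2) by rewrite (curve_init sc); case: (x).
  have oc f : cyl f -> on_circle f x = f (Th 0) x.2.
    by move=> cf; rewrite [in LHS]x1 cyl_pi.
  have IbB := Bw b (curve_noise_cont sc) (curve_noise sc).
  set Ib := \int[_]_(_ in _) _ in IbB.
  have Ib0 : 0 <= Ib by exact: Rintegral_itv_ge0.
  (* The size of the noise path on its natural scales: b t is of order r, its integral r ^ 3. *)
  pose k := 1 + (`|b t| / r + Ib / r ^+ 3).
  have k1 : 1 <= k by rewrite lerDl addr_ge0// divr_ge0// ?exprn_ge0// ltW.
  have bk : `|b t| <= r * k.
    rewrite /k mulrDr mulr1 mulrDr.
    have -> : r * (`|b t| / r) = `|b t| by rewrite mulrC divfK// gt_eqF.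
    by rewrite addrCA lerDl addr_ge0 ?(ltW r0)// mulr_ge0 ?(ltW r0)// divr_ge0// exprn_ge0// ltW.
  have Ibk : Ib <= r ^+ 3 * k.
    rewrite /k mulrDr mulr1 mulrDr.
    have -> : r ^+ 3 * (Ib / r ^+ 3) = Ib by rewrite mulrC divfK// expf_neq0// gt_eqF.
    by rewrite addrA lerDr addr_ge0 ?exprn_ge0 ?(ltW r0)// mulr_ge0 ?exprn_ge0 ?(ltW r0)// divr_ge0// ltW.
  have := path_taylor gamma0 alpha0 t0 (curve_theta_cont sc) (curve_z_cont sc) (curve_noise_cont sc)
    gr (curve_theta sc) (curve_z sc) t1 r0 (erefl _) k1 bk Ibk (b1 _ _) (b2 _ _) (b3 _ _) (rem _ _ _ _).
  rewrite (curve_noise sc (ltW t0)) -/c1 -D0E.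
  set V := 1 + _ + k => H.
  have V1 : 1 <= V by rewrite /V -addrA lerDl addr_ge0// (le_trans ler01).
  have HV : V ^+ 3 <= 64 * (Y x ^+ 4 + 1 + (t ^- 2 * W t w ^+ 4 + t ^- 3 * B w)).
    apply: (@le_trans _ _ (V ^+ 4)); first by rewrite ler_weXn2l.
    have -> : V = Y x + 1 + `|b t| / r + Ib / r ^+ 3 by rewrite /V /k -/(Y x); ring.
    apply: (le_trans (pow4_sum4 _ _ _ _)); rewrite ler_wpM2l// expr1n -!addrA !lerD2l.
    rewrite (curve_noise sc (ltW t0)).
    apply: lerD.
      rewrite expr_div_n -normrX ger0_norm ?exprn_even_ge0// /t.
      by rewrite -exprM mulrC.
    rewrite expr_div_n -exprM /t -exprM.
    rewrite ler_pdivrMr ?exprn_gt0//.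
    apply: (le_trans IbB); rewrite /t -exprM le_eqVlt; apply/orP; left; apply/eqP.
    have -> : r ^+ 12 = r ^+ 6 * r ^+ 6 by rewrite -exprD.
    by rewrite mulrACA mulrA mulVf ?mul1r 1?mulrC// expf_neq0// gt_eqF.
  have H2 := le_trans (ler_norm _) H.
  have H3 : D0 * (r ^+ 3 * V ^+ 3) <= G3 w.
    rewrite /G3 /D3 -[leRHS]mulrA -[_ * 64 * _]mulrA; apply: ler_wpM2l => //; apply: ler_wpM2l => //.
    exact/exprn_ge0/ltW.
  rewrite /psi /c0 /G1 /G2 /a2 /a22 (oc _ (cyl_j0 sJ)) (oc _ (cyl_j2 sJ)) (oc _ (cyl_j22 sJ)).
  rewrite (oc L (cyl_generator sJ)) /L.
  move: H2 H3; rewrite -/t; lra.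
have ipsi : \int[mu]_x on_circle psi x = \int[mu]_x (on_circle (j0 J) x + C) by [].
move: key; rewrite ipsi /K (RintegralD measurableT iA iB) lerDl.
rewrite RintegralD//; [|exact: integrableRZ|exact: integrableRZ].
rewrite RintegralZl// RintegralZl// (RintegralD measurableT integrable_Y4 (icst 7)).
rewrite Rintegral_cst//.
have -> : fine (mu setT) = 1 by rewrite probability_setT.
rewrite mulr1 -/e -/L => key.
have : 0 <= t * (\int[mu]_x on_circle L x + D0 * (64 * (e + 7)) * r).
  by apply: (le_trans key); rewrite /t le_eqVlt; apply/orP; left; apply/eqP; ring.
by rewrite pmulr_rge0//; lra.
Qed.

Definition jet_opp (J : jet R) : jet R := Jet (fun th z => - j0 J th z) (fun th z => - j1 J th z)
  (fun th z => - j2 J th z) (fun th z => - j22 J th z).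

Lemma blN I f : bl I f -> bl I (fun th z : R => - f th z).
Proof.
move=> [C C0 [b l]]; exists C => //; split=> [th z Iz|th th' z z' Iz Iz']; first by rewrite normrN b.
by rewrite -opprD normrN l.
Qed.

Lemma smooth_opp I J : smooth I J -> smooth I (jet_opp J).
Proof.
case=> *; split; rewrite /=; try exact: cylN; try exact: blN.
- by move=> th z; apply: is_deriveN.
- by move=> th z; apply: is_deriveN.
- by move=> th z; apply: is_deriveN.
Qed.

(** The lower bound for J and for - J, as r -> 0. *)
Theorem generator_mean J : smooth setT J ->
  \int[mu]_x on_circle (generator gamma zs alpha J) x = 0.
Proof.
have lower F : smooth setT F -> 0 <= \int[mu]_x on_circle (generator gamma zs alpha F) x.
  move=> sF; have [D DP] := generator_mean_lower sF.
  set A := Rintegral _ _ _ in DP *.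
  rewrite leNgt; apply/negP => A0.
  (* A time step r at which D * r is less than - A, if A were negative. *)
  pose q := 1 + gamma + `|D| / (- A).
  have A0' : 0 < - A by rewrite oppr_gt0.
  have q1 : 1 <= q by rewrite /q -addrA lerDl addr_ge0// ?divr_ge0// ltW.
  have gq : gamma <= q.
    by rewrite /q addrAC addrC lerDl addr_ge0// divr_ge0// ltW.
  pose r := (2 * q)^-1.
  have q0 : 0 < q by apply: lt_le_trans q1.
  have r0 : 0 < r by rewrite invr_gt0 mulr_gt0.
  have rq : r * q = 2^-1 by rewrite /r; field; rewrite gt_eqF.
  have r1 : r <= 2^-1 by rewrite -rq ler_peMr// ltW.
  have r1' : r <= 1 by move: r1; lra.
  have gr : gamma * r ^+ 2 <= 2^-1.
    have h1 : gamma * r <= 2^-1 by rewrite mulrC -rq ler_wpM2l// ltW.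
    have : gamma * r * r <= gamma * r * 1 by rewrite ler_wpM2l// mulr_ge0// ltW.
    by rewrite -mulrA -expr2; lra.
  have := DP r r0 r1' gr.
  have : D * r <= - A / 2.
    apply: (le_trans (ler_wpM2r (ltW r0) (ler_norm D))).
    have h : `|D| <= q * - A.
      by rewrite /q mulrDl divfK ?gt_eqF// lerDr mulr_ge0// ?addr_ge0// ltW.
    apply: (le_trans (ler_wpM2r (ltW r0) h)).
    by rewrite mulrAC (mulrC q) rq mulrC.
  lra.
move=> sJ; apply/eqP; rewrite eq_le lower// andbT.
have := lower _ (smooth_opp sJ).
have -> : \int[mu]_x on_circle (generator gamma zs alpha (jet_opp J)) x =
   \int[mu]_x (-1 * on_circle (generator gamma zs alpha J) x).
  apply: eq_Rintegral => x _; rewrite /on_circle /generator/=; ring.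
rewrite RintegralZl//; last exact/integrable_moderate/moderate_generator.
by rewrite mulN1r oppr_ge0.
Qed.

End stationarity.

(** * Calculus of test functions *)

Section derivatives.
Variable R : realType.

Lemma is_derive_quadratic (f : R -> R) (x a C : R) :
  (forall y, `|y - x| <= 1 -> `|f y - f x - a * (y - x)| <= C * `|y - x| ^+ 2) ->
  is_derive x 1 f a.
Proof.
move=> H.
have cv : h^-1 *: ((f \o shift x) (h *: 1) - f x) @[h --> 0^'] --> a.
  apply/cvgrPdist_le => e e0.
  have C0 : 0 < `|C| + 1 by rewrite ltr_wpDl.
  near=> h.
  have h0 : h != 0 by near: h; exact: nbhs_dnbhs_neq.
  have h1 : `|h| <= 1 by near: h; apply: dnbhs0_le.
  have hC : `|h| <= e / (`|C| + 1) by near: h; apply: dnbhs0_le; rewrite divr_gt0.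
  have := H (h + x); rewrite addrK => /(_ h1) Hh.
  have -> : a - h^-1 *: ((f \o shift x) (h *: 1) - f x) =
    - (h^-1 * (f (h + x) - f x - a * h)).
    by rewrite /= /shift/= [h *: 1]mulr1 /GRing.scale/=; field.
  rewrite normrN normrM normfV mulrC ler_pdivrMr ?normr_gt0//.
  apply: (le_trans Hh); rewrite expr2 mulrA ler_wpM2r//.
  apply: (le_trans (ler_wpM2r (normr_ge0 h) (ler_norm C))).
  rewrite ler_pdivlMr// in hC; apply: le_trans hC.
  by rewrite mulrC ler_wpM2l// lerDl.
apply: DeriveDef; first by apply/cvg_ex; exists a.
by apply: cvg_lim.
Unshelve. all: by end_near. Qed.

(** The cube makes the positive part twice continuously differentiable. *)
Definition pos3 (u : R) := Num.max u 0 ^+ 3.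
Definition pos3' (u : R) := 3 * Num.max u 0 ^+ 2.
Definition pos3'' (u : R) := 6 * Num.max u 0.

Lemma max0_lip (u v : R) : `|Num.max v 0 - Num.max u 0| <= `|v - u|.
Proof.
have [u0|u0] := leP u 0; have [v0|v0] := leP v 0.
- by rewrite subrr normr0.
- by rewrite subr0 !ger0_norm; lra.
- by rewrite sub0r normrN distrC !ger0_norm; lra.
- by [].
Qed.

Lemma is_derive_pos3 (u : R) : is_derive u 1 pos3 (pos3' u).
Proof.
apply: (@is_derive_quadratic _ _ _ (3 * `|u| + 2)) => v uv.
have b : `|v - u| ^+ 3 <= `|v - u| ^+ 2.
  by rewrite [leLHS]exprSr ler_piMr// exprn_ge0.
have ub : 0 <= `|u| * `|v - u| ^+ 2 by rewrite mulr_ge0// exprn_ge0.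
have b0 : 0 <= `|v - u| ^+ 2 by rewrite exprn_ge0.
rewrite /pos3 /pos3'; have [u0|u0] := leP u 0; have [v0|v0] := leP v 0.
- rewrite !expr0n/= mulr0 mul0r !subr0 normr0; lra.
- rewrite !expr0n/= mulr0 mul0r !subr0 ger0_norm ?exprn_ge0 ?(ltW v0)//.
  have : v ^+ 3 <= `|v - u| ^+ 3.
    by rewrite lerXn2r ?nnegrE ?(ltW v0)// (ger0_norm (_ : 0 <= v - u)); lra.
  lra.
- rewrite expr0n/= sub0r.
  have -> : - u ^+ 3 - 3 * u ^+ 2 * (v - u) = 3 * u ^+ 2 * (- v) + 2 * u ^+ 3 by ring.
  have u2 : u ^+ 2 <= `|v - u| ^+ 2.
    by rewrite lerXn2r ?nnegrE ?(ltW u0)// distrC (ger0_norm (_ : 0 <= u - v)); lra.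
  have v3 : - v <= `|v - u| by rewrite distrC (ger0_norm (_ : 0 <= u - v)); lra.
  have t1 : u ^+ 2 * (- v) <= `|v - u| ^+ 2.
    apply: (@le_trans _ _ (`|v - u| ^+ 2 * 1)); last by rewrite mulr1.
    by apply: ler_pM => //; [exact: sqr_ge0|lra|lra].
  have t2 : u ^+ 3 <= `|u| * `|v - u| ^+ 2.
    by rewrite exprS (ger0_norm (ltW u0)) ler_wpM2l// ltW.
  have t3 : 0 <= u ^+ 2 * (- v) by rewrite mulr_ge0 ?sqr_ge0; lra.
  have t4 : 0 <= u ^+ 3 by rewrite exprn_ge0// ltW.
  have t5 : u ^+ 2 * (- v) <= `|u| * `|v - u| ^+ 2.
    rewrite expr2 -mulrA (ger0_norm (ltW u0)) ler_wpM2l ?(ltW u0)// expr2.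
    apply: ler_pM => //; [exact: ltW|lra|].
    by rewrite distrC (ger0_norm (_ : 0 <= u - v)); lra.
  rewrite ger0_norm; lra.
- have -> : v ^+ 3 - u ^+ 3 - 3 * u ^+ 2 * (v - u) = (v - u) ^+ 3 + 3 * u * (v - u) ^+ 2 by ring.
  apply: (le_trans (ler_normD _ _)); rewrite normrX (normrM (3 * u)) (normrM 3 u) normrX (ger0_norm (ler0n _ 3)).
  lra.
Qed.

Lemma is_derive_pos3' (u : R) : is_derive u 1 pos3' (pos3'' u).
Proof.
apply: (@is_derive_quadratic _ _ _ 3) => v _.
rewrite /pos3' /pos3''; have [u0|u0] := leP u 0; have [v0|v0] := leP v 0.
- rewrite !expr0n/= !(mulr0,mul0r,subr0) normr0; exact: mulr_ge0.
- have -> : 3 * v ^+ 2 - 3 * 0 ^+ 2 - 6 * 0 * (v - u) = 3 * v ^+ 2 by ring.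
  rewrite normrM normrX ger0_norm// (ger0_norm (ltW v0)) ler_wpM2l//.
  by rewrite lerXn2r ?nnegrE ?(ltW v0)// (ger0_norm (_ : 0 <= v - u)); lra.
- rewrite expr0n/= mulr0 sub0r.
  have -> : - (3 * u ^+ 2) - 6 * u * (v - u) = 3 * (u * (u - 2 * v)) by ring.
  rewrite ger0_norm; last by rewrite !mulr_ge0 ?(ltW u0)//; lra.
  rewrite ler_wpM2l// -normrX ger0_norm ?sqr_ge0//.
  by rewrite -subr_ge0 (_ : _ - _ = v ^+ 2) ?sqr_ge0//; ring.
- have -> : 3 * v ^+ 2 - 3 * u ^+ 2 - 6 * u * (v - u) = 3 * (v - u) ^+ 2 by ring.
  by rewrite normrM normrX ger0_norm.
Qed.

Lemma measurable_max0 : measurable_fun setT (fun u : R => Num.max u 0).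
Proof. exact: measurable_maxr. Qed.

End derivatives.

Section closure.
Variable R : realType.
Implicit Types (I S : set R) (f g : R -> R -> R) (F G : jet R).

Lemma bl_cst I (c : R) : bl I (fun _ _ => c).
Proof.
exists `|c| => //; split=> // *.
by rewrite subrr normr0 mulr_ge0// addr_ge0.
Qed.

Lemma bl_cos I : bl I (fun th _ => cos th).
Proof.
exists 1 => //; split=> [th z _|th th' z z' _ _]; first by rewrite ler_norml cos_geN1 cos_le1.
rewrite mul1r (@le_trans _ _ `|th' - th|)// ?lerDl// -[leRHS]mul1r.
apply: (@derive_bounded_lipschitz R cos (fun x => - sin x)) => x.
by rewrite normrN ler_norml sin_geN1 sin_le1.
Qed.

Lemma bl_sin I : bl I (fun th _ => sin th).
Proof.
exists 1 => //; split=> [th z _|th th' z z' _ _]; first by rewrite ler_norml sin_geN1 sin_le1.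
rewrite mul1r (@le_trans _ _ `|th' - th|)// ?lerDl// -[leRHS]mul1r.
apply: (@derive_bounded_lipschitz R sin cos) => x.
by rewrite ler_norml cos_geN1 cos_le1.
Qed.

Lemma bl_z (a b : R) : bl `[a, b] (fun _ z => z).
Proof.
exists (1 + `|a| + `|b|); first by rewrite !addr_ge0.
split=> [th z|th th' z z' _ _].
  rewrite /= in_itv/= => /andP[az zb]; rewrite ler_norml.
  have := ler_norm b; have := ler_norm (- a); rewrite normrN.
  by have := normr_ge0 a; have := normr_ge0 b; move=> *; apply/andP; split; lra.
rewrite -[leLHS]mul1r ler_pM// ?lerDr// -addrA lerDl addr_ge0//.
Qed.

Lemma blD I f g : bl I f -> bl I g -> bl I (fun th z => f th z + g th z).
Proof.
move=> [C C0 [bf lf]] [D D0 [bg lg]]; exists (C + D); first exact: addr_ge0.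
split=> [th z Iz|th th' z z' Iz Iz'].
  by apply: (le_trans (ler_normD _ _)); rewrite lerD ?bf ?bg.
rewrite opprD addrACA mulrDl; apply: (le_trans (ler_normD _ _)).
by rewrite lerD ?lf ?lg.
Qed.

Lemma blM I f g : bl I f -> bl I g -> bl I (fun th z => f th z * g th z).
Proof.
move=> [C C0 [bf lf]] [D D0 [bg lg]]; exists (2 * (C * D)); first by rewrite !mulr_ge0.
have CD : 0 <= C * D by rewrite mulr_ge0.
split=> [th z Iz|th th' z z' Iz Iz'].
  by rewrite normrM; apply: (le_trans (ler_pM _ _ (bf th z Iz) (bg th z Iz))) => //; lra.
have -> : f th' z' * g th' z' - f th z * g th z =
  (f th' z' - f th z) * g th' z' + f th z * (g th' z' - g th z) by ring.
apply: (le_trans (ler_normD _ _)); rewrite !normrM.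
have h1 := ler_pM (normr_ge0 _) (normr_ge0 _) (lf th th' z z' Iz Iz') (bg th' z' Iz').
have h2 := ler_pM (normr_ge0 _) (normr_ge0 _) (bf th z Iz) (lg th th' z z' Iz Iz').
apply: (le_trans (lerD h1 h2)).
by rewrite le_eqVlt; apply/orP; left; apply/eqP; ring.
Qed.

(** On the values of f, psi is bounded by its value at u0 and the Lipschitz inequality. *)
Lemma bl_comp I S (psi : R -> R) (u0 L : R) f : S u0 ->
  (forall u v, S u -> S v -> `|psi v - psi u| <= L * `|v - u|) ->
  (forall th z, I z -> S (f th z)) -> bl I f -> bl I (fun th z => psi (f th z)).
Proof.
move=> Su0 lpsi Sf [C C0 [bf lf]].
have lpsi' u v : S u -> S v -> `|psi v - psi u| <= `|L| * `|v - u|.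
  by move=> Su Sv; apply: (le_trans (lpsi _ _ Su Sv)); rewrite ler_wpM2r// ler_norm.
exists (`|psi u0| + `|L| * (C + `|u0|)); first by rewrite addr_ge0// mulr_ge0// addr_ge0.
split=> [th z Iz|th th' z z' Iz Iz'].
  have := lpsi' _ _ Su0 (Sf th z Iz) => h.
  rewrite -(subrK (psi u0) (psi (f th z))) addrC; apply: (le_trans (ler_normD _ _)).
  rewrite lerD2l; apply: (le_trans h); rewrite ler_wpM2l//.
  by apply: (le_trans (ler_normB _ _)); rewrite lerD2r bf.
apply: (le_trans (lpsi' _ _ (Sf _ _ Iz) (Sf _ _ Iz'))).
apply: (@le_trans _ _ (`|L| * (C * (`|th' - th| + `|z' - z|)))).
  by rewrite ler_wpM2l// lf.
rewrite mulrA ler_wpM2r ?addr_ge0//.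
have := normr_ge0 (psi u0); have : 0 <= `|L| * `|u0| by rewrite mulr_ge0.
by rewrite mulrDr; lra.
Qed.

Lemma bl_inv I f (lo : R) : 0 < lo -> (forall th z, I z -> lo <= f th z) ->
  bl I f -> bl I (fun th z => (f th z)^-1).
Proof.
move=> lo0 flo; apply: (@bl_comp I [set u | lo <= u] GRing.inv lo (lo ^- 2)) => //=.
move=> u v lu lv; have u0 := lt_le_trans lo0 lu; have v0 := lt_le_trans lo0 lv.
have -> : v^-1 - u^-1 = (u - v) * (v * u)^-1 by field; rewrite !gt_eqF.
rewrite normrM distrC mulrC ler_wpM2r// gtr0_norm ?invr_gt0 ?mulr_gt0//.
by rewrite lef_pV2 ?posrE ?mulr_gt0 ?exprn_gt0// expr2 ler_pM// ltW.
Qed.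

Lemma bl_ln I f (lo : R) : 0 < lo -> (forall th z, I z -> lo <= f th z) ->
  bl I f -> bl I (fun th z => ln (f th z)).
Proof.
move=> lo0 flo; apply: (@bl_comp I [set u | lo <= u] (@ln R) lo (lo^-1)) => //=.
have H u v : lo <= u -> u <= v -> `|ln v - ln u| <= lo^-1 * `|v - u|.
  move=> lu uv; have u0 := lt_le_trans lo0 lu; have v0 := lt_le_trans u0 uv.
  rewrite -ln_div ?posrE// ger0_norm; last by rewrite ln_ge0// ler_pdivlMr// mul1r.
  rewrite ger0_norm ?subr_ge0//.
  apply: (@le_trans _ _ (v / u - 1)); first by rewrite -{1}(subrKC 1 (v / u)) le_ln1Dx// ltrBrDr addNr divr_gt0.
  have -> : v / u - 1 = u^-1 * (v - u) by field; rewrite gt_eqF.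
  by rewrite ler_wpM2r ?subr_ge0// lef_pV2.
move=> u v lu lv; have [uv|/ltW vu] := leP u v; first exact: H.
by rewrite distrC (distrC v); exact: H.
Qed.

Lemma bl_sqrt I f (lo : R) : 0 < lo -> (forall th z, I z -> lo <= f th z) ->
  bl I f -> bl I (fun th z => Num.sqrt (f th z)).
Proof.
move=> lo0 flo; apply: (@bl_comp I [set u | lo <= u] (@Num.sqrt R) lo ((Num.sqrt lo)^-1)) => //=.
move=> u v lu lv; have u0 := lt_le_trans lo0 lu; have v0 := lt_le_trans lo0 lv.
have su : 0 < Num.sqrt u by rewrite sqrtr_gt0.
have sv : 0 < Num.sqrt v by rewrite sqrtr_gt0.
have -> : `|v - u| = `|Num.sqrt v - Num.sqrt u| * (Num.sqrt v + Num.sqrt u).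
  rewrite -[in LHS](sqr_sqrtr (ltW u0)) -[in LHS](sqr_sqrtr (ltW v0)) subr_sqr normrM.
  by rewrite (gtr0_norm (addr_gt0 sv su)).
rewrite mulrCA ler_peMr// mulrC ler_pdivlMr ?sqrtr_gt0// mul1r.
have : Num.sqrt lo <= Num.sqrt u by rewrite ler_sqrt ?(ltW u0).
lra.
Qed.

Lemma bl_max0 I f : bl I f -> bl I (fun th z => Num.max (f th z) 0).
Proof.
by apply: (@bl_comp I setT (fun u => Num.max u 0) 0 1) => // u v _ _; rewrite mul1r max0_lip.
Qed.

End closure.

Section jets.
Variable R : realType.
Implicit Types (I : set R) (F G : jet R).

Lemma jet_eq F G : (forall th z, j0 F th z = j0 G th z) ->
  (forall th z, j1 F th z = j1 G th z) -> (forall th z, j2 F th z = j2 G th z) ->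
  (forall th z, j22 F th z = j22 G th z) -> F = G.
Proof.
case: F G => a b c e [a' b' c' e'] /= h0 h1 h2 h3.
by congr Jet; apply/funext => th; apply/funext => z.
Qed.

Definition jcst (c : R) := Jet (fun _ _ => c) (fun _ _ => 0) (fun _ _ => 0) (fun _ _ => 0).
Definition jcos := Jet (fun th _ : R => cos th) (fun th _ => - sin th) (fun _ _ => 0) (fun _ _ => 0).
Definition jsin := Jet (fun th _ : R => sin th) (fun th _ => cos th) (fun _ _ => 0) (fun _ _ => 0).
Definition zjet (g g' g'' : R -> R) :=
  Jet (fun _ z => g z) (fun _ _ => 0) (fun _ z => g' z) (fun _ z => g'' z).
Definition jadd F G := Jet (fun th z => j0 F th z + j0 G th z) (fun th z => j1 F th z + j1 G th z)
  (fun th z => j2 F th z + j2 G th z) (fun th z => j22 F th z + j22 G th z).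
Definition jmul F G := Jet (fun th z => j0 F th z * j0 G th z)
  (fun th z => j0 F th z * j1 G th z + j1 F th z * j0 G th z)
  (fun th z => j0 F th z * j2 G th z + j2 F th z * j0 G th z)
  (fun th z => j0 F th z * j22 G th z + 2 * (j2 F th z * j2 G th z) + j22 F th z * j0 G th z).
Definition jcomp (psi psi' psi'' : R -> R) F := Jet (fun th z => psi (j0 F th z))
  (fun th z => psi' (j0 F th z) * j1 F th z)
  (fun th z => psi' (j0 F th z) * j2 F th z)
  (fun th z => psi'' (j0 F th z) * (j2 F th z * j2 F th z) + psi' (j0 F th z) * j22 F th z).
Definition jln := jcomp (@ln R) GRing.inv (fun u => - (u^-1 * u^-1)).
Definition jsqrt := jcomp (@Num.sqrt R) (fun u => 2^-1 * (Num.sqrt u)^-1)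
  (fun u => - (4^-1 * ((Num.sqrt u)^-1 * u^-1))).
Definition jpos3 := jcomp (@pos3 R) (@pos3' R) (@pos3'' R).

Lemma smooth_cst I c : smooth I (jcst c).
Proof.
split; rewrite /=; try exact: cyl_cst; try exact: bl_cst.
- by move=> th z; exact: is_derive_cst.
- by move=> th z; exact: is_derive_cst.
- by move=> th z; exact: is_derive_cst.
Qed.

Lemma smooth_cos I : smooth I jcos.
Proof.
split; rewrite /=; try exact: cyl_cst; try exact: bl_cst.
- exact: cyl_cos.
- by apply: cylN; exact: cyl_sin.
- by move=> th z; exact: is_derive_cos.
- by move=> th z; exact: is_derive_cst.
- by move=> th z; exact: is_derive_cst.
- exact: bl_cos.
- by apply: blN; exact: bl_sin.
Qed.

Lemma smooth_sin I : smooth I jsin.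
Proof.
split; rewrite /=; try exact: cyl_cst; try exact: bl_cst.
- exact: cyl_sin.
- exact: cyl_cos.
- by move=> th z; exact: is_derive_sin.
- by move=> th z; exact: is_derive_cst.
- by move=> th z; exact: is_derive_cst.
- exact: bl_sin.
- exact: bl_cos.
Qed.

Lemma smooth_id a b : smooth `[a, b] (zjet id (cst 1) (cst 0)).
Proof.
split; rewrite /=; try exact: cyl_cst; try exact: bl_cst.
- exact: cyl_z.
- by move=> th z; exact: is_derive_cst.
- by move=> th z; exact: is_derive_id.
- by move=> th z; exact: is_derive_cst.
- exact: bl_z.
Qed.

Lemma smooth_add I F G : smooth I F -> smooth I G -> smooth I (jadd F G).
Proof.
move=> [a1 a2 a3 a4 d1 d2 d3 b1 b2 b3 b4] [a1' a2' a3' a4' d1' d2' d3' b1' b2' b3' b4'].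
split; rewrite /=; try exact: cylD; try exact: blD.
- by move=> th z; apply: is_deriveD.
- by move=> th z; apply: is_deriveD.
- by move=> th z; apply: is_deriveD.
Qed.

Lemma smooth_mul I F G : smooth I F -> smooth I G -> smooth I (jmul F G).
Proof.
move=> [a1 a2 a3 a4 d1 d2 d3 b1 b2 b3 b4] [a1' a2' a3' a4' d1' d2' d3' b1' b2' b3' b4'].
split; rewrite /=.
- exact: cylM.
- by apply: cylD; exact: cylM.
- by apply: cylD; exact: cylM.
- apply: cylD; last exact: cylM.
  by apply: cylD; [exact: cylM|apply: cylM; [exact: cyl_cst|exact: cylM]].
- move=> th z; apply: (is_derive_eq (is_deriveM (d1 th z) (d1' th z))).
  by rewrite /GRing.scale/= [j0 G _ _ * _]mulrC.
- move=> th z; apply: (is_derive_eq (is_deriveM (d2 th z) (d2' th z))).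
  by rewrite /GRing.scale/= [j0 G _ _ * _]mulrC.
- move=> th z; apply: (is_derive_eq (is_deriveD (is_deriveM (d2 th z) (d3' th z))
    (is_deriveM (d3 th z) (d2' th z)))).
  by rewrite /GRing.scale/=; ring.
- exact: blM.
- by apply: blD; exact: blM.
- by apply: blD; exact: blM.
- apply: blD; last exact: blM.
  by apply: blD; [exact: blM|apply: blM; [exact: bl_cst|exact: blM]].
Qed.

Lemma smooth_comp I (psi psi' psi'' : R -> R) F : smooth I F ->
  measurable_fun setT psi -> measurable_fun setT psi' -> measurable_fun setT psi'' ->
  (forall th z, is_derive (j0 F th z) 1 psi (psi' (j0 F th z))) ->
  (forall th z, is_derive (j0 F th z) 1 psi' (psi'' (j0 F th z))) ->
  bl I (fun th z => psi (j0 F th z)) -> bl I (fun th z => psi' (j0 F th z)) ->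
  bl I (fun th z => psi'' (j0 F th z)) ->
  smooth I (jcomp psi psi' psi'' F).
Proof.
move=> [a1 a2 a3 a4 d1 d2 d3 b1 b2 b3 b4] m0 m1 m2 e1 e2 c0 c1 c2.
have k0 := cyl_comp m0 a1; have k1 := cyl_comp m1 a1; have k2 := cyl_comp m2 a1.
split; rewrite /= => //.
- exact: cylM.
- exact: cylM.
- by apply: cylD; apply: cylM => //; exact: cylM.
- move=> th z; exact: (@is_derive1_comp R psi (fun th => j0 F th z) th _ _ (e1 th z) (d1 th z)).
- move=> th z; exact: (@is_derive1_comp R psi (j0 F th) z _ _ (e1 th z) (d2 th z)).
- move=> th z; apply: (is_derive_eq (is_deriveM (@is_derive1_comp R psi' (j0 F th) z _ _ (e2 th z) (d2 th z)) (d3 th z))).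
  by rewrite /GRing.scale/=; ring.
- exact: blM.
- exact: blM.
- by apply: blD; apply: blM => //; exact: blM.
Qed.

Lemma measurable_inv : measurable_fun setT (@GRing.inv R).
Proof.
rewrite (_ : GRing.inv = fun u : R => if 0 < u then expR (- ln u) else
    if u < 0 then - expR (- ln (- u)) else 0); last first.
  apply/funext => u; case: ltgtP => u0.
  - by rewrite expRN lnK.
  - by rewrite expRN lnK ?posrE ?oppr_gt0// invrN opprK.
  - by rewrite -u0 invr0.
have mE : measurable_fun setT (fun u : R => expR (- ln u)).
  by apply: measurableT_comp => //; apply: measurable_funN; exact: measurable_ln.
apply: measurable_fun_ifT => //; first exact: measurable_fun_ltr.
apply: measurable_fun_ifT => //; first exact: measurable_fun_ltr.
by apply: measurable_funN; exact: (measurableT_comp mE).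
Qed.

Lemma smooth_ln I F lo : 0 < lo -> (forall th z, 0 < j0 F th z) ->
  (forall th z, I z -> lo <= j0 F th z) -> smooth I F -> smooth I (jln F).
Proof.
move=> lo0 F0 Flo sF; have bi := bl_inv lo0 Flo (bl_j0 sF).
have mV : measurable_fun setT (@GRing.inv R) by exact: measurable_inv.
apply: smooth_comp => //.
- by apply: measurable_funN; exact: measurable_funM.
- by move=> th z; exact: is_derive1_ln.
- move=> th z; apply: (is_derive_eq (is_deriveV _ (is_derive_id _ _))).
    by rewrite gt_eqF.
  by rewrite /GRing.scale/= mulr1 expr2 invfM.
- exact: bl_ln lo0 Flo (bl_j0 sF).
- by apply: blN; exact: blM.
Qed.

Lemma smooth_sqrt I F lo : 0 < lo -> (forall th z, 0 < j0 F th z) ->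
  (forall th z, I z -> lo <= j0 F th z) -> smooth I F -> smooth I (jsqrt F).
Proof.
move=> lo0 F0 Flo sF; have bi := bl_inv lo0 Flo (bl_j0 sF).
have bs := bl_sqrt lo0 Flo (bl_j0 sF).
have slo : 0 < Num.sqrt lo by rewrite sqrtr_gt0.
have Fslo th z : I z -> Num.sqrt lo <= Num.sqrt (j0 F th z).
  by move=> Iz; rewrite ler_sqrt ?(ltW (F0 _ _))// Flo.
have bis := bl_inv slo Fslo bs.
have mV : measurable_fun setT (@GRing.inv R) by exact: measurable_inv.
have mS : measurable_fun setT (@Num.sqrt R) by apply: continuous_measurable_fun; exact: sqrt_continuous.
have mVS : measurable_fun setT (fun u : R => (Num.sqrt u)^-1) by exact: measurableT_comp.
apply: smooth_comp => //.
- exact: measurable_funM.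
- by apply: measurable_funN; apply: measurable_funM => //; exact: measurable_funM.
- by move=> th z; apply: (is_derive_eq (is_derive1_sqrt (F0 th z))); rewrite invfM.
- move=> th z; have s0 : 0 < Num.sqrt (j0 F th z) by rewrite sqrtr_gt0.
  have := is_deriveV (f := @Num.sqrt R) (x := j0 F th z) (v := 1) (t := (2 * Num.sqrt (j0 F th z))^-1).
  rewrite gt_eqF// => /(_ isT (is_derive1_sqrt (F0 th z))) h.
  apply: (is_derive_eq (@is_deriveZ _ _ _ _ 2^-1 _ _ _ h)); rewrite /GRing.scale/=.
  have -> : Num.sqrt (j0 F th z) ^- 2 = (j0 F th z)^-1 by rewrite sqr_sqrtr// ltW.
  by field; rewrite !gt_eqF.
- by apply: blM => //; exact: bl_cst.
- by apply: blN; apply: blM; [exact: bl_cst|exact: blM].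
Qed.

Lemma smooth_pos3 I F : smooth I F -> smooth I (jpos3 F).
Proof.
move=> sF; have bm := bl_max0 (bl_j0 sF).
have m0 := @measurable_max0 R.
apply: smooth_comp => //.
- exact: measurable_funX.
- by apply: measurable_funM => //; exact: measurable_funX.
- exact: measurable_funM.
- by move=> th z; exact: is_derive_pos3.
- by move=> th z; exact: is_derive_pos3'.
- by rewrite /pos3; under eq_fun do under eq_fun do rewrite exprS expr2; apply: blM => //; exact: blM.
- rewrite /pos3'; apply: blM; first exact: bl_cst.
  by under eq_fun do under eq_fun do rewrite expr2; exact: blM.
- by apply: blM => //; exact: bl_cst.
Qed.

Definition clamp (a b z : R) := Num.min (Num.max z a) b.

Lemma clamp_itv a b z : a <= b -> clamp a b z \in `[a, b].
Proof.
move=> ab; rewrite in_itv/= /clamp ge_min lexx orbT andbT le_min ab andbT.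
by rewrite le_max lexx orbT.
Qed.

Lemma clamp_id a b z : z \in `[a, b] -> clamp a b z = z.
Proof. by rewrite in_itv/= => /andP[az zb]; rewrite /clamp max_l// min_l. Qed.

Lemma clamp_lip a b (z z' : R) : `|clamp a b z' - clamp a b z| <= `|z' - z|.
Proof.
have H (u v : R) : u <= v -> `|clamp a b v - clamp a b u| <= v - u.
  move=> uv; rewrite /clamp.
  case: (leP u a) => ua; case: (leP v a) => va; case: (leP v b) => vb;
  case: (leP u b) => ub; case: (leP a b) => ab; rewrite ger0_norm; lra.
have [h|/ltW h] := leP z z'.
  by rewrite (ger0_norm (_ : 0 <= z' - z)) ?subr_ge0//; exact: H.
by rewrite distrC (distrC z') (ger0_norm (_ : 0 <= z - z')) ?subr_ge0//; exact: H.
Qed.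

Lemma bl_clamp a b f : a <= b -> bl `[a, b] f ->
  (forall th z, f th z = f th (clamp a b z)) -> bl setT f.
Proof.
move=> ab [C C0 [bf lf]] fE; exists C => //; split=> [th z _|th th' z z' _ _].
  by rewrite fE bf//=; exact: clamp_itv.
rewrite fE (fE th z); apply: (le_trans (lf _ _ _ _ _ _)); [exact: clamp_itv|exact: clamp_itv|].
by rewrite ler_wpM2l// lerD2l clamp_lip.
Qed.

(** A jet that is constant in z beyond both ends of an interval inherits its bounds from it. *)
Lemma smooth_clamp a b F : a <= b -> smooth `[a, b] F ->
  (forall th z, [/\ j0 F th z = j0 F th (clamp a b z), j1 F th z = j1 F th (clamp a b z),
     j2 F th z = j2 F th (clamp a b z) & j22 F th z = j22 F th (clamp a b z)]) ->
  smooth setT F.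
Proof.
move=> ab [a1 a2 a3 a4 d1 d2 d3 b1 b2 b3 b4] FE.
by split => //; apply: (bl_clamp ab) => // th z; have [] := FE th z.
Qed.

Lemma zjet_clamp a b g g' g'' : a <= b -> smooth `[a, b] (zjet g g' g'') ->
  (forall z, z \notin `[a, b] -> [/\ g z = g (clamp a b z), g' z = g' (clamp a b z) &
     g'' z = g'' (clamp a b z)]) -> smooth setT (zjet g g' g'').
Proof.
move=> ab sg gE; apply: (smooth_clamp ab sg) => th z /=.
have [zab|zab] := boolP (z \in `[a, b]); first by rewrite clamp_id.
by have [] := gE z zab; split.
Qed.

Variables (gamma zs alpha : R).
Notation L := (generator gamma zs alpha).

Lemma generator_add F G th z : L (jadd F G) th z = L F th z + L G th z.
Proof. by rewrite /generator/=; ring. Qed.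

(** The last term is the carre du champ of the noise in z. *)
Lemma generator_mul F G th z : L (jmul F G) th z =
  j0 F th z * L G th z + j0 G th z * L F th z + alpha ^+ 2 * (j2 F th z * j2 G th z).
Proof. by rewrite /generator/=; field. Qed.

Lemma generator_comp psi psi' psi'' F th z : L (jcomp psi psi' psi'' F) th z =
  psi' (j0 F th z) * L F th z + alpha ^+ 2 / 2 * psi'' (j0 F th z) * j2 F th z ^+ 2.
Proof. by rewrite /generator/=; field. Qed.

Lemma generator_cst c th z : L (jcst c) th z = 0.
Proof. by rewrite /generator/=; ring. Qed.

End jets.

(** * Growth rates of quadratic forms *)

Section quadratic_forms.
Variable R : realType.
Implicit Types (U V M d tau rho k q : R).

(** z sin cos plus the generator applied to 1/2 ln (U ^ 2 + d ^ 2 V ^ 2), for linear forms U and V that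
    grow at the rates M and - M up to the errors rho and rho', and mix by the noise tau in M. *)
Definition form_rate M tau rho (rho' : R) d U V : R :=
  let F := U ^+ 2 + d ^+ 2 * V ^+ 2 in
  (M * (U ^+ 2 - d ^+ 2 * V ^+ 2) + (rho * U + d ^+ 2 * rho' * V) * ((U - V) / (2 * M)) +
   tau * (U - V) ^+ 2 * (1 + d ^+ 2)) / F - 2 * tau * (U - V) ^+ 2 * (U - d ^+ 2 * V) ^+ 2 / F ^+ 2.

Lemma square_form_le U V : (U - V) ^+ 2 <= 2 * (U ^+ 2 + V ^+ 2).
Proof. by have := sqr_ge0 (U + V); rewrite sqrrB sqrrD; lra. Qed.

Lemma cross_form_le d U V : 0 < d ->
  `|U * V| <= (2 * d)^-1 * (U ^+ 2 + d ^+ 2 * V ^+ 2).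
Proof.
move=> d0; have dd : 0 < 2 * d by rewrite mulr_gt0.
rewrite ler_pdivlMl// -{1}(gtr0_norm dd) -normrM ler_norml.
have := sqr_ge0 (U - d * V); have := sqr_ge0 (U + d * V).
by rewrite sqrrB sqrrD exprMn => *; apply/andP; split; lra.
Qed.

(** For d = 1 the noise enters through w (1 - w), w = (U - V) ^ 2 / (U ^ 2 + V ^ 2) being at most 2. *)
Lemma form_rate1 M tau (AM : R) q U V : 0 < M -> 0 <= tau -> 0 < U ^+ 2 + V ^+ 2 ->
  `|form_rate M tau (q - M ^+ 2 + AM) (q - M ^+ 2 - AM) 1 U V -
    (q + M ^+ 2) / (2 * M) * (1 - 2 * (V ^+ 2 / (U ^+ 2 + V ^+ 2)))| <= `|AM| / M + 4 * tau.
Proof.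
move=> M0 tau0 F0; set F := U ^+ 2 + V ^+ 2 in F0 *.
pose w := (U - V) ^+ 2 / F.
have w0 : 0 <= w by rewrite divr_ge0 ?sqr_ge0// ltW.
have w2 : w <= 2 by rewrite ler_pdivrMr//; exact: square_form_le.
have -> : form_rate M tau (q - M ^+ 2 + AM) (q - M ^+ 2 - AM) 1 U V -
    (q + M ^+ 2) / (2 * M) * (1 - 2 * (V ^+ 2 / F)) = AM / M * (w / 2) + 2 * tau * (w * (1 - w)).
  rewrite /form_rate /w expr1n !mul1r -/F; move: (gt_eqF F0); rewrite /F => F1; field.
  by rewrite F1 gt_eqF.
apply: (le_trans (ler_normD _ _)).
rewrite (normrM (AM / M)) (normrM AM) normfV (gtr0_norm M0) (normrM (2 * tau)).
rewrite (ger0_norm (_ : 0 <= 2 * tau)) ?mulr_ge0//; apply: lerD.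
  by rewrite ler_piMr ?mulr_ge0 ?invr_ge0 ?(ltW M0)// ger0_norm; lra.
have : `|w * (1 - w)| <= 2.
  rewrite ler_norml; apply/andP; split; last by have := sqr_ge0 w; rewrite expr2; lra.
  have h : 0 <= (2 - w) * (1 + w) by apply: mulr_ge0; lra.
  by move: h; lra.
by move=> h; have := ler_wpM2l tau0 h; lra.
Qed.

(** With P = U ^ 2 and Q = V ^ 2. When neither of them vanishes, lowering the weight of the decaying
    form V raises the growth rate: this is the first term. It vanishes on the line P = 0, where the
    noise takes over. *)
Lemma gain_main M tau k d (P Q : R) : 0 < M -> 0 < d -> d <= 2^-1 -> 0 <= tau -> tau <= M * d ->
  0 <= k -> k <= 2^-1 -> k * (2 * M * d) <= tau -> 0 <= P -> 0 <= Q -> 0 < P + d * Q ->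
  3 / 4 * M * k * (Q / (P + Q)) <=
  2 * (1 - d) * M * (P * Q / ((P + d * Q) * (P + Q))) +
  tau * (1 - d) * (Q * (d * Q - P) / (P + d * Q) ^+ 2).
Proof.
move=> M0 d0 d2 tau0 tauM k0 k2 ktau P0 Q0 F0.
pose t := tau / M.
have tE : tau = M * t by rewrite /t mulrC divfK// gt_eqF.
have t0 : 0 <= t by rewrite divr_ge0// ltW.
have td : t <= d by rewrite -(ler_pM2l M0) -tE.
have kt : 2 * k * d <= t by rewrite -(ler_pM2l M0) -tE; apply: le_trans ktau; lra.
have F1 : 0 < P + Q.
  have : d * Q <= 1 * Q by rewrite ler_wpM2r//; lra.
  by rewrite mul1r; lra.
pose X := d * Q; have X0 : 0 <= X by rewrite mulr_ge0// ltW.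
have key : 3 / 2 * k * (P + X) ^+ 2 <= 2 * P * (P + X) + t * (X - P) * (P + Q).
  have PX : 0 <= P * X by rewrite mulr_ge0.
  have P2 : 0 <= P ^+ 2 by exact: sqr_ge0.
  have X2 : 0 <= X ^+ 2 by exact: sqr_ge0.
  have S0 : 0 <= (P + X) ^+ 2 by exact: sqr_ge0.
  have [PleX|/ltW XleP] := leP P X.
    have h1 : 2 * k * (X - P) * X <= t * (X - P) * (P + Q).
      have -> : 2 * k * (X - P) * X = (2 * k * d) * ((X - P) * Q) by rewrite /X; ring.
      rewrite -[leRHS]mulrA; apply: ler_pM => //.
      - by rewrite !mulr_ge0// ltW.
      - by rewrite mulr_ge0//; lra.
      - by rewrite ler_wpM2l; lra.
    have h2 : 4 * k * (P * (P + X)) <= 2 * P * (P + X).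
      have := ler_wpM2r (_ : 0 <= P * (P + X)) k2; rewrite mulr_ge0 ?addr_ge0// => /(_ isT); lra.
    have h3 : 0 <= k * ((P - X) ^+ 2 + 3 * P ^+ 2 + 2 * (P * X) ).
      by rewrite mulr_ge0// !addr_ge0 ?sqr_ge0// mulr_ge0.
    have h4 : 0 <= k * (5 * P ^+ 2 - 2 * (P * X) + X ^+ 2).
      rewrite mulr_ge0//; have -> : 5 * P ^+ 2 - 2 * (P * X) + X ^+ 2 = (P - X) ^+ 2 + 4 * P ^+ 2 by ring.
      by rewrite addr_ge0 ?sqr_ge0// mulr_ge0.
    have E : 2 * k * (X - P) * X + 4 * k * (P * (P + X)) - 3 / 2 * k * (P + X) ^+ 2 =
       2^-1 * (k * (5 * P ^+ 2 - 2 * (P * X) + X ^+ 2)) by field.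
    lra.
  have h1 : - (P - X) * (2^-1 * P + X) <= t * (X - P) * (P + Q).
    have -> : t * (X - P) * (P + Q) = - ((P - X) * (t * (P + Q))) by ring.
    rewrite mulNr lerN2 ler_wpM2l ?subr_ge0//.
    apply: (@le_trans _ _ (d * (P + Q))); first by rewrite ler_wpM2r// ltW.
    by rewrite mulrDr -/X lerD2r ler_wpM2r.
  have h2 : 3 / 2 * k * (P + X) ^+ 2 <= 3 / 4 * (P + X) ^+ 2.
    by rewrite ler_wpM2r//; lra.
  have E : 2 * P * (P + X) - (P - X) * (2^-1 * P + X) - 3 / 4 * (P + X) ^+ 2 =
     3 / 4 * P ^+ 2 + 4^-1 * X ^+ 2 by field.
  lra.
have -> : 2 * (1 - d) * M * (P * Q / ((P + d * Q) * (P + Q))) +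
    tau * (1 - d) * (Q * (d * Q - P) / (P + d * Q) ^+ 2) =
  (1 - d) * (M * Q / ((P + Q) * (P + X) ^+ 2)) * (2 * P * (P + X) + t * (X - P) * (P + Q)).
  by rewrite tE /X; field; rewrite !gt_eqF.
have B0 : 0 <= M * Q / ((P + Q) * (P + X) ^+ 2).
  by rewrite divr_ge0// mulr_ge0// ?exprn_ge0// ltW.
have K0 : 0 <= 3 / 2 * k * (P + X) ^+ 2 by apply: mulr_ge0; [rewrite mulr_ge0|exact: sqr_ge0].
apply: (@le_trans _ _ (2^-1 * (M * Q / ((P + Q) * (P + X) ^+ 2)) * (3 / 2 * k * (P + X) ^+ 2))).
  rewrite le_eqVlt; apply/orP; left; apply/eqP.
  by rewrite /X; field; rewrite !gt_eqF.
apply: ler_pM => //; first by rewrite mulr_ge0.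
by rewrite ler_wpM2r//; lra.
Qed.

(** The remaining terms of order tau have no sign, but they are of order 1 / d only. *)
Lemma gain_rest d U V : 0 < d -> d ^+ 2 <= 2^-1 ->
  let F := U ^+ 2 + d ^+ 2 * V ^+ 2 in 0 < F ->
  - (9 / d) <= ((U ^+ 2 - 2 * (U * V)) * ((1 - d ^+ 2) * (d ^+ 2 * V ^+ 2 - U ^+ 2)) +
     4 * d ^+ 2 * (U * V) * (U - V) ^+ 2) / F ^+ 2.
Proof.
move=> d0 d2 F F0.
have d1 : d <= 1.
  have : d ^+ 2 <= 1 ^+ 2 by rewrite expr1n; lra.
  by rewrite ler_sqr ?nnegrE// ltW.
have V2 : 0 <= d ^+ 2 * V ^+ 2 by rewrite mulr_ge0 ?sqr_ge0.
have U2 : 0 <= U ^+ 2 := sqr_ge0 U.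
have uv := cross_form_le U V d0; rewrite -/F in uv.
have di : 1 <= d^-1 by rewrite invr_ge1 ?unitfE ?gt_eqF.
have Fd : F <= d^-1 * F by rewrite ler_peMl// ltW.
have h1 : `|U ^+ 2 - 2 * (U * V)| <= 2 * d^-1 * F.
  apply: (le_trans (ler_normB _ _)); rewrite (normrM 2) (ger0_norm U2) (ger0_norm (ler0n _ 2)).
  have : U ^+ 2 <= F by rewrite /F; lra.
  move: uv; rewrite invfM; lra.
have h2 : `|(1 - d ^+ 2) * (d ^+ 2 * V ^+ 2 - U ^+ 2)| <= F.
  rewrite -[leRHS]mul1r normrM; apply: ler_pM => //.
    by rewrite ger0_norm ?lerBlDl ?lerDr ?sqr_ge0//; have := sqr_ge0 d; lra.
  by rewrite ler_norml /F; apply/andP; split; lra.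
have h3 : `|4 * d ^+ 2 * (U * V) * (U - V) ^+ 2| <= 4 * d^-1 * F ^+ 2.
  have s2 : d ^+ 2 * (U - V) ^+ 2 <= 2 * F.
    apply: (le_trans (ler_wpM2l (sqr_ge0 d) (square_form_le U V))).
    have : d ^+ 2 * U ^+ 2 <= 1 * U ^+ 2 by rewrite ler_wpM2r//; lra.
    by rewrite /F; lra.
  have -> : 4 * d ^+ 2 * (U * V) * (U - V) ^+ 2 = 4 * ((U * V) * (d ^+ 2 * (U - V) ^+ 2)) by ring.
  rewrite normrM (ger0_norm (ler0n _ 4)) normrM.
  have q0 := mulr_ge0 (sqr_ge0 d) (sqr_ge0 (U - V)).
  rewrite (ger0_norm q0); have := ler_pM (normr_ge0 _) q0 uv s2.
  have -> : (2 * d)^-1 * F * (2 * F) = d^-1 * F ^+ 2 by field; rewrite gt_eqF.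
  lra.
have F2 : 0 < F ^+ 2 by exact: exprn_gt0.
have h12 := ler_pM (normr_ge0 _) (normr_ge0 _) h1 h2; rewrite -normrM in h12.
rewrite ler_pdivlMr//.
have := ler_norm (- ((U ^+ 2 - 2 * (U * V)) * ((1 - d ^+ 2) * (d ^+ 2 * V ^+ 2 - U ^+ 2)))).
have := ler_norm (- (4 * d ^+ 2 * (U * V) * (U - V) ^+ 2)); rewrite !normrN.
have : 0 <= d^-1 * F ^+ 2 by rewrite mulr_ge0// ltW// invr_gt0.
have E : 2 * d^-1 * F * F = 2 * (d^-1 * F ^+ 2) by ring.
rewrite E in h12; lra.
Qed.

(** The form of small weight d ^ 2 on V grows faster than the isotropic one, by a multiple of the share
    of V in the latter. *)
Lemma form_gain M tau k rho (rho' : R) d U V : 0 < M -> 0 < d -> d ^+ 2 <= 2^-1 ->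
  0 <= tau -> tau <= M * d ^+ 2 -> 0 <= k -> k <= 2^-1 -> k * (2 * M * d ^+ 2) <= tau ->
  0 < U ^+ 2 + V ^+ 2 ->
  3 / 4 * M * k * (V ^+ 2 / (U ^+ 2 + V ^+ 2)) <=
  form_rate M tau rho rho' d U V - form_rate M tau rho rho' 1 U V +
  (10 * tau / d + 2 * `|rho| / (M * d) + 2 * `|rho'| / M).
Proof.
move=> M0 d0 d2 tau0 tauM k0 k2 ktau F1.
have d1 : d <= 1.
  have : d ^+ 2 <= 1 ^+ 2 by rewrite expr1n; lra.
  by rewrite ler_sqr ?nnegrE// ltW.
have di : 1 <= d^-1 by rewrite invr_ge1 ?unitfE ?gt_eqF.
have dd0 : 0 < d ^+ 2 by exact: exprn_gt0.
have U2 : 0 <= U ^+ 2 := sqr_ge0 U.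
have V2 : 0 <= V ^+ 2 := sqr_ge0 V.
have F0 : 0 < U ^+ 2 + d ^+ 2 * V ^+ 2.
  have h : d ^+ 2 * U ^+ 2 <= 1 * U ^+ 2 by rewrite ler_wpM2r//; lra.
  have : 0 < d ^+ 2 * (U ^+ 2 + V ^+ 2) by exact: mulr_gt0.
  by rewrite mulrDr; lra.
have gm := gain_main M0 dd0 d2 tau0 tauM k0 k2 ktau U2 V2 F0.
have gr := gain_rest d0 d2 F0.
set F := U ^+ 2 + d ^+ 2 * V ^+ 2 in F0 gm gr *; set G := U ^+ 2 + V ^+ 2 in F1 gm *.
pose w := (U - V) ^+ 2 / G.
pose r1 := ((U - V) * U) / F. pose r2 := d ^+ 2 * ((U - V) * V) / F.
pose r3 := ((U - V) * U) / G. pose r4 := ((U - V) * V) / G.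
set rest := (_ / F ^+ 2) in gr.
have E : form_rate M tau rho rho' d U V - form_rate M tau rho rho' 1 U V =
  (2 * (1 - d ^+ 2) * M * (U ^+ 2 * V ^+ 2 / (F * G)) +
   tau * (1 - d ^+ 2) * (V ^+ 2 * (d ^+ 2 * V ^+ 2 - U ^+ 2) / F ^+ 2)) +
  tau * rest - 2 * tau * (w * (1 - w)) + (rho * (r1 - r3) + rho' * (r2 - r4)) / (2 * M).
  rewrite /form_rate expr1n !mul1r -/F -/G /rest /w /r1 /r2 /r3 /r4.
  have := gt_eqF F0; have := gt_eqF F1; rewrite /F /G => e1 e2; field.
  by rewrite e1 exprMn e2 gt_eqF.
rewrite E.
have w1 : w * (1 - w) <= 4^-1.
  by have := sqr_ge0 (w - 2^-1); rewrite !expr2; lra.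
have tr := ler_wpM2l tau0 gr.
have tw := ler_wpM2l tau0 w1.
have uv := cross_form_le U V d0; rewrite -/F in uv.
have uv1 := cross_form_le U V (ltr01 : 0 < 1 :> R); rewrite expr1n mul1r mulr1 -/G in uv1.
have dV := mulr_ge0 (ltW dd0) V2.
have UF : U ^+ 2 <= F by rewrite /F lerDl.
have UG : U ^+ 2 <= G by rewrite /G lerDl.
have VG : V ^+ 2 <= G by rewrite /G lerDr.
have VF : d ^+ 2 * V ^+ 2 <= F by rewrite /F lerDr.
have iF : 0 <= d^-1 * F by rewrite mulr_ge0 ?invr_ge0// ltW.
have Fd : F <= d^-1 * F by rewrite ler_peMl// ltW.
have e1 : (U - V) * U = U ^+ 2 - U * V by ring.
have e2 : (U - V) * V = U * V - V ^+ 2 by ring.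
have b1 : `|r1| <= 3 / 2 * d^-1.
  rewrite normrM normfV (gtr0_norm F0) ler_pdivrMr// e1.
  by apply: (le_trans (ler_normB _ _)); rewrite (ger0_norm U2); move: uv; rewrite invfM; lra.
have b2 : `|r2| <= 3 / 2.
  rewrite normrM normfV (gtr0_norm F0) ler_pdivrMr// e2 mulrBr.
  apply: (le_trans (ler_normB _ _)).
  rewrite (ger0_norm dV) normrM (ger0_norm (ltW dd0)).
  have : d ^+ 2 * `|U * V| <= d * (2^-1 * F).
    have := ler_wpM2l (ltW dd0) uv.
    by have -> : d ^+ 2 * ((2 * d)^-1 * F) = d * (2^-1 * F) by field; rewrite gt_eqF.
  have : d * (2^-1 * F) <= 1 * (2^-1 * F) by rewrite ler_wpM2r// mulr_ge0// ltW.
  lra.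
have b3 : `|r3| <= 3 / 2.
  rewrite normrM normfV (gtr0_norm F1) ler_pdivrMr// e1.
  by apply: (le_trans (ler_normB _ _)); rewrite (ger0_norm U2); lra.
have b4 : `|r4| <= 3 / 2.
  rewrite normrM normfV (gtr0_norm F1) ler_pdivrMr// e2.
  by apply: (le_trans (ler_normB _ _)); rewrite (ger0_norm V2); lra.
have b13 : `|r1 - r3| <= 4 * d^-1.
  by apply: (le_trans (ler_normB _ _)); lra.
have b24 : `|r2 - r4| <= 4 by apply: (le_trans (ler_normB _ _)); lra.
have rr : - (2 * `|rho| / (M * d) + 2 * `|rho'| / M) <= (rho * (r1 - r3) + rho' * (r2 - r4)) / (2 * M).
  rewrite ler_pdivlMr ?mulr_gt0//.
  have -> : - (2 * `|rho| / (M * d) + 2 * `|rho'| / M) * (2 * M) = - (`|rho| * (4 * d^-1) + `|rho'| * 4).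
    by field; rewrite !gt_eqF.
  have h1 := ler_wpM2l (normr_ge0 rho) b13; have h2 := ler_wpM2l (normr_ge0 rho') b24.
  have := ler_norm (- (rho * (r1 - r3))); have := ler_norm (- (rho' * (r2 - r4))).
  rewrite !normrN !normrM; lra.
have td : tau <= tau / d by rewrite ler_peMr.
have tE : tau * - (9 / d) = - (9 * (tau / d)) by ring.
rewrite tE in tr.
have -> : 10 * tau / d = 10 * (tau / d) by ring.
lra.
Qed.

End quadratic_forms.

(** The angle is that of a solution of the linear system x' = (z - 1) y, y' = x, whose radius grows at
    the rate z sin cos. For a frozen z > 1 the forms x + M y and x - M y are eigenforms of eigenvalues
    M and - M if M = sqrt (z - 1). Here M is a function of z, and jU and jV are these forms on the
    unit circle. *)
Section forms.
Variable R : realType.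
Variables (gamma zs alpha : R) (M M1 M2 : R -> R) (m0 : R).
Hypotheses (m00 : 0 < m0) (Mm0 : forall z, m0 <= M z).
Hypothesis sM : smooth setT (zjet M M1 M2).
Notation L := (generator gamma zs alpha).

Let M0 z : 0 < M z. Proof. exact: lt_le_trans m00 (Mm0 z). Qed.

Definition jM := zjet M M1 M2.
Definition jU := jadd (jcos R) (jmul jM (jsin R)).
Definition jV := jadd (jcos R) (jmul (jcst (-1)) (jmul jM (jsin R))).
Definition jF (d : R) := jadd (jmul jU jU) (jmul (jcst (d ^+ 2)) (jmul jV jV)).
Definition jphi (d : R) := jmul (jcst 2^-1) (jln (jF d)).
Definition drift (z : R) : R := - gamma * (z - zs) * M1 z + alpha ^+ 2 / 2 * M2 z.
Definition noise (z : R) : R := alpha ^+ 2 * M1 z ^+ 2 / (8 * M z ^+ 2).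

Notation U th z := (cos th + M z * sin th).
Notation V th z := (cos th - M z * sin th).

Lemma noise_ge0 z : 0 <= noise z.
Proof. by rewrite divr_ge0// mulr_ge0 ?sqr_ge0. Qed.

Lemma jF_E d th z : j0 (jF d) th z = U th z ^+ 2 + d ^+ 2 * V th z ^+ 2.
Proof. by rewrite /=; ring. Qed.

(** U ^ 2 + V ^ 2 = 2 cos ^ 2 + 2 M ^ 2 sin ^ 2. *)
Lemma sum_squares_ge th z : Num.min 1 (m0 ^+ 2) <= U th z ^+ 2 + V th z ^+ 2.
Proof.
set q := Num.min _ _.
have q1 : q <= 1 by rewrite ge_min lexx.
have qm : q <= M z ^+ 2.
  apply: (@le_trans _ _ (m0 ^+ 2)); first by rewrite ge_min lexx orbT.
  by rewrite lerXn2r ?nnegrE ?(ltW m00) ?(ltW (M0 z)).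
have q0 : 0 <= q by rewrite le_min ler01 sqr_ge0.
have -> : U th z ^+ 2 + V th z ^+ 2 = 2 * (1 * cos th ^+ 2 + M z ^+ 2 * sin th ^+ 2) by ring.
have h1 : q * cos th ^+ 2 <= 1 * cos th ^+ 2 by rewrite ler_wpM2r ?sqr_ge0.
have h2 : q * sin th ^+ 2 <= M z ^+ 2 * sin th ^+ 2 by rewrite ler_wpM2r ?sqr_ge0.
have : q * cos th ^+ 2 + q * sin th ^+ 2 = q by rewrite -mulrDr cos2Dsin2 mulr1.
lra.
Qed.

Lemma sum_squares_gt0 th z : 0 < U th z ^+ 2 + V th z ^+ 2.
Proof. by apply: lt_le_trans (sum_squares_ge th z); rewrite lt_min ltr01 exprn_gt0. Qed.

Lemma jF_ge d th z : 0 < d -> d <= 1 ->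
  d ^+ 2 * Num.min 1 (m0 ^+ 2) <= j0 (jF d) th z.
Proof.
move=> d0 d1; rewrite jF_E.
apply: (le_trans (ler_wpM2l (sqr_ge0 d) (sum_squares_ge th z))).
rewrite mulrDr lerD2r ler_piMl ?sqr_ge0//.
by rewrite exprn_ile1// ltW.
Qed.

Lemma jF_gt0 d th z : 0 < d -> d <= 1 -> 0 < j0 (jF d) th z.
Proof.
move=> d0 d1; apply: lt_le_trans (jF_ge th z d0 d1).
by rewrite mulr_gt0 ?exprn_gt0// lt_min ltr01 exprn_gt0.
Qed.

Lemma smooth_phi d : 0 < d -> d <= 1 -> smooth setT (jphi d).
Proof.
move=> d0 d1; apply: smooth_mul; first exact: smooth_cst.
apply: (@smooth_ln _ _ _ (d ^+ 2 * Num.min 1 (m0 ^+ 2))).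
- by rewrite mulr_gt0 ?exprn_gt0// lt_min ltr01 exprn_gt0.
- by move=> th z; exact: jF_gt0.
- by move=> th z _; exact: jF_ge.
have sMs : smooth setT (jmul jM (jsin R)) by apply: smooth_mul => //; exact: smooth_sin.
have sU : smooth setT jU by apply: smooth_add => //; exact: smooth_cos.
have sV : smooth setT jV.
  by apply: smooth_add; [exact: smooth_cos|apply: smooth_mul => //; exact: smooth_cst].
apply: smooth_add; first exact: smooth_mul.
by apply: smooth_mul; [exact: smooth_cst|exact: smooth_mul].
Qed.

Let circ (th : R) : cos th ^+ 2 = 1 - sin th ^+ 2.
Proof. by rewrite -(cos2Dsin2 th) addrK. Qed.

Lemma generator_U th z : L jU th z =
  M z * U th z + (z - 1 - M z ^+ 2 + drift z) * sin th - z * (sin th * cos th) * U th z.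
Proof.
rewrite /generator /drift /=.
have -> : z * (sin th * cos th) * (cos th + M z * sin th) =
  z * sin th * (cos th ^+ 2) + z * M z * cos th * sin th ^+ 2 by ring.
by rewrite circ; field.
Qed.

Lemma generator_V th z : L jV th z =
  - M z * V th z + (z - 1 - M z ^+ 2 - drift z) * sin th - z * (sin th * cos th) * V th z.
Proof.
rewrite /generator /drift /=.
have -> : z * (sin th * cos th) * (cos th - M z * sin th) =
  z * sin th * (cos th ^+ 2) - z * M z * cos th * sin th ^+ 2 by ring.
by rewrite circ; field.
Qed.

Lemma j2_U th z : j2 jU th z = M1 z * sin th. Proof. by rewrite /=; ring. Qed.
Lemma j2_V th z : j2 jV th z = - (M1 z * sin th). Proof. by rewrite /=; ring. Qed.

Lemma j2_F d th z : j2 (jF d) th z = 2 * (M1 z * sin th) * (U th z - d ^+ 2 * V th z).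
Proof. by rewrite /=; ring. Qed.

Lemma j2_phi d th z : 0 < d -> d <= 1 ->
  j2 (jphi d) th z = M1 z * sin th * (U th z - d ^+ 2 * V th z) / j0 (jF d) th z.
Proof.
move=> d0 d1; have F0 := jF_gt0 th z d0 d1.
have -> : j2 (jphi d) th z = 2^-1 * ((j0 (jF d) th z)^-1 * j2 (jF d) th z) by rewrite /=; ring.
by rewrite j2_F; field; rewrite gt_eqF.
Qed.

Lemma generator_phi d th z : 0 < d -> d <= 1 ->
  z * (sin th * cos th) + L (jphi d) th z =
  form_rate (M z) (noise z) (z - 1 - M z ^+ 2 + drift z) (z - 1 - M z ^+ 2 - drift z) d
    (U th z) (V th z).
Proof.
move=> d0 d1; have F0 := jF_gt0 th z d0 d1.
rewrite /jphi generator_mul generator_cst generator_comp.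
rewrite [j0 (jcst _) _ _]/= [j2 (jcst _) _ _]/= j2_F.
have LF : L (jF d) th z = 2 * U th z * L jU th z + d ^+ 2 * (2 * V th z * L jV th z)
    + alpha ^+ 2 * (M1 z * sin th) ^+ 2 * (1 + d ^+ 2).
  rewrite /jF generator_add !generator_mul generator_cst j2_U j2_V.
  by rewrite [j0 (jcst _) _ _]/= [j2 (jcst _) _ _]/= [j0 jU _ _]/= [j0 jV _ _]/=; ring.
rewrite LF generator_U generator_V /form_rate.
have hs : (U th z - V th z) / (2 * M z) = sin th by field; rewrite gt_eqF.
have hn : noise z * (U th z - V th z) ^+ 2 = 2^-1 * (alpha ^+ 2 * (M1 z * sin th) ^+ 2).
  by rewrite /noise; field; rewrite gt_eqF.
have -> : 2 * noise z * (U th z - V th z) ^+ 2 * (U th z - d ^+ 2 * V th z) ^+ 2 =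
  2 * (noise z * (U th z - V th z) ^+ 2) * (U th z - d ^+ 2 * V th z) ^+ 2 by ring.
rewrite hs hn -jF_E; set F := j0 (jF d) th z in F0 *.
have FE : F = U th z ^+ 2 + d ^+ 2 * V th z ^+ 2 by rewrite /F jF_E.
move: F FE F0 => F FE F0; clear LF hs hn.
set u := U th z in FE *; set v := V th z in FE *.
set s := sin th; set c := cos th; set dr := drift z.
have E : z * (s * c) = z * (s * c) * (u * u + d ^+ 2 * (v * v)) / F.
  have -> : u * u + d ^+ 2 * (v * v) = F by rewrite FE; ring.
  by rewrite mulfK// gt_eqF.
rewrite [X in X + _ = _]E.
by field; rewrite gt_eqF.
Qed.

Notation v th z := (V th z ^+ 2 / (U th z ^+ 2 + V th z ^+ 2)).

Lemma v_itv th z : 0 <= v th z <= 1.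
Proof.
have h := sum_squares_gt0 th z; have hu := sqr_ge0 (U th z); have hv := sqr_ge0 (V th z).
by rewrite divr_ge0 ?(ltW h)//= ler_pdivrMr// mul1r lerDr.
Qed.

(** For d = 1 the growth rate is that of the frozen system up to derivatives of M and to the share v
    of the decaying direction. *)
Lemma rate_approx th z :
  `|z * (sin th * cos th) + L (jphi 1) th z -
    (z - 1 + M z ^+ 2) / (2 * M z) * (1 - 2 * v th z)| <= `|drift z| / M z + 4 * noise z.
Proof.
rewrite generator_phi//; exact: form_rate1 (M0 z) (noise_ge0 z) (sum_squares_gt0 th z).
Qed.

Definition jdiff (d : R) := jadd (jphi d) (jmul (jcst (-1)) (jphi 1)).

Lemma smooth_diff d : 0 < d -> d <= 1 -> smooth setT (jdiff d).
Proof.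
move=> d0 d1; apply: smooth_add; first exact: smooth_phi.
by apply: smooth_mul; [exact: smooth_cst|exact: smooth_phi].
Qed.

Lemma diff_bound d th z : 0 < d -> d <= 1 -> `|j0 (jdiff d) th z| <= - ln d.
Proof.
move=> d0 d1; have F0 := jF_gt0 th z d0 d1; have F1 := jF_gt0 th z ltr01 (lexx 1).
have -> : j0 (jdiff d) th z = 2^-1 * (ln (j0 (jF d) th z) - ln (j0 (jF 1) th z)).
  by rewrite [LHS]/= /=; ring.
have d2 : d ^+ 2 <= 1 by rewrite exprn_ile1// ltW.
have hu := sqr_ge0 (U th z); have hv := sqr_ge0 (V th z).
have up : j0 (jF d) th z <= j0 (jF 1) th z.
  by rewrite !jF_E expr1n lerD2l ler_wpM2r.
have lo : d ^+ 2 * j0 (jF 1) th z <= j0 (jF d) th z.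
  by rewrite !jF_E expr1n mul1r mulrDr lerD2r ler_piMl.
have up' : ln (j0 (jF d) th z) <= ln (j0 (jF 1) th z) by rewrite ler_ln ?posrE.
have lo' : 2 * ln d + ln (j0 (jF 1) th z) <= ln (j0 (jF d) th z).
  rewrite mulr_natl -lnXn// -lnM ?posrE ?exprn_gt0// ler_ln ?posrE// mulr_gt0// exprn_gt0//.
rewrite ler_norml; apply/andP; split; lra.
Qed.

Lemma diff_slope_bound d th z : 0 < d -> d ^+ 2 <= 2^-1 ->
  `|j2 (jdiff d) th z| <= 2 * `|M1 z| / (M z * d).
Proof.
move=> d0 d2.
have d1 : d <= 1.
  have : d ^+ 2 <= 1 ^+ 2 by rewrite expr1n; lra.
  by rewrite ler_sqr ?nnegrE// ltW.
have F0 := jF_gt0 th z d0 d1; have F1 := jF_gt0 th z ltr01 (lexx 1).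
have -> : j2 (jdiff d) th z = j2 (jphi d) th z - j2 (jphi 1) th z by rewrite /=; ring.
rewrite !j2_phi// expr1n mul1r.
have hs : sin th = (U th z - V th z) / (2 * M z) by field; rewrite gt_eqF.
set u := U th z in hs *; set w := V th z in hs *.
have di : 1 <= d^-1 by rewrite invr_ge1 ?unitfE ?gt_eqF.
have FE : j0 (jF d) th z = u ^+ 2 + d ^+ 2 * w ^+ 2 by rewrite jF_E.
have GE : j0 (jF 1) th z = u ^+ 2 + w ^+ 2 by rewrite jF_E expr1n mul1r.
rewrite -/u -/w in FE GE.
set F := j0 (jF d) th z in F0 FE *; set G := j0 (jF 1) th z in F1 GE *.
have -> : M1 z * sin th * (u - d ^+ 2 * w) / F - M1 z * sin th * (u - w) / G =
  M1 z / M z * (2^-1 * ((u - w) * (u - d ^+ 2 * w) / F - (u - w) ^+ 2 / G)).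
  by rewrite hs; field; rewrite !gt_eqF.
rewrite normrM normrM normfV (gtr0_norm (M0 z)).
have -> : 2 * `|M1 z| / (M z * d) = `|M1 z| / M z * (2 * d^-1) by field; rewrite !gt_eqF.
apply: ler_wpM2l; first by rewrite divr_ge0// ltW.
rewrite normrM (ger0_norm (_ : 0 <= 2^-1))//.
have b2 : `|(u - w) ^+ 2 / G| <= 2.
  rewrite normrM normfV (gtr0_norm F1) (ger0_norm (sqr_ge0 _)) ler_pdivrMr// GE.
  exact: square_form_le.
have b1 : `|(u - w) * (u - d ^+ 2 * w) / F| <= 2 * d^-1.
  rewrite normrM normfV (gtr0_norm F0) ler_pdivrMr//.
  have -> : (u - w) * (u - d ^+ 2 * w) = F - (1 + d ^+ 2) * (u * w) by rewrite FE; ring.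
  have uw := cross_form_le u w d0; rewrite -FE invfM in uw.
  apply: (le_trans (ler_normB _ _)); rewrite (gtr0_norm F0) normrM.
  rewrite (ger0_norm (_ : 0 <= 1 + d ^+ 2)) ?addr_ge0 ?sqr_ge0//.
  have Fd : F <= d^-1 * F by rewrite ler_peMl// ltW.
  have h : (1 + d ^+ 2) * `|u * w| <= 3 / 2 * (2^-1 * d^-1 * F).
    by apply: ler_pM => //; [rewrite addr_ge0 ?sqr_ge0|lra].
  have : 0 <= d^-1 * F by rewrite mulr_ge0 ?invr_ge0// ltW.
  lra.
have := ler_normB ((u - w) * (u - d ^+ 2 * w) / F) ((u - w) ^+ 2 / G); lra.
Qed.

(** The share v of the decaying form is large near the line U = 0, which the frozen system leaves
    invariant, and from which only the noise expels the angle. The logarithms of the forms of weights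
    d ^ 2 and 1 differ by at most - ln d, and their difference gains 3/4 M k v per unit of time: as the
    generator has mean zero, v is small on average. The cutoff chi restricts this to the values of z
    where the noise in M is large enough. *)
Lemma localized_gain (chi chi1 chi2 : R -> R) (d k th z : R) :
  0 < d -> d ^+ 2 <= 2^-1 -> 0 <= chi z <= 1 ->
  0 <= k <= 2^-1 -> (0 < chi z -> noise z <= M z * d ^+ 2 /\ k * (2 * M z * d ^+ 2) <= noise z) ->
  chi z * (3 / 4 * M z * k * v th z) <=
  L (jmul (zjet chi chi1 chi2) (jdiff d)) th z +
  (chi z * (10 * noise z / d + 2 * `|z - 1 - M z ^+ 2 + drift z| / (M z * d) +
     2 * `|z - 1 - M z ^+ 2 - drift z| / M z) +
   `|- gamma * (z - zs) * chi1 z + alpha ^+ 2 / 2 * chi2 z| * - ln d +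
   alpha ^+ 2 * (`|chi1 z| * (2 * `|M1 z| / (M z * d)))).
Proof.
move=> d0 d2 /andP[chi0 chi1'] /andP[k0 k2] kP.
have d1 : d <= 1.
  have : d ^+ 2 <= 1 ^+ 2 by rewrite expr1n; lra.
  by rewrite ler_sqr ?nnegrE// ltW.
rewrite generator_mul.
have -> : j0 (zjet chi chi1 chi2) th z = chi z by [].
have -> : j2 (zjet chi chi1 chi2) th z = chi1 z by [].
have -> : L (zjet chi chi1 chi2) th z = - gamma * (z - zs) * chi1 z + alpha ^+ 2 / 2 * chi2 z.
  by rewrite /generator/=; ring.
set K := _ + alpha ^+ 2 / 2 * chi2 z.
have b := diff_bound th z d0 d1; have b2 := diff_slope_bound th z d0 d2.
have ld : 0 <= - ln d by apply: le_trans b.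
have t1 : - (`|K| * - ln d) <= j0 (jdiff d) th z * K.
  have := ler_norm (- (j0 (jdiff d) th z * K)); rewrite normrN normrM mulrC.
  have := ler_wpM2l (normr_ge0 K) b; lra.
have t2 : - (alpha ^+ 2 * (`|chi1 z| * (2 * `|M1 z| / (M z * d)))) <=
    alpha ^+ 2 * (chi1 z * j2 (jdiff d) th z).
  rewrite -mulrN ler_wpM2l ?sqr_ge0//.
  have := ler_norm (- (chi1 z * j2 (jdiff d) th z)); rewrite normrN normrM.
  have := ler_wpM2l (normr_ge0 (chi1 z)) b2; lra.
suff : chi z * (3 / 4 * M z * k * v th z) <= chi z * (L (jdiff d) th z +
    (10 * noise z / d + 2 * `|z - 1 - M z ^+ 2 + drift z| / (M z * d) +
     2 * `|z - 1 - M z ^+ 2 - drift z| / M z)) by rewrite [in X in X -> _]mulrDr; lra.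
move: chi0; rewrite le_eqVlt => /orP[/eqP<-|chi0]; first by rewrite !mul0r.
rewrite ler_wpM2l ?(ltW chi0)//; have [n1 n2] := kP chi0.
have -> : L (jdiff d) th z = (z * (sin th * cos th) + L (jphi d) th z) -
    (z * (sin th * cos th) + L (jphi 1) th z).
  by rewrite /jdiff generator_add generator_mul generator_cst
    [j0 (jcst _) _ _]/= [j2 (jcst _) _ _]/=; ring.
rewrite !generator_phi//.
exact: form_gain (M0 z) d0 d2 (noise_ge0 z) n1 k0 k2 n2 (sum_squares_gt0 th z).
Qed.

End forms.

(** * The Gaussian marginal *)

Section antiderivative.
Variable R : realType.
Notation leb := (@lebesgue_measure R).
Variables (r : R) (h : R -> R).
Hypotheses (r0 : 0 <= r) (ch : continuous h) (h0 : forall x, r <= `|x| -> h x = 0).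

Lemma integrable_compact_support : leb.-integrable setT (EFin \o h).
Proof.
rewrite (_ : EFin \o h = (EFin \o h) \_ `[- r, r]).
  apply: (iffLR (integrable_mkcond _ _)) => //; exact: continuous_integrable_itv.
apply/funext => x; rewrite patchE; case: ifPn => //.
rewrite notin_setE/= in_itv/= => /negP xr; rewrite /= h0// leNgt.
by apply: contra xr; rewrite ltr_norml => /andP[/ltW -> /ltW ->].
Qed.

Definition primitive (x : R) : R := \int[leb]_(t in `]-oo, x]) h t.

Lemma is_derive_primitive (x : R) : is_derive x 1 primitive (h x).
Proof.
have i : leb.-integrable [set` Interval -oo%O (BRight (x + 1))] (EFin \o h).
  by apply: integrableS integrable_compact_support.
have xx : x < x + 1 by rewrite ltrDl.
have [d dE] := @continuous_FTC1 R h -oo%O x (x + 1) xx i (ltNyr _) (@ch x).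
by apply: (DeriveDef d); rewrite -derive1E; exact: dE.
Qed.

Lemma primitive_left x : x <= - r -> primitive x = 0.
Proof.
move=> xr; rewrite /primitive /Rintegral integral0_eq// => t; rewrite /= in_itv/= => tx.
rewrite h0//; have /le_trans -> // : r <= - t by rewrite lerNr (le_trans tx).
by rewrite -normrN ler_norm.
Qed.

Lemma primitive_right x : r <= x -> primitive x = \int[leb]_t h t.
Proof.
move=> rx; rewrite /primitive /Rintegral [in LHS]integral_mkcond; congr fine.
apply: eq_integral => t _; rewrite patchE; case: ifPn => //.
rewrite notin_setE/= in_itv/= => /negP; rewrite -ltNge => xt.
by rewrite h0// (le_trans rx)// (le_trans (ltW xt))// ler_norm.
Qed.

End antiderivative.

Section functions_of_z.
Variable R : realType.
Implicit Types f g h : R -> R.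

Lemma bl_derive_bounded f g (C : R) : 0 <= C -> (forall x : R, is_derive x 1 f (g x)) ->
  (forall x, `|g x| <= C) -> forall a b : R, a <= b -> bl `[a, b] (fun _ z => f z).
Proof.
move=> C0 fg gC a b ab.
have lip := derive_bounded_lipschitz fg gC.
exists (`|f a| + C * (b - a) + C); first by rewrite !addr_ge0// mulr_ge0// subr_ge0.
have fa0 := normr_ge0 (f a); have cb : 0 <= C * (b - a) by rewrite mulr_ge0// subr_ge0.
split=> [th z|th th' z z' _ _].
  rewrite /= in_itv/= => /andP[az zb].
  have : `|f z - f a| <= C * (b - a).
    apply: (le_trans (lip a z)); rewrite ler_wpM2l// ger0_norm ?subr_ge0//.
    by rewrite lerB.
  have := ler_normD (f z - f a) (f a); rewrite subrK; lra.
apply: (le_trans (lip z z')); apply: ler_pM => //; first lra.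
by rewrite lerDr.
Qed.

(** A bounded function takes values in a segment, on which exp is Lipschitz. *)
Lemma bl_expR I (f : R -> R -> R) : bl I f -> bl I (fun th z => expR (f th z)).
Proof.
move=> bf; have [C C0 [fC _]] := bf.
apply: (@bl_comp _ I [set u | u <= C] expR 0 (expR C)) => //=; last first.
  by move=> th z Iz; have := fC th z Iz; rewrite ler_norml => /andP[].
have H (u v : R) : u <= v -> v <= C -> `|expR v - expR u| <= expR C * `|v - u|.
  move=> uv vC; rewrite (ger0_norm (_ : 0 <= v - u)) ?subr_ge0//.
  rewrite ger0_norm ?subr_ge0 ?ler_expR//.
  have -> : expR v - expR u = expR v * (1 - expR (u - v)).
    by rewrite mulrBr mulr1 -expRD addrCA subrr addr0.
  apply: ler_pM; rewrite ?expR_ge0 ?ler_expR ?subr_ge0 ?expR_le1 ?subr_le0//.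
  by have := expR_ge1Dx (u - v); lra.
move=> u v uC vC; have [uv|/ltW vu] := leP u v; first exact: H.
by rewrite distrC (distrC v); exact: H.
Qed.

Lemma smooth_zjetP g g' g'' : (forall x : R, is_derive x 1 g (g' x)) ->
  (forall x : R, is_derive x 1 g' (g'' x)) -> continuous g'' ->
  bl setT (fun _ z => g z) -> bl setT (fun _ z => g' z) -> bl setT (fun _ z => g'' z) ->
  smooth setT (zjet g g' g'').
Proof.
move=> d1 d2 c2 b0 b1 b2.
have cc k : continuous k -> cyl (fun _ z : R => k z).
  move=> ck; apply: (@cyl_comp _ k (fun _ z => z)); last exact: cyl_z.
  exact: continuous_measurable_fun.
split; rewrite /= => //.
- apply: cc; exact: is_derive_continuous d1.
- exact: cyl_cst.
- apply: cc; exact: is_derive_continuous d2.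
- exact: cc.
- by move=> th z; exact: is_derive_cst.
- exact: bl_cst.
Qed.

Lemma bl_clamp0 (r : R) f : 0 <= r -> bl `[- r, r] (fun _ z => f z) ->
  (forall x, r <= `|x| -> f x = 0) -> bl setT (fun _ z => f z).
Proof.
move=> r0 bf f0; have rr : - r <= r by lra.
apply: (bl_clamp rr bf) => _ z; have [zr|zr] := boolP (z \in `[- r, r]).
  by rewrite clamp_id.
have h : r <= `|z|.
  rewrite leNgt; apply: contra zr; rewrite ltr_norml in_itv/=.
  by move=> /andP[/ltW -> /ltW ->].
rewrite f0// f0// /clamp; have [z0|z0] := leP z (- r).
  by rewrite min_l// normrN ler_norm.
rewrite min_r ?ler_norm// leNgt; apply/negP => zr2.
by move: h; rewrite leNgt ltr_norml z0 zr2.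
Qed.

Lemma smooth_affine (a b : R) g g' g'' : smooth setT (zjet g g' g'') ->
  smooth setT (zjet (fun z => g (a * (z - b))) (fun z => a * g' (a * (z - b)))
     (fun z => a ^+ 2 * g'' (a * (z - b)))).
Proof.
move=> [/= c0 _ c2 c22 _ d1 d2 b0 _ b2 b22].
have dl (z : R) : is_derive z 1 (fun z : R => a * (z - b)) a.
  apply: (is_derive_eq (is_deriveZ a (is_deriveB (is_derive_id z 1) (is_derive_cst b z 1)))).
  by rewrite /GRing.scale/= subr0 mulr1.
have bla f : bl setT (fun _ z : R => f z) -> bl setT (fun _ z => f (a * (z - b))).
  move=> [C C0 [bf lf]]; exists (C * (1 + `|a|)); first by rewrite mulr_ge0// addr_ge0.
  split=> [th z _|th th' z z' _ _].
    by apply: (le_trans (bf 0 _ Logic.I)); rewrite ler_peMr// lerDl.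
  have := lf 0 0 (a * (z - b)) (a * (z' - b)) Logic.I Logic.I.
  rewrite subrr normr0 add0r => /le_trans; apply; rewrite -mulrA ler_wpM2l//.
  rewrite -mulrBr normrM; have -> : z' - b - (z - b) = z' - z by ring.
  by rewrite ler_pM// ?lerDr.
have cyla f : cyl (fun _ z : R => f z) -> cyl (fun _ z => f (a * (z - b))).
  move=> [F mF fF]; exists (fun x => F (1, 0, a * (x.2 - b))); last first.
    by move=> th z; rewrite (fF 0) cos0 sin0.
  apply: measurableT_comp => //; apply: measurable_fun_pair => //.
  apply: measurable_funM => //; apply: measurable_funB => //; exact: measurable_snd.
split; rewrite /=.
- exact: cyla.
- exact: cyl_cst.
- by apply: cylM; [exact: cyl_cst|exact: cyla].
- by apply: cylM; [exact: cyl_cst|exact: cyla].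
- by move=> th z; exact: is_derive_cst.
- move=> th z; apply: (is_derive_eq (@is_derive1_comp R g (fun z => a * (z - b)) z _ _ (d1 0 _) (dl z))).
  by rewrite mulrC.
- move=> th z; have := @is_derive1_comp R g' (fun z => a * (z - b)) z _ _ (d2 0 _) (dl z).
  move=> h; apply: (is_derive_eq (is_deriveZ a h)).
  by rewrite /GRing.scale/= expr2 -mulrA [g'' _ * a]mulrC.
- exact: bla.
- exact: bl_cst.
- by apply: blM; [exact: bl_cst|exact: bla].
- by apply: blM; [exact: bl_cst|exact: bla].
Qed.

End functions_of_z.

Section stein_equation.
Variables (R : realType) (gamma : R).
Hypothesis gamma0 : 0 < gamma.
Notation leb := (@lebesgue_measure R).
Notation w := (gauss (2 * gamma)^-1).

Let v0 : 0 < (2 * gamma)^-1. Proof. by rewrite invr_gt0 mulr_gt0. Qed.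

Lemma bl_continuous (F : R -> R) : bl setT (fun _ z => F z) -> continuous F.
Proof.
move=> [C C0 [_ lF]] x; apply/cvgrPdist_le => e e0.
have C1 : 0 < C + 1 by rewrite ltr_wpDl.
apply/nbhs_ballP; exists (e / (C + 1)) => /=; first exact: divr_gt0.
move=> y /ltW /= xy; have := lF 0 0 y x Logic.I Logic.I; rewrite subrr normr0 add0r => /le_trans; apply.
apply: (@le_trans _ _ ((C + 1) * `|x - y|)); first by rewrite ler_wpM2r// lerDl.
by rewrite mulrC -ler_pdivlMr.
Qed.

(** Variation of constants: g = 2 exp (gamma x ^ 2) times the primitive of F exp (- gamma x ^ 2), which
    vanishes on both sides of the support of F since F has Gaussian mean zero. *)
Lemma stein_solution (F : R -> R) (r : R) : 0 <= r -> bl setT (fun _ z => F z) ->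
  (forall x, r <= `|x| -> F x = 0) -> \int[leb]_x (F x * w x) = 0 ->
  exists f g h : R -> R, smooth setT (zjet f g h) /\
    forall x, 2^-1 * h x - gamma * x * g x = F x.
Proof.
move=> r0 bF F0 IF; have rr : - r <= r by lra.
have cF := bl_continuous bF.
have dw (x : R) : is_derive x 1 w (- (2 * gamma * x) * w x).
  by apply: (is_derive_eq (is_derive_gauss v0 x)); congr (_ * _); field; rewrite gt_eqF.
have cw : continuous w := is_derive_continuous dw.
pose p x := F x * w x.
have cp : continuous p by exact: continuous_mul.
have p0 x : r <= `|x| -> p x = 0 by move=> xr; rewrite /p F0// mul0r.
pose G := primitive p.
have dG := is_derive_primitive cp p0.
have G0 x : r <= `|x| -> G x = 0.
  have [x0|x0] := leP 0 x.
    by rewrite ger0_norm// => rx; rewrite /G (primitive_right p0 rx).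
  by rewrite ltr0_norm// => rx; rewrite /G (primitive_left p0)//; lra.
have [C C0 [FC _]] := bF.
have w1 x : `|w x| <= 1.
  rewrite (ger0_norm (gauss_ge0 _ _)) /gauss expR_le1 mulNr oppr_le0.
  by rewrite divr_ge0 ?sqr_ge0// mulr_ge0// ltW.
have pC x : `|p x| <= C.
  by rewrite normrM -[leRHS]mulr1 ler_pM// FC.
have bG : bl `[- r, r] (fun _ z => G z) by exact: (bl_derive_bounded C0 dG pC).
pose q x := expR (gamma * x ^+ 2).
have qw x : q x * w x = 1.
  rewrite /q /gauss -expRD (_ : _ + _ = 0) ?expR0//; field.
  by rewrite gt_eqF//.
have dq (x : R) : is_derive x 1 q (q x * (2 * gamma * x)).
  have d1 : is_derive x 1 (fun x : R => gamma * x ^+ 2) (2 * gamma * x).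
    apply: (is_derive_eq (is_deriveZ gamma (is_deriveX 2 (is_derive_id x 1)))).
    by rewrite /GRing.scale/= expr1 mulr1; ring.
  exact: (@is_derive1_comp R expR (fun x => gamma * x ^+ 2) x _ _ (is_derive_expR _) d1).
have bz : bl `[- r, r] (fun _ z : R => z) by exact: bl_z.
have bq : bl `[- r, r] (fun _ z => q z).
  apply: bl_expR; apply: blM; first exact: bl_cst.
  exact: (blM bz) bz.
pose g x := 2 * (q x * G x).
have g0 x : r <= `|x| -> g x = 0 by move=> xr; rewrite /g G0// !mulr0.
have bg : bl `[- r, r] (fun _ z => g z).
  by apply: blM; [exact: bl_cst|exact: blM].
pose h x := 2 * gamma * x * g x + 2 * F x.
have dg (x : R) : is_derive x 1 g (h x).
  apply: (is_derive_eq (is_deriveZ 2 (is_deriveM (dq x) (dG x)))).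
  rewrite /GRing.scale/= /h /g -/G /p.
  have -> : 2 * (q x * (F x * w x) + G x * (q x * (2 * gamma * x))) =
    2 * F x * (q x * w x) + 2 * gamma * x * (2 * (q x * G x)) by ring.
  by rewrite qw mulr1 addrC.
have h0 x : r <= `|x| -> h x = 0 by move=> xr; rewrite /h g0// F0// !mulr0 addr0.
have bF' : bl `[- r, r] (fun _ z => F z).
  by have [K K0 [bK lK]] := bF; exists K => //; split=> *; [exact: bK|exact: lK].
have bh : bl `[- r, r] (fun _ z => h z).
  apply: blD; last by apply: blM => //; exact: bl_cst.
  by apply: blM => //; apply: blM => //; exact: bl_cst.
have bgT := bl_clamp0 r0 bg g0; have bhT := bl_clamp0 r0 bh h0.
have cg : continuous g := is_derive_continuous dg.
pose f := primitive g.
have df := is_derive_primitive cg g0.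
have [K K0 [gK _]] := bgT.
have bf : bl `[- r, r] (fun _ z => f z).
  by apply: (bl_derive_bounded K0 df) => // x; exact: (gK 0).
have bfT : bl setT (fun _ z => f z).
  apply: (bl_clamp rr bf) => _ z.
  have [zr|zr] := boolP (z \in `[- r, r]); first by rewrite clamp_id.
  rewrite /clamp; have [z0|z0] := leP z (- r).
    by rewrite min_l// /f !(primitive_left g0).
  have rz : r <= z.
    by rewrite leNgt; apply: contra zr; rewrite in_itv/= (ltW z0) => /ltW ->.
  by rewrite min_r// /f !(primitive_right g0).
exists f, g, h; split; last by move=> x; rewrite /h; field.
apply: smooth_zjetP => //; exact: bl_continuous.
Qed.

End stein_equation.

Section tents.
Variable R : realType.
Implicit Types (r : R) (F : R -> R).

Definition tent r (x : R) : R := Num.max (1 - `|x| / r) 0.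

Lemma tent_itv r x : 0 < r -> 0 <= tent r x <= 1.
Proof.
move=> r0; rewrite /tent le_max lexx orbT/= ge_max ler01 andbT.
by rewrite lerBlDr lerDl divr_ge0// ltW.
Qed.

Lemma tent_out r x : 0 < r -> r <= `|x| -> tent r x = 0.
Proof. by move=> r0 rx; rewrite /tent max_r// subr_le0 ler_pdivlMr// mul1r. Qed.

Lemma bl_tent_itv r : bl `[- r, r] (fun _ z => tent r z).
Proof.
apply: bl_max0; apply: blD; first exact: bl_cst.
apply: blN; apply: blM; last exact: bl_cst.
apply: (@bl_comp _ _ setT (fun u => `|u|) 0 1 (fun _ z => z)) => //; last exact: bl_z.
by move=> u v _ _; rewrite mul1r ler_dist_dist.
Qed.

Lemma bl_tent r : 0 < r -> bl setT (fun _ z => tent r z).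
Proof.
move=> r0; apply: (bl_clamp0 (ltW r0) (bl_tent_itv r)) => x; exact: tent_out.
Qed.

(** Lipschitz approximations of the square root, of compact support. *)
Definition sqrt_tent r (x : R) : R := Num.sqrt (Num.max x 0 + r^-1) * tent r x.

Lemma sqrt_tent_bound r x : 1 <= r -> `|sqrt_tent r x| <= 1 + `|x|.
Proof.
move=> r1; have r0 : 0 < r by apply: lt_le_trans r1.
have /andP[t0 t1] := tent_itv x r0.
rewrite ger0_norm; last by rewrite mulr_ge0 ?sqrtr_ge0.
apply: (@le_trans _ _ ((1 + `|x|) * 1)); last by rewrite mulr1.
apply: ler_pM => //; rewrite ?sqrtr_ge0//; apply: sqrtr_le; first by rewrite addr_ge0.
have ri : r^-1 <= 1 by rewrite invf_le1.
have : Num.max x 0 <= `|x| by rewrite ge_max ler_norm normr_ge0.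
have := sqr_ge0 `|x|; have := normr_ge0 x; rewrite sqrrD expr1n mul1r; lra.
Qed.

Lemma bl_sqrt_tent r : 0 < r -> bl setT (fun _ z => sqrt_tent r z).
Proof.
move=> r0; have ri : 0 < r^-1 by rewrite invr_gt0.
apply: (@bl_clamp0 _ r); first exact: ltW.
  apply: blM; last exact: bl_tent_itv.
  apply: (bl_sqrt ri); first by move=> _ z _; rewrite lerDr le_max lexx orbT.
  by apply: blD; [apply: bl_max0; exact: bl_z|exact: bl_cst].
by move=> x rx; rewrite /sqrt_tent tent_out// mulr0.
Qed.

Lemma cvg_tent (x : R) : tent n.+1%:R x @[n --> \oo] --> (1 : R).
Proof.
have c1 : 1 - `|x| / n.+1%:R @[n --> \oo] --> (1 : R).
  suff : 1 - `|x| / n.+1%:R @[n --> \oo] --> 1 - `|x| * 0 by rewrite mulr0 subr0.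
  apply: cvgB; first exact: cvg_cst.
  by apply: cvgM; [exact: cvg_cst|exact: cvg_harmonic].
apply: cvg_trans c1; apply: near_eq_cvg; near=> n.
rewrite /tent max_l// subr_ge0 ler_pdivrMr// mul1r.
have : (Num.truncn `|x| <= n)%N by near: n; exact: nbhs_infty_ge.
by move=> h; apply: (le_trans (ltW (truncnS_gt _))); rewrite ler_nat ltnS.
Unshelve. all: by end_near. Qed.

Lemma cvg_sqrt_tent (x : R) : sqrt_tent n.+1%:R x @[n --> \oo] --> Num.sqrt x.
Proof.
have -> : Num.sqrt x = Num.sqrt (Num.max x 0 + 0) * 1.
  rewrite addr0 mulr1; have [x0|//] := leP x 0.
  by rewrite ler0_sqrtr// sqrtr0.
apply: cvgM; last exact: cvg_tent.
apply: (@continuous_cvg _ _ _ _ _ _ (@Num.sqrt R)); first exact: sqrt_continuous.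
by apply: cvgD; [exact: cvg_cst|exact: cvg_harmonic].
Qed.

End tents.

Section invariant_means.
Context (R : realType) d (T : measurableType d) (P : probability T R).
Variable W : R -> {RV P >-> R}.
Hypothesis BW : brownian_motion W.
Variables (gamma zs alpha : R).
Hypotheses (gamma0 : 0 < gamma) (alpha0 : 0 < alpha).
Notation leb := (@lebesgue_measure R).
Notation X := (circle R * R)%type.
Variable mu : probability X R.
Hypothesis inv : invariant_measure gamma zs alpha W mu.
Notation L := (generator gamma zs alpha).
Notation Ex f := (\int[mu]_x on_circle f x).

Let Y1 (z : R) : 1 <= 1 + `|z - zs|. Proof. by rewrite lerDl. Qed.
Let Y4 (z : R) : 1 <= (1 + `|z - zs|) ^+ 4. Proof. exact: exprn_ege1. Qed.

Lemma moderate_bounded f (C : R) : cyl f -> (forall th z, `|f th z| <= C) -> moderate zs f.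
Proof.
move=> cf fC; split=> //; exists C => th z; apply: (le_trans (fC th z)).
by rewrite ler_peMr// (le_trans _ (fC th z)).
Qed.

Lemma moderateD f g : moderate zs f -> moderate zs g -> moderate zs (fun th z => f th z + g th z).
Proof.
move=> [cf [C fC]] [cg [D gD]]; split; first exact: cylD.
by exists (C + D) => th z; rewrite mulrDl (le_trans (ler_normD _ _))// lerD.
Qed.

Lemma moderateZ c f : moderate zs f -> moderate zs (fun th z => c * f th z).
Proof.
move=> [cf [C fC]]; split; first by apply: cylM => //; exact: cyl_cst.
by exists (`|c| * C) => th z; rewrite normrM -mulrA ler_wpM2l.
Qed.

Lemma moderate_z (h : R -> R) (C : R) : measurable_fun setT h ->
  (forall z, `|h z| <= C * (1 + `|z - zs|) ^+ 4) -> moderate zs (fun _ z => h z).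
Proof.
move=> mh hC; split; last by exists C => _ z; exact: hC.
by apply: (@cyl_comp _ h (fun _ z => z)) => //; exact: cyl_z.
Qed.

Let imod f : moderate zs f -> mu.-integrable setT (EFin \o on_circle f).
Proof. by move=> mf; exact: (integrable_moderate BW gamma0 alpha0 inv mf). Qed.

Lemma meanD f g : moderate zs f -> moderate zs g ->
  Ex (fun th z => f th z + g th z) = Ex f + Ex g.
Proof. by move=> mf mg; rewrite -RintegralD//; exact: imod. Qed.

Lemma meanZ c f : moderate zs f -> Ex (fun th z => c * f th z) = c * Ex f.
Proof. by move=> mf; rewrite -RintegralZl//; exact: imod. Qed.

Lemma le_mean f g : moderate zs f -> moderate zs g -> (forall th z, f th z <= g th z) ->
  Ex f <= Ex g.
Proof.
move=> mf mg fg; apply: le_Rintegral => //; [exact: imod|exact: imod|].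
by move=> x _; exact: fg.
Qed.

Lemma mean_cst c : Ex (fun _ _ => c) = c.
Proof.
rewrite (_ : on_circle _ = cst c)// Rintegral_cst//.
have -> : fine (mu setT) = 1 by rewrite probability_setT.
by rewrite mulr1.
Qed.

(** The unit in which the pointwise errors are measured: its mean is bounded independently of the
    noise. *)
Definition quartic (z : R) : R := 1 + ((z - zs) / alpha) ^+ 4.

Lemma quartic_ge1 z : 1 <= quartic z.
Proof. by rewrite lerDl exprn_even_ge0. Qed.

Lemma moderate_quartic : moderate zs (fun _ z => quartic z).
Proof.
apply: (@moderate_z _ (1 + (alpha ^- 4))).
  apply: measurable_funD => //; apply: measurable_funX => //; apply: measurable_funM => //.
  exact: measurable_funB.
move=> z; rewrite ger0_norm ?(le_trans ler01 (quartic_ge1 z))// /quartic [leRHS]mulrDl mul1r.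
rewrite lerD// expr_div_n mulrC ler_wpM2l ?invr_ge0 ?exprn_ge0 ?(ltW alpha0)//.
rewrite -(ger0_norm (exprn_even_ge0 (z - zs) (isT : ~~ odd 4))) normrX.
by rewrite lerXn2r ?nnegrE ?addr_ge0// lerDr.
Qed.

Lemma mean_quartic : Ex (fun _ z => quartic z) <= 1 + 6528 / gamma ^+ 2.
Proof.
have [i4 m4] := invariant_moment4 BW gamma0 alpha0 inv.
rewrite (_ : on_circle _ = fun x : X => 1 + alpha ^- 4 * (x.2 - zs) ^+ 4); last first.
  by apply/funext => x; rewrite /on_circle /quartic expr_div_n [_ / _]mulrC.
rewrite RintegralD//; [|exact: finite_measure_integrable_cst|exact: integrableRZ].
rewrite RintegralZl// Rintegral_cst//.
have -> : fine (mu setT) = 1 by rewrite probability_setT.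
rewrite mulr1 lerD2l.
have a4 : 0 <= alpha ^- 4 by rewrite invr_ge0 exprn_ge0// ltW.
apply: (le_trans (ler_wpM2l a4 m4)); rewrite le_eqVlt; apply/orP; left; apply/eqP.
by field; rewrite !gt_eqF.
Qed.

Let zsc th z : R := z * (sin th * cos th).

Let moderate_zsc : moderate zs zsc.
Proof.
split.
  apply: cylM; [exact: cyl_z|apply: cylM; [exact: cyl_sin|exact: cyl_cos]].
exists (1 + `|zs|) => th z; rewrite /zsc normrM normrM.
have h1 : `|sin th| <= 1 by rewrite ler_norml sin_geN1 sin_le1.
have h2 : `|cos th| <= 1 by rewrite ler_norml cos_geN1 cos_le1.
have h3 : `|z| <= `|z - zs| + `|zs| by rewrite -{1}(subrK zs z) ler_normD.
apply: (@le_trans _ _ (`|z| * (1 * 1))).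
  by rewrite ler_wpM2l// ler_pM.
rewrite !mulr1; apply: (@le_trans _ _ ((1 + `|zs|) * (1 + `|z - zs|))).
  have : 0 <= `|zs| * `|z - zs| by rewrite mulr_ge0.
  by rewrite mulrDl !mulrDr !mul1r mulr1; lra.
rewrite ler_wpM2l ?addr_ge0//.
by rewrite -{1}(expr1 (1 + _)) ler_weXn2l.
Qed.

Lemma lyapunov_mean : lyapunov mu + 1 = Ex zsc.
Proof.
rewrite /lyapunov addrC addNKr -RintegralZl//.
  apply: eq_Rintegral => x _; rewrite /on_circle /zsc.
  have -> : 2 * repr x.1 = repr x.1 *+ 2 by rewrite mulr_natl.
  by rewrite sin_mulr2n -mulr_natl; field.
rewrite (_ : EFin \o _ = fun x => (2 * on_circle zsc x)%:E).
  exact/integrableRZ/imod/moderate_zsc.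
apply/funext => x; rewrite /=; congr EFin; rewrite /on_circle /zsc.
have -> : 2 * repr x.1 = repr x.1 *+ 2 by rewrite mulr_natl.
by rewrite sin_mulr2n -mulr_natl; ring.
Qed.

Let mean_exact J : smooth setT J -> Ex (fun th z => zsc th z + L J th z) = lyapunov mu + 1.
Proof.
move=> sJ; rewrite meanD//; last exact: moderate_generator.
by rewrite (generator_mean BW gamma0 alpha0 inv sJ) addr0 lyapunov_mean.
Qed.

Let moderate_exact J : smooth setT J -> moderate zs (fun th z => zsc th z + L J th z).
Proof. by move=> sJ; apply: moderateD => //; exact: moderate_generator. Qed.

(** The generator being centered, it may be added to z sin cos in order to make it comparable with a
    function of z. *)
Lemma lyapunov_ge J (phi : R -> R) (B : R) : smooth setT J -> 0 <= B ->
  moderate zs (fun _ z => phi z) ->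
  (forall th z, phi z - B * quartic z <= z * (sin th * cos th) + L J th z) ->
  Ex (fun _ z => phi z) - B * (1 + 6528 / gamma ^+ 2) <= lyapunov mu + 1.
Proof.
move=> sJ B0 mphi H; rewrite -(mean_exact sJ).
have mq := moderateZ (- B) moderate_quartic.
apply: (@le_trans _ _ (Ex (fun _ z => phi z + - B * quartic z))).
  rewrite meanD// meanZ//; last exact: moderate_quartic.
  by rewrite lerD2l mulNr lerN2 ler_wpM2l// mean_quartic.
apply: le_mean; [exact: moderateD|exact: moderate_exact|].
by move=> th z; rewrite mulNr; exact: H.
Qed.

Lemma lyapunov_le J (phi : R -> R) (B : R) : smooth setT J -> 0 <= B ->
  moderate zs (fun _ z => phi z) ->
  (forall th z, z * (sin th * cos th) + L J th z <= phi z + B * quartic z) ->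
  lyapunov mu + 1 <= Ex (fun _ z => phi z) + B * (1 + 6528 / gamma ^+ 2).
Proof.
move=> sJ B0 mphi H; rewrite -(mean_exact sJ).
have mq := moderateZ B moderate_quartic.
apply: (@le_trans _ _ (Ex (fun _ z => phi z + B * quartic z))); last first.
  rewrite meanD// meanZ//; last exact: moderate_quartic.
  by rewrite lerD2l ler_wpM2l// mean_quartic.
by apply: le_mean; [exact: moderate_exact|exact: moderateD|].
Qed.

Notation xi z := (alpha^-1 * (z - zs)).
Notation w := (gauss (2 * gamma)^-1).

Let v0 : 0 < (2 * gamma)^-1. Proof. by rewrite invr_gt0 mulr_gt0. Qed.

Let iw : leb.-integrable setT (EFin \o w). Proof. exact: integrable_gauss. Qed.

(** F is the generator applied to the rescaled solution of the Stein equation. *)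
Lemma mean_stein (F : R -> R) (r : R) : 0 <= r -> bl setT (fun _ z => F z) ->
  (forall x, r <= `|x| -> F x = 0) -> \int[leb]_x (F x * w x) = 0 ->
  Ex (fun _ z => F (xi z)) = 0.
Proof.
move=> r0 bF F0 IF; have [f [g [h [sm eq]]]] := stein_solution gamma0 r0 bF F0 IF.
have := generator_mean BW gamma0 alpha0 inv (smooth_affine alpha^-1 zs sm).
rewrite (_ : on_circle _ = on_circle (fun _ z => F (xi z)))//.
apply/funext => x; rewrite /on_circle /generator/= -eq.
by field; rewrite gt_eqF.
Qed.

Let ibw (F : R -> R) : bl setT (fun _ z => F z) -> leb.-integrable setT (EFin \o (fun x => F x * w x)).
Proof.
move=> bF; have [C C0 [FC _]] := bF.
apply: (@integrable_dominated _ (measurableTypeR R) R leb (fun x => F x * w x) (fun x => C * w x)); last exact: integrableRZ.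
  apply: continuous_measurable_fun; apply: continuous_mul; first exact: bl_continuous.
  exact: continuous_gauss.
by move=> x; rewrite normrM (ger0_norm (gauss_ge0 _ _)) ler_wpM2r ?gauss_ge0//; exact: (FC 0).
Qed.

Let modxi (F : R -> R) : bl setT (fun _ z => F z) -> moderate zs (fun _ z => F (xi z)).
Proof.
move=> bF; have [C C0 [FC _]] := bF; apply: (@moderate_bounded _ C); last by move=> _ z; exact: (FC 0).
apply: (@cyl_comp _ (fun z => F (xi z)) (fun _ z => z)); last exact: cyl_z.
apply: continuous_measurable_fun => z.
apply: (@continuous_comp _ _ _ (fun z => xi z) F); last exact: bl_continuous.
by apply: continuous_mul; [exact: continuous_const|apply: continuous_add; [move=> ?; exact: cvg_id|exact: continuous_const]].
Qed.

(** A combination of F and B has Gaussian mean zero. *)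
Lemma mean_gauss_proportional (F B : R -> R) (r : R) : 0 <= r ->
  bl setT (fun _ z => F z) -> bl setT (fun _ z => B z) ->
  (forall x, r <= `|x| -> F x = 0) -> (forall x, r <= `|x| -> B x = 0) ->
  Ex (fun _ z => F (xi z)) * \int[leb]_x (B x * w x) =
  Ex (fun _ z => B (xi z)) * \int[leb]_x (F x * w x).
Proof.
move=> r0 bF bB F0 B0; set cB := \int[leb]_x (B x * w x); set cF := \int[leb]_x (F x * w x).
pose K x := cB * F x + - cF * B x.
have bK : bl setT (fun _ z => K z) by apply: blD; apply: blM => //; exact: bl_cst.
have K0 x : r <= `|x| -> K x = 0 by move=> rx; rewrite /K F0// B0// !mulr0 addr0.
have IK : \int[leb]_x (K x * w x) = 0.
  rewrite (_ : (fun x => _) = fun x => cB * (F x * w x) + - cF * (B x * w x)); last first.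
    by apply/funext => x; rewrite /K; ring.
  rewrite RintegralD//; [|exact/integrableRZ/ibw|exact/integrableRZ/ibw].
  by rewrite !RintegralZl//; [rewrite -/cB -/cF; ring|exact: ibw|exact: ibw].
have := mean_stein r0 bK K0 IK; rewrite /K.
rewrite meanD; [|exact/moderateZ/modxi|exact/moderateZ/modxi].
rewrite !meanZ; [|exact: modxi|exact: modxi].
by move/eqP; rewrite mulNr subr_eq0 mulrC => /eqP ->; rewrite mulrC.
Qed.

(** Normalization by tents that increase to 1. *)
Lemma mean_gauss_compact (F : R -> R) (r : R) : 0 <= r -> bl setT (fun _ z => F z) ->
  (forall x, r <= `|x| -> F x = 0) ->
  Ex (fun _ z => F (xi z)) * \int[leb]_x w x = \int[leb]_x (F x * w x).
Proof.
move=> r0 bF F0.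
pose B (n : nat) := tent (n.+1%:R : R).
have n0 (n : nat) : 0 < n.+1%:R :> R by [].
have E n : Ex (fun _ z => F (xi z)) * \int[leb]_x (B n x * w x) =
    Ex (fun _ z => B n (xi z)) * \int[leb]_x (F x * w x).
  apply: (@mean_gauss_proportional _ _ (r + n.+1%:R)) => //.
  - by rewrite addr_ge0.
  - exact: bl_tent.
  - by move=> x rx; rewrite F0// (le_trans _ rx)// lerDl.
  - by move=> x rx; rewrite /B tent_out// (le_trans _ rx)// lerDr.
have c1 : \int[leb]_x (B n x * w x) @[n --> \oo] --> \int[leb]_x w x.
  apply: (@Rintegral_dominated_cvg _ _ _ leb (fun n x => B n x * w x) w w) => //.
  - move=> n; apply: continuous_measurable_fun; apply: continuous_mul; last exact: continuous_gauss.
    exact/bl_continuous/bl_tent.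
  - move=> x; rewrite -[X in _ --> X]mul1r; apply: cvgM; last exact: cvg_cst.
    exact: cvg_tent.
  - move=> n x; have /andP[t0 t1] := tent_itv x (n0 n).
    rewrite normrM (ger0_norm t0) (ger0_norm (gauss_ge0 _ _)).
    by rewrite ler_piMl ?gauss_ge0.
have c2 : Ex (fun _ z => B n (xi z)) @[n --> \oo] --> (1 : R).
  rewrite -[X in _ --> X](mean_cst 1).
  apply: (@Rintegral_dominated_cvg _ _ _ mu (fun n => on_circle (fun _ z => B n (xi z))) _ (cst 1)).
  - by move=> n; apply: measurable_cyl; have [] := modxi (bl_tent (n0 n)).
  - by move=> x; exact: cvg_tent.
  - exact: finite_measure_integrable_cst.
  - move=> n x; rewrite /on_circle /B.
    by have /andP[t0 t1] := tent_itv (xi x.2) (n0 n); rewrite ger0_norm.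
have d1 : Ex (fun _ z => F (xi z)) * \int[leb]_x (B n x * w x) @[n --> \oo] -->
    Ex (fun _ z => F (xi z)) * \int[leb]_x w x by apply: cvgM; [exact: cvg_cst|exact: c1].
have d2 : Ex (fun _ z => B n (xi z)) * \int[leb]_x (F x * w x) @[n --> \oo] -->
    1 * \int[leb]_x (F x * w x) by apply: cvgM; [exact: c2|exact: cvg_cst].
rewrite -[RHS]mul1r; apply: (cvg_unique _ d1) => //.
by rewrite (funext E).
Qed.

Lemma moderate_sqrt : moderate zs (fun _ z => Num.sqrt (xi z)).
Proof.
apply: (@moderate_z _ (1 + alpha^-1)).
  apply: measurableT_comp; last by apply: measurable_funM => //; exact: measurable_funB.
  by apply: continuous_measurable_fun; exact: sqrt_continuous.
move=> z; rewrite ger0_norm ?sqrtr_ge0//.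
have a0 : 0 < alpha^-1 by rewrite invr_gt0.
apply: (@le_trans _ _ ((1 + alpha^-1) * (1 + `|z - zs|))); last first.
  by rewrite ler_wpM2l ?addr_ge0 ?(ltW a0)// -{1}(expr1 (1 + _)) ler_weXn2l.
apply: sqrtr_le; first by rewrite mulr_ge0// addr_ge0// ltW.
have h1 : alpha^-1 * (z - zs) <= alpha^-1 * `|z - zs| by rewrite ler_wpM2l ?(ltW a0)// ler_norm.
have h2 : 1 <= (1 + alpha^-1) * (1 + `|z - zs|).
  have := mulr_ge0 (ltW a0) (normr_ge0 (z - zs)); have := normr_ge0 (z - zs).
  by rewrite mulrDl mul1r mulrDr; move: a0; lra.
apply: (@le_trans _ _ ((1 + alpha^-1) * (1 + `|z - zs|))).
  have ay := mulr_ge0 (ltW a0) (normr_ge0 (z - zs)).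
  by move: h1 a0 ay (normr_ge0 (z - zs)); lra.
by rewrite expr2 ler_peMl// (le_trans ler01).
Qed.

Lemma mean_sqrt : Ex (fun _ z => Num.sqrt (xi z)) =
  Num.sqrt (Num.sqrt (2 * (2 * gamma)^-1)) / (2 * Num.sqrt pi) * Gamma (3 / 4).
Proof.
have [iS ES] := Rintegral_sqrt_gauss v0.
have w0 : 0 < \int[leb]_x w x.
  by rewrite Rintegral_gauss// sqrtr_gt0 !mulr_gt0 ?pi_gt0 ?invr_gt0 ?mulr_gt0.
apply: (mulIf (lt0r_neq0 w0)); rewrite -ES.
pose F (n : nat) := sqrt_tent (n.+1%:R : R).
have n0 (n : nat) : 0 < n.+1%:R :> R by [].
have n1 (n : nat) : 1 <= n.+1%:R :> R by rewrite ler1n.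
have E n : Ex (fun _ z => F n (xi z)) * \int[leb]_x w x = \int[leb]_x (F n x * w x).
  apply: (@mean_gauss_compact _ n.+1%:R) => //; first exact: bl_sqrt_tent.
  by move=> x rx; rewrite /F /sqrt_tent tent_out// mulr0.
have c1 : \int[leb]_x (F n x * w x) @[n --> \oo] --> \int[leb]_x (Num.sqrt x * w x).
  apply: (@Rintegral_dominated_cvg _ _ _ leb (fun n x => F n x * w x) _
    (fun x => 2 * (w x + x ^+ 2 * w x))) => //.
  - move=> n; apply: continuous_measurable_fun; apply: continuous_mul; last exact: continuous_gauss.
    exact/bl_continuous/bl_sqrt_tent.
  - move=> x; apply: cvgM; last exact: cvg_cst.
    exact: cvg_sqrt_tent.
  - apply: integrableRZ; apply: integrableRD => //.
    exact: (integrable_moment_gauss v0 (isT : (2 <= 4)%N)).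
  - move=> n x; rewrite normrM (ger0_norm (gauss_ge0 _ _)).
    rewrite -{2}[w x]mul1r -mulrDl mulrA ler_wpM2r ?gauss_ge0//.
    apply: (le_trans (sqrt_tent_bound x (n1 n))).
    have := sqr_ge0 (`|x| - 1); rewrite -(real_normK (num_real x)) sqrrB mulr1 expr1n.
    by have := sqr_ge0 `|x|; lra.
have c2 : Ex (fun _ z => F n (xi z)) @[n --> \oo] --> Ex (fun _ z => Num.sqrt (xi z)).
  pose D := 1 + alpha^-1.
  have mD : moderate zs (fun _ z => 1 + `|xi z|).
    apply: (@moderate_z _ D).
      apply: measurable_funD => //; apply: measurableT_comp => //; apply: measurable_funM => //.
      exact: measurable_funB.
    move=> z; have ai : 0 < alpha^-1 by rewrite invr_gt0.
    rewrite ger0_norm ?addr_ge0// normrM (gtr0_norm ai) /D mulrDl mul1r.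
    rewrite lerD// ler_wpM2l ?(ltW ai)//.
    apply: (@le_trans _ _ (1 + `|z - zs|)); first by rewrite lerDr.
    by rewrite -{1}(expr1 (1 + _)) ler_weXn2l.
  apply: (@Rintegral_dominated_cvg _ _ _ mu (fun n => on_circle (fun _ z => F n (xi z))) _
    (on_circle (fun _ z => 1 + `|xi z|))).
  - by move=> n; apply: measurable_cyl; have [] := modxi (bl_sqrt_tent (n0 n)).
  - by move=> x; exact: cvg_sqrt_tent.
  - exact: imod.
  - by move=> n x; exact: sqrt_tent_bound.
have d2 : Ex (fun _ z => F n (xi z)) * \int[leb]_x w x @[n --> \oo] -->
    Ex (fun _ z => Num.sqrt (xi z)) * \int[leb]_x w x by apply: cvgM; [exact: c2|exact: cvg_cst].
apply: (cvg_unique _ d2) => //.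
by rewrite (funext E).
Qed.

End invariant_means.

(** * Cutoff functions *)

Section cutoffs.
Variable R : realType.
Variable w : R.
Hypothesis w0 : 0 < w.

Let q (x : R) : R := (x / w) ^+ 2.
Let u (x : R) : R := Num.max (1 - q x) 0.

Definition bump (x : R) : R := pos3 (1 - (x / w) ^+ 2).
Definition bump' (x : R) : R := pos3' (1 - (x / w) ^+ 2) * (- 2 * x / w ^+ 2).
Definition bump'' (x : R) : R := pos3'' (1 - (x / w) ^+ 2) * (- 2 * x / w ^+ 2) ^+ 2 +
  pos3' (1 - (x / w) ^+ 2) * (- 2 / w ^+ 2).

(** Close to the identity near 0, and 0 beyond the radius w. *)
Definition cutid (x : R) : R := x * bump x.
Definition cutid' (x : R) : R := bump x + x * bump' x.
Definition cutid'' (x : R) : R := 2 * bump' x + x * bump'' x.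

Let ww : - w <= w. Proof. by move: w0; lra. Qed.

Let out_max x : w <= `|x| -> Num.max (1 - (x / w) ^+ 2) 0 = 0.
Proof.
move=> wx; rewrite max_r// subr_le0 -[leRHS]ger0_norm ?sqr_ge0// normrX normrM normfV (gtr0_norm w0).
by rewrite exprn_ege1// ler_pdivlMr// mul1r.
Qed.

Lemma bump_out x : w <= `|x| -> [/\ bump x = 0, bump' x = 0 & bump'' x = 0].
Proof.
move=> /out_max h; rewrite /bump /bump' /bump'' /pos3 /pos3' /pos3'' h.
by rewrite !expr0n/= !mulr0 !mul0r addr0.
Qed.

Let itv_out x : x \notin `[- w, w] -> w <= `|x|.
Proof.
move=> xw; rewrite leNgt; apply: contra xw; rewrite ltr_norml in_itv/=.
by move=> /andP[/ltW -> /ltW ->].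
Qed.

Let clamp_out x : x \notin `[- w, w] -> w <= `|clamp (- w) w x|.
Proof.
move=> xw; rewrite /clamp; have [x0|x0] := leP x (- w).
  by rewrite min_l// normrN ler_norm.
rewrite min_r ?ler_norm// leNgt; apply/negP => xw2.
by move/negP: xw; apply; rewrite in_itv/= !ltW.
Qed.

Let jinner := jadd (jcst 1) (jmul (jcst (- w ^- 2))
  (jmul (zjet id (cst 1) (cst 0)) (zjet (id : R -> R) (cst 1) (cst 0)))).

Let smooth_inner : smooth `[- w, w] jinner.
Proof.
apply: smooth_add; first exact: smooth_cst.
apply: smooth_mul; first exact: smooth_cst.
by apply: smooth_mul; exact: smooth_id.
Qed.

Let inner_E th z : j0 jinner th z = 1 - (z / w) ^+ 2.
Proof. by rewrite /=; field; rewrite gt_eqF. Qed.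

Let bump_jet : jpos3 jinner = zjet bump bump' bump''.
Proof.
have e1 th z : j1 jinner th z = 0 by rewrite /=; ring.
have e2 th z : j2 jinner th z = - 2 * z / w ^+ 2 by rewrite /=; field; rewrite gt_eqF.
have e22 th z : j22 jinner th z = - 2 / w ^+ 2 by rewrite /=; field; rewrite gt_eqF.
apply: jet_eq => th z.
- by change (pos3 (j0 jinner th z) = bump z); rewrite inner_E.
- by change (pos3' (j0 jinner th z) * j1 jinner th z = 0); rewrite e1 mulr0.
- by change (pos3' (j0 jinner th z) * j2 jinner th z = bump' z); rewrite inner_E e2.
- change (pos3'' (j0 jinner th z) * (j2 jinner th z * j2 jinner th z) +
    pos3' (j0 jinner th z) * j22 jinner th z = bump'' z).
  by rewrite inner_E e2 e22.
Qed.

Lemma smooth_bump : smooth setT (zjet bump bump' bump'').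
Proof.
apply: (@zjet_clamp _ (- w) w) ww _ _.
  by rewrite -bump_jet; apply: smooth_pos3; exact: smooth_inner.
move=> z zw; have [-> -> ->] := bump_out (itv_out zw).
by have [-> -> ->] := bump_out (clamp_out zw).
Qed.

Lemma smooth_cutid : smooth setT (zjet cutid cutid' cutid'').
Proof.
apply: (@zjet_clamp _ (- w) w) => //.
  have -> : zjet cutid cutid' cutid'' = jmul (zjet id (cst 1) (cst 0)) (zjet bump bump' bump'').
    by apply: jet_eq => th z; rewrite /zjet /jmul/= /cutid /cutid' /cutid'' /cst; ring.
  apply: smooth_mul; first exact: smooth_id.
  by rewrite -bump_jet; apply: smooth_pos3; exact: smooth_inner.
move=> z zw; rewrite /cutid /cutid' /cutid''.
have [-> -> ->] := bump_out (itv_out zw).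
by have [-> -> ->] := bump_out (clamp_out zw); rewrite !mulr0 addr0.
Qed.

Let u_itv x : 0 <= u x <= 1.
Proof.
rewrite /u le_max lexx orbT/= ge_max ler01 andbT lerBlDr lerDl.
exact: sqr_ge0.
Qed.

Let q_ge0 x : 0 <= q x. Proof. exact: sqr_ge0. Qed.

Let uE x : (u x = 1 - q x /\ q x <= 1) \/ (u x = 0 /\ 1 < q x).
Proof.
rewrite /u; have [h|h] := leP (1 - q x) 0; last by left; split=> //; lra.
move: h; rewrite le_eqVlt => /orP[/eqP h|h].
  by left; split; [rewrite h|lra].
by right; split=> //; lra.
Qed.

Let bumpE x : bump x = u x ^+ 3. Proof. by []. Qed.
Let bump'E x : x * bump' x = - 6 * (q x * u x ^+ 2).
Proof. by rewrite /bump' /pos3' -/(q x) -/(u x) /q; field; rewrite gt_eqF. Qed.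
Let bump'E2 x : bump' x = - (6 * u x ^+ 2) * (x / w ^+ 2).
Proof. by rewrite /bump' /pos3' -/(q x) -/(u x); field; rewrite gt_eqF. Qed.
Let bump''E x : x * bump'' x = (24 * (q x * u x) - 6 * u x ^+ 2) * (x / w ^+ 2).
Proof.
by rewrite /bump'' /pos3'' /pos3' -/(q x) -/(u x) /q; field; rewrite gt_eqF.
Qed.

Let qu x : 0 <= q x * u x <= 1.
Proof.
have := q_ge0 x; have [[-> h]|[-> h]] := uE x => q0; last by rewrite mulr0 lexx ler01.
by rewrite mulr_ge0 ?subr_ge0//=; have := sqr_ge0 (q x); nra.
Qed.

Let u2 x : 0 <= u x ^+ 2 <= 1.
Proof. by have /andP[a b] := u_itv x; rewrite exprn_ge0//= exprn_ile1. Qed.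

Let u3 x : 0 <= u x ^+ 3 <= 1.
Proof. by have /andP[a b] := u_itv x; rewrite exprn_ge0//= exprn_ile1. Qed.

Let qu2 x : 0 <= q x * u x ^+ 2 <= 1.
Proof.
have /andP[a b] := u_itv x; have /andP[c e] := qu x.
rewrite expr2 mulrA mulr_ge0//=; apply: (@le_trans _ _ (1 * 1)); last by rewrite mulr1.
exact: ler_pM.
Qed.

Lemma bump_itv x : 0 <= bump x <= 1. Proof. by rewrite bumpE. Qed.

Lemma bump_ge x : 1 - 3 * (x / w) ^+ 2 <= bump x.
Proof.
rewrite bumpE -/(q x); have q0 := q_ge0 x; have [[-> h]|[-> h]] := uE x.
  have -> : (1 - q x) ^+ 3 = 1 - 3 * q x + q x ^+ 2 * (3 - q x) by ring.
  by rewrite lerDl mulr_ge0 ?sqr_ge0//; lra.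
by rewrite expr0n/=; lra.
Qed.

Lemma bump_ge_inner x (r : R) : 0 <= r -> r <= 1 - (x / w) ^+ 2 -> r ^+ 3 <= bump x.
Proof.
move=> r0 rx; rewrite bumpE -/(q x) in rx *; rewrite lerXn2r ?nnegrE//.
  by have /andP[] := u_itv x.
by rewrite /u le_max rx.
Qed.

Lemma cutid_le x : `|cutid x| <= `|x|.
Proof.
have /andP[a b] := bump_itv x.
by rewrite /cutid normrM (ger0_norm a) ler_piMr.
Qed.

Lemma cutid_le_radius x : `|cutid x| <= w.
Proof.
have [h|h] := leP w `|x|; last exact: le_trans (cutid_le x) (ltW h).
by have [b _ _] := bump_out h; rewrite /cutid b mulr0 normr0 ltW.
Qed.

Lemma cutid'_le x : `|cutid' x| <= 7.
Proof.
rewrite /cutid' bumpE bump'E.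
have := u3 x; have := qu2 x => /andP[a b] /andP[c e].
by rewrite ler_norml; apply/andP; split; lra.
Qed.

Lemma cutid''_le x : `|cutid'' x| <= 42 * `|x| / w ^+ 2.
Proof.
rewrite /cutid'' bump''E bump'E2.
have -> : 2 * (- (6 * u x ^+ 2) * (x / w ^+ 2)) + (24 * (q x * u x) - 6 * u x ^+ 2) * (x / w ^+ 2)
   = (24 * (q x * u x) - 18 * u x ^+ 2) * (x / w ^+ 2) by ring.
rewrite normrM -mulrA; have -> : `|x / w ^+ 2| = `|x| / w ^+ 2.
  by rewrite normrM normfV (ger0_norm (sqr_ge0 w)).
apply: ler_wpM2r; first by rewrite divr_ge0// sqr_ge0.
have := qu x; have := u2 x => /andP[a b] /andP[c e].
by rewrite ler_norml; apply/andP; split; lra.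
Qed.

Lemma cutid_cutid''_le x : `|cutid x * cutid'' x| <= 42.
Proof.
have [h|h] := leP w `|x|.
  by have [b b' b''] := bump_out h; rewrite /cutid b mulr0 mul0r normr0.
rewrite normrM; apply: (le_trans (ler_pM _ _ (cutid_le x) (cutid''_le x))) => //.
rewrite mulrA ler_pdivrMr ?exprn_gt0// mulrCA ler_wpM2l// -expr2.
by rewrite lerXn2r ?nnegrE// ltW.
Qed.

Lemma cutid_near x : `|x - cutid x| <= 3 * `|x| ^+ 3 / w ^+ 2.
Proof.
have /andP[a b] := bump_itv x; have c := bump_ge x.
have -> : x - cutid x = x * (1 - bump x) by rewrite /cutid; ring.
rewrite normrM (ger0_norm (_ : 0 <= 1 - bump x)) ?subr_ge0//.
have -> : 3 * `|x| ^+ 3 / w ^+ 2 = `|x| * (3 * (x / w) ^+ 2).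
  rewrite expr_div_n -(real_normK (num_real x)) exprS; field; by rewrite gt_eqF.
by rewrite ler_wpM2l//; lra.
Qed.

Lemma cutid'_near x : `|1 - cutid' x| <= 9 * (x / w) ^+ 2.
Proof.
rewrite /cutid' bump'E -/(q x).
have /andP[a b] := bump_itv x; have c := bump_ge x; rewrite -/(q x) in c.
have := u2 x; have := q_ge0 x => q0 /andP[d e].
have : 0 <= q x * u x ^+ 2 <= q x.
  by rewrite mulr_ge0//= ler_piMr.
move=> /andP[f g]; rewrite ler_norml; apply/andP; split; lra.
Qed.

End cutoffs.

Section rescaled.
Variable R : realType.
Implicit Types g : R -> R.

Lemma smooth_shift (c e a b : R) g g' g'' : smooth setT (zjet g g' g'') ->
  smooth setT (zjet (fun z => c + e * g (a * (z - b))) (fun z => e * (a * g' (a * (z - b))))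
    (fun z => e * (a ^+ 2 * g'' (a * (z - b))))).
Proof.
move=> sg.
have -> : zjet (fun z => c + e * g (a * (z - b))) (fun z => e * (a * g' (a * (z - b))))
    (fun z => e * (a ^+ 2 * g'' (a * (z - b)))) =
  jadd (jcst c) (jmul (jcst e) (zjet (fun z => g (a * (z - b))) (fun z => a * g' (a * (z - b)))
     (fun z => a ^+ 2 * g'' (a * (z - b))))).
  by apply: jet_eq => th z; rewrite /=; ring.
apply: smooth_add; first exact: smooth_cst.
by apply: smooth_mul; [exact: smooth_cst|exact: smooth_affine].
Qed.

End rescaled.

(** * Vanishing noise *)

Ltac nonneg := repeat (first [ assumption | apply: ltW; assumption | exact: ler0n | exact: ler01
  | exact: normr_ge0 | exact: sqr_ge0 | apply: exprn_ge0 | rewrite invr_ge0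
  | apply: addr_ge0 | apply: mulr_ge0 ]).

Lemma lower_combine (R : realFieldType) (c m K E Z G V Q : R) : - (c * Q) <= Z - m * (1 - 2 * V) ->
  2 * m * V <= 2 * m * (K * G + E * Q) -> m - (c + 2 * m * E) * Q <= Z + 2 * m * K * G.
Proof. lra. Qed.

Lemma upper_combine (R : realFieldType) (c m E Z V Q : R) : Z - m * (1 - 2 * V) <= c * Q ->
  0 <= m * V -> 0 <= 2 * m * E * Q -> Z <= m + (c + 2 * m * E) * Q.
Proof. lra. Qed.

Section quartic_bounds.
Variables (R : realType) (zs alpha : R).
Hypothesis alpha0 : 0 < alpha.
Notation q := (quartic zs alpha).

Lemma abs_pow_quartic (z : R) (k : nat) : (k <= 4)%N -> `|z - zs| ^+ k <= alpha ^+ k * q z.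
Proof.
move=> k4; pose x := `|(z - zs) / alpha|.
have -> : `|z - zs| ^+ k = alpha ^+ k * x ^+ k.
  by rewrite /x normrM normfV (gtr0_norm alpha0) -exprMn mulrC divfK// gt_eqF.
rewrite ler_wpM2l ?exprn_ge0 ?(ltW alpha0)// /quartic.
have -> : ((z - zs) / alpha) ^+ 4 = x ^+ 4 by rewrite /x -normrX ger0_norm// exprn_even_ge0.
have x0 : 0 <= x := normr_ge0 _.
have [x1|/ltW x1] := leP x 1.
  by rewrite (le_trans (exprn_ile1 _ _ _))// lerDl exprn_ge0.
by rewrite (le_trans (ler_weXn2l x1 k4))// lerDr.
Qed.

End quartic_bounds.

Section small_noise.
Context (R : realType) d (T : measurableType d) (P : probability T R).
Variable W : R -> {RV P >-> R}.
Hypothesis BW : brownian_motion W.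
Variables (gamma zs alpha : R).
Hypotheses (gamma0 : 0 < gamma) (alpha0 : 0 < alpha).
Notation X := (circle R * R)%type.
Variable mu : probability X R.
Hypothesis inv : invariant_measure gamma zs alpha W mu.
Notation L := (generator gamma zs alpha).
Notation q := (quartic zs alpha).
Notation C4 := (1 + 6528 / gamma ^+ 2).

Let mcst c : moderate zs (fun _ _ => c).
Proof. by apply: (@moderate_bounded _ _ _ `|c|) => //; exact: cyl_cst. Qed.

Let q1 z : 1 <= q z. Proof. exact: quartic_ge1. Qed.

Lemma v_factor_le (M : R -> R) (m0 : R) th z : 0 < m0 -> (forall z, m0 <= M z) ->
  `|1 - 2 * ((cos th - M z * sin th) ^+ 2 /
     ((cos th + M z * sin th) ^+ 2 + (cos th - M z * sin th) ^+ 2))| <= 1.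
Proof.
move=> m00 Mm0; have /andP[a b] := v_itv m00 Mm0 th z.
by rewrite ler_norml; apply/andP; split; lra.
Qed.

(** A constant M: by the choice M ^ 2 = 1 - zs + alpha the frozen rate (z - 1 + M ^ 2) / (2 M) is
    (z - zs + alpha) / (2 M), which is of order sqrt alpha as M >= sqrt alpha. *)
Lemma small_noise_subcritical : zs <= 1 -> `|lyapunov mu + 1| <= Num.sqrt alpha * C4.
Proof.
move=> zs1; pose m := Num.sqrt (1 - zs + alpha).
have ma : 0 < 1 - zs + alpha by move: alpha0; lra.
have m0 : 0 < m by rewrite sqrtr_gt0.
have mE : m ^+ 2 = 1 - zs + alpha by rewrite sqr_sqrtr// ltW.
have sa : 0 < Num.sqrt alpha by rewrite sqrtr_gt0.
have sam : Num.sqrt alpha <= m by rewrite ler_sqrt ?(ltW ma)// lerDr subr_ge0.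
have sM : smooth setT (zjet (fun _ : R => m) (fun _ => 0) (fun _ => 0)) by exact: smooth_cst.
have Mm (z : R) : m <= m by [].
have sJ := smooth_phi m0 Mm sM ltr01 (lexx 1).
have H th z : `|z * (sin th * cos th) + L (jphi (fun _ : R => m) (fun _ => 0) (fun _ => 0) 1) th z|
    <= Num.sqrt alpha * q z.
  have := @rate_approx R gamma zs alpha (fun=> m) (fun=> 0) (fun=> 0) m m0 Mm th z.
  rewrite /drift /noise !mulr0 addr0 normr0 expr0n/= mulr0 !mul0r mulr0 addr0 => ra.
  set A := (X in `|_ - X|) in ra; set B := (X in `|X - _|) in ra.
  have -> : z * (sin th * cos th) + L (jphi (fun=> m) (fun=> 0) (fun=> 0) 1) th z = A.
    by apply/eqP; rewrite -subr_eq0 -normr_le0.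
  rewrite /A normrM mE.
  apply: (le_trans (ler_wpM2l (normr_ge0 _) (@v_factor_le (fun=> m) m th z m0 Mm))); rewrite mulr1.
  rewrite normrM normfV (gtr0_norm (_ : 0 < 2 * m)) ?mulr_gt0// ler_pdivrMr ?mulr_gt0//.
  have -> : z - 1 + (1 - zs + alpha) = (z - zs) + alpha by ring.
  apply: (le_trans (ler_normD _ _)); rewrite (gtr0_norm alpha0).
  have := abs_pow_quartic zs alpha0 z (isT : (1 <= 4)%N); rewrite !expr1 => y1.
  have aq : alpha <= alpha * q z by rewrite ler_peMr// ltW.
  apply: (@le_trans _ _ (2 * (alpha * q z))).
    by apply: (le_trans (lerD y1 aq)); rewrite mulr_natl mulr2n.
  have -> : Num.sqrt alpha * q z * (2 * m) = 2 * (Num.sqrt alpha * m * q z) by ring.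
  rewrite ler_wpM2l// ler_wpM2r//; first by rewrite (le_trans ler01).
  by rewrite -{1}(sqr_sqrtr (ltW alpha0)) expr2 ler_wpM2l// ltW.
have H1 := lyapunov_le BW gamma0 alpha0 inv sJ (ltW sa) (mcst 0).
have H2 := lyapunov_ge BW gamma0 alpha0 inv sJ (ltW sa) (mcst 0).
rewrite mean_cst in H1 H2; rewrite ler_norml; apply/andP; split.
  rewrite -[leLHS]add0r; apply: H2 => th z; rewrite sub0r.
  by have := H th z; rewrite ler_norml => /andP[].
rewrite -[leRHS]add0r; apply: H1 => th z; rewrite add0r.
by have := H th z; rewrite ler_norml => /andP[].
Qed.

(** Here m = sqrt (zs - 1) is the frozen growth rate and M = m + a (z - zs) near zs. The slope
    a = 1 / (2 m + gamma) cancels the terms linear in z - zs of z - 1 - M ^ 2 + drift, so that this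
    error is of order alpha ^ 2, still small after a division by d = D alpha. Far from zs the cut off M
    is too flat for a gain, but this event has a probability of order alpha at most. *)
Section supercritical.
Variables (m D : R).
Hypotheses (m0 : 0 < m) (mE : m ^+ 2 = zs - 1) (D0 : 0 < D).
Let a : R := (2 * m + gamma)^-1.
Let w : R := m ^+ 2.
Hypothesis aD : 49 * a ^+ 2 <= m ^+ 3 * D ^+ 2.
Hypotheses (alpha1 : alpha <= 1) (Dalpha : (D * alpha) ^+ 2 <= 2^-1).

Let a0 : 0 < a. Proof. by rewrite invr_gt0 addr_gt0// mulr_gt0. Qed.
Let aE : 2 * m * a + gamma * a = 1.
Proof. by rewrite /a; field; rewrite gt_eqF// addr_gt0// mulr_gt0. Qed.
Let w0 : 0 < w. Proof. exact: exprn_gt0. Qed.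
Let aw : a * w <= m / 2.
Proof.
have : 0 <= gamma * a * m by rewrite !mulr_ge0// ltW.
have -> : a * w = m / 2 * (2 * m * a) by rewrite /w; field.
move=> h; have : m / 2 * (2 * m * a) + m / 2 * (gamma * a) = m / 2 by rewrite -mulrDr aE mulr1.
by move: h; lra.
Qed.

Let M (z : R) : R := m + a * cutid w (1 * (z - zs)).
Let M1 (z : R) : R := a * (1 * cutid' w (1 * (z - zs))).
Let M2 (z : R) : R := a * (1 ^+ 2 * cutid'' w (1 * (z - zs))).

Let sM : smooth setT (zjet M M1 M2).
Proof. exact: (smooth_shift m a 1 zs (smooth_cutid w0)). Qed.

Let Mdist z : `|M z - m| <= m / 2.
Proof.
rewrite /M addrC addKr normrM (gtr0_norm a0); apply: le_trans aw.
by rewrite ler_wpM2l ?(ltW a0)// cutid_le_radius.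
Qed.

Let Mlo z : m / 2 <= M z.
Proof. by have := Mdist z; rewrite ler_norml => /andP[]; move: m0; lra. Qed.
Let Mhi z : M z <= 3 / 2 * m.
Proof. by have := Mdist z; rewrite ler_norml => /andP[]; move: m0; lra. Qed.
Let m20 : 0 < m / 2. Proof. by rewrite divr_gt0. Qed.
Let Mgt z : 0 < M z. Proof. exact: lt_le_trans m20 (Mlo z). Qed.
Let q0 z : 0 <= q z. Proof. exact: le_trans ler01 (q1 z). Qed.

Let cd : R := 7 * gamma * a + 21 * a / w ^+ 2.
Let crho : R := 6 * m * a / w ^+ 2 + 9 * gamma * a / w ^+ 2 + a ^+ 2 + 21 * a / w ^+ 2.
Let ctau : R := 49 * a ^+ 2 / (2 * m ^+ 2).

Let y1 z : `|z - zs| <= alpha * q z.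
Proof. by have := abs_pow_quartic zs alpha0 z (isT : (1 <= 4)%N); rewrite !expr1. Qed.
Let y2 z : `|z - zs| ^+ 2 <= alpha ^+ 2 * q z. Proof. exact: abs_pow_quartic. Qed.
Let y3 z : `|z - zs| ^+ 3 <= alpha ^+ 3 * q z. Proof. exact: abs_pow_quartic. Qed.
Let a2le : alpha ^+ 2 <= alpha. Proof. by rewrite expr2 ler_piMr// ltW. Qed.
Let a3le : alpha ^+ 3 <= alpha ^+ 2. Proof. by rewrite exprSr ler_piMr// exprn_ge0// ltW. Qed.
Let a2ge : 0 <= alpha ^+ 2. Proof. exact: sqr_ge0. Qed.
Let wi : 0 <= (w ^+ 2)^-1. Proof. by rewrite invr_ge0 sqr_ge0. Qed.

Let second_le z : alpha ^+ 2 / 2 * `|M2 z| <= 21 * a / w ^+ 2 * (alpha ^+ 3 * q z).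
Proof.
rewrite /M2 expr1n !mul1r normrM (gtr0_norm a0).
have h := cutid''_le w0 (z - zs).
have h2 : `|cutid'' w (z - zs)| <= 42 * (alpha * q z) / w ^+ 2.
  apply: (le_trans h); rewrite ler_wpM2r// ler_wpM2l//.
have -> : 21 * a / w ^+ 2 * (alpha ^+ 3 * q z) = alpha ^+ 2 / 2 * (a * (42 * (alpha * q z) / w ^+ 2)).
  by field; rewrite gt_eqF.
by rewrite ler_wpM2l ?divr_ge0// ler_wpM2l// ltW.
Qed.

Let drift_le z : `|drift gamma zs alpha M1 M2 z| <= cd * (alpha * q z).
Proof.
apply: (le_trans (ler_normD _ _)); rewrite /cd [leRHS]mulrDl; apply: lerD.
  have hM1 : `|M1 z| <= a * 7.
    by rewrite /M1 !mul1r normrM (gtr0_norm a0) ler_wpM2l ?(ltW a0)// cutid'_le.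
  rewrite (normrM (- gamma * _)) (normrM (- gamma)) normrN (gtr0_norm gamma0).
  have -> : 7 * gamma * a * (alpha * q z) = gamma * (alpha * q z) * (a * 7) by ring.
  apply: ler_pM => //; first by rewrite mulr_ge0// ltW.
  by rewrite ler_wpM2l// ltW.
rewrite normrM (ger0_norm (_ : 0 <= alpha ^+ 2 / 2)) ?divr_ge0//.
apply: (le_trans (second_le z)); rewrite ler_wpM2l//.
  by rewrite mulr_ge0// mulr_ge0// ltW.
by rewrite ler_wpM2r// (le_trans a3le).
Qed.

Let rho z := z - 1 - M z ^+ 2 + drift gamma zs alpha M1 M2 z.

Let rho_le z : `|rho z| <= crho * (alpha ^+ 2 * q z).
Proof.
pose y := z - zs; pose t := cutid w y; pose t' := cutid' w y.
have -> : rho z = 2 * m * a * (y - t) + gamma * a * y * (1 - t') - a ^+ 2 * t ^+ 2 + alpha ^+ 2 / 2 * M2 z.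
  rewrite /rho /drift /M /M1 !mul1r -/y -/t -/t'.
  have zE : z = y + 1 + m ^+ 2 by rewrite mE /y; ring.
  rewrite {1}zE.
  have -> : y + 1 + m ^+ 2 - 1 - (m + a * t) ^+ 2 + (- gamma * y * (a * t') + alpha ^+ 2 / 2 * M2 z) =
    y * 1 - 2 * m * a * t - a ^+ 2 * t ^+ 2 - gamma * a * y * t' + alpha ^+ 2 / 2 * M2 z by ring.
  by rewrite -{1}aE; ring.
have T1 : `|2 * m * a * (y - t)| <= 6 * m * a / w ^+ 2 * (alpha ^+ 2 * q z).
  rewrite normrM (ger0_norm (_ : 0 <= 2 * m * a)) ?mulr_ge0 ?(ltW m0) ?(ltW a0)//.
  have -> : 6 * m * a / w ^+ 2 * (alpha ^+ 2 * q z) = 2 * m * a * (3 * (alpha ^+ 2 * q z) / w ^+ 2) by ring.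
  rewrite ler_wpM2l ?mulr_ge0 ?(ltW m0) ?(ltW a0)//.
  apply: (le_trans (cutid_near w0 y)); rewrite ler_wpM2r// ler_wpM2l//.
  by apply: (le_trans (y3 z)); rewrite ler_wpM2r.
have T2 : `|gamma * a * y * (1 - t')| <= 9 * gamma * a / w ^+ 2 * (alpha ^+ 2 * q z).
  rewrite normrM normrM (ger0_norm (_ : 0 <= gamma * a)) ?mulr_ge0 ?(ltW gamma0) ?(ltW a0)//.
  have -> : 9 * gamma * a / w ^+ 2 * (alpha ^+ 2 * q z) = gamma * a * (9 * (alpha ^+ 2 * q z) / w ^+ 2) by ring.
  rewrite -mulrA ler_wpM2l ?mulr_ge0 ?(ltW gamma0) ?(ltW a0)//.
  apply: (le_trans (ler_wpM2l (normr_ge0 y) (cutid'_near w0 y))).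
  have -> : `|y| * (9 * (y / w) ^+ 2) = 9 * `|y| ^+ 3 / w ^+ 2.
    rewrite expr_div_n -(real_normK (num_real y)) [`|y| ^+ 3]exprS; field; by rewrite gt_eqF.
  rewrite ler_wpM2r// ler_wpM2l//.
  by apply: (le_trans (y3 z)); rewrite ler_wpM2r.
have T3 : `|a ^+ 2 * t ^+ 2| <= a ^+ 2 * (alpha ^+ 2 * q z).
  rewrite normrM (ger0_norm (sqr_ge0 a)) ler_wpM2l ?sqr_ge0// normrX.
  apply: le_trans (y2 z); rewrite lerXn2r ?nnegrE//; exact: cutid_le.
have T4 : `|alpha ^+ 2 / 2 * M2 z| <= 21 * a / w ^+ 2 * (alpha ^+ 2 * q z).
  rewrite normrM (ger0_norm (_ : 0 <= alpha ^+ 2 / 2)) ?divr_ge0//.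
  apply: (le_trans (second_le z)); rewrite ler_wpM2l//.
    by rewrite mulr_ge0// mulr_ge0// ltW.
  by rewrite ler_wpM2r.
apply: (le_trans (ler_normD _ _)); apply: (le_trans (lerD (ler_normB _ _) (lexx _))).
apply: (le_trans (lerD (lerD (ler_normD _ _) (lexx _)) (lexx _))).
apply: (le_trans (lerD (lerD (lerD T1 T2) T3) T4)).
by rewrite /crho -!mulrDl.
Qed.

Let noise_le z : noise alpha M M1 z <= ctau * alpha ^+ 2.
Proof.
rewrite /noise /M1 !mul1r exprMn.
rewrite ler_pdivrMr ?mulr_gt0 ?exprn_gt0//.
have t2 : cutid' w (z - zs) ^+ 2 <= 49.
  rewrite -(real_normK (num_real _)) (_ : 49 = 7 ^+ 2); last by ring.
  by rewrite lerXn2r ?nnegrE// cutid'_le.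
have M2l : m ^+ 2 / 4 <= M z ^+ 2.
  have -> : m ^+ 2 / 4 = (m / 2) ^+ 2 by field.
  by rewrite lerXn2r ?nnegrE ?(ltW m20) ?(ltW (Mgt z)).
have aa := sqr_ge0 a.
apply: (@le_trans _ _ (alpha ^+ 2 * (a ^+ 2 * 49))).
  by rewrite ler_wpM2l// ler_wpM2l.
have -> : alpha ^+ 2 * (a ^+ 2 * 49) = ctau * alpha ^+ 2 * (8 * (m ^+ 2 / 4)).
  by rewrite /ctau; field; rewrite gt_eqF.
rewrite ler_wpM2l//; last by rewrite ler_wpM2l.
by rewrite mulr_ge0// divr_ge0// mulr_ge0// sqr_ge0.
Qed.

Let noise_cond z : noise alpha M M1 z <= M z * (D * alpha) ^+ 2.
Proof.
apply: (le_trans (noise_le z)); apply: (@le_trans _ _ (m / 2 * (D * alpha) ^+ 2)); last first.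
  by rewrite ler_wpM2r ?sqr_ge0.
rewrite exprMn [leRHS]mulrA ler_wpM2r// /ctau ler_pdivrMr ?mulr_gt0 ?exprn_gt0//.
by have -> : m / 2 * D ^+ 2 * (2 * m ^+ 2) = m ^+ 3 * D ^+ 2 by field.
Qed.

Let k0 : R := a ^+ 2 / (96 * m ^+ 3 * D ^+ 2).
Let k00 : 0 < k0.
Proof. by rewrite divr_gt0 ?mulr_gt0 ?exprn_gt0. Qed.
Let k02 : k0 <= 2^-1.
Proof.
have h : 0 < m ^+ 3 * D ^+ 2 by rewrite mulr_gt0// exprn_gt0.
rewrite /k0 ler_pdivrMr; last by rewrite -mulrA mulr_gt0.
have := sqr_ge0 a; rewrite -[96 * _ * _]mulrA; move: aD; lra.
Qed.

(* The derivative of the cutoff is at least 3/4 for |z - zs| <= w / 6. *)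
Let k (z : R) : R := if `|z - zs| <= w / 6 then k0 else 0.

Let k_cond z : k z * (2 * M z * (D * alpha) ^+ 2) <= noise alpha M M1 z.
Proof.
rewrite /k; case: ifP => yw; last by rewrite mul0r noise_ge0// => x; exact: Mlo.
have t' : 3 / 4 <= cutid' w (z - zs).
  have h : ((z - zs) / w) ^+ 2 <= 36^-1.
    rewrite -(real_normK (num_real _)) normrM normfV (gtr0_norm w0).
    have -> : 36^-1 = (6^-1) ^+ 2 :> R by field.
    by rewrite lerXn2r ?nnegrE ?divr_ge0 ?(ltW w0)// ler_pdivrMr// mulrC.
  have := cutid'_near w0 (z - zs); rewrite ler_norml => /andP[_].
  by move: h; lra.
have t2 : 9 / 16 <= cutid' w (z - zs) ^+ 2.
  have -> : 9 / 16 = (3 / 4) ^+ 2 :> R by field.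
  by rewrite lerXn2r ?nnegrE// (le_trans _ t').
have Mz := Mgt z; have Mz3 := Mhi z.
rewrite /noise /M1 !mul1r ler_pdivlMr ?mulr_gt0 ?exprn_gt0//.
have M3 : M z ^+ 3 <= 27 / 8 * m ^+ 3.
  have -> : 27 / 8 * m ^+ 3 = (3 / 2 * m) ^+ 3 by field.
  by rewrite lerXn2r ?nnegrE ?(ltW Mz)// mulr_ge0// ltW.
have -> : k0 * (2 * M z * (D * alpha) ^+ 2) * (8 * M z ^+ 2) =
   a ^+ 2 * alpha ^+ 2 / (6 * m ^+ 3) * M z ^+ 3.
  by rewrite /k0; field; rewrite !gt_eqF.
have c0 : 0 <= a ^+ 2 * alpha ^+ 2 / (6 * m ^+ 3).
  apply: divr_ge0; apply: mulr_ge0; rewrite ?sqr_ge0//.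
  by rewrite exprn_ge0// ltW.
apply: (le_trans (ler_wpM2l c0 M3)).
have -> : a ^+ 2 * alpha ^+ 2 / (6 * m ^+ 3) * (27 / 8 * m ^+ 3) = alpha ^+ 2 * (a ^+ 2 * (9 / 16)).
  by field; rewrite gt_eqF.
by rewrite exprMn ler_wpM2l// ler_wpM2l// sqr_ge0.
Qed.

(* The pointwise errors are below these constants times alpha q. *)
Let cE : R := 10 * ctau / D + 4 * crho / (m * D) + 4 * (crho + 2 * cd) / m.
Let cA : R := (a ^+ 2 + 1) / m.
Let cR : R := 2 * cd / m + 4 * ctau.

Notation v th z := ((cos th - M z * sin th) ^+ 2 /
     ((cos th + M z * sin th) ^+ 2 + (cos th - M z * sin th) ^+ 2)).

Let jone := zjet (fun _ : R => 1 : R) (fun _ => 0) (fun _ => 0).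
Let jgain := jmul jone (jdiff M M1 M2 (D * alpha)).

Let Da0 : 0 < D * alpha. Proof. exact: mulr_gt0. Qed.
Let Da1 : D * alpha <= 1.
Proof.
have : (D * alpha) ^+ 2 <= 1 ^+ 2 by rewrite expr1n; move: Dalpha; lra.
by rewrite ler_sqr ?nnegrE// ltW.
Qed.

Let gain th z : 3 / 4 * M z * k z * v th z <= L jgain th z + cE * (alpha * q z).
Proof.
have kk : 0 <= k z <= 2^-1.
  by rewrite /k; case: ifP => _; rewrite ?(ltW k00) ?lexx//= ?invr_ge0.
have := @localized_gain R gamma zs alpha M M1 M2 _ m20 Mlo (fun=> 1) (fun=> 0) (fun=> 0)
  (D * alpha) (k z) th z Da0 Dalpha.
rewrite ler01 lexx => /(_ isT kk (fun _ => conj (noise_cond z) (k_cond z))).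
rewrite !mulr0 !addr0 normr0 !mul0r mulr0 !addr0 !mul1r -/jone -/jgain => /le_trans; apply.
rewrite lerD2l.
have di : 0 <= (D * alpha)^-1 by rewrite invr_ge0 ltW.
have mi : 0 <= m^-1 by rewrite invr_ge0 ltW.
have ctau0 : 0 <= ctau by rewrite divr_ge0// mulr_ge0// sqr_ge0.
have E1 : 10 * noise alpha M M1 z / (D * alpha) <= 10 * ctau / D * (alpha * q z).
  have h1 : 10 * noise alpha M M1 z / (D * alpha) <= 10 * (ctau * alpha ^+ 2) / (D * alpha).
    by rewrite ler_wpM2r// ler_wpM2l.
  apply: (le_trans h1).
  have -> : 10 * (ctau * alpha ^+ 2) / (D * alpha) = 10 * ctau / D * alpha.
    by field; rewrite !gt_eqF.
  apply: ler_wpM2l; last by rewrite ler_peMr// ltW.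
  by apply: divr_ge0; [exact: mulr_ge0|exact: ltW].
have rle := rho_le z.
have iM : (M z)^-1 <= 2 / m.
  have -> : 2 / m = (m / 2)^-1 by rewrite invf_div.
  by rewrite lef_pV2 ?posrE.
have E2 : 2 * `|rho z| / (M z * (D * alpha)) <= 4 * crho / (m * D) * (alpha * q z).
  rewrite invfM.
  have -> : 4 * crho / (m * D) * (alpha * q z) =
     2 * (crho * (alpha ^+ 2 * q z)) * (2 / m * (D * alpha)^-1) by field; rewrite !gt_eqF.
  apply: ler_pM; rewrite ?mulr_ge0 ?invr_ge0 ?(ltW (Mgt z)) ?(ltW Da0) ?(ltW D0) ?(ltW alpha0)//.
    by rewrite ler_wpM2l.
  by rewrite ler_wpM2r.
have E3 : 2 * `|z - 1 - M z ^+ 2 - drift gamma zs alpha M1 M2 z| / M z <=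
    4 * (crho + 2 * cd) / m * (alpha * q z).
  have dle := drift_le z.
  have h : `|z - 1 - M z ^+ 2 - drift gamma zs alpha M1 M2 z| <= (crho + 2 * cd) * (alpha * q z).
    have -> : z - 1 - M z ^+ 2 - drift gamma zs alpha M1 M2 z =
      rho z - 2 * drift gamma zs alpha M1 M2 z by rewrite /rho; ring.
    apply: (le_trans (ler_normB _ _)); rewrite (normrM 2) (ger0_norm (ler0n _ 2)) [leRHS]mulrDl; apply: lerD.
      apply: (le_trans rle); rewrite ler_wpM2l//; last by rewrite ler_wpM2r.
      by rewrite /crho; nonneg.
    by rewrite -mulrA ler_wpM2l.
  have -> : 4 * (crho + 2 * cd) / m * (alpha * q z) = 2 * ((crho + 2 * cd) * (alpha * q z)) * (2 / m).
    by field; rewrite gt_eqF.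
  apply: ler_pM; rewrite ?mulr_ge0 ?invr_ge0 ?(ltW (Mgt z))//.
  by rewrite ler_wpM2l.
by apply: (le_trans (lerD (lerD E1 E2) E3)); rewrite -!mulrDl.
Qed.

Let rate th z : `|z * (sin th * cos th) + L (jphi M M1 M2 1) th z - m * (1 - 2 * v th z)| <=
  (cA + cR) * (alpha * q z).
Proof.
have ra := @rate_approx R gamma zs alpha M M1 M2 _ m20 Mlo th z.
have vf := @v_factor_le M _ th z m20 Mlo.
set A := (z - 1 + M z ^+ 2) / (2 * M z) in ra *.
set Z := _ + L _ th z in ra *; set V := 1 - 2 * _ in ra vf *.
have iM : (M z)^-1 <= 2 / m.
  have -> : 2 / m = (m / 2)^-1 by rewrite invf_div.
  by rewrite lef_pV2 ?posrE.
have hA : `|A - m| <= cA * (alpha * q z).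
  have -> : A - m = ((z - zs) + (M z - m) ^+ 2) * (2^-1 * (M z)^-1).
    have zsE : zs = m ^+ 2 + 1 by rewrite mE; ring.
    by rewrite /A zsE; field; rewrite gt_eqF.
  rewrite normrM (ger0_norm (_ : 0 <= 2^-1 * (M z)^-1)) ?mulr_ge0 ?invr_ge0 ?(ltW (Mgt z))//.
  have -> : cA * (alpha * q z) = ((a ^+ 2 + 1) * (alpha * q z)) * (2^-1 * (2 / m)).
    by rewrite /cA; field; rewrite gt_eqF.
  apply: ler_pM => //; rewrite ?mulr_ge0 ?invr_ge0 ?(ltW (Mgt z))//; last by rewrite ler_wpM2l.
  apply: (le_trans (ler_normD _ _)); rewrite mulrDl mul1r addrC; apply: lerD => //.
  rewrite normrX /M addrC addKr mul1r normrM (gtr0_norm a0) exprMn ler_wpM2l ?sqr_ge0//.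
  apply: (@le_trans _ _ (alpha ^+ 2 * q z)); last by rewrite ler_wpM2r.
  by apply: le_trans (y2 z); rewrite lerXn2r ?nnegrE// cutid_le.
have hR : `|drift gamma zs alpha M1 M2 z| / M z + 4 * noise alpha M M1 z <= cR * (alpha * q z).
  rewrite /cR [leRHS]mulrDl; apply: lerD.
    have -> : 2 * cd / m * (alpha * q z) = cd * (alpha * q z) * (2 / m) by ring.
    by apply: ler_pM => //; rewrite invr_ge0 ltW.
  rewrite -mulrA ler_wpM2l//; apply: (le_trans (noise_le z)).
  apply: ler_wpM2l; first by rewrite /ctau; nonneg.
  by apply: (le_trans a2le); rewrite ler_peMr// ltW.
have -> : Z - m * V = (Z - A * V) + (A - m) * V by ring.
apply: (le_trans (ler_normD _ _)); rewrite [leRHS]mulrDl [leLHS]addrC.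
apply: lerD; last exact: le_trans ra hR.
rewrite normrM; apply: le_trans hA; by rewrite ler_piMr.
Qed.

Let cK : R := 8 / (3 * m * k0).
Let cL : R := cA + cR + 2 * m * (cK * cE + 6 / w).

Let cA0 : 0 <= cA. Proof. by rewrite /cA; nonneg. Qed.
Let cd0 : 0 <= cd.
Proof. by rewrite /cd; nonneg. Qed.
Let crho0 : 0 <= crho.
Proof. by rewrite /crho; nonneg. Qed.
Let ctau0 : 0 <= ctau. Proof. by rewrite /ctau; nonneg. Qed.
Let cR0 : 0 <= cR.
Proof. by rewrite /cR; nonneg. Qed.
Let cE0 : 0 <= cE.
Proof. by rewrite /cE; nonneg. Qed.
Let cK0 : 0 <= cK.
Proof. by rewrite /cK; nonneg. Qed.

Let v_le th z : v th z <= cK * L jgain th z + (cK * cE + 6 / w) * (alpha * q z).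
Proof.
have g := gain th z; have /andP[v0 v1] := v_itv m20 Mlo th z.
have aq : 0 <= alpha * q z by rewrite mulr_ge0// ltW.
have h6 : 0 <= 6 / w * (alpha * q z) by rewrite mulr_ge0// divr_ge0// ltW.
move: g; rewrite /k; case: ifPn => [yw|yw] g.
  have h : cK * (3 / 4 * (m / 2) * k0 * v th z) <= cK * (3 / 4 * M z * k0 * v th z).
    rewrite ler_wpM2l// ler_wpM2r// ler_wpM2r ?(ltW k00)// ler_wpM2l//.
  have E V : cK * (3 / 4 * (m / 2) * k0 * V) = V.
    by rewrite /cK; field; rewrite !gt_eqF.
  rewrite E in h; apply: (le_trans h); apply: (le_trans (ler_wpM2l cK0 g)).
  by rewrite mulrDr (mulrA cK cE) lerD2l [leRHS]mulrDl lerDl.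
have := ler_wpM2l cK0 g; rewrite !mulr0 mul0r mulr0 mulrDr (mulrA cK cE) => g0.
have h1 : 1 <= 6 / w * (alpha * q z).
  move: yw; rewrite -ltNge => /ltW yw; apply: (@le_trans _ _ (6 / w * `|z - zs|)).
    rewrite mulrAC ler_pdivlMr// mul1r mulrC -ler_pdivrMr//.
  by rewrite ler_wpM2l// divr_ge0// ltW.
apply: (le_trans v1); apply: (le_trans h1).
by rewrite [X in _ + X]mulrDl addrA lerDr.
Qed.

Lemma small_noise_supercritical : `|lyapunov mu + 1 - m| <= cL * alpha * C4.
Proof.
have sphi := smooth_phi m20 Mlo sM ltr01 (lexx 1).
have sgain : smooth setT jgain.
  exact: (smooth_mul (smooth_cst _ _) (smooth_diff m20 Mlo sM Da0 Da1)).
have mm := mcst m.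
have cw : 0 <= cK * cE + 6 / w by nonneg.
have cL0 : 0 <= cL by rewrite /cL; nonneg.
have ca0 : 0 <= cL * alpha by rewrite mulr_ge0// ltW.
rewrite ler_distl; apply/andP; split.
  have sJ : smooth setT (jadd (jphi M M1 M2 1) (jmul (jcst (2 * m * cK)) jgain)).
    exact: (smooth_add sphi (smooth_mul (smooth_cst _ _) sgain)).
  have := lyapunov_ge BW gamma0 alpha0 inv sJ ca0 mm; rewrite mean_cst; apply => th z.
  rewrite generator_add generator_mul generator_cst [j0 (jcst _) _ _]/= [j2 (jcst _) _ _]/=.
  have := rate th z; rewrite ler_norml => /andP[r1 _].
  have r2 : 2 * m * v th z <= 2 * m * (cK * L jgain th z + (cK * cE + 6 / w) * (alpha * q z)).
    by rewrite ler_wpM2l ?v_le// mulr_ge0// ltW.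
  rewrite mulr0 addr0 mul0r mulr0 addr0 addrA -[cL * alpha * _]mulrA.
  exact: lower_combine r1 r2.
have := lyapunov_le BW gamma0 alpha0 inv sphi ca0 mm; rewrite mean_cst; apply => th z.
have := rate th z; rewrite ler_norml => /andP[_ r2].
have /andP[v0 v1] := v_itv m20 Mlo th z.
have h1 : 0 <= m * v th z by rewrite mulr_ge0// ltW.
have h2 : 0 <= 2 * m * (cK * cE + 6 / w) * (alpha * q z).
  by rewrite !mulr_ge0// ltW.
rewrite -[cL * alpha * _]mulrA; exact: upper_combine r2 h1 h2.
Qed.

End supercritical.

End small_noise.

(** * Strong noise: the frozen growth rate *)

(** Here alpha = p ^ 12. In the variable x = (z - zs) / alpha, M is p ^ 6 sqrt H where the modulus H is
    a positive smooth substitute for |x|, cut off beyond |x| = p ^ 2 and regularized at the scale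
    p ^ -2. These two scales cost relative errors of order 1 / p. *)
Section profile.
Variable R : realType.
Variable p : R.
Hypothesis p1 : 1 <= p.
Let p0 : 0 < p. Proof. exact: lt_le_trans p1. Qed.
Let w : R := p ^+ 2.
Let e : R := p ^- 2.
Let w0 : 0 < w. Proof. exact: exprn_gt0. Qed.
Let e0 : 0 < e. Proof. by rewrite invr_gt0. Qed.
Let T := cutid w. Let T' := cutid' w. Let T'' := cutid'' w.

Definition modulus (x : R) : R := Num.sqrt (T x ^+ 2 + e ^+ 2).
Definition modulus' (x : R) : R := T x * T' x / modulus x.
Definition modulus'' (x : R) : R := (T' x ^+ 2 + T x * T'' x) / modulus x -
  (T x * T' x) ^+ 2 / modulus x ^+ 3.
Notation H := modulus.

Let s0 x : 0 < T x ^+ 2 + e ^+ 2.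
Proof. by rewrite ltr_wpDl ?sqr_ge0// exprn_gt0. Qed.

Lemma modulus_gt0 x : 0 < H x. Proof. by rewrite sqrtr_gt0. Qed.

Lemma modulus_sqr x : H x ^+ 2 = T x ^+ 2 + e ^+ 2.
Proof. by rewrite sqr_sqrtr// ltW. Qed.

Lemma smooth_modulus : smooth setT (zjet H modulus' modulus'').
Proof.
have sT := smooth_cutid w0.
have sS : smooth setT (jadd (jmul (zjet T T' T'') (zjet T T' T'')) (jcst (e ^+ 2))).
  by apply: smooth_add; [exact: smooth_mul|exact: smooth_cst].
have e20 : 0 < e ^+ 2 by exact: exprn_gt0.
have SE th z : j0 (jadd (jmul (zjet T T' T'') (zjet T T' T'')) (jcst (e ^+ 2))) th z = T z ^+ 2 + e ^+ 2.
  by [].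
have -> : zjet H modulus' modulus'' =
    jsqrt (jadd (jmul (zjet T T' T'') (zjet T T' T'')) (jcst (e ^+ 2))).
  apply: jet_eq => th z; rewrite /jsqrt /jcomp /=.
  - by [].
  - by rewrite mulr0 mul0r !addr0 mulr0.
  - change (modulus' z = 2^-1 * (H z)^-1 * (T z * T' z + T' z * T z + 0)).
    by rewrite /modulus'; field; rewrite gt_eqF// modulus_gt0.
  - change (modulus'' z = - (4^-1 * ((H z)^-1 * (T z ^+ 2 + e ^+ 2)^-1)) *
       ((T z * T' z + T' z * T z + 0) * (T z * T' z + T' z * T z + 0)) +
       2^-1 * (H z)^-1 * (T z * T'' z + 2 * (T' z * T' z) + T'' z * T z + 0)).
    rewrite -modulus_sqr /modulus''; field; by rewrite gt_eqF// modulus_gt0.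
apply: (smooth_sqrt e20) => //.
by move=> th z _; rewrite SE lerDr sqr_ge0.
Qed.

Lemma modulus_ge_eps x : e <= H x.
Proof. by apply: le_sqrtr; rewrite lerDr sqr_ge0. Qed.

Lemma modulus_ge_abs x : `|T x| <= H x.
Proof. by apply: le_sqrtr; rewrite real_normK ?num_real// lerDl sqr_ge0. Qed.

Lemma modulus_le x : H x <= `|T x| + e.
Proof.
apply: sqrtr_le; first by rewrite addr_ge0// ltW.
rewrite sqrrD real_normK ?num_real//.
have : 0 <= `|T x| * e by rewrite mulr_ge0// ltW.
lra.
Qed.

Let Hi x : 0 < (H x)^-1. Proof. by rewrite invr_gt0 modulus_gt0. Qed.

Lemma modulus'_le x : `|modulus' x| <= 7.
Proof.
rewrite /modulus' normrM normfV (gtr0_norm (modulus_gt0 x)) ler_pdivrMr ?modulus_gt0//.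
rewrite normrM mulrC ler_pM//; [exact: cutid'_le|exact: modulus_ge_abs].
Qed.

Lemma modulus''_le x : `|modulus'' x| <= 140 / H x.
Proof.
have Hx := modulus_gt0 x.
have t1 := cutid'_le w0 x; have t2 := cutid_cutid''_le w0 x; have t3 := modulus'_le x.
have -> : modulus'' x = ((T' x ^+ 2 + T x * T'' x) - modulus' x ^+ 2) / H x.
  by rewrite /modulus'' /modulus'; field; rewrite gt_eqF.
rewrite normrM normfV (gtr0_norm Hx) ler_wpM2r ?(ltW (Hi x))//.
have sq49 (u : R) : `|u| <= 7 -> `|u ^+ 2| <= 49.
  move=> u7; rewrite normrX (_ : 49 = 7 ^+ 2); last by ring.
  by rewrite lerXn2r ?nnegrE.
apply: (le_trans (ler_normB _ _)); apply: (le_trans (lerD (ler_normD _ _) (lexx _))).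
by move: (sq49 _ t1) (sq49 _ t3) t2; rewrite -/(T' x) -/(T x) -/(T'' x); lra.
Qed.

(** The first and second derivatives of sqrt H divided by sqrt H. *)
Definition slope (x : R) : R := modulus' x / (2 * H x).
Definition slope2 (x : R) : R := modulus'' x / (2 * H x) - modulus' x ^+ 2 / (4 * H x ^+ 2).

Lemma slope_le x : `|slope x| <= 7 / (2 * H x).
Proof.
have Hx := modulus_gt0 x.
rewrite normrM normfV (gtr0_norm (_ : 0 < 2 * H x)) ?mulr_gt0//.
by rewrite ler_wpM2r ?modulus'_le// invr_ge0 mulr_ge0// ltW.
Qed.

Lemma slope2_le x : `|slope2 x| <= 83 / H x ^+ 2.
Proof.
have Hx := modulus_gt0 x.
have -> : slope2 x = (modulus'' x * H x / 2 - modulus' x ^+ 2 / 4) / H x ^+ 2.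
  by rewrite /slope2; field; rewrite gt_eqF.
rewrite normrM normfV (gtr0_norm (_ : 0 < H x ^+ 2)) ?exprn_gt0//.
rewrite ler_wpM2r ?invr_ge0 ?sqr_ge0//.
have h1 : `|modulus'' x * H x / 2| <= 70.
  rewrite -mulrA normrM; have -> : `|H x / 2| = H x / 2 by rewrite gtr0_norm// divr_gt0.
  have -> : 70 = 140 / H x * (H x / 2) by field; rewrite gt_eqF.
  by rewrite ler_wpM2r ?modulus''_le// divr_ge0// ltW.
have h2 : `|modulus' x ^+ 2 / 4| <= 49 / 4.
  rewrite normrM normrX (ger0_norm (_ : 0 <= 4^-1))// ler_wpM2r//.
  rewrite (_ : 49 = 7 ^+ 2); last by ring.
  by rewrite lerXn2r ?nnegrE// modulus'_le.
by apply: (le_trans (ler_normB _ _)); lra.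
Qed.

Definition root (x : R) : R := p ^+ 6 * Num.sqrt (H x).
Definition root' (x : R) : R := root x * slope x.
Definition root'' (x : R) : R := root x * slope2 x.

Lemma root_sqr x : root x ^+ 2 = p ^+ 12 * H x.
Proof. by rewrite exprMn sqr_sqrtr ?(ltW (modulus_gt0 x))// -exprM. Qed.

Lemma sqrt_modulus_ge x : p^-1 <= Num.sqrt (H x).
Proof. by apply: le_sqrtr; rewrite exprVn; exact: modulus_ge_eps. Qed.

Lemma root_ge x : p ^+ 5 <= root x.
Proof.
rewrite /root (_ : p ^+ 5 = p ^+ 6 * p^-1); last by field; rewrite gt_eqF.
by rewrite ler_wpM2l ?exprn_ge0 ?(ltW p0)// sqrt_modulus_ge.
Qed.

Lemma smooth_root : smooth setT (zjet root root' root'').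
Proof.
have -> : zjet root root' root'' = jmul (jcst (p ^+ 6)) (jsqrt (zjet H modulus' modulus'')).
  apply: jet_eq => th z; rewrite /jsqrt /jcomp /=.
  - by [].
  - by ring.
  - rewrite /root' /slope /root; have Hz := modulus_gt0 z.
    have hz : 0 < Num.sqrt (H z) by rewrite sqrtr_gt0.
    have hE := sqr_sqrtr (ltW Hz).
    by move: (Num.sqrt (H z)) hz hE => h hz <-; field; rewrite gt_eqF.
  - rewrite /root'' /slope2 /root; have Hz := modulus_gt0 z.
    have hz : 0 < Num.sqrt (H z) by rewrite sqrtr_gt0.
    have hE := sqr_sqrtr (ltW Hz).
    by move: (Num.sqrt (H z)) hz hE => h hz <-; field; rewrite gt_eqF.
apply: smooth_mul; first exact: smooth_cst.
apply: (smooth_sqrt e0); [by move=> th z; exact: modulus_gt0| |exact: smooth_modulus].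
by move=> th z _; exact: modulus_ge_eps.
Qed.

(** The frozen rate (z - 1 + M ^ 2) / (2 M) in units of p ^ 6: it approximates sqrt x, which is 0 for
    x < 0. *)
Definition frozen_rate (x : R) : R := (x + H x) / (2 * Num.sqrt (H x)).

Lemma frozen_rate_ge x : 0 <= x -> Num.sqrt x <= frozen_rate x.
Proof.
move=> x0; have Hx := modulus_gt0 x.
have hz : 0 < Num.sqrt (H x) by rewrite sqrtr_gt0.
rewrite /frozen_rate ler_pdivlMr ?mulr_gt0//.
have := sqr_ge0 (Num.sqrt x - Num.sqrt (H x)).
by rewrite sqrrB !sqr_sqrtr// ?(ltW Hx)//; lra.
Qed.

Lemma frozen_rate_le x : `|frozen_rate x| <= Num.sqrt x + 3 * (1 + x ^+ 4) / p.
Proof.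
have Hx := modulus_gt0 x.
set h := Num.sqrt (H x).
have hz : 0 < h by rewrite sqrtr_gt0.
have hE : h ^+ 2 = H x by rewrite sqr_sqrtr// ltW.
have hp : p^-1 <= h := sqrt_modulus_ge x.
have hi : h^-1 <= p by rewrite -[leRHS]invrK lef_pV2 ?posrE ?invr_gt0.
have pi0 : 0 < p^-1 by rewrite invr_gt0.
have -> : frozen_rate x = (x - T x) / (2 * h) + (T x + H x) / (2 * h).
  by rewrite /frozen_rate -/h; field; rewrite gt_eqF.
have x3 : `|x| ^+ 3 <= 1 + x ^+ 4.
  have -> : x ^+ 4 = `|x| ^+ 4 by rewrite -normrX ger0_norm// exprn_even_ge0.
  have [h1|/ltW h1] := leP `|x| 1.
    by rewrite (le_trans (exprn_ile1 _ _ h1))// lerDl exprn_ge0.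
  by rewrite (le_trans (ler_weXn2l h1 (isT : (3 <= 4)%N)))// lerDr.
have t1 : `|(x - T x) / (2 * h)| <= 3 / 2 * (1 + x ^+ 4) / p.
  rewrite normrM normfV (gtr0_norm (_ : 0 < 2 * h)) ?mulr_gt0// invfM.
  have n1 := cutid_near w0 x; rewrite -/(T x) in n1.
  apply: (@le_trans _ _ (3 * (1 + x ^+ 4) / w ^+ 2 * (2^-1 * p))).
    apply: ler_pM; rewrite ?mulr_ge0 ?invr_ge0 ?(ltW hz)//; last by rewrite ler_wpM2l.
    by apply: (le_trans n1); rewrite ler_wpM2r ?invr_ge0 ?sqr_ge0// ler_wpM2l.
  have -> : 3 * (1 + x ^+ 4) / w ^+ 2 * (2^-1 * p) = 3 / 2 * (1 + x ^+ 4) / p * p ^- 2.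
    by rewrite /w; field; rewrite gt_eqF.
  rewrite ler_piMr//; last by rewrite invf_le1 ?exprn_gt0// exprn_ege1.
  by rewrite !mulr_ge0 ?addr_ge0 ?exprn_even_ge0// ltW.
have t2 : `|(T x + H x) / (2 * h)| <= Num.sqrt x + p^-1.
  have THx := modulus_ge_abs x.
  have TH0 : 0 <= T x + H x.
    by have := ler_norm (- T x); rewrite normrN; move: THx; lra.
  rewrite ger0_norm ?divr_ge0 ?mulr_ge0 ?(ltW hz)//.
  rewrite ler_pdivrMr ?mulr_gt0//.
  have [x0|x0] := leP x 0.
    have Tx : T x <= 0.
      by rewrite /T /cutid mulr_le0_ge0//; have /andP[] := bump_itv w x.
    rewrite ler0_sqrtr// add0r.
    have h1 : T x + H x <= e by have := modulus_le x; rewrite ler0_norm//; lra.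
    apply: (le_trans h1); rewrite /e (_ : p ^- 2 = p^-1 * p^-1); last by rewrite -invfM.
    by rewrite ler_wpM2l ?(ltW pi0)//; move: hp hz; lra.
  have Tx : T x <= x by apply: le_trans (ler_norm _) _; rewrite -{2}(gtr0_norm x0) cutid_le.
  have Tx0 : 0 <= T x by rewrite /T /cutid mulr_ge0 ?(ltW x0)//; have /andP[] := bump_itv w x.
  have hx : h <= Num.sqrt x + p^-1.
    apply: sqrtr_le; first by rewrite addr_ge0 ?sqrtr_ge0 ?(ltW pi0).
    rewrite sqrrD sqr_sqrtr ?(ltW x0)//; apply: (le_trans (modulus_le x)).
    rewrite (ger0_norm Tx0) exprVn -/e.
    have : 0 <= Num.sqrt x * p^-1 by rewrite mulr_ge0 ?sqrtr_ge0 ?(ltW pi0).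
    by move: Tx; lra.
  apply: (@le_trans _ _ (2 * h ^+ 2)).
    by rewrite hE; move: THx; rewrite (ger0_norm Tx0); lra.
  have -> : 2 * h ^+ 2 = h * (2 * h) by ring.
  by rewrite ler_wpM2r// mulr_ge0// ltW.
apply: (le_trans (ler_normD _ _)); apply: (le_trans (lerD t1 t2)).
have q1 : p^-1 <= (1 + x ^+ 4) / p.
  by rewrite ler_peMl ?(ltW pi0)// lerDl exprn_even_ge0.
have -> : 3 / 2 * (1 + x ^+ 4) / p = 3 / 2 * ((1 + x ^+ 4) / p) by ring.
have -> : 3 * (1 + x ^+ 4) / p = 3 * ((1 + x ^+ 4) / p) by ring.
have : 0 <= (1 + x ^+ 4) / p by apply: le_trans q1; exact: ltW.
by move: q1; lra.
Qed.

Section window.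
Variables l hh : R.
Hypotheses (l0 : 0 < l) (l1 : l <= 2^-1) (hh1 : 1 <= hh).
Hypotheses (ph : 6 * hh <= p ^+ 2) (pl : p ^- 2 <= l / 2).
Variable x : R.
Hypothesis (lx : l <= x) (xh : x <= hh).

Let x0 : 0 < x. Proof. exact: lt_le_trans l0 lx. Qed.

Let xw : (x / w) ^+ 2 <= 36^-1.
Proof.
have -> : 36^-1 = 6^-1 ^+ 2 :> R by field.
rewrite lerXn2r ?nnegrE ?divr_ge0 ?(ltW x0) ?(ltW w0)// ler_pdivrMr// /w.
by move: ph xh; lra.
Qed.

Lemma window_cut : x / 2 <= T x.
Proof.
have := bump_ge w x => b.
by rewrite /T /cutid ler_wpM2l ?(ltW x0)//; move: b xw; lra.
Qed.

Let T0 : 0 < T x. Proof. by apply: lt_le_trans window_cut; rewrite divr_gt0. Qed.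

Lemma window_cut' : 3 / 4 <= T' x.
Proof.
have := cutid'_near w0 x; rewrite -/(T' x) ler_norml => /andP[_].
by move: xw; lra.
Qed.

Lemma window_modulus_ge : l / 2 <= H x.
Proof.
apply: le_trans (modulus_ge_abs x); rewrite (gtr0_norm T0).
by apply: le_trans window_cut; rewrite ler_wpM2r.
Qed.

Lemma window_modulus_le : H x <= hh + 1.
Proof.
apply: (le_trans (modulus_le x)); apply: lerD.
  by apply: (le_trans (cutid_le w x)); rewrite gtr0_norm.
by rewrite invf_le1 ?exprn_gt0// exprn_ege1.
Qed.

Lemma window_slope : 3 / (16 * (hh + 1)) <= slope x.
Proof.
have Hx := modulus_gt0 x; have t' := window_cut'.
have HT : H x <= 2 * T x.
  have := modulus_le x; rewrite (gtr0_norm T0).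
  have := window_cut; move: pl lx; rewrite -/e; lra.
have m' : 3 / 8 <= modulus' x.
  rewrite /modulus' ler_pdivlMr//.
  have : H x * (3 / 4) <= 2 * T x * T' x by apply: ler_pM => //; exact: ltW.
  by lra.
rewrite /slope ler_pdivlMr ?mulr_gt0//.
apply: le_trans m'; have := window_modulus_le => Hh.
have h1 : 0 < hh + 1 by move: hh1; lra.
rewrite mulrAC ler_pdivrMr ?mulr_gt0//.
by move: Hh; lra.
Qed.

Lemma window_near : `|x - H x| <= (3 * hh ^+ 3 + 2 / l) / p ^+ 4.
Proof.
have Hx := modulus_gt0 x.
have -> : x - H x = (x - T x) - (H x - T x) by ring.
apply: (le_trans (ler_normB _ _)); rewrite mulrDl; apply: lerD.
  apply: (le_trans (cutid_near w0 x)).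
  have -> : w ^+ 2 = p ^+ 4 by rewrite /w -exprM.
  rewrite ler_wpM2r ?invr_ge0 ?exprn_ge0 ?(ltW p0)// ler_wpM2l// gtr0_norm//.
  by rewrite lerXn2r ?nnegrE ?(ltW x0)// (le_trans ler01).
have TH : T x <= H x by apply: le_trans (ler_norm _) (modulus_ge_abs x).
rewrite ger0_norm ?subr_ge0//.
have -> : H x - T x = e ^+ 2 / (H x + T x).
  have HT : 0 < H x + T x by exact: addr_gt0.
  apply: (mulIf (lt0r_neq0 HT)); rewrite divfK ?gt_eqF//.
  have -> : (H x - T x) * (H x + T x) = H x ^+ 2 - T x ^+ 2 by ring.
  by rewrite modulus_sqr addrAC subrr add0r.
have -> : 2 / l / p ^+ 4 = e ^+ 2 / (l / 2).
  by rewrite /e; field; rewrite !gt_eqF.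
rewrite ler_wpM2l ?sqr_ge0// lef_pV2 ?posrE ?divr_gt0 ?addr_gt0//.
by apply: (le_trans window_modulus_ge); rewrite lerDl ltW.
Qed.

Lemma window_slope_le : `|slope x| <= 7 / l.
Proof.
apply: (le_trans (slope_le x)).
have Hl := window_modulus_ge; have Hx := modulus_gt0 x.
by rewrite ler_wpM2l// lef_pV2 ?posrE ?mulr_gt0//; move: Hl; lra.
Qed.

Lemma window_slope2_le : `|slope2 x| <= 332 / l ^+ 2.
Proof.
apply: (le_trans (slope2_le x)).
have Hl := window_modulus_ge; have Hx := modulus_gt0 x.
have -> : 332 / l ^+ 2 = 83 / (l / 2) ^+ 2 by field; rewrite gt_eqF.
rewrite ler_wpM2l// lef_pV2 ?posrE ?exprn_gt0 ?divr_gt0//.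
by rewrite lerXn2r ?nnegrE ?(ltW Hx)// divr_ge0// ltW.
Qed.

Lemma window_root_ge : p ^+ 6 * (l / 2) <= root x.
Proof.
rewrite ler_wpM2l ?exprn_ge0 ?(ltW p0)//; apply: le_sqrtr; apply: le_trans window_modulus_ge.
have : l / 2 * (l / 2) <= l / 2 * 1.
  by rewrite ler_wpM2l ?divr_ge0 ?(ltW l0)//; move: l1; lra.
by rewrite expr2 mulr1.
Qed.

Lemma window_root_le : root x <= p ^+ 6 * (hh + 1).
Proof.
rewrite ler_wpM2l ?exprn_ge0 ?(ltW p0)//; apply: sqrtr_le; first by move: hh1; lra.
apply: (le_trans window_modulus_le).
by rewrite expr2 ler_peMr//; move: hh1; lra.
Qed.

End window.

End profile.

(** * Strong noise: the two bounds *)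

Section large_noise.
Context (R : realType) d (T : measurableType d) (P : probability T R).
Variable W : R -> {RV P >-> R}.
Hypothesis BW : brownian_motion W.
Variables (gamma zs alpha p : R).
Hypotheses (gamma0 : 0 < gamma) (p1 : 1 <= p) (alphaE : alpha = p ^+ 12).
Notation X := (circle R * R)%type.
Variable mu : probability X R.
Hypothesis inv : invariant_measure gamma zs alpha W mu.
Notation L := (generator gamma zs alpha).
Notation q := (quartic zs alpha).
Notation C4 := (1 + 6528 / gamma ^+ 2).

Let p0 : 0 < p. Proof. exact: lt_le_trans p1. Qed.
Let alpha0 : 0 < alpha. Proof. by rewrite alphaE exprn_gt0. Qed.
Let xi (z : R) : R := alpha^-1 * (z - zs).
Let xiE z : z = zs + alpha * xi z.
Proof. by rewrite /xi mulrA mulfV ?mul1r ?gt_eqF//; ring. Qed.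
Let qE z : q z = 1 + xi z ^+ 4. Proof. by rewrite /quartic mulrC. Qed.
Let q1 z : 1 <= q z. Proof. exact: quartic_ge1. Qed.
Let q0 z : 0 <= q z. Proof. exact: le_trans ler01 (q1 z). Qed.

Let sq_le (u v : R) : `|u| <= v -> u ^+ 2 <= v ^+ 2.
Proof.
move=> uv; rewrite -(real_normK (num_real u)) lerXn2r ?nnegrE//.
exact: le_trans (normr_ge0 u) uv.
Qed.

Let M (z : R) : R := root p (alpha^-1 * (z - zs)).
Let M1 (z : R) : R := alpha^-1 * root' p (alpha^-1 * (z - zs)).
Let M2 (z : R) : R := alpha^-1 ^+ 2 * root'' p (alpha^-1 * (z - zs)).
Let sM : smooth setT (zjet M M1 M2).
Proof. exact: (smooth_affine alpha^-1 zs (smooth_root p1)). Qed.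

Let m0 : R := p ^+ 5.
Let m00 : 0 < m0. Proof. exact: exprn_gt0. Qed.
Let Mm0 z : m0 <= M z. Proof. exact: root_ge. Qed.
Let Mgt z : 0 < M z. Proof. exact: lt_le_trans m00 (Mm0 z). Qed.

Let H (z : R) : R := modulus p (xi z).
Let H0 z : 0 < H z. Proof. exact: modulus_gt0. Qed.
Let Hi z : (H z)^-1 <= p ^+ 2.
Proof. by rewrite -[leRHS]invrK lef_pV2 ?posrE ?invr_gt0 ?exprn_gt0// modulus_ge_eps. Qed.
Let Hi0 z : 0 <= (H z)^-1. Proof. by rewrite invr_ge0 ltW. Qed.

Let noiseE z : noise alpha M M1 z = slope p (xi z) ^+ 2 / 8.
Proof.
rewrite /noise /M1 /root' -/(xi z); have := Mgt z; rewrite /M -/(xi z) => h.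
by field; rewrite !gt_eqF.
Qed.

Let driftE z : drift gamma zs alpha M1 M2 z =
  M z * (- gamma * xi z * slope p (xi z) + 2^-1 * slope2 p (xi z)).
Proof.
rewrite /drift /M1 /M2 /M /root' /root'' -/(xi z).
have {1}-> : z - zs = alpha * xi z by rewrite {1}(xiE z); ring.
by field; rewrite gt_eqF.
Qed.

Notation v th z := ((cos th - M z * sin th) ^+ 2 /
     ((cos th + M z * sin th) ^+ 2 + (cos th - M z * sin th) ^+ 2)).

Let speed z : (z - 1 + M z ^+ 2) / (2 * M z) =
  p ^+ 6 * frozen_rate p (xi z) + (zs - 1) / (2 * M z).
Proof.
have h0 : 0 < Num.sqrt (H z) by rewrite sqrtr_gt0.
have hE := sqr_sqrtr (ltW (H0 z)).
have -> : M z ^+ 2 = p ^+ 12 * H z by exact: root_sqr.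
have -> : M z = p ^+ 6 * Num.sqrt (H z) by [].
have -> : frozen_rate p (xi z) = (xi z + H z) / (2 * Num.sqrt (H z)) by [].
have -> : z - 1 = zs - 1 + p ^+ 12 * xi z by rewrite {1}(xiE z) alphaE; ring.
move: (Num.sqrt (H z)) (xi z) h0 hE => h x h0 <-.
by field; rewrite !gt_eqF.
Qed.

Let xq z : `|xi z| <= q z.
Proof.
have := abs_pow_quartic zs alpha0 z (isT : (1 <= 4)%N); rewrite !expr1.
rewrite /xi normrM normfV (gtr0_norm alpha0) => h.
by rewrite mulrC ler_pdivrMr// mulrC.
Qed.

Let ppow (i j : nat) : (i <= j)%N -> p ^+ i <= p ^+ j.
Proof. by move=> ij; rewrite ler_weXn2l. Qed.

Let rate_error z : `|drift gamma zs alpha M1 M2 z| / M z + 4 * noise alpha M M1 z <=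
  (4 * gamma + 50) * (p ^+ 5 * q z).
Proof.
have s1 := slope_le p1 (xi z); have s2 := slope2_le p1 (xi z); rewrite -/(H z) in s1 s2.
have Hp : 0 <= p ^+ 2 by exact: sqr_ge0.
have iH2 : (H z ^+ 2)^-1 <= p ^+ 4.
  by rewrite (_ : p ^+ 4 = p ^+ 2 * p ^+ 2); [rewrite expr2 invfM ler_pM|rewrite -exprD].
have e1 : `|slope p (xi z)| <= 7 / 2 * p ^+ 2.
  apply: (le_trans s1); rewrite invfM mulrA ler_wpM2l// mulr_ge0//.
have e2 : `|slope2 p (xi z)| <= 83 * p ^+ 4.
  by apply: (le_trans s2); rewrite ler_wpM2l.
have e1' : slope p (xi z) ^+ 2 <= 49 / 4 * p ^+ 4.
  have -> : 49 / 4 * p ^+ 4 = (7 / 2 * p ^+ 2) ^+ 2 by field.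
  exact: sq_le.
rewrite driftE noiseE normrM (gtr0_norm (Mgt z)) mulrC mulKf ?gt_eqF//.
have t1 : `|- gamma * xi z * slope p (xi z)| <= 7 / 2 * gamma * (p ^+ 2 * q z).
  rewrite (normrM (- gamma * _)) (normrM (- gamma)) normrN (gtr0_norm gamma0).
  have -> : 7 / 2 * gamma * (p ^+ 2 * q z) = gamma * q z * (7 / 2 * p ^+ 2) by ring.
  apply: ler_pM => //; first by rewrite mulr_ge0// ltW.
  by rewrite ler_wpM2l// ltW.
have t2 : `|2^-1 * slope2 p (xi z)| <= 83 / 2 * p ^+ 4.
  by rewrite normrM (ger0_norm (_ : 0 <= 2^-1))//; move: e2; lra.
have P5 : 0 <= p ^+ 5 * q z by rewrite mulr_ge0// exprn_ge0// ltW.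
have p25 : p ^+ 2 * q z <= p ^+ 5 * q z by rewrite ler_wpM2r// ppow.
have p45 : p ^+ 4 <= p ^+ 5 * q z.
  by apply: (le_trans (ppow (isT : (4 <= 5)%N))); rewrite ler_peMr// exprn_ge0// ltW.
have t3 := ler_wpM2l (ltW gamma0) p25.
have t4 : 0 <= gamma * (p ^+ 5 * q z) by rewrite mulr_ge0// ltW.
have r1 : 7 / 2 * gamma * (p ^+ 2 * q z) = 7 / 2 * (gamma * (p ^+ 2 * q z)) by ring.
rewrite r1 in t1.
have -> : (4 * gamma + 50) * (p ^+ 5 * q z) = 4 * (gamma * (p ^+ 5 * q z)) + 50 * (p ^+ 5 * q z).
  by ring.
have := ler_normD (- gamma * xi z * slope p (xi z)) (2^-1 * slope2 p (xi z)).
by move: t1 t2 e1' p45 t3 t4 P5; lra.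
Qed.

Let second_le z : `|(zs - 1) / (2 * M z)| <= `|zs - 1| * (p ^+ 5 * q z).
Proof.
have h2M : 0 < 2 * M z by apply: mulr_gt0 => //; exact: Mgt.
rewrite normrM normfV (gtr0_norm h2M) ler_wpM2l//; apply: (@le_trans _ _ 1).
  have m1 : 1 <= m0 by exact: exprn_ege1.
  by rewrite invf_le1//; move: (Mm0 z) m1; lra.
by apply: mulr_ege1; [exact: exprn_ege1|exact: q1].
Qed.

Let frozen_le z : `|frozen_rate p (xi z)| <= Num.sqrt (xi z) + 3 * q z / p.
Proof. by rewrite qE; exact: frozen_rate_le. Qed.

Let p65 z : p ^+ 6 * (3 * q z / p) = 3 * (p ^+ 5 * q z).
Proof. by field; rewrite gt_eqF. Qed.

Let cU : R := 3 + `|zs - 1| + (4 * gamma + 50).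
Let cU0 : 0 <= cU. Proof. by rewrite /cU; nonneg. Qed.

Let rate th z : `|z * (sin th * cos th) + L (jphi M M1 M2 1) th z -
   p ^+ 6 * frozen_rate p (xi z) * (1 - 2 * v th z)| <=
   (`|zs - 1| + (4 * gamma + 50)) * (p ^+ 5 * q z).
Proof.
have ra := @rate_approx R gamma zs alpha M M1 M2 _ m00 Mm0 th z.
have vf := @v_factor_le R M _ th z m00 Mm0.
rewrite speed in ra.
set F := p ^+ 6 * _ in ra *; set S := (zs - 1) / _ in ra; set V := 1 - 2 * _ in ra vf *.
set Z := _ + L _ th z in ra *.
have -> : Z - F * V = (Z - (F + S) * V) + S * V by ring.
apply: (le_trans (ler_normD _ _)); rewrite [leRHS]mulrDl [leLHS]addrC; apply: lerD.
  by rewrite normrM; apply: le_trans (second_le z); rewrite ler_piMr.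
exact: le_trans ra (rate_error z).
Qed.

(** Whatever v is, |1 - 2 v| <= 1. *)
Lemma large_noise_upper : lyapunov mu + 1 <=
  p ^+ 6 * (\int[mu]_x on_circle (fun _ z => Num.sqrt (alpha^-1 * (z - zs))) x) + cU * p ^+ 5 * C4.
Proof.
have sphi := smooth_phi m00 Mm0 sM ltr01 (lexx 1).
have msq := moderate_sqrt zs alpha0.
have B0 : 0 <= cU * p ^+ 5 by rewrite mulr_ge0// exprn_ge0// ltW.
have := lyapunov_le BW gamma0 alpha0 inv sphi B0 (moderateZ (p ^+ 6) msq).
rewrite (meanZ BW gamma0 alpha0 inv)//; apply => th z.
have := rate th z; rewrite ler_norml => /andP[_].
have vf := @v_factor_le R M _ th z m00 Mm0.
rewrite lerBlDr => /le_trans; apply.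
have : p ^+ 6 * frozen_rate p (xi z) * (1 - 2 * v th z) <= p ^+ 6 * Num.sqrt (xi z) + 3 * (p ^+ 5 * q z).
  apply: (le_trans (ler_norm _)); rewrite normrM.
  apply: (le_trans (ler_wpM2l (normr_ge0 _) vf)); rewrite mulr1 normrM.
  rewrite (ger0_norm (_ : 0 <= p ^+ 6)) ?exprn_ge0 ?(ltW p0)// -p65 -mulrDr.
  by rewrite ler_wpM2l ?exprn_ge0 ?(ltW p0).
have -> : cU * p ^+ 5 * q z = 3 * (p ^+ 5 * q z) +
    (`|zs - 1| + (4 * gamma + 50)) * (p ^+ 5 * q z) by rewrite /cU; ring.
by rewrite -/(xi z); lra.
Qed.

(** Outside of the window s ^ 2 <= x <= 1 / s ^ 2, sqrt x is at most s times the quartic weight, and v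
    may be anything. Inside, v is controlled by the gain of the form of weight d = D / p ^ 3 on V, of
    order alpha ^ (-1/4): the noise in ln M is of order 1, and has to stay below M d ^ 2. The cutoff chi
    is 0 outside of [l, c + r], where l = s ^ 2 / 2, and at least s ^ 12 on the window. All errors are of
    order p ^ 5, to be compared with the rate p ^ 6. *)
Section lower.
Variable s : R.
Hypotheses (s0 : 0 < s) (s1 : s <= 2^-1).
Let l : R := s ^+ 2 / 2.
Let r : R := (2 * s ^+ 2)^-1.
Let c : R := l + r.
Let hh : R := 2 / s ^+ 2.
Let D : R := 7 / l ^+ 2.
Hypotheses (ph : 6 * hh <= p ^+ 2) (pl : p ^- 2 <= l / 2) (pD : 2 * D ^+ 2 <= p ^+ 6).

Let ss0 : 0 < s ^+ 2. Proof. exact: exprn_gt0. Qed.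
Let ss1 : s ^+ 2 <= 1. Proof. by rewrite exprn_ile1 ?(ltW s0)//; move: s1; lra. Qed.
Let l0 : 0 < l. Proof. by rewrite divr_gt0. Qed.
Let l1 : l <= 2^-1. Proof. by rewrite /l; move: ss1; lra. Qed.
Let r0 : 0 < r. Proof. by rewrite invr_gt0 mulr_gt0. Qed.
Let si1 : 1 <= (s ^+ 2)^-1. Proof. by rewrite invr_ge1 ?unitfE ?gt_eqF. Qed.
Let rE : r = 2^-1 * (s ^+ 2)^-1. Proof. by rewrite /r invfM. Qed.
Let hh1 : 1 <= hh. Proof. by rewrite /hh; move: si1; lra. Qed.
Let crh : c + r <= hh.
Proof. by rewrite /c /hh rE /l; move: si1 ss1; lra. Qed.
Let D1 : 1 <= D.
Proof.
rewrite /D ler_pdivlMr ?exprn_gt0// mul1r.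
have : l ^+ 2 <= 1 by rewrite exprn_ile1 ?(ltW l0)//; move: l1; lra.
lra.
Qed.
Let D0 : 0 < D. Proof. exact: lt_le_trans D1. Qed.

Let dl : R := D / p ^+ 3.
Let dl0 : 0 < dl. Proof. by rewrite divr_gt0 ?exprn_gt0. Qed.
Let dlE : dl ^+ 2 = D ^+ 2 / p ^+ 6. Proof. by rewrite expr_div_n -exprM. Qed.
Let dl2 : dl ^+ 2 <= 2^-1.
Proof. by rewrite dlE ler_pdivrMr ?exprn_gt0//; move: pD; lra. Qed.
Let dli : dl^-1 = p ^+ 3 / D. Proof. by rewrite /dl invf_div. Qed.
Let dli_le : dl^-1 <= p ^+ 3.
Proof. by rewrite dli ler_pdivrMr// ler_peMr// exprn_ge0// ltW. Qed.

Let b : R := zs + alpha * c.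
Let chi (z : R) : R := bump r (alpha^-1 * (z - b)).
Let chi1 (z : R) : R := alpha^-1 * bump' r (alpha^-1 * (z - b)).
Let chi2 (z : R) : R := alpha^-1 ^+ 2 * bump'' r (alpha^-1 * (z - b)).
Let schi : smooth setT (zjet chi chi1 chi2).
Proof. exact: (smooth_affine alpha^-1 b (smooth_bump r0)). Qed.

Let shift z : alpha^-1 * (z - b) = xi z - c.
Proof. by rewrite /b /xi; field; rewrite gt_eqF. Qed.

Let inwin z : `|xi z - c| < r -> l <= xi z /\ xi z <= hh.
Proof.
rewrite ltr_norml => /andP[h1 h2]; split; first by move: h1; rewrite /c; lra.
by apply: le_trans crh; move: h2; lra.
Qed.

Let chi_out z : r <= `|xi z - c| -> [/\ chi z = 0, chi1 z = 0 & chi2 z = 0].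
Proof.
move=> h; rewrite /chi /chi1 /chi2 shift; have [-> -> ->] := bump_out r0 h.
by rewrite !mulr0.
Qed.

Let k0 : R := 9 / (64 * 64 * (hh + 1) ^+ 3 * D ^+ 2).
Let hp : 0 < hh + 1. Proof. by move: hh1; lra. Qed.
Let k00 : 0 < k0. Proof.
apply: divr_gt0 => //; apply: mulr_gt0; last exact: exprn_gt0.
by apply: mulr_gt0; [rewrite mulr_gt0|exact: exprn_gt0].
Qed.
Let k02 : k0 <= 2^-1.
Proof.
have h1 : 1 <= (hh + 1) ^+ 3 by rewrite exprn_ege1//; move: hh1; lra.
have h2 : 1 <= D ^+ 2 by rewrite exprn_ege1.
have h3 : 1 <= (hh + 1) ^+ 3 * D ^+ 2 by exact: mulr_ege1.
have -> : k0 = 9 / (64 * 64) / ((hh + 1) ^+ 3 * D ^+ 2).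
  by rewrite /k0 -(mulrA (64 * 64)) (invfM (64 * 64)) mulrA.
rewrite ler_pdivrMr; last exact: lt_le_trans h3.
by move: h3; lra.
Qed.

Let cond z : 0 < chi z -> noise alpha M M1 z <= M z * dl ^+ 2 /\
  k0 * (2 * M z * dl ^+ 2) <= noise alpha M M1 z.
Proof.
move=> chi0.
have [|lx xh] := @inwin z.
  by rewrite ltNge; apply/negP => /chi_out[h _ _]; move: chi0; rewrite h ltxx.
have sl := window_slope p1 l0 hh1 ph pl lx xh.
have su := window_slope_le p1 l0 ph lx xh.
have Ml := window_root_ge p1 l0 l1 ph lx xh.
have Mh := window_root_le p1 l0 hh1 lx xh.
rewrite noiseE; split.
  apply: (@le_trans _ _ ((7 / l) ^+ 2 / 8)).
    by rewrite ler_wpM2r// sq_le.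
  apply: (@le_trans _ _ (p ^+ 6 * (l / 2) * dl ^+ 2)); last by rewrite ler_wpM2r ?sqr_ge0.
  rewrite dlE /D.
  have -> : p ^+ 6 * (l / 2) * ((7 / l ^+ 2) ^+ 2 / p ^+ 6) = 49 / 2 / l ^+ 2 * l^-1.
    by field; rewrite !gt_eqF.
  have -> : (7 / l) ^+ 2 / 8 = 49 / 8 / l ^+ 2 by field; rewrite gt_eqF.
  have li : 1 <= l^-1 by rewrite invr_ge1 ?unitfE ?gt_eqF//; move: l1; lra.
  have lp : 0 <= (l ^+ 2)^-1 by rewrite invr_ge0 sqr_ge0.
  apply: (@le_trans _ _ (49 / 2 / l ^+ 2)); first by rewrite ler_wpM2r//; lra.
  by rewrite ler_peMr// mulr_ge0.
apply: (@le_trans _ _ ((3 / (16 * (hh + 1))) ^+ 2 / 8)); last first.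
  by rewrite ler_wpM2r// lerXn2r ?nnegrE ?(le_trans _ sl)// divr_ge0// mulr_ge0// ltW.
apply: (@le_trans _ _ (k0 * (2 * (p ^+ 6 * (hh + 1)) * dl ^+ 2))).
  by rewrite ler_wpM2l ?(ltW k00)// ler_wpM2r ?sqr_ge0// ler_wpM2l.
rewrite dlE /k0 le_eqVlt; apply/orP; left; apply/eqP; field.
by rewrite !gt_eqF.
Qed.

Variable B : R.
Hypothesis B0 : 0 <= B.
Hypotheses (bB1 : forall x, `|bump' r x| <= B) (bB2 : forall x, `|bump'' r x| <= B).

Let c1 : R := 3 * hh ^+ 3 + 2 / l.
Let c2 : R := gamma * hh * (7 / l) + 166 / l ^+ 2.
Let c3 : R := 2 * (c1 + `|zs - 1|) / l + c2.
Let cE : R := 62 / l ^+ 2 + 2 * c3 + (2 * c3 + 4 * c2) + (gamma * hh + 1) * B + 14 * B / l.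

Let li0 : 0 <= l^-1. Proof. by rewrite invr_ge0 ltW. Qed.
Let hh0 : 0 <= hh. Proof. exact: le_trans hh1. Qed.
Let c10 : 0 <= c1. Proof. by rewrite /c1; nonneg. Qed.
Let c20 : 0 <= c2. Proof. by rewrite /c2; nonneg. Qed.
Let c30 : 0 <= c3. Proof. by rewrite /c3; nonneg. Qed.
Let cE0 : 0 <= cE. Proof. by rewrite /cE; nonneg. Qed.
Let p35 : p ^+ 3 <= p ^+ 5. Proof. exact: ppow. Qed.
Let p25 : p ^+ 2 <= p ^+ 5. Proof. exact: ppow. Qed.
Let P50 : 0 <= p ^+ 5. Proof. by rewrite exprn_ge0// ltW. Qed.
Let P30 : 0 <= p ^+ 3. Proof. by rewrite exprn_ge0// ltW. Qed.

Let drift_win z : l <= xi z -> xi z <= hh -> `|drift gamma zs alpha M1 M2 z| / M z <= c2.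
Proof.
move=> lx xh; have x0 : 0 < xi z by exact: lt_le_trans l0 lx.
have su := window_slope_le p1 l0 ph lx xh; have su2 := window_slope2_le p1 l0 ph lx xh.
rewrite driftE normrM (gtr0_norm (Mgt z)) mulrC mulKf ?gt_eqF//.
apply: (le_trans (ler_normD _ _)); rewrite /c2; apply: lerD.
  rewrite (normrM (- gamma * _)) (normrM (- gamma)) normrN (gtr0_norm gamma0) (gtr0_norm x0).
  apply: ler_pM => //; first by rewrite mulr_ge0// ltW.
  by rewrite ler_wpM2l// ltW.
rewrite normrM (ger0_norm (_ : 0 <= 2^-1))//.
have -> : 166 / l ^+ 2 = 2^-1 * (332 / l ^+ 2) by field; rewrite gt_eqF.
by rewrite ler_wpM2l.
Qed.

Let rho_win z : l <= xi z -> xi z <= hh ->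
  `|z - 1 - M z ^+ 2 + drift gamma zs alpha M1 M2 z| / M z <= c3 * p ^+ 2.
Proof.
move=> lx xh; have dw := drift_win lx xh.
have Ml := window_root_ge p1 l0 l1 ph lx xh.
have nr := window_near p1 l0 hh1 ph lx xh.
have iM : (M z)^-1 <= 2 / (p ^+ 6 * l).
  have -> : 2 / (p ^+ 6 * l) = (p ^+ 6 * (l / 2))^-1 by field; rewrite !gt_eqF.
  have hl : 0 < p ^+ 6 * (l / 2) by rewrite mulr_gt0 ?exprn_gt0// divr_gt0.
  by rewrite lef_pV2 ?posrE//; exact: Mgt.
have E : z - 1 - M z ^+ 2 = p ^+ 12 * (xi z - H z) + (zs - 1).
  have -> : M z ^+ 2 = p ^+ 12 * H z by exact: root_sqr.
  by rewrite {1}(xiE z) alphaE; ring.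
have t1 : `|z - 1 - M z ^+ 2| <= (c1 + `|zs - 1|) * p ^+ 8.
  rewrite E; apply: (le_trans (ler_normD _ _)); rewrite mulrDl; apply: lerD.
    rewrite normrM (ger0_norm (_ : 0 <= p ^+ 12)) ?exprn_ge0 ?(ltW p0)//.
    have -> : c1 * p ^+ 8 = p ^+ 12 * (c1 / p ^+ 4) by field; rewrite gt_eqF.
    by rewrite ler_wpM2l ?exprn_ge0 ?(ltW p0).
  by rewrite ler_peMr// exprn_ege1.
apply: (@le_trans _ _ (`|z - 1 - M z ^+ 2| / M z + `|drift gamma zs alpha M1 M2 z| / M z)).
  by rewrite -mulrDl ler_wpM2r ?ler_normD// invr_ge0 ltW.
rewrite /c3 mulrDl; apply: lerD.
  have -> : 2 * (c1 + `|zs - 1|) / l * p ^+ 2 = (c1 + `|zs - 1|) * p ^+ 8 * (2 / (p ^+ 6 * l)).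
    by field; rewrite !gt_eqF.
  by apply: ler_pM => //; rewrite invr_ge0 ltW.
by apply: (le_trans dw); rewrite ler_peMr// exprn_ege1.
Qed.

Let jgain := jmul (zjet chi chi1 chi2) (jdiff M M1 M2 dl).

Let gain th z : chi z * (3 / 4 * M z * k0 * v th z) <= L jgain th z + cE * p ^+ 5.
Proof.
have chi01 : 0 <= chi z <= 1 by exact: bump_itv.
have k01 : 0 <= k0 <= 2^-1 by rewrite (ltW k00).
have := @localized_gain R gamma zs alpha M M1 M2 _ m00 Mm0 chi chi1 chi2 dl k0 th z dl0 dl2
  chi01 k01 (@cond z).
rewrite -/jgain => /le_trans; apply; rewrite lerD2l.
have [out|win] := leP r `|xi z - c|.
  have [-> -> ->] := chi_out out.
  by rewrite !mulr0 addr0 normr0 !mul0r mulr0 !addr0; exact: mulr_ge0.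
have [lx xh] := inwin win.
have x0 : 0 < xi z by exact: lt_le_trans l0 lx.
have su := window_slope_le p1 l0 ph lx xh.
have dw := drift_win lx xh; have rw := rho_win lx xh.
have di0 : 0 <= dl^-1 by rewrite invr_ge0 ltW.
have Mi0 : 0 <= (M z)^-1 by rewrite invr_ge0 ltW.
have nz : noise alpha M M1 z <= 49 / 8 / l ^+ 2.
  rewrite noiseE; have -> : 49 / 8 / l ^+ 2 = (7 / l) ^+ 2 / 8 by field; rewrite gt_eqF.
  by rewrite ler_wpM2r// sq_le.
have nz0 := noise_ge0 alpha M M1 z.
set rho := z - 1 - M z ^+ 2 + drift gamma zs alpha M1 M2 z in rw *.
set dr := drift gamma zs alpha M1 M2 z in dw rho rw *.
have E1 : 10 * noise alpha M M1 z / dl <= 62 / l ^+ 2 * p ^+ 5.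
  apply: ler_pM => //; [by apply: mulr_ge0| |exact: le_trans dli_le p35].
  have : 0 <= (l ^+ 2)^-1 by rewrite invr_ge0 sqr_ge0.
  by move: nz; lra.
have E2 : 2 * `|rho| / (M z * dl) <= 2 * c3 * p ^+ 5.
  have -> : 2 * `|rho| / (M z * dl) = 2 * (`|rho| / M z * dl^-1) by rewrite invfM; ring.
  have -> : 2 * c3 * p ^+ 5 = 2 * (c3 * p ^+ 2 * p ^+ 3) by ring.
  by rewrite ler_wpM2l//; apply: ler_pM => //; rewrite mulr_ge0.
have E3 : 2 * `|z - 1 - M z ^+ 2 - dr| / M z <= (2 * c3 + 4 * c2) * p ^+ 5.
  have h : `|z - 1 - M z ^+ 2 - dr| <= `|rho| + 2 * `|dr|.
    have -> : z - 1 - M z ^+ 2 - dr = rho - 2 * dr by rewrite /rho; ring.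
    by apply: (le_trans (ler_normB _ _)); rewrite (normrM 2) (ger0_norm (ler0n _ 2)).
  apply: (@le_trans _ _ (2 * (`|rho| / M z) + 4 * (`|dr| / M z))).
    have -> : 2 * (`|rho| / M z) + 4 * (`|dr| / M z) = 2 * (`|rho| + 2 * `|dr|) / M z by ring.
    by rewrite ler_wpM2r// ler_wpM2l.
  have h1 : c3 * p ^+ 2 <= c3 * p ^+ 5 by rewrite ler_wpM2l.
  have h2 : c2 <= c2 * p ^+ 5 by rewrite ler_peMr// exprn_ege1.
  have -> : (2 * c3 + 4 * c2) * p ^+ 5 = 2 * (c3 * p ^+ 5) + 4 * (c2 * p ^+ 5) by ring.
  by move: rw dw h1 h2; lra.
have E4 : `|- gamma * (z - zs) * chi1 z + alpha ^+ 2 / 2 * chi2 z| * - ln dl <=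
    (gamma * hh + 1) * B * p ^+ 5.
  have ln0 : - ln dl <= p ^+ 5.
    rewrite -lnV//; apply: (le_trans (ltW (ln_sublinear _))); first by rewrite invr_gt0.
    exact: le_trans dli_le p35.
  have dl1 : dl <= 1.
    have : dl ^+ 2 <= 1 ^+ 2 by rewrite expr1n; move: dl2; lra.
    by rewrite ler_sqr ?nnegrE// ltW.
  apply: ler_pM => //; first by rewrite oppr_ge0 ln_le0.
  have -> : - gamma * (z - zs) * chi1 z + alpha ^+ 2 / 2 * chi2 z =
    - gamma * xi z * bump' r (xi z - c) + 2^-1 * bump'' r (xi z - c).
    rewrite /chi1 /chi2 shift; have {1}-> : z - zs = alpha * xi z by rewrite {1}(xiE z); ring.
    by field; rewrite gt_eqF.
  apply: (le_trans (ler_normD _ _)); rewrite mulrDl; apply: lerD.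
    rewrite (normrM (- gamma * _)) (normrM (- gamma)) normrN (gtr0_norm gamma0) (gtr0_norm x0).
    apply: ler_pM => //; first by rewrite mulr_ge0// ltW.
    by rewrite ler_wpM2l// ltW.
  rewrite normrM (ger0_norm (_ : 0 <= 2^-1))// mul1r.
  by have := bB2 (xi z - c); move: B0; lra.
have E5 : alpha ^+ 2 * (`|chi1 z| * (2 * `|M1 z| / (M z * dl))) <= 14 * B / l * p ^+ 5.
  have -> : alpha ^+ 2 * (`|chi1 z| * (2 * `|M1 z| / (M z * dl))) =
     2 * (`|bump' r (xi z - c)| * `|slope p (xi z)| * dl^-1).
    have -> : `|chi1 z| = alpha^-1 * `|bump' r (xi z - c)|.
      by rewrite /chi1 shift (normrM alpha^-1) gtr0_norm ?invr_gt0.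
    have -> : `|M1 z| = alpha^-1 * (M z * `|slope p (xi z)|).
      have -> : M1 z = alpha^-1 * (M z * slope p (xi z)) by [].
      by rewrite (normrM alpha^-1) (normrM (M z)) (gtr0_norm (Mgt z)) gtr0_norm ?invr_gt0.
    have := Mgt z; move: (M z) => m m1; field.
    by rewrite !gt_eqF.
  have -> : 14 * B / l * p ^+ 5 = 2 * (B * (7 / l) * p ^+ 5) by ring.
  have h1 : `|bump' r (xi z - c)| * `|slope p (xi z)| <= B * (7 / l) by exact: ler_pM.
  apply: (ler_wpM2l (ler0n _ 2)); apply: (ler_pM _ di0 h1 (le_trans dli_le p35)).
  exact: mulr_ge0.
have E123 : chi z * (10 * noise alpha M M1 z / dl + 2 * `|rho| / (M z * dl) +
     2 * `|z - 1 - M z ^+ 2 - dr| / M z) <=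
    62 / l ^+ 2 * p ^+ 5 + 2 * c3 * p ^+ 5 + (2 * c3 + 4 * c2) * p ^+ 5.
  apply: le_trans (lerD (lerD E1 E2) E3).
  have /andP[_ h] := chi01; rewrite -[leRHS]mul1r ler_wpM2r//.
  have nr (u : R) : 0 <= 2 * `|u| by rewrite mulr_ge0.
  apply: addr_ge0; last by apply: mulr_ge0; [exact: nr|exact: Mi0].
  apply: addr_ge0; first by apply: mulr_ge0 di0; exact: mulr_ge0.
  by apply: mulr_ge0; [exact: nr|rewrite invfM; exact: mulr_ge0].
by apply: (le_trans (lerD (lerD E123 E4) E5)); rewrite -!mulrDl.
Qed.

Let cK : R := (s ^+ 12 * (3 / 8) * l * k0)^-1.
Let cK0 : 0 < cK. Proof.
rewrite invr_gt0; apply: mulr_gt0 k00; apply: mulr_gt0 l0.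
by apply: mulr_gt0; rewrite ?exprn_gt0// divr_gt0.
Qed.

Let v_le th z : s ^+ 2 <= xi z -> xi z <= (s ^+ 2)^-1 ->
  p ^+ 6 * v th z <= cK * (L jgain th z + cE * p ^+ 5).
Proof.
move=> sx xs; have /andP[v0 v1] := v_itv m00 Mm0 th z.
have lx : l <= xi z by apply: le_trans sx; rewrite /l; move: ss0; lra.
have xh : xi z <= hh by apply: (le_trans xs); rewrite /hh; move: si1; lra.
have Ml := window_root_ge p1 l0 l1 ph lx xh.
have chi_ge : s ^+ 12 <= chi z.
  have -> : s ^+ 12 = (s ^+ 4) ^+ 3 by rewrite -exprM.
  rewrite /chi shift; apply: (bump_ge_inner (w := r)).
    by rewrite exprn_ge0// ltW.
  have h : `|(xi z - c) / r| <= 1 - s ^+ 4.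
    rewrite normrM normfV (gtr0_norm r0) ler_pdivrMr//.
    have -> : (1 - s ^+ 4) * r = 2^-1 * (s ^+ 2)^-1 - 2^-1 * s ^+ 2.
      by rewrite rE; field; rewrite gt_eqF.
    rewrite ler_norml /c rE /l; apply/andP; split; [move: sx|move: xs]; lra.
  have s4 : 0 <= s ^+ 4 by rewrite exprn_ge0// ltW.
  have s41 : s ^+ 4 <= 1 by rewrite exprn_ile1// ?(ltW s0)//; move: s1; lra.
  have : `|(xi z - c) / r| ^+ 2 <= (1 - s ^+ 4) * 1.
    rewrite expr2; apply: ler_pM => //; lra.
  rewrite real_normK ?num_real//; lra.
have g := gain th z.
have s12 : 0 <= s ^+ 12 by rewrite exprn_ge0// ltW.
have h1 : s ^+ 12 * (3 / 4 * (p ^+ 6 * (l / 2)) * k0 * v th z) <= chi z * (3 / 4 * M z * k0 * v th z).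
  apply: ler_pM => //.
    have hl : 0 <= p ^+ 6 * (l / 2) by apply: mulr_ge0; rewrite ?exprn_ge0 ?divr_ge0// ltW.
    by apply: mulr_ge0 v0; apply: mulr_ge0 (ltW k00); apply: mulr_ge0 => //; rewrite divr_ge0.
  by rewrite ler_wpM2r// ler_wpM2r ?(ltW k00)// ler_wpM2l.
have E V : p ^+ 6 * V = cK * (s ^+ 12 * (3 / 4 * (p ^+ 6 * (l / 2)) * k0 * V)).
  by rewrite /cK; field; rewrite !gt_eqF.
by rewrite E ler_wpM2l ?(ltW cK0)//; exact: le_trans h1 g.
Qed.

Let G_ge0 th z : 0 <= cK * (L jgain th z + cE * p ^+ 5).
Proof.
rewrite mulr_ge0 ?(ltW cK0)//; apply: le_trans (gain th z).
have /andP[c0 _] : 0 <= chi z <= 1 by exact: bump_itv.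
have /andP[v0 _] := v_itv m00 Mm0 th z.
apply: mulr_ge0 c0 _; apply: mulr_ge0 v0; apply: mulr_ge0 (ltW k00).
by apply: mulr_ge0 (ltW (Mgt z)); rewrite divr_ge0.
Qed.

(* For large x, sqrt x <= s x, and x is at most the quartic weight. *)
Let sqrt_off z : ~~ ((s ^+ 2 <= xi z) && (xi z <= (s ^+ 2)^-1)) -> Num.sqrt (xi z) <= s * q z.
Proof.
have sq : s <= s * q z by rewrite ler_peMr// ltW.
rewrite negb_and -!ltNge => /orP[h|h].
  apply: le_trans sq; apply: sqrtr_le; [exact: ltW|exact: ltW].
have x0 : 0 < xi z by apply: lt_trans h; rewrite invr_gt0.
have t0 : 0 <= Num.sqrt (xi z) by exact: sqrtr_ge0.
have st : s^-1 <= Num.sqrt (xi z) by apply: le_sqrtr; rewrite exprVn ltW.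
apply: (@le_trans _ _ (s * xi z)); last first.
  by rewrite ler_wpM2l ?(ltW s0)//; apply: le_trans (xq z); exact: ler_norm.
rewrite -{2}(sqr_sqrtr (ltW x0)) expr2 mulrA ler_peMl//.
by rewrite mulrC -ler_pdivrMr// mul1r.
Qed.

Let cL : R := 6 + 2 / s * cK * cE + (`|zs - 1| + (4 * gamma + 50)).

Lemma large_noise_lower :
  p ^+ 6 * (\int[mu]_x on_circle (fun _ z => Num.sqrt (alpha^-1 * (z - zs))) x) -
    (2 * s * p ^+ 6 + cL * p ^+ 5) * C4 <= lyapunov mu + 1.
Proof.
have dl1 : dl <= 1.
  have : dl ^+ 2 <= 1 ^+ 2 by rewrite expr1n; move: dl2; lra.
  by rewrite ler_sqr ?nnegrE// ltW.
have sphi := smooth_phi m00 Mm0 sM ltr01 (lexx 1).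
have sgain : smooth setT jgain := smooth_mul schi (smooth_diff m00 Mm0 sM dl0 dl1).
have msq := moderate_sqrt zs alpha0.
have cKs : 0 <= 2 / s * cK by apply: mulr_ge0 (ltW cK0); rewrite divr_ge0// ltW.
have cL0 : 0 <= cL by rewrite /cL; nonneg.
have P60 : 0 <= p ^+ 6 by rewrite exprn_ge0// ltW.
have B0' : 0 <= 2 * s * p ^+ 6 + cL * p ^+ 5.
  by rewrite addr_ge0// !mulr_ge0// ltW.
have sJ := smooth_add sphi (smooth_mul (smooth_cst _ (2 / s * cK)) sgain).
have := lyapunov_ge BW gamma0 alpha0 inv sJ B0' (moderateZ (p ^+ 6) msq).
rewrite (meanZ BW gamma0 alpha0 inv)//; apply => th z.
rewrite generator_add generator_mul generator_cst [j0 (jcst _) _ _]/= [j2 (jcst _) _ _]/=.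
rewrite mulr0 addr0 mul0r mulr0 addr0 addrA -/(xi z).
have := rate th z; rewrite ler_norml => /andP[r1 _].
have fr := frozen_le z; have fr6 := ler_wpM2l P60 fr; rewrite mulrDr p65 in fr6.
have vf := @v_factor_le R M _ th z m00 Mm0.
have /andP[v0 v1] := v_itv m00 Mm0 th z.
have G0 := G_ge0 th z.
have pq : p ^+ 5 <= p ^+ 5 * q z by rewrite ler_peMr.
set Fr := frozen_rate p (xi z) in r1 fr fr6 *.
set sx := Num.sqrt (xi z) in fr fr6 *.
set G := L jgain th z in G0 *.
have sx0 : 0 <= sx by exact: sqrtr_ge0.
have s60 : 0 <= 2 * s * p ^+ 6 * q z by rewrite !mulr_ge0// ltW.
have key : p ^+ 6 * sx - 2 * s * p ^+ 6 * q z - 6 * (p ^+ 5 * q z) -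
    2 / s * (cK * (G + cE * p ^+ 5)) <= p ^+ 6 * Fr * (1 - 2 * v th z).
  have [/andP[h1 h2]|off] := boolP ((s ^+ 2 <= xi z) && (xi z <= (s ^+ 2)^-1)).
    have x0 : 0 <= xi z by apply: le_trans h1; exact: ltW.
    have fl : sx <= Fr by exact: frozen_rate_ge.
    have Fr0 : 0 <= Fr by exact: le_trans fl.
    rewrite (ger0_norm Fr0) in fr6.
    have sxs : sx <= s^-1.
      by apply: sqrtr_le; rewrite ?invr_ge0 ?(ltW s0)// exprVn.
    have vl := v_le th h1 h2.
    have t1 := ler_wpM2l P60 fl.
    have t2 : p ^+ 6 * Fr * v th z <= s^-1 * (cK * (G + cE * p ^+ 5)) + 3 * (p ^+ 5 * q z).
      apply: (le_trans (ler_wpM2r v0 fr6)); rewrite mulrDl; apply: lerD.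
        rewrite mulrAC mulrC; apply: ler_pM => //; exact: mulr_ge0.
      by rewrite ler_piMr//; apply: mulr_ge0 => //; exact: mulr_ge0.
    have -> : p ^+ 6 * Fr * (1 - 2 * v th z) = p ^+ 6 * Fr - 2 * (p ^+ 6 * Fr * v th z) by ring.
    have -> : 2 / s * (cK * (G + cE * p ^+ 5)) = 2 * (s^-1 * (cK * (G + cE * p ^+ 5))) by ring.
    move: t1 t2 s60; lra.
  have so := ler_wpM2l P60 (sqrt_off off); rewrite -/sx in so.
  have t : - (p ^+ 6 * sx + 3 * (p ^+ 5 * q z)) <= p ^+ 6 * Fr * (1 - 2 * v th z).
    have := ler_norm (- (p ^+ 6 * Fr * (1 - 2 * v th z))); rewrite normrN normrM (normrM (p ^+ 6)) (ger0_norm P60).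
    have := ler_wpM2l (mulr_ge0 P60 (normr_ge0 Fr)) vf; rewrite mulr1; move: fr6; lra.
  have G0' : 0 <= 2 / s * (cK * (G + cE * p ^+ 5)).
    by rewrite mulr_ge0// divr_ge0// ltW.
  have pq0 : 0 <= p ^+ 5 * q z by rewrite mulr_ge0.
  have E : 2 * s * p ^+ 6 * q z = 2 * (p ^+ 6 * (s * q z)) by ring.
  rewrite E; move: t so G0' pq0; lra.
have E1 : 2 / s * (cK * (G + cE * p ^+ 5)) = 2 / s * cK * G + 2 / s * cK * cE * p ^+ 5 by ring.
have pE := ler_wpM2l (mulr_ge0 cKs cE0) pq.
have E2 : (2 * s * p ^+ 6 + cL * p ^+ 5) * q z = 2 * s * p ^+ 6 * q z + 6 * (p ^+ 5 * q z) +
    2 / s * cK * cE * (p ^+ 5 * q z) + (`|zs - 1| + (4 * gamma + 50)) * (p ^+ 5 * q z).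
  by rewrite /cL; ring.
rewrite E2; rewrite E1 in key; move: key pE r1; lra.
Qed.

End lower.

End large_noise.

(** * The limits *)

Lemma moment_constant (R : realType) (gamma : R) : exists2 C : R, 0 < C & 1 + 6528 / gamma ^+ 2 = C.
Proof.
exists (1 + 6528 / gamma ^+ 2) => [|//]; apply: ltr_wpDr ltr01.
by apply: mulr_ge0; [exact: ler0n|rewrite invr_ge0 sqr_ge0].
Qed.

Lemma norm_le_combine (R : realFieldType) (A l S c a b q e : R) :
  A - (S + c) <= l + 1 -> l + 1 <= A + b -> S <= e -> a + b + q <= e -> c <= a ->
  0 <= a -> 0 <= b -> 1 <= q -> 0 <= e -> `|A - l| <= e + e.
Proof. by move=> *; rewrite ler_norml; apply/andP; split; lra. Qed.

Section limits.
Context (R : realType) d (T : measurableType d) (P : probability T R).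
Variables (W : R -> {RV P >-> R}) (gamma zs : R).
Hypotheses (BW : brownian_motion W) (gamma0 : 0 < gamma).
Notation X := (circle R * R)%type.
Notation C4 := (1 + 6528 / gamma ^+ 2).


Notation E := (Gamma (3 / 4) / (2 * gamma `^ (4^-1) * pi `^ (2^-1))).

Lemma mean_sqrtE alpha (mu : probability X R) : 0 < alpha -> invariant_measure gamma zs alpha W mu ->
  \int[mu]_x on_circle (fun _ z => Num.sqrt (alpha^-1 * (z - zs))) x = E.
Proof.
move=> alpha0 inv; rewrite (mean_sqrt BW gamma0 alpha0 inv).
have -> : 2 / (2 * gamma) = gamma^-1 by field; rewrite gt_eqF.
have -> : gamma `^ (4^-1) = Num.sqrt (Num.sqrt gamma).
  rewrite (_ : 4^-1 = 2^-1 * 2^-1); last by field.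
  by rewrite powRrM powR12_sqrt ?powR_ge0// powR12_sqrt// ltW.
rewrite (powR12_sqrt (pi_ge0 R)) !sqrtrV ?sqrtr_ge0 ?(ltW gamma0)//.
have g0 : 0 < Num.sqrt (Num.sqrt gamma) by rewrite !sqrtr_gt0.
have p0 : 0 < Num.sqrt (pi : R) by rewrite sqrtr_gt0 pi_gt0.
by field; rewrite !gt_eqF.
Qed.

Lemma large_noise_lower_uniform (s : R) : 0 < s -> s <= 2^-1 ->
  exists p0 c : R, forall (p alpha : R) (mu : probability X R), 1 <= p -> p0 <= p -> alpha = p ^+ 12 ->
    invariant_measure gamma zs alpha W mu ->
    p ^+ 6 * E - (2 * s * p ^+ 6 + c * p ^+ 5) * C4 <= lyapunov mu + 1.
Proof.
move=> s0 s1.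
have r0 : 0 < (2 * s ^+ 2)^-1 by rewrite invr_gt0 mulr_gt0// exprn_gt0.
have sb := smooth_bump r0.
have [B1 B10 [b1 _]] := bl_j2 sb; have [B2 B20 [b2 _]] := bl_j22 sb.
pose p1 := 6 * (2 / s ^+ 2); pose p2 := (s ^+ 2 / 2 / 2)^-1.
pose p3 := 2 * (7 / (s ^+ 2 / 2) ^+ 2) ^+ 2.
have ss0 : 0 < s ^+ 2 by exact: exprn_gt0.
have [p10 p20 p30] : [/\ 0 <= p1, 0 < p2 & 0 <= p3].
  split; [by rewrite mulr_ge0// divr_ge0// ltW|by rewrite invr_gt0 !divr_gt0|].
  by apply: mulr_ge0 => //; exact: sqr_ge0.
exists (p1 + p2 + p3); eexists => p alpha mu ge1 gep alphaE inv.
have alpha0 : 0 < alpha by rewrite alphaE exprn_gt0// (lt_le_trans ltr01).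
rewrite -(mean_sqrtE alpha0 inv).
have pw n : (0 < n)%N -> p <= p ^+ n.
  by move=> n0; rewrite -{1}(expr1 p) ler_weXn2l.
have h1 : 6 * (2 / s ^+ 2) <= p ^+ 2.
  by apply: le_trans (pw 2 isT); move: gep p10 p20 p30; rewrite -/p1; lra.
have h2 : p ^- 2 <= s ^+ 2 / 2 / 2.
  have pgt0 : 0 < p ^+ 2 by rewrite exprn_gt0// (lt_le_trans ltr01).
  rewrite -[leRHS]invrK lef_pV2 ?posrE//.
  by apply: le_trans (pw 2 isT); move: gep p10 p20 p30; rewrite -/p2; lra.
have h3 : 2 * (7 / (s ^+ 2 / 2) ^+ 2) ^+ 2 <= p ^+ 6.
  by apply: le_trans (pw 6 isT); move: gep p10 p20 p30; rewrite -/p3; lra.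
have h4 x : `|bump' (2 * s ^+ 2)^-1 x| <= B1 + B2.
  by apply: (le_trans (b1 0 x I)); rewrite lerDl.
have h5 x : `|bump'' (2 * s ^+ 2)^-1 x| <= B1 + B2.
  by apply: (le_trans (b2 0 x I)); rewrite lerDr.
exact: (large_noise_lower BW gamma0 ge1 alphaE inv s0 s1 h1 h2 h3 (addr_ge0 B10 B20) h4 h5).
Qed.

(** Both bounds on the exponent are p ^ 6 E up to 2 s p ^ 6 + O(p ^ 5), and s is arbitrary. *)
Lemma large_noise (e : R) : 0 < e -> exists p0 : R,
  forall (p alpha : R) (mu : probability X R), 1 <= p -> p0 <= p -> alpha = p ^+ 12 ->
    invariant_measure gamma zs alpha W mu -> `|E - (p ^+ 6)^-1 * lyapunov mu| <= e.
Proof.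
move=> e0; have [C C0 CE] := moment_constant gamma.
pose s := Num.min 2^-1 (e / (4 * C)).
have s0 : 0 < s by rewrite lt_min invr_gt0 divr_gt0 ?mulr_gt0//= ltr0n.
have s1 : s <= 2^-1 by rewrite ge_min lexx.
have se : 2 * s * C <= e / 2.
  have : s <= e / (4 * C) by rewrite ge_min lexx orbT.
  by rewrite ler_pdivlMr ?mulr_gt0//; lra.
have [p0 [c low]] := large_noise_lower_uniform s0 s1; rewrite CE in low.
pose K := (`|c| + (3 + `|zs - 1| + (4 * gamma + 50))) * C + 1.
have K0 : 0 < K.
  by rewrite ltr_wpDl// mulr_ge0 ?(ltW C0)// !addr_ge0// ?ler0n// mulr_ge0// ltW.
exists (`|p0| + 2 * K / e) => p alpha mu p1 pp alphaE inv.
have pgt0 : 0 < p by exact: lt_le_trans p1.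
have alpha0 : 0 < alpha by rewrite alphaE exprn_gt0.
have Ke : 2 * K / e <= p by apply: le_trans pp; rewrite lerDr.
have {}pp : p0 <= p.
  apply: le_trans (ler_norm _) (le_trans _ pp).
  by rewrite lerDl !mulr_ge0 ?invr_ge0 ?(ltW K0) ?(ltW e0).
have lo := low _ _ _ p1 pp alphaE inv.
have up := large_noise_upper BW gamma0 p1 alphaE inv; rewrite (mean_sqrtE alpha0 inv) CE in up.
have p6 : 0 < p ^+ 6 by exact: exprn_gt0.
have p5 : 0 < p ^+ 5 by exact: exprn_gt0.
have p51 : 1 <= p ^+ 5 by exact: exprn_ege1.
have Kp : K * p ^+ 5 <= e / 2 * p ^+ 6.
  rewrite ler_pdivrMr// in Ke.
  have -> : e / 2 * p ^+ 6 = e / 2 * p * p ^+ 5 by ring.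
  by rewrite ler_pM2r// mulrAC ler_pdivlMr// mulrC (mulrC e).
have cc := ler_norm c; have nz : 0 <= `|zs - 1| by [].
have -> : E - (p ^+ 6)^-1 * lyapunov mu = (p ^+ 6 * E - lyapunov mu) / p ^+ 6.
  by move: (Gamma _ / _) => G; field; rewrite gt_eqF.
rewrite normrM normfV (gtr0_norm p6) ler_pdivrMr//.
set A := p ^+ 6 * E in lo up *; set l := lyapunov mu in lo up *.
have se6 := ler_wpM2r (ltW p6) se.
have KE : K * p ^+ 5 = `|c| * p ^+ 5 * C + (3 + `|zs - 1| + (4 * gamma + 50)) * p ^+ 5 * C + p ^+ 5.
  by rewrite /K; ring.
have t1 : 0 <= `|c| * p ^+ 5 * C by rewrite !mulr_ge0// ltW.
have t2 : 0 <= (3 + `|zs - 1| + (4 * gamma + 50)) * p ^+ 5 * C by nonneg.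
have t3 : c * p ^+ 5 * C <= `|c| * p ^+ 5 * C.
  by rewrite ler_wpM2r ?(ltW C0)// ler_wpM2r// ltW.
have lE : (2 * s * p ^+ 6 + c * p ^+ 5) * C = 2 * s * C * p ^+ 6 + c * p ^+ 5 * C by ring.
rewrite lE in lo; rewrite KE in Kp.
have e6 : 0 <= e / 2 * p ^+ 6 by rewrite mulr_ge0 ?divr_ge0 ?(ltW e0) ?(ltW p6).
have -> : e * p ^+ 6 = e / 2 * p ^+ 6 + e / 2 * p ^+ 6 by field.
exact: norm_le_combine lo up se6 Kp t3 t1 t2 p51 e6.
Qed.

Lemma small_noise_supercritical_rate : 1 < zs -> exists K a0 : R, 0 < a0 /\
  forall (alpha : R) (mu : probability X R), 0 < alpha -> alpha <= a0 -> invariant_measure gamma zs alpha W mu ->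
    `|lyapunov mu + 1 - Num.sqrt (zs - 1)| <= K * alpha.
Proof.
move=> zs1; set m := Num.sqrt (zs - 1).
have m0 : 0 < m by rewrite sqrtr_gt0 subr_gt0.
have mE : m ^+ 2 = zs - 1 by rewrite sqr_sqrtr// subr_ge0 ltW.
(* This D satisfies 49 a ^ 2 <= m ^ 3 D ^ 2, as m ^ 3 (1 + 1 / m) ^ 4 >= 4. *)
pose a := (2 * m + gamma)^-1; pose D := 7 * a * (1 + m^-1) ^+ 2.
have a0 : 0 < a by rewrite invr_gt0 addr_gt0// mulr_gt0.
have mi0 : 0 < m^-1 by rewrite invr_gt0.
have D0 : 0 < D by rewrite /D; apply: mulr_gt0; [rewrite mulr_gt0|rewrite exprn_gt0// addr_gt0].
have aD : 49 * a ^+ 2 <= m ^+ 3 * D ^+ 2.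
  have -> : m ^+ 3 * D ^+ 2 = 49 * a ^+ 2 * (m ^+ 3 * (1 + m^-1) ^+ 4) by rewrite /D; ring.
  rewrite ler_peMr//; first by rewrite mulr_ge0// ?ler0n// sqr_ge0.
  have -> : m ^+ 3 * (1 + m^-1) ^+ 4 = m ^+ 3 + 4 * m ^+ 2 + 6 * m + 4 + m^-1.
    by field; rewrite gt_eqF.
  have := exprn_gt0 3 m0; have := exprn_gt0 2 m0; move: mi0 m0; lra.
eexists; exists (Num.min 1 (2 * D)^-1); split.
  by rewrite lt_min ltr01 invr_gt0 mulr_gt0.
move=> alpha mu alpha0; rewrite le_min => /andP[al1 alD] inv.
have D2 : (D * alpha) ^+ 2 <= 2^-1.
  have h : D * alpha <= 2^-1.
    have := ler_wpM2l (ltW D0) alD; have -> // : D / (2 * D) = 2^-1 by field; rewrite gt_eqF.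
  have h0 : 0 <= D * alpha by rewrite mulr_ge0// ltW.
  have := ler_pM h0 h0 h h; rewrite -expr2; lra.
have h := small_noise_supercritical BW gamma0 alpha0 inv m0 mE D0 aD al1 D2.
by rewrite [leRHS]mulrAC in h; exact: h.
Qed.

End limits.

Theorem theorem5p2 (R : realType) (d : measure_display) (T : measurableType d)
  (P : probability T R) (W : R -> {RV P >-> R}) (gamma z_star : R)
  (mu : R -> probability (circle R * R)%type R) :
  brownian_motion W -> 0 < gamma ->
  (forall alpha : R, 0 < alpha -> invariant_measure gamma z_star alpha W (mu alpha)) ->
  (alpha `^ (- 2^-1) * lyapunov (mu alpha) @[alpha --> +oo] -->
     Gamma (3 / 4) / (2 * gamma `^ (4^-1) * pi `^ (2^-1))) /\
  (lyapunov (mu alpha) @[alpha --> 0^'+] -->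
     if 1 < z_star then Num.sqrt (z_star - 1) - 1 else -1).
Proof.
move=> BW gamma0 inv; split.
  apply/cvgrPdist_le => e e0.
  have [p0 large] := large_noise z_star BW gamma0 e0.
  near=> alpha.
  have alpha0 : 0 < alpha by near: alpha; exact: nbhs_pinfty_gt.
  pose p := alpha `^ (12^-1).
  have pE : p ^+ 12 = alpha.
    by rewrite -powR_mulrn ?powR_ge0// -powRrM mulVf// powRr1// ltW.
  have pp : 0 <= p by exact: powR_ge0.
  have ge (b : R) : `|b| ^+ 12 <= alpha -> b <= p.
    by rewrite -pE ler_pXn2r ?nnegrE//; apply: le_trans; exact: ler_norm.
  have -> : alpha `^ (- 2^-1) = (p ^+ 6)^-1.
    rewrite powRN -powR_mulrn// -powRrM; congr (_ `^ _)^-1; by field.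
  apply: (large p alpha) => //; last exact: inv.
    by apply: ge; near: alpha; exact: nbhs_pinfty_ge.
  by apply: ge; near: alpha; exact: nbhs_pinfty_ge.
have right_lt (c : R) : 0 < c -> \forall x \near 0^'+, x < c by exact: nbhs_right_lt.
case: ltP => zs1; apply/cvgrPdist_le => e e0.
  have [K [a0 [a00 sup]]] := small_noise_supercritical_rate BW gamma0 zs1.
  near=> alpha.
  have alpha0 : 0 < alpha by near: alpha; exact: nbhs_right_gt.
  have aa : alpha <= a0 by apply: ltW; near: alpha; exact: right_lt.
  have ae : alpha < e / (`|K| + 1).
    by near: alpha; apply: right_lt; rewrite divr_gt0// ltr_wpDl.
  rewrite distrC; have -> : lyapunov (mu alpha) - (Num.sqrt (z_star - 1) - 1) =
    lyapunov (mu alpha) + 1 - Num.sqrt (z_star - 1) by ring.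
  apply: (le_trans (sup _ _ alpha0 aa (inv _ alpha0))).
  have K1 : 0 < `|K| + 1 by rewrite ltr_wpDl.
  rewrite ltr_pdivlMr// in ae.
  have := ler_wpM2r (ltW alpha0) (ler_norm K); move: ae alpha0; lra.
have [C C0 CE] := moment_constant gamma.
have eC : 0 < (e / C) ^+ 2 by rewrite exprn_gt0// divr_gt0.
near=> alpha.
have alpha0 : 0 < alpha by near: alpha; exact: nbhs_right_gt.
rewrite distrC opprK; apply: (le_trans (small_noise_subcritical BW gamma0 alpha0 (inv _ alpha0) zs1)).
rewrite CE -ler_pdivlMr//; apply: sqrtr_le; first by rewrite divr_ge0// ltW.
apply: ltW; near: alpha; exact: right_lt.
Unshelve. all: by end_near. Qed.
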